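(* Let $n\ge1$, $k\ge0$, $\mu_0=k(n-1)$. For $\nu\in\mathbb{C}$ and $w,z\in\mathbb{C}^n$ with $\Re w>0$, $\Re z>0$, the integral \[ \mathcal{K}_\nu(w,z)=\int_{\mathbb{R}_+^n}E^A(-x,w)E^A(-\tfrac1x,z)\Delta(x)^{\nu-\mu_0-1}\omega^A(x)\,dx \] converges absolutely, and $(\nu,w,z)\mapsto\mathcal{K}_\nu(w,z)$ is holomorphic on $\mathbb{C}\times\{\Re w>0\}\times\{\Re z>0\}$. Moreover: (i) $\mathcal{K}_\nu(\sigma w,\sigma z)=\mathcal{K}_\nu(w,z)$ for all $\sigma\in\mathcal{S}_n$; (ii) $\mathcal{K}_\nu(w,z)=\mathcal{K}_{-\nu}(z,w)$ and $|\mathcal{K}_\nu(w,z)|\le\mathcal{K}_{\Re\nu}(\Re w,\Re z)$; (iii) if $\nu\in\mathbb{R}$ and $x,y\in\mathbb{R}_+^n$, then $0<\mathcal{K}_\nu(x,y)\le\Gamma_n(\nu)\Delta(x)^{-\nu}$ if $\nu>\mu_0$ and $0<\mathcal{K}_\nu(x,y)\le\Gamma_n(-\nu)\Delta(y)^{\nu}$ if $\nu<-\mu_0$; and for fixed $x,y\in\mathbb{R}_+^n$ the map $\nu\mapsto\mathcal{K}_\nu(x,y)$ is convex on $\mathbb{R}$; (iv) if $\nu\in\mathbb{R}$, $|\nu|\le\mu_0$ and $x,y\in\mathbb{R}_+^n$, then for all $\epsilon>0$: $0<\mathcal{K}_\nu(x,y)\le\Gamma_n(\mu_0+1)\Delta(x)^{-\mu_0-1}+\Gamma_n(\mu_0+\epsilon)\Delta(y)^{-\mu_0-\epsilon}$;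 (v) $\Delta(T^A)\mathcal{K}_\nu(w,\cdot)=(-1)^n\mathcal{K}_{\nu-1}(w,\cdot)$ and $\Delta(T^A)\mathcal{K}_\nu(\cdot,z)=(-1)^n\mathcal{K}_{\nu+1}(\cdot,z)$; (vi) if $\Re\nu<-\mu_0$ then $\lim_{\epsilon\to0}\epsilon^{-n\nu}\mathcal{K}_\nu(w,\epsilon z)=\Gamma_n(-\nu)\Delta(z)^{\nu}$, and if $\Re\nu>\mu_0$ then $\lim_{\epsilon\to0}\epsilon^{n\nu}\mathcal{K}_\nu(\epsilon w,z)=\Gamma_n(\nu)\Delta(w)^{-\nu}$ (limits over $\epsilon>0$).
   Context: $\mathbb{R}_+^n=]0,\infty[^n$, inequalities between vectors componentwise, $\tfrac1x$ componentwise, $\Delta(x)=x_1\cdots x_n$, principal complex powers. Type $A$ Dunkl operators with multiplicity $k$: $T_i^Af(x)=\partial_if(x)+k\sum_{j\ne i}\frac{f(x)-f(s_{ij}x)}{x_i-x_j}$ ($s_{ij}$ swaps coordinates $i,j$); $\Delta(T^A)=T_1^A\cdots T_n^A$. $E^A(\lambda,\cdot)$ is the unique holomorphic function on $\mathbb{C}^n$ with $T_i^AE^A(\lambda,\cdot)=\lambda_iE^A(\lambda,\cdot)$ for all $i$ and $E^A(\lambda,0)=1$. $\omega^A(x)=\prod_{i<j}|x_i-x_j|^{2k}$, $c_A=\int_{\mathbb{R}^n}e^{-|x|^2/2}\omega^A(x)dx$, $\Gamma_n(z)=c_A(2\pi)^{-n/2}\prod_{j=1}^n\Gamma(z_j-k(j-1))$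 for $z\in\mathbb{C}^n$ and $\Gamma_n(\alpha)=\Gamma_n(\alpha,\dots,\alpha)$ for $\alpha\in\mathbb{C}$. *)

(* Defs.v *)
From HB Require Import structures.
From mathcomp Require Import all_boot all_order all_algebra.
From mathcomp Require Import all_classical all_reals all_analysis.
From mathcomp Require Import complex.
From mathcomp Require Import fingroup perm.
Import Order.TTheory GRing.Theory Num.Theory.
Import numFieldNormedType.Exports.


Local Open Scope ring_scope.
Local Open Scope classical_set_scope.

(* The complex numbers C = R[i] over a realType R, seen as a normed module  *)
(* over ITSELF (so that derivatives / differentiability below are complex,  *)
(* i.e. holomorphic, notions).  The alias CC avoids the canonical           *)
(* R-module structure that R[i] carries in the real_closed library.         *)
Definition CC (R : realType) : Type := R[i].
HB.instance Definition _ (R : realType) := Num.ClosedField.copy (CC R) R[i].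
HB.instance Definition _ (R : realType) := GRing.ComAlgebra.copy (CC R) (CC R)^o.
HB.instance Definition _ (R : realType) := Vector.copy (CC R) (CC R)^o.
HB.instance Definition _ (R : realType) := NormedModule.copy (CC R) (CC R)^o.

Definition RC {R : realType} (x : R) : CC R := Complex x 0.
Definition cRe {R : realType} (z : CC R) : R := complex.Re z.
Definition cIm {R : realType} (z : CC R) : R := complex.Im z.

Definition cmod {R : realType} (z : CC R) : R := Num.sqrt (cRe z ^+ 2 + cIm z ^+ 2).
Definition carg {R : realType} (z : CC R) : R :=
  if 0 <= cIm z then acos (cRe z / cmod z) else - acos (cRe z / cmod z).
Definition cLog {R : realType} (z : CC R) : CC R := Complex (ln (cmod z)) (carg z).

Definition cexp {R : realType} (z : CC R) : CC R :=
  Complex (expR (cRe z) * cos (cIm z)) (expR (cRe z) * sin (cIm z)).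
Definition cpow {R : realType} (a s : CC R) : CC R := cexp (s * cLog a).

Definition rv2C {R : realType} {n : nat} (x : 'rV[R]_n) : 'rV[CC R]_n := map_mx RC x.
Definition rvRe {R : realType} {n : nat} (w : 'rV[CC R]_n) : 'rV[CC R]_n :=
  map_mx (fun c => RC (cRe c)) w.
Definition rvinv {R : realType} {n : nat} (x : 'rV[R]_n) : 'rV[R]_n := \row_i (x 0 i)^-1.
Definition posv {R : realType} {n : nat} (x : 'rV[R]_n) : Prop := forall i, 0 < x 0 i.
Definition RePos {R : realType} {n : nat} (w : 'rV[CC R]_n) : Prop := forall i, 0 < cRe (w 0 i).
Definition permv {T : Type} {n : nat} (s : 'S_n) (w : 'rV[T]_n) : 'rV[T]_n :=
  \row_i w 0 (s i).

(* Delta(z)^s, with the holomorphic branch on {Re z > 0} given by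
   prod_j z_j^s (principal powers); for z in R_+^n it is the usual real power. *)
Definition Deltapow {R : realType} {n : nat} (z : 'rV[CC R]_n) (s : CC R) : CC R :=
  \prod_(i < n) cpow (z 0 i) s.

Definition omegaA {R : realType} {n : nat} (k : R) (x : 'rV[R]_n) : R :=
  \prod_(i < n) \prod_(j < n | (i < j)%N) (`|x 0 i - x 0 j| `^ (2 * k)).

(* The difference quotient (f(x) - f(s_ij x))/(x_i - x_j) is extended at    *)
(* x_i = x_j by its limit d_i f(x) - d_j f(x) (valid for holomorphic f).    *)
Definition evec {R : realType} {n : nat} (i : 'I_n) : 'rV[CC R]_n := delta_mx 0 i.
Definition swapv {T : Type} {n : nat} (i j : 'I_n) (x : 'rV[T]_n) : 'rV[T]_n :=
  \row_l x 0 (tperm i j l).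

Definition dunkl_quot {R : realType} {n : nat} (f : 'rV[CC R]_n -> CC R)
    (i j : 'I_n) (x : 'rV[CC R]_n) : CC R :=
  if x 0 i == x 0 j then 'D_(evec i) f x - 'D_(evec j) f x
  else (f x - f (swapv i j x)) / (x 0 i - x 0 j).

Definition dunklA {R : realType} {n : nat} (k : R) (i : 'I_n)
    (f : 'rV[CC R]_n -> CC R) : 'rV[CC R]_n -> CC R :=
  fun x => 'D_(evec i) f x + RC k * \sum_(j < n | j != i) dunkl_quot f i j x.

Definition DeltaT {R : realType} {n : nat} (k : R) (f : 'rV[CC R]_n -> CC R) :
    'rV[CC R]_n -> CC R :=
  foldr (fun i g => dunklA k i g) f (enum 'I_n).

(* E^A(lam, .): the unique holomorphic function on C^n with T_i E = lam_i E and E(0) = 1 *)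
Definition is_EA {R : realType} {n : nat} (k : R) (lam : 'rV[CC R]_n)
    (f : 'rV[CC R]_n -> CC R) : Prop :=
  (forall z, differentiable f z) /\
  (forall i z, dunklA k i f z = lam 0 i * f z) /\
  f 0 = 1.

Definition EA {R : realType} {n : nat} (k : R) (lam : 'rV[CC R]_n) : 'rV[CC R]_n -> CC R :=
  get [set f | is_EA k lam f].

(* Lebesgue integrals over D^n (D = ]0,+oo[ or R), as iterated integrals     *)
(* w.r.t. the Lebesgue measure (Fubini / Tonelli).                          *)
Definition vec_of_seq {R : realType} (n : nat) (s : seq R) : 'rV[R]_n :=
  \row_(i < n) nth 0 s i.

Fixpoint iint {R : realType} (D : set R) (m : nat) (F : seq R -> R) : R :=
  match m with
  | O => F [::]
  | m'.+1 => \int[lebesgue_measure]_(t in D) iint D m' (fun s => F (t :: s))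
  end.

Fixpoint iint_abs {R : realType} (D : set R) (m : nat) (F : seq R -> R) : \bar R :=
  match m with
  | O => (`|F [::]|)%:E
  | m'.+1 => (\int[lebesgue_measure]_(t in D) iint_abs D m' (fun s => F (t :: s)))%E
  end.

Definition intC_pos {R : realType} (n : nat) (G : 'rV[R]_n -> CC R) : CC R :=
  Complex (iint `](0%R : R), +oo[%classic n (fun s => cRe (G (vec_of_seq n s))))
          (iint `](0%R : R), +oo[%classic n (fun s => cIm (G (vec_of_seq n s)))).

Definition abs_conv_pos {R : realType} (n : nat) (G : 'rV[R]_n -> CC R) : Prop :=
  (iint_abs `](0%R : R), +oo[%classic n (fun s => cmod (G (vec_of_seq n s))) < +oo)%E.

Definition cGamma {R : realType} (s : CC R) : CC R :=
  let g := fun t : R => cpow (RC t) (s - 1) * RC (expR (- t)) in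
  Complex (\int[lebesgue_measure]_(t in `](0:R), +oo[) cRe (g t))
          (\int[lebesgue_measure]_(t in `](0:R), +oo[) cIm (g t)).

Definition cA {R : realType} (n : nat) (k : R) : R :=
  iint setT n (fun s => let x := vec_of_seq n s in
                 expR (- (\sum_(i < n) x 0 i ^+ 2) / 2) * omegaA k x).

Definition Gamma_n {R : realType} {n : nat} (k : R) (z : 'rV[CC R]_n) : CC R :=
  RC (cA n k * (2 * pi) `^ (- (n%:R / 2))) *
  \prod_(j < n) cGamma (z 0 j - RC (k * j%:R)).

Definition Gamma_ns {R : realType} (n : nat) (k : R) (alpha : CC R) : CC R :=
  Gamma_n k (const_mx alpha : 'rV[CC R]_n).

Definition mu0 {R : realType} (n : nat) (k : R) : R := k * (n - 1)%:R.

Definition Kintegrand {R : realType} (n : nat) (k : R) (nu : CC R)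
    (w z : 'rV[CC R]_n) (x : 'rV[R]_n) : CC R :=
  EA k (- rv2C x) w * EA k (- rv2C (rvinv x)) z *
  Deltapow (rv2C x) (nu - RC (mu0 n k) - 1) * RC (omegaA k x).

Definition Kker {R : realType} (n : nat) (k : R) (nu : CC R) (w z : 'rV[CC R]_n) : CC R :=
  intC_pos n (Kintegrand n k nu w z).

(* Main.v *)
(* The kernel is the series E(l, z) = sum_m f_m(l, z), with f_(m+1) obtained from f_m by inverting m+1 + k sum_tau (1 - tau) (tau the transpositions) on the group algebra of S_n. The inverse has nonnegative coefficients, so f_m has nonnegative coefficients and E is bounded by its values at nonnegative arguments; with the shift identity E(l, z + c 1) = e^(c sum l) E(l, z) this gives |E(-x, w)| <= E(-x, Re w) <= e^(-d sum x) for x >= 0 and Re w > d. Uniqueness of E is a Gronwall argument along segments issued from a point of the diagonal, where the Dunkl operators reduce to a dissipative term.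

Absolute convergence, holomorphy and (v) follow by domination; (i) and (ii) from the changes of variables x -> s x and x -> 1/x; (iii), (iv) and (vi) from the Laplace transform L_nu(w) = int E(-x, w) Delta(x)^(nu - mu0 - 1) omega(x) dx = Gamma_n(nu) Delta(w)^(-nu), because 0 < E(-1/x, z) <= 1 for z > 0, with limit 1 as z -> 0.

For the Laplace transform, integration by parts gives w_i T_i L_nu = - nu L_nu, so L_nu Delta^nu is annihilated by all T_i, hence constant. Applying T_1 ... T_n to both sides yields L_(nu+1)(1) = prod_j (nu - k j) L_nu(1), the recursion satisfied by Gamma_n, and Stirling's substitution t = N + sqrt N u, N -> oo, turns L_(nu+N)(1) into the Gaussian integral c_A and fixes the remaining constant. *)
Require Import Defs.
From HB Require Import structures.
From mathcomp Require Import all_boot all_order all_algebra.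
From mathcomp Require Import all_classical all_reals all_analysis.
From mathcomp Require Import complex.
From mathcomp Require Import fingroup perm.
From mathcomp Require Import measurable_realfun lebesgue_integral ftc.
From mathcomp Require Import ring lra.
Import Order.TTheory GRing.Theory Num.Theory.
Import numFieldNormedType.Exports.
Local Open Scope ring_scope.
Local Open Scope classical_set_scope.
Set Implicit Arguments.
Unset Strict Implicit.
Unset Printing Implicit Defensive.

(** * Complex-valued functions and integrals *)

(** Complex differentiability is handled by a quadratic remainder bound with an explicit majorant
    ([qr]) instead of Cauchy estimates: such a bound survives any dominated integral, so one lemma
    differentiates both the kernel series (counting measure) and the integrals over the orthant. The
    decay of E(-x, w) is geometric: a diagonal shift by d turns it into e^(-d sum x) E(x, d 1 - w),
    and the discs |d - w_i| <= d - c exhaust the half-plane Re w_i > c. In the Gronwall argument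
    |f|^2 is summed over the S_n-orbit of the segment; there the reflection terms add up to a
    Dirichlet form of favourable sign. The integration by parts is obstructed by the weight, which
    for small k is not differentiable on the walls x_i = x_j: it is done for a smooth weight, and
    the singular quotients are paired under x_i <-> x_j before the smoothing is removed. The
    recursion for L(1) leaves a 1-periodic factor open; it is fixed by comparing, far to the right,
    with a product of n one-variable integrals, since the Gamma function is the case n = 1, k = 0 of
    the same transform. *)

Section complex_basics.
Variable R : realType.
Implicit Types (z w : CC R) (x y : R).
Lemma RC_is_rmorph : GRing.monoid_morphism (@RC R : R -> CC R).
Proof. split => [|x y]; [exact: (rmorph1 (real_complex R))|exact: (rmorphM (real_complex R))]. Qed.
Lemma RC_is_zmod : zmod_morphism (@RC R : R -> CC R).
Proof. move=> x y; exact: (rmorphB (real_complex R)). Qed.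
HB.instance Definition _ := GRing.isZmodMorphism.Build R (CC R) (@RC R) RC_is_zmod.
HB.instance Definition _ := GRing.isMonoidMorphism.Build R (CC R) (@RC R) RC_is_rmorph.
Lemma cRe_is_zmod : zmod_morphism (@cRe R : CC R -> R).
Proof. by move=> [a b] [c d]. Qed.
HB.instance Definition _ := GRing.isZmodMorphism.Build (CC R) R (@cRe R) cRe_is_zmod.
Lemma cIm_is_zmod : zmod_morphism (@cIm R : CC R -> R).
Proof. by move=> [a b] [c d]. Qed.
HB.instance Definition _ := GRing.isZmodMorphism.Build (CC R) R (@cIm R) cIm_is_zmod.
Lemma cReM z w : cRe (z * w) = cRe z * cRe w - cIm z * cIm w.
Proof. by case: z w => [a b] [c d]. Qed.
Lemma cImM z w : cIm (z * w) = cRe z * cIm w + cIm z * cRe w.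
Proof. by case: z w => [a b] [c d]; rewrite /= /cIm /=. Qed.
Lemma cReRC x : cRe (RC x) = x. Proof. by []. Qed.
Lemma cImRC x : cIm (RC x) = 0. Proof. by []. Qed.
Lemma CCP z w : cRe z = cRe w -> cIm z = cIm w -> z = w.
Proof. by case: z w => [a b] [c d] /= -> ->. Qed.
(** The order compares only numbers with equal imaginary parts. An inequality [0 <= z] or [|u| <= g]
    in [CC R] therefore also says that z or g is real, and real and complex estimates can be
    mixed. *)
Lemma CC_le z w : (z <= w) = (cIm w == cIm z) && (cRe z <= cRe w).
Proof. by case: z w => [a b] [c d]. Qed.
Lemma CC_lt z w : (z < w) = (cIm w == cIm z) && (cRe z < cRe w).
Proof. by case: z w => [a b] [c d]. Qed.
Lemma CC_norm z : `|z| = RC (cmod z).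
Proof. by case: z => [a b]. Qed.
Lemma RC_le x y : (RC x <= RC y) = (x <= y).
Proof. by rewrite CC_le eqxx. Qed.
Lemma RC_lt x y : (RC x < RC y) = (x < y).
Proof. by rewrite CC_lt eqxx. Qed.
Lemma RC_norm x : `|RC x| = RC `|x|.
Proof. by rewrite CC_norm /cmod /= expr0n addr0 sqrtr_sqr. Qed.
Lemma RC_real z : 0 <= z -> z = RC (cRe z).
Proof. by rewrite CC_le => /andP[/eqP i _]; apply: CCP; rewrite // i. Qed.
Lemma RC_inv x : RC (x^-1) = (RC x)^-1.
Proof. exact: fmorphV. Qed.
End complex_basics.

Section CC_order.
Variable R : realType.
Implicit Types (z w : CC R) (x y : R).
Lemma cRe_le_norm z : `|cRe z| <= cmod z.
Proof. by rewrite /cmod -sqrtr_sqr ler_wsqrtr// lerDl sqr_ge0. Qed.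
Lemma cIm_le_norm z : `|cIm z| <= cmod z.
Proof. by rewrite /cmod -sqrtr_sqr ler_wsqrtr// lerDr sqr_ge0. Qed.
Lemma cmod_ge0 z : 0 <= cmod z. Proof. exact: sqrtr_ge0. Qed.
Lemma cmod_le z : cmod z <= `|cRe z| + `|cIm z|.
Proof.
rewrite -(ler_pXn2r (ltn0Sn 1)) ?nnegrE ?cmod_ge0 ?addr_ge0//.
rewrite sqr_sqrtr ?addr_ge0 ?sqr_ge0// sqrrD !real_normK ?num_real//.
by rewrite addrAC lerDl mulrn_wge0// mulr_ge0.
Qed.
Lemma cRe_le z w : z <= w -> cRe z <= cRe w.
Proof. by rewrite CC_le => /andP[]. Qed.
Lemma cRe_ge0 z : 0 <= z -> 0 <= cRe z. Proof. exact: cRe_le. Qed.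
Lemma RC_ge0 x : (0 <= RC x) = (0 <= x). Proof. exact: (RC_le 0 x). Qed.
Lemma RC_gt0 x : (0 < RC x) = (0 < x). Proof. exact: (RC_lt 0 x). Qed.
Lemma ge0_cIm z : 0 <= z -> cIm z = 0.
Proof. by rewrite CC_le => /andP[/eqP]. Qed.
End CC_order.

Section cint.
Context d (T : measurableType d) (R : realType).
Variable mu : {measure set T -> \bar R}.
Variable D : set T.
Hypothesis mD : measurable D.
Implicit Types (F G : T -> CC R).

Definition cmeas F := measurable_fun D (cRe \o F) /\ measurable_fun D (cIm \o F).
Definition cintble F := mu.-integrable D (EFin \o (cRe \o F)) /\ mu.-integrable D (EFin \o (cIm \o F)).
Definition cint F : CC R := Complex (\int[mu]_(x in D) (cRe (F x))) (\int[mu]_(x in D) (cIm (F x))).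

Lemma cintble_meas F : cintble F -> cmeas F.
Proof. by move=> [/integrableP[/measurable_EFinP ? _] /integrableP[/measurable_EFinP ? _]]. Qed.

Lemma eq_cmeas F G : {in D, F =1 G} -> cmeas F -> cmeas G.
Proof.
move=> e [a b]; split.
  by apply: eq_measurable_fun a => x xD /=; rewrite e.
by apply: eq_measurable_fun b => x xD /=; rewrite e.
Qed.
Lemma eq_cint F G : {in D, F =1 G} -> cint F = cint G.
Proof. by move=> e; congr Complex; apply: eq_Rintegral => x xD; rewrite e. Qed.
Lemma eq_cintble F G : {in D, F =1 G} -> cintble F -> cintble G.
Proof.
move=> e [a b]; split.
  by apply: eq_integrable a => // x xD /=; rewrite e.
by apply: eq_integrable b => // x xD /=; rewrite e.
Qed.
Lemma cmeas_cst c : cmeas (fun=> c). Proof. by split; exact: measurable_cst. Qed.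
Lemma cmeasD F G : cmeas F -> cmeas G -> cmeas (fun x => F x + G x).
Proof.
move=> [a b] [a' b']; split.
  by apply: (eq_measurable_fun (fun x => cRe (F x) + cRe (G x))); [move=> x _ /=; rewrite raddfD|exact: measurable_funD].
by apply: (eq_measurable_fun (fun x => cIm (F x) + cIm (G x))); [move=> x _ /=; rewrite raddfD|exact: measurable_funD].
Qed.
Lemma cmeasM F G : cmeas F -> cmeas G -> cmeas (fun x => F x * G x).
Proof.
move=> [a b] [a' b']; split.
  apply: (eq_measurable_fun (fun x => cRe (F x) * cRe (G x) - cIm (F x) * cIm (G x))); first by move=> x _ /=; rewrite cReM.
  by apply: measurable_funB; exact: measurable_funM.
apply: (eq_measurable_fun (fun x => cRe (F x) * cIm (G x) + cIm (F x) * cRe (G x))); first by move=> x _ /=; rewrite cImM.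
by apply: measurable_funD; exact: measurable_funM.
Qed.
Lemma cmeasN F : cmeas F -> cmeas (fun x => - F x).
Proof.
move=> mF; apply: eq_cmeas (cmeasM (cmeas_cst (-1)) mF) => x _ /=; exact: mulN1r.
Qed.
Lemma cmeasB F G : cmeas F -> cmeas G -> cmeas (fun x => F x - G x).
Proof. by move=> a b; apply: cmeasD => //; exact: cmeasN. Qed.
Lemma cmeas_sum I (r : seq I) (P : pred I) (F : I -> T -> CC R) :
  (forall i, P i -> cmeas (F i)) -> cmeas (fun x => \sum_(i <- r | P i) F i x).
Proof.
move=> mF; elim: r => [|i r IH]; first by apply: eq_cmeas (cmeas_cst 0) => x _; rewrite big_nil.
case Pi: (P i); last by apply: eq_cmeas IH => x _; rewrite big_cons Pi.
by apply: eq_cmeas (cmeasD (mF _ Pi) IH) => x _; rewrite big_cons Pi.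
Qed.
Lemma cmeas_prod I (r : seq I) (P : pred I) (F : I -> T -> CC R) :
  (forall i, P i -> cmeas (F i)) -> cmeas (fun x => \prod_(i <- r | P i) F i x).
Proof.
move=> mF; elim: r => [|i r IH]; first by apply: eq_cmeas (cmeas_cst 1) => x _; rewrite big_nil.
case Pi: (P i); last by apply: eq_cmeas IH => x _; rewrite big_cons Pi.
by apply: eq_cmeas (cmeasM (mF _ Pi) IH) => x _; rewrite big_cons Pi.
Qed.
Lemma cmeas_RC (f : T -> R) : measurable_fun D f -> cmeas (fun x => RC (f x)).
Proof. by move=> mf; split; [exact: mf|exact: measurable_cst]. Qed.
Lemma cmeas_cmod F : cmeas F -> measurable_fun D (fun x => cmod (F x)).
Proof.
move=> [a b].
apply: (measurableT_comp (f := @Num.sqrt R)).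
  by apply: continuous_measurable_fun; exact: sqrt_continuous.
by apply: measurable_funD; apply: measurable_funX.
Qed.
Lemma cmeas_norm F : cmeas F -> cmeas (fun x => `|F x|).
Proof.
move=> /cmeas_cmod h; apply: eq_cmeas (cmeas_RC h) => x _; by rewrite CC_norm.
Qed.
Lemma cmeas_cvg (F : nat -> T -> CC R) G : (forall n, cmeas (F n)) ->
  (forall x, D x -> (fun n => cRe (F n x)) @ \oo --> cRe (G x) /\ (fun n => cIm (F n x)) @ \oo --> cIm (G x)) ->
  cmeas G.
Proof.
move=> mF cF; split.
  by apply: (measurable_fun_cvg (fun n => (mF n).1)) => x Dx; have [] := cF x Dx.
by apply: (measurable_fun_cvg (fun n => (mF n).2)) => x Dx; have [] := cF x Dx.
Qed.

Lemma cintbleD F G : cintble F -> cintble G -> cintble (fun x => F x + G x).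
Proof.
move=> [a b] [a' b']; split.
  apply: (eq_integrable mD _ _ _ (integrableD mD a a')) => x _ /=.
  by rewrite raddfD EFinD.
apply: (eq_integrable mD _ _ _ (integrableD mD b b')) => x _ /=.
by rewrite raddfD EFinD.
Qed.
(** The majorant is complex-valued on purpose: [|F x| <= G x] forces [G x] to be real and
    nonnegative, so the majorants of [qr], which live in [CC R], are used as they are. *)
Lemma cintble_dom F G : cmeas F -> cintble G -> (forall x, D x -> `|F x| <= G x) -> cintble F.
Proof.
move=> [a b] [iG _] FG; split; apply: le_integrable iG => //;
  try by apply/measurable_EFinP.
- move=> x Dx /=; rewrite lee_fin [leRHS]ger0_norm; last first.
    by apply: cRe_ge0; apply: le_trans (FG _ Dx).
  by apply: le_trans (cRe_le_norm _) _; rewrite -(cReRC (cmod _)) -CC_norm cRe_le// FG.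
- move=> x Dx /=; rewrite lee_fin [leRHS]ger0_norm; last first.
    by apply: cRe_ge0; apply: le_trans (FG _ Dx).
  by apply: le_trans (cIm_le_norm _) _; rewrite -(cReRC (cmod _)) -CC_norm cRe_le// FG.
Qed.
Lemma cintble_RC (f : T -> R) : mu.-integrable D (EFin \o f) -> cintble (fun x => RC (f x)).
Proof. by move=> i; split => //; exact: integrable0. Qed.
Lemma cintble_norm F : cintble F -> cintble (fun x => `|F x|).
Proof.
move=> iF; have [mF [a b]] := (cintble_meas iF, iF).
pose G x : CC R := RC (`|cRe (F x)| + `|cIm (F x)|).
apply: (cintble_dom (G:=G)); first exact: cmeas_norm.
  apply: cintble_RC; have := integrableD mD (integrable_norm a) (integrable_norm b).
  by apply: eq_integrable.
by move=> x Dx; rewrite normr_id CC_norm RC_le cmod_le.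
Qed.
Lemma cintbleZ c F : cintble F -> cintble (fun x => c * F x).
Proof.
move=> iF; have [mF [a b]] := (cintble_meas iF, iF).
have h x (r : R) : (fun x => (r * cRe (F x))%:E) = (fun x => (r%:E * ((EFin \o (cRe \o F)) x)))%E by apply/funext.
split.
- have := integrableB mD (integrableZl mD (cRe c) a) (integrableZl mD (cIm c) b).
  by apply: eq_integrable => // x _ /=; rewrite cReM EFinB !EFinM.
- have := integrableD mD (integrableZl mD (cRe c) b) (integrableZl mD (cIm c) a).
  by apply: eq_integrable => // x _ /=; rewrite cImM EFinD !EFinM.
Qed.
Lemma cintbleN F : cintble F -> cintble (fun x => - F x).
Proof. by move=> i; apply: eq_cintble (cintbleZ (-1) i) => x _; exact: mulN1r. Qed.
Lemma cintbleB F G : cintble F -> cintble G -> cintble (fun x => F x - G x).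
Proof. by move=> a b; apply: cintbleD => //; exact: cintbleN. Qed.
Lemma cintble0 : cintble (fun=> 0).
Proof. by split; exact: integrable0. Qed.
Lemma cintble_sum I (r : seq I) (P : pred I) (F : I -> T -> CC R) :
  (forall i, P i -> cintble (F i)) -> cintble (fun x => \sum_(i <- r | P i) F i x).
Proof.
move=> mF; elim: r => [|i r IH]; first by apply: eq_cintble cintble0 => x _; rewrite big_nil.
case Pi: (P i); last by apply: eq_cintble IH => x _; rewrite big_cons Pi.
by apply: eq_cintble (cintbleD (mF _ Pi) IH) => x _; rewrite big_cons Pi.
Qed.
Lemma cintD F G : cintble F -> cintble G -> cint (fun x => F x + G x) = cint F + cint G.
Proof.
move=> [a b] [a' b']; apply: CCP; rewrite /= /cRe /cIm /=.
  by rewrite -RintegralD//; apply: eq_Rintegral => x _; rewrite -[LHS]/(cRe _) raddfD.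
by rewrite -RintegralD//; apply: eq_Rintegral => x _; rewrite -[LHS]/(cIm _) raddfD.
Qed.
Lemma cintZ c F : cintble F -> cint (fun x => c * F x) = c * cint F.
Proof.
move=> [a b]; apply: CCP.
  rewrite cReM -[cRe (cint _)]/(\int[mu]_(x in D) _) -[cIm (cint _)]/(\int[mu]_(x in D) _).
  rewrite -!RintegralZl// -RintegralB//.
  - by apply: eq_Rintegral => x _; rewrite cReM.
  - exact: (integrableZl mD (cRe c) a).
  - exact: (integrableZl mD (cIm c) b).
rewrite cImM -[cRe (cint _)]/(\int[mu]_(x in D) _) -[cIm (cint _)]/(\int[mu]_(x in D) _).
rewrite -!RintegralZl// -RintegralD//.
- by apply: eq_Rintegral => x _; rewrite cImM.
- exact: (integrableZl mD (cRe c) b).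
- exact: (integrableZl mD (cIm c) a).
Qed.
Lemma cint0 : cint (fun=> 0) = 0.
Proof. by apply: CCP; rewrite /cint /cRe /cIm /= /Rintegral integral0. Qed.
Lemma cintN F : cintble F -> cint (fun x => - F x) = - cint F.
Proof. by move=> i; rewrite -mulN1r -cintZ//; apply: eq_cint => x _; rewrite mulN1r. Qed.
Lemma cintB F G : cintble F -> cintble G -> cint (fun x => F x - G x) = cint F - cint G.
Proof. by move=> a b; rewrite cintD ?cintN//; exact: cintbleN. Qed.
Lemma cint_sum I (r : seq I) (P : pred I) (F : I -> T -> CC R) :
  (forall i, P i -> cintble (F i)) -> cint (fun x => \sum_(i <- r | P i) F i x) = \sum_(i <- r | P i) cint (F i).
Proof.
move=> mF; elim: r => [|i r IH].
  by rewrite [RHS]big_nil -[RHS]cint0; apply: eq_cint => x _; rewrite big_nil.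
rewrite big_cons -IH; case: ifPn => Pi; last first.
  by apply: eq_cint => x _; rewrite big_cons (negPf Pi).
rewrite -cintD//; [|exact: mF|exact: cintble_sum].
by apply: eq_cint => x _; rewrite big_cons Pi.
Qed.
Lemma le_cint F G : cintble F -> cintble G -> (forall x, D x -> F x <= G x) -> cint F <= cint G.
Proof.
move=> [a b] [a' b'] FG; rewrite CC_le /cint /cRe /cIm /=; apply/andP; split.
  apply/eqP; apply: eq_Rintegral => x /set_mem Dx; have := FG _ Dx.
  by rewrite CC_le => /andP[/eqP].
by apply: le_Rintegral => // x Dx; apply: cRe_le; exact: FG.
Qed.
Lemma cint_ge0 F : (forall x, D x -> 0 <= F x) -> 0 <= cint F.
Proof.
move=> F0; rewrite CC_le /cint /cRe /cIm /=; apply/andP; split.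
  apply/eqP; rewrite -[RHS](_ : \int[mu]_(x in D) 0 = 0).
    by apply: eq_Rintegral => x /set_mem Dx; exact/ge0_cIm/F0.
  by rewrite /Rintegral integral0.
by apply: Rintegral_ge0 => x Dx; apply: cRe_ge0; exact: F0.
Qed.
(** Multiplying by the unit number u = |I| / I makes the integral I real and nonnegative; it then
    remains to compare real parts. *)
Lemma norm_cint F : cintble F -> `|cint F| <= cint (fun x => `|F x|).
Proof.
move=> iF; have inF := cintble_norm iF.
have [->|N0] := eqVneq (cint F) 0; first by rewrite normr0 cint_ge0.
pose u := `|cint F| / cint F.
have nu : `|u| = 1 by rewrite normrM normfV normr_id mulfV// normr_eq0.
have e : `|cint F| = cint (fun x => u * F x) by rewrite cintZ// divfK.
rewrite e CC_le; apply/andP; split.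
  by rewrite -e CC_norm cImRC ge0_cIm// cint_ge0.
apply: le_Rintegral => //.
- exact: (cintbleZ u iF).1.
- exact: inF.1.
- move=> x Dx; rewrite CC_norm cReRC; apply: le_trans (ler_norm _) _.
  by apply: le_trans (cRe_le_norm _) _; rewrite -RC_le -!CC_norm normrM nu mul1r.
Qed.
Lemma cint_dct (F : nat -> T -> CC R) G (g : T -> CC R) : (forall n, cmeas (F n)) -> cintble g ->
  (forall n x, D x -> `|F n x| <= g x) ->
  (forall x, D x -> (fun n => cRe (F n x)) @ \oo --> cRe (G x) /\ (fun n => cIm (F n x)) @ \oo --> cIm (G x)) ->
  [/\ cintble G, (fun n => cRe (cint (F n))) @ \oo --> cRe (cint G) &
   (fun n => cIm (cint (F n))) @ \oo --> cIm (cint G)].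
Proof.
move=> mF ig Fg FG; have mG := cmeas_cvg mF FG.
have key (p : CC R -> R) : (forall z, `|p z| <= cmod z) -> (forall n, measurable_fun D (p \o F n)) ->
   measurable_fun D (p \o G) ->
   (forall x, D x -> (fun n => p (F n x)) @ \oo --> p (G x)) ->
   mu.-integrable D (EFin \o (p \o G)) /\ (fun n => \int[mu]_(x in D) p (F n x)) @ \oo --> \int[mu]_(x in D) p (G x).
  move=> pl mp mpG pc.
  have [|||||iG _ cG] := @dominated_convergence _ T R mu D mD (fun n => EFin \o (p \o F n)) (EFin \o (p \o G)) (EFin \o (cRe \o g)).
  - by move=> n; apply/measurable_EFinP.
  - by apply/measurable_EFinP.
  - by apply: aeW => x Dx; apply: cvg_EFin; [near=> n|exact: pc].
  - exact: ig.1.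
  - apply: aeW => x n Dx /=; rewrite lee_fin; apply: le_trans (pl _) _.
    by rewrite -[leLHS]cReRC -CC_norm cRe_le// Fg.
  split => //; apply: fine_cvg; rewrite fineK; first exact: cG.
  by apply: integrable_fin_num.
have [iR cR] := key cRe (@cRe_le_norm R) (fun n => (mF n).1) mG.1 (fun x Dx => (FG x Dx).1).
have [iI cI] := key cIm (@cIm_le_norm R) (fun n => (mF n).2) mG.2 (fun x Dx => (FG x Dx).2).
by split.
Unshelve. all: by end_near. Qed.
End cint.

(** * Quadratic remainder bounds and differentiation under the integral sign *)

Section qr.
Variable R : realType.
Variable V : normedModType (CC R).
Implicit Types (f L : V -> CC R) (p h v : V) (rho g : CC R).
Definition clinear L := forall (a : CC R) u v, L (a *: u + v) = a * L u + L v.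
Lemma clinear0 L : clinear L -> L 0 = 0.
Proof. by move=> /(_ (-1) 0 0); rewrite scaler0 addr0 mulN1r addNr. Qed.
Lemma clinearZ L : clinear L -> forall a u, L (a *: u) = a * L u.
Proof. by move=> l a u; have := l a u 0; rewrite (clinear0 l) !addr0. Qed.
Lemma clinearD L : clinear L -> forall u v, L (u + v) = L u + L v.
Proof. by move=> l u v; have := l 1 u v; rewrite scale1r mul1r. Qed.

(* [f] is linearly approximated by [L] at [p], with a quadratic error controlled by [g] on the ball of radius [rho]. *)
Definition qr f p L rho g := clinear L /\ forall h, `|h| <= rho ->
  [/\ `|f (p + h)| <= g, rho * `|f (p + h) - f p| <= `|h| * g &
      rho ^+ 2 * `|f (p + h) - f p - L h| <= `|h| ^+ 2 * g].

Lemma qr_ge0 f p L rho g : 0 < rho -> qr f p L rho g -> 0 <= g.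
Proof. by move=> r0 [_ /(_ 0)]; rewrite normr0 => /(_ (ltW r0)) [h _ _]; apply: le_trans h. Qed.
Lemma qr_le f p L rho g g' : g <= g' -> qr f p L rho g -> qr f p L rho g'.
Proof.
move=> gg' [l H]; split => // h hr; have [a b c] := H h hr; split.
- exact: le_trans gg'.
- by apply: le_trans b _; rewrite ler_wpM2l.
- by apply: le_trans c _; rewrite ler_wpM2l// exprn_ge0.
Qed.
Lemma qr_eq f f' p L L' rho g : f =1 f' -> L =1 L' -> qr f p L rho g -> qr f' p L' rho g.
Proof. by move=> /funext -> /funext ->. Qed.
Lemma qr_cst c p rho g : `|c| <= g -> qr (fun=> c) p (fun=> 0) rho g.
Proof.
move=> cg; split; first by move=> a u v; rewrite mulr0 addr0.
move=> h hr; split; rewrite ?subrr ?subr0 ?normr0 ?mulr0 ?mulr_ge0 ?exprn_ge0//;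
  exact: le_trans cg.
Qed.
Lemma qrD f f' p L L' rho g g' : 0 < rho -> qr f p L rho g -> qr f' p L' rho g' ->
  qr (fun v => f v + f' v) p (fun v => L v + L' v) rho (g + g').
Proof.
move=> r0 [l H] [l' H']; split; first by move=> a u v; rewrite l l'; ring.
move=> h hr; have [a b c] := H h hr; have [a' b' c'] := H' h hr; split.
- by apply: le_trans (ler_normD _ _) _; apply: lerD.
- rewrite mulrDr; apply: le_trans (lerD b b'); rewrite -mulrDr ler_wpM2l ?(ltW r0)//.
  by apply: le_trans (ler_normD _ _); rewrite le_eqVlt; apply/orP; left; apply/eqP; congr (`|_|); ring.
- rewrite mulrDr; apply: le_trans (lerD c c'); rewrite -mulrDr ler_wpM2l ?exprn_ge0 ?(ltW r0)//.
  by apply: le_trans (ler_normD _ _); rewrite le_eqVlt; apply/orP; left; apply/eqP; congr (`|_|); ring.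
Qed.
(** The remainder of a product splits into three terms, the product of the two increments and the
    two cross terms, each bounded by g g'; this is the factor 3. *)
Lemma qrM f f' p L L' rho g g' : 0 < rho -> qr f p L rho g -> qr f' p L' rho g' ->
  qr (fun v => f v * f' v) p (fun v => L v * f' p + f p * L' v) rho (3%:R * (g * g')).
Proof.
move=> r0 Hf Hf'; have g0 := qr_ge0 r0 Hf; have g0' := qr_ge0 r0 Hf'.
have r1 := ltW r0.
case: Hf Hf' => [l H] [l' H']; split; first by move=> a u v; rewrite l l'; ring.
have [fp _ _] := H 0 ltac:(by rewrite normr0); have [fp' _ _] := H' 0 ltac:(by rewrite normr0).
rewrite addr0 in fp; rewrite addr0 in fp'.
move=> h hr; have [a b c] := H h hr; have [a' b' c'] := H' h hr; split.
- rewrite normrM; apply: (@le_trans _ _ (g * g')); first exact: ler_pM.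
  by rewrite ler_peMl ?mulr_ge0// ler1n.
- have -> : f (p + h) * f' (p + h) - f p * f' p = (f (p + h) - f p) * f' (p + h) + f p * (f' (p + h) - f' p) by ring.
  apply: (@le_trans _ _ (rho * `|f (p + h) - f p| * `|f' (p + h)| + `|f p| * (rho * `|f' (p + h) - f' p|))).
    have -> : rho * `|f (p + h) - f p| * `|f' (p + h)| + `|f p| * (rho * `|f' (p + h) - f' p|) =
      rho * (`|(f (p + h) - f p) * f' (p + h)| + `|f p * (f' (p + h) - f' p)|) by rewrite !normrM; ring.
    by rewrite ler_wpM2l// ler_normD.
  apply: (@le_trans _ _ ((`|h| * g) * g' + g * (`|h| * g'))).
    by apply: lerD; apply: ler_pM; rewrite ?mulr_ge0.
  have -> : `|h| * (3%:R * (g * g')) = (`|h| * g * g' + g * (`|h| * g')) + `|h| * (g * g') by ring.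
  by rewrite lerDl ?mulr_ge0.
- have -> : f (p + h) * f' (p + h) - f p * f' p - (L h * f' p + f p * L' h) =
    (f (p + h) - f p) * (f' (p + h) - f' p) + (f p * (f' (p + h) - f' p - L' h) + f' p * (f (p + h) - f p - L h)) by ring.
  apply: (@le_trans _ _ ((rho * `|f (p + h) - f p|) * (rho * `|f' (p + h) - f' p|) + (`|f p| * (rho ^+ 2 * `|f' (p + h) - f' p - L' h|)
     + `|f' p| * (rho ^+ 2 * `|f (p + h) - f p - L h|)))).
    set A := `|f (p + h) - f p| ; set B := `|f' (p + h) - f' p|.
    have -> : rho * A * (rho * B) + (`|f p| * (rho ^+ 2 * `|f' (p + h) - f' p - L' h|) + `|f' p| * (rho ^+ 2 * `|f (p + h) - f p - L h|)) =
      rho ^+ 2 * (`|(f (p + h) - f p) * (f' (p + h) - f' p)| + (`|f p * (f' (p + h) - f' p - L' h)| + `|f' p * (f (p + h) - f p - L h)|)).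
      by rewrite !normrM -/A -/B; ring.
    rewrite ler_wpM2l// ?exprn_ge0//; apply: le_trans (ler_normD _ _) _; rewrite lerD2l; exact: ler_normD.
  have -> : `|h| ^+ 2 * (3%:R * (g * g')) = (`|h| * g) * (`|h| * g') + (g * (`|h| ^+ 2 * g') + g' * (`|h| ^+ 2 * g)) by ring.
  by apply: lerD; [apply: ler_pM; rewrite ?mulr_ge0|apply: lerD; apply: ler_pM; rewrite ?mulr_ge0 ?exprn_ge0].
Qed.
(** Rescale h to norm rho. There the increment and the remainder are both at most g, and L h is
    their difference. *)
Lemma qr_lin_le f p L rho g h : 0 < rho -> qr f p L rho g -> rho * `|L h| <= 2%:R * (`|h| * g).
Proof.
move=> r0 H; have g0 := qr_ge0 r0 H; case: H => l H.
have [->|h0] := eqVneq h 0; first by rewrite (clinear0 l) !normr0 mul0r !mulr0.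
pose t := rho / `|h|; have h1 : 0 < `|h| by rewrite normr_gt0.
have t0 : 0 < t by rewrite divr_gt0.
have th : `|t *: h| = rho by rewrite normrZ gtr0_norm// divfK// gt_eqF.
have [_ b c] := H (t *: h) ltac:(by rewrite th).
rewrite th (clinearZ l) in b c.
rewrite ler_pM2l// in b; rewrite ler_pM2l ?exprn_gt0// in c.
have : `|t * L h| <= g + g.
  have -> : t * L h = (f (p + t *: h) - f p) - (f (p + t *: h) - f p - t * L h) by ring.
  by apply: le_trans (ler_normB _ _) _; exact: lerD.
rewrite normrM (gtr0_norm t0) /t mulrAC ler_pdivrMr// => hh; apply: le_trans hh _.
by rewrite le_eqVlt; apply/orP; left; apply/eqP; ring.
Qed.
Lemma qr_diff f p L rho g : 0 < rho -> qr f p L rho g ->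
  differentiable f p /\ 'd f p = L :> (V -> CC R).
Proof.
move=> r0 H; have g0 := qr_ge0 r0 H.
have lb h := qr_lin_le h r0 H.
case: H => l H.
have lL : linear L by move=> a u v; exact: l.
pose isl := GRing.isLinear.Build _ _ _ _ L lL.
pose l' : {linear V -> CC R} := HB.pack L isl.
have lc : continuous l'.
  apply: bounded_linear_continuous; apply/linear_boundedP.
  exists (2%:R * g / rho); split; first by rewrite realE !mulr_ge0// invr_ge0 ltW.
  move=> M hM x; apply: le_trans (_ : 2%:R * g / rho * `|x| <= _); last by rewrite ler_wpM2r// ltW.
  by rewrite mulrAC ler_pdivlMr// mulrC -mulrA (mulrC g); exact: lb.
have e : f \o shift p = cst (f p) + l' +o_ 0 id.
  apply/eqaddoP => eps e0; near=> x.
  rewrite /= -[(_ - _) x]/(f (x + p) - (f p + L x)) opprD addrA (addrC x).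
  have xr : `|x| <= rho by near: x; apply: nbhs0_le.
  have [_ _ c] := H x xr.
  have xe : `|x| <= eps * rho ^+ 2 / (g + 1).
    by near: x; apply: nbhs0_le; rewrite divr_gt0 ?mulr_gt0 ?exprn_gt0// ltr_wpDl.
  rewrite -(ler_pM2l (x := rho ^+ 2)) ?exprn_gt0//; apply: le_trans c _.
  rewrite expr2 -mulrA mulrCA mulrC [leRHS]mulrA (mulrC (rho ^+ 2)); apply: ler_wpM2r => //.
  rewrite ler_pdivlMr ?ltr_wpDl// in xe; apply: le_trans xe.
  by rewrite ler_wpM2l// lerDl.
have d : 'd f p = l' :> (V -> CC R) := diff_unique lc e.
split; last exact: d.
apply/diff_locallyP; rewrite d; split; [exact: lc|exact: e].
Unshelve. all: by end_near. Qed.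
Lemma qr_derive f p L rho g v : 0 < rho -> qr f p L rho g -> 'D_v f p = L v.
Proof. by move=> r0 /(qr_diff r0) [d e]; rewrite deriveE// e. Qed.
End qr.

Section qr_cint.
Context d (T : measurableType d) (R : realType).
Variable mu : {measure set T -> \bar R}.
Variable D : set T.
Hypothesis mD : measurable D.
Variable V : normedModType (CC R).
Lemma CC_cvg_le (u : nat -> CC R) l (b : nat -> R) : (forall N, `|u N - l| <= RC (b N)) ->
  b @ \oo --> 0 -> (fun n => cRe (u n)) @ \oo --> cRe l /\ (fun n => cIm (u n)) @ \oo --> cIm l.
Proof.
move=> ub b0.
have key (q : {additive CC R -> R}) : (forall z, `|q z| <= cmod z) -> (fun n => q (u n)) @ \oo --> q l.
  move=> qz; apply/cvgrPdist_lt => e e0; near=> n.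
  rewrite distrC -raddfB; apply: le_lt_trans (qz _) _.
  have := ub n; rewrite CC_norm RC_le => /le_lt_trans; apply.
  by near: n; apply: (cvgr_lt _ b0).
split; [exact: (key cRe (@cRe_le_norm R))|exact: (key cIm (@cIm_le_norm R))].
Unshelve. all: by end_near. Qed.

(** The three inequalities of [qr] are integrated as they stand. Measurability of the derivative is
    deduced: [L x h] is the pointwise limit of (m+1) (Phi (p + h/(m+1)) - Phi p), the quadratic
    bound giving an error of order 1/(m+1). Directions longer than rho are reached by scaling. *)
Lemma qr_cint (Phi L : T -> V -> CC R) (p : V) (rho : CC R) (g : T -> CC R) :
  0 < rho -> cintble mu D g -> (forall x, D x -> qr (Phi x) p (L x) rho (g x)) ->
  (forall h, `|h| <= rho -> cmeas D (fun x => Phi x (p + h))) ->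
  qr (fun v => cint mu D (fun x => Phi x v)) p (fun v => cint mu D (fun x => L x v)) rho (cint mu D g)
  /\ (forall v, cintble mu D (fun x => L x v)).
Proof.
move=> r0 ig H mP.
have iP h : `|h| <= rho -> cintble mu D (fun x => Phi x (p + h)).
  by move=> hr; apply: (cintble_dom mD (mP h hr) ig) => x Dx; have [] := (H x Dx).2 h hr.
have iP0 : cintble mu D (fun x => Phi x p).
  by have := iP 0; rewrite normr0 addr0 => /(_ (ltW r0)).
have mL h : `|h| <= rho -> cmeas D (fun x => L x h).
  move=> hr.
  pose F (n : nat) x := n.+1%:R * (Phi x (p + n.+1%:R^-1 *: h) - Phi x p).
  have nh (n : nat) : `|(n.+1%:R^-1 : CC R) *: h| <= rho.
    rewrite normrZ normfV normr_nat; apply: le_trans hr.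
    by rewrite ler_piMl// invf_le1 ?ler1n// ltr0n.
  apply: (cmeas_cvg (F := F)).
    move=> n; apply: cmeasM; first exact: cmeas_cst.
    by apply: cmeasB; [exact: mP|exact: (cintble_meas iP0)].
  move=> x Dx; have [lx Hx] := H x Dx.
  have g0 := qr_ge0 r0 (H x Dx).
  pose C := `|h| ^+ 2 * g x / rho ^+ 2.
  have C0 : 0 <= C by rewrite !mulr_ge0 ?exprn_ge0// invr_ge0 exprn_ge0// ltW.
  apply: (@CC_cvg_le _ _ (fun n => cRe C * harmonic n)); last first.
    by rewrite -(mulr0 (cRe C)); apply: cvgMr; exact: cvg_harmonic.
  move=> n; rewrite rmorphM/= -(RC_real C0) /harmonic fmorphV rmorph_nat.
  have n0 : 0 < (n.+1%:R : CC R) by rewrite ltr0n.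
  have -> : F n x - L x h = n.+1%:R * (Phi x (p + n.+1%:R^-1 *: h) - Phi x p - L x (n.+1%:R^-1 *: h)).
    by rewrite /F (clinearZ lx) [RHS]mulrBr mulVKf// gt_eqF.
  have [_ _ c] := Hx _ (nh n).
  rewrite normrM (gtr0_norm n0).
  have := c; rewrite mulrC -ler_pdivlMr ?exprn_gt0// => c'.
  apply: le_trans (_ : n.+1%:R * (`|n.+1%:R^-1 *: h| ^+ 2 * g x / rho ^+ 2) <= _).
    by rewrite ler_wpM2l// ltW.
  rewrite normrZ normfV normr_nat le_eqVlt; apply/orP; left; apply/eqP.
  by rewrite /C; field; rewrite !gt_eqF.
have iL v : cintble mu D (fun x => L x v).
  have [->|v0] := eqVneq v 0.
    have e0 : {in D, (fun=> 0) =1 (fun x => L x 0)} by move=> x /set_mem Dx /=; rewrite (clinear0 (H x Dx).1).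
    exact: eq_cintble e0 (cintble0 mu D).
  pose t := rho / `|v|; have h1 : 0 < `|v| by rewrite normr_gt0.
  have t0 : 0 < t by rewrite divr_gt0.
  have tv : `|t *: v| <= rho by rewrite normrZ gtr0_norm// divfK// gt_eqF.
  have i1 : cintble mu D (fun x => L x (t *: v)).
    apply: (cintble_dom mD (mL _ tv) (cintbleZ mD (2%:R) ig)) => x Dx.
    rewrite -(ler_pM2l r0); apply: le_trans (qr_lin_le _ r0 (H x Dx)) _.
    by rewrite [leRHS]mulrCA ler_wpM2l// ler_wpM2r// (qr_ge0 r0 (H x Dx)).
  have e : {in D, (fun x => t^-1 * L x (t *: v)) =1 (fun x => L x v)}.
    by move=> x /set_mem Dx; rewrite (clinearZ (H x Dx).1) mulKf// gt_eqF.
  exact: (eq_cintble mD e (cintbleZ mD t^-1 i1)).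
split => //; split.
  move=> a u v; rewrite -cintZ// -cintD//; last exact: cintbleZ.
  by apply: eq_cint => x /set_mem Dx; exact: (H x Dx).1.
move=> h hr; have iPh := iP h hr.
split.
- apply: le_trans (norm_cint mD iPh) _; apply: le_cint => //; first exact: cintble_norm.
  by move=> x Dx; have [] := (H x Dx).2 h hr.
- rewrite -cintB//; have i1 := cintbleB mD iPh iP0.
  apply: le_trans (_ : rho * cint mu D (fun x => `|Phi x (p + h) - Phi x p|) <= _).
    by rewrite ler_wpM2l ?(ltW r0)//; exact: norm_cint.
  rewrite -!cintZ//; last exact: cintble_norm.
  apply: le_cint => //; [exact/cintbleZ/cintble_norm|exact: cintbleZ|].
  by move=> x Dx; have [] := (H x Dx).2 h hr.
- rewrite -!cintB//; last exact: cintbleB.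
  have i1 := cintbleB mD (cintbleB mD iPh iP0) (iL h).
  apply: le_trans (_ : rho ^+ 2 * cint mu D (fun x => `|Phi x (p + h) - Phi x p - L x h|) <= _).
    by rewrite ler_wpM2l ?exprn_ge0 ?(ltW r0)//; exact: norm_cint.
  rewrite -!cintZ//; last exact: cintble_norm.
  apply: le_cint => //; [exact/cintbleZ/cintble_norm|exact: cintbleZ|].
  by move=> x Dx; have [] := (H x Dx).2 h hr.
Qed.
End qr_cint.

(** * Lebesgue measure on tuples and changes of variables *)
Section tmeasure.
Variable R : realType.
Local Notation T n := (n.-tuple (measurableTypeR R)).
Local Notation leb := (@lebesgue_measure R).

Definition consT n (p : measurableTypeR R * T n) : T n.+1 := [the n.+1.-tuple _ of p.1 :: p.2].
Lemma measurable_consT n : measurable_fun setT (@consT n).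
Proof. by apply: measurable_cons => //. Qed.
HB.instance Definition _ n := isMeasurableFun.Build _ _ _ _ (@consT n) (@measurable_consT n).

Section step.
Let lebs : {sigma_finite_measure set (measurableTypeR R) -> \bar R} := [the {sigma_finite_measure set (measurableTypeR R) -> \bar R} of leb].
Variables (n : nat) (m : {sigma_finite_measure set (T n) -> \bar R}).
Definition tstep : set (T n.+1) -> \bar R := pushforward (lebs \x m)%E (@consT n).
Let pm : {measure set (T n.+1) -> \bar R} :=
  measure_function_pushforward__canonical__measure_function_Measure (lebs \x m)%E (@measurable_consT n).
Let tstep0 : tstep set0 = 0%E. Proof. exact: (measure0 pm). Qed.
Let tstep_ge0 A : (0 <= tstep A)%E. Proof. exact: (measure_ge0 pm). Qed.
Let tstep_sigma_additive : semi_sigma_additive tstep.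
Proof. exact: (@measure_semi_sigma_additive _ _ _ pm). Qed.
HB.instance Definition _ := isMeasure.Build _ _ _ tstep tstep0 tstep_ge0 tstep_sigma_additive.
(** Sigma-finiteness is carried along because the next product measure and Tonelli's theorem ask for
    it. Products of two exhausting families, indexed by encoded pairs, are pulled back along the
    inverse of [consT]. *)
Lemma tstep_sigma_finite : sigma_finite setT tstep.
Proof.
have [F FT mF] := sigma_finiteT lebs.
have [G GT mG] := sigma_finiteT m.
pose H (k : nat) : set (measurableTypeR R * T n) :=
  if (unpickle k : option (nat * nat)) is Some ij then F ij.1 `*` G ij.2 else set0.
pose u (x : T n.+1) : measurableTypeR R * T n := (thead x, [tuple of behead x]).
have mu : measurable_fun setT u.
  by apply: measurable_fun_pair; [exact: measurable_tnth|exact: measurable_behead].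
exists (fun k => u @^-1` (H k)).
  apply/seteqP; split => // x _.
  have : [set: measurableTypeR R] (u x).1 by [].
  rewrite FT => -[i _ Fi]; have : [set: T n] (u x).2 by [].
  rewrite GT => -[j _ Gj]; exists (pickle (i, j)) => //.
  by rewrite /H /= pickleK.
move=> k; have [mk fk] : measurable (H k) /\ ((lebs \x m) (H k) < +oo)%E.
  rewrite /H; case: (unpickle k) => [[i j]|]; last by rewrite measure0.
  have [? ?] := mF i; have [? ?] := mG j; split; first exact: measurableX.
  by rewrite product_measure1E// lte_mul_pinfty// ge0_fin_numE.
split.
  by rewrite -[X in measurable X]setTI; exact: mu.
rewrite /tstep /pushforward (_ : _ @^-1` _ = H k)//.
apply/seteqP; split => -[t s] /=.
  rewrite /u /consT /= theadE (_ : [tuple of behead (t :: s)] = s)//.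
  by apply: val_inj.
move=> Hts; rewrite /u /consT /= theadE (_ : [tuple of behead (t :: s)] = s)//.
by apply: val_inj.
Qed.
HB.instance Definition _ := Measure_isSigmaFinite.Build _ _ _ tstep tstep_sigma_finite.
End step.

Definition behT n (x : T n.+1) : T n := [tuple of behead x].
Lemma behTE n t (s : T n) : behT (consT (t, s)) = s.
Proof. exact: val_inj. Qed.
(** Lebesgue measure on n-tuples, built by the same recursion on the head coordinate as the iterated
    integrals [iint], so that one Tonelli step per coordinate identifies the two. *)
Fixpoint tmu n : {sigma_finite_measure set (T n) -> \bar R} :=
  match n with
  | 0 => [the {sigma_finite_measure set (T 0) -> \bar R} of @dirac _ (T 0) [tuple] R]
  | n'.+1 => [the {sigma_finite_measure set (T n'.+1) -> \bar R} of tstep (tmu n')]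
  end.

Local Open Scope ereal_scope.
Lemma tmu_recl n (F : T n.+1 -> \bar R) : measurable_fun setT F -> (forall x, 0 <= F x) ->
  \int[tmu n.+1]_x F x = \int[leb]_t \int[tmu n]_s F (consT (t, s)).
Proof.
move=> mF F0.
rewrite [LHS](_ : _ = \int[pushforward (leb \x tmu n) (@consT n)]_x F x)//.
rewrite ge0_integral_pushforward// preimage_setT.
have mFc := measurableT_comp mF (@measurable_consT n).
by rewrite (@fubini_tonelli1 _ _ _ _ _ leb (tmu n) (F \o @consT n) mFc)// => z; exact: F0.
Qed.
Lemma tmu_rec0 (F : T 0 -> \bar R) : measurable_fun setT F ->
  \int[tmu 0]_x F x = F [tuple].
Proof. by move=> mF; rewrite /= integral_dirac// diracT mul1e. Qed.

Definition tset (D : set R) n : set (T n) := [set x | forall i, D (tnth x i)].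
Arguments tset D n : clear implicits.
Lemma measurable_tset D n : measurable (D : set (measurableTypeR R)) -> measurable (tset D n).
Proof.
move=> mD; rewrite (_ : tset D n = \bigcap_(i in [set: 'I_n]) ((fun x => tnth x i) @^-1` D)).
  apply: fin_bigcap_measurable => // i _.
  by rewrite -[X in measurable X]setTI; exact: measurable_tnth.
by apply/seteqP; split => x h i; [move=> _; exact: h|exact: h].
Qed.
Lemma tset_cons D n t (s : T n) : tset D n.+1 (consT (t, s)) <-> D t /\ tset D n s.
Proof.
split => [h|[Dt Ds] i].
  split; first by have := h ord0.
  by move=> i; have := h (lift ord0 i); rewrite tnthS.
by case: (unliftP ord0 i) => [j ->|->]; rewrite ?tnthS.
Qed.
Lemma measurable_section n (F : T n.+1 -> \bar R) t : measurable_fun setT F ->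
  measurable_fun setT (fun s => F (consT (t, s))).
Proof.
move=> mF; apply: measurableT_comp => //; apply: (measurableT_comp (@measurable_consT n)).
exact: measurable_pair1.
Qed.
Lemma measurable_int_section n (F : T n.+1 -> \bar R) : measurable_fun setT F -> (forall x, 0 <= F x) ->
  measurable_fun setT (fun t => \int[tmu n]_s F (consT (t, s))).
Proof.
move=> mF F0.
apply: (@measurable_fun_fubini_tonelli_F _ _ _ _ _ (tmu n) (fun z => F (consT z))) => //.
exact: (measurableT_comp mF (@measurable_consT n)).
Qed.
Lemma restrict_consE D n (F : T n.+1 -> \bar R) t s :
  (F \_ (tset D n.+1)) (consT (t, s)) = if t \in D then ((fun s => F (consT (t, s))) \_ (tset D n)) s else 0.
Proof.
rewrite /patch; case: ifPn => h; case: ifPn => tD; try case: ifPn => sD //.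
- by move: h => /set_mem/tset_cons [_ /mem_set]; rewrite (negPf sD).
- by move: h => /set_mem/tset_cons [/mem_set]; rewrite (negPf tD).
- by case/negP: h; apply/mem_set/tset_cons; split; exact: set_mem.
- exact: erefl.
Qed.
Lemma tmu_recl_set D n (F : T n.+1 -> \bar R) : measurable (D : set (measurableTypeR R)) ->
   measurable_fun (tset D n.+1) F ->
   (forall x, tset D n.+1 x -> 0 <= F x) ->
  \int[tmu n.+1]_(x in tset D n.+1) F x = \int[leb]_(t in D) \int[tmu n]_(s in tset D n) F (consT (t, s)).
Proof.
move=> mD mF F0; have mDn := @measurable_tset D n.+1 mD.
rewrite integral_mkcond tmu_recl//; last 2 first.
- exact/(measurable_restrictT _ mDn).
- by move=> x; rewrite /patch; case: ifPn => // /set_mem; exact: F0.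
rewrite [RHS]integral_mkcond; apply: eq_integral => t _.
rewrite [in RHS]/patch; case: ifPn => tD.
  by rewrite [RHS]integral_mkcond; apply: eq_integral => s _; rewrite restrict_consE tD.
by apply: integral0_eq => s _; rewrite restrict_consE (negPf tD).
Qed.

(* [phi] maps [D] to [D'] and pulls [mu'] back to the measure with density [J] with respect to [mu]. *)
Definition cvar d d' (X : measurableType d) (Y : measurableType d') (mu : set X -> \bar R) (D : set X) (phi : X -> Y) (J : X -> R)
  (mu' : set Y -> \bar R) (D' : set Y) :=
  forall f : Y -> \bar R, measurable_fun setT f -> (forall y, 0 <= f y) ->
  \int[mu]_(x in D) (f (phi x) * (J x)%:E) = \int[mu']_(y in D') f y.

Definition tmap (f : R -> R) n (x : T n) : T n := [tuple of map f x].
Lemma tmap_cons f n t (s : T n) : tmap f (consT (t, s)) = consT (f t, tmap f s).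
Proof. exact: val_inj. Qed.
Lemma measurable_tmap f n : measurable_fun setT (f : measurableTypeR R -> measurableTypeR R) -> measurable_fun setT (@tmap f n).
Proof.
move=> mf; apply/measurable_fun_tnthP => i.
rewrite (_ : _ \o _ = f \o (fun x => tnth x i)); last by apply/funext => x /=; rewrite tnth_map.
by apply: measurableT_comp => //; exact: measurable_tnth.
Qed.
Lemma measurable_tprod (J : R -> R) n : measurable_fun setT (J : measurableTypeR R -> R) ->
  measurable_fun setT (fun x : T n => (\prod_(i < n) J (tnth x i))%R).
Proof.
move=> mJ; apply: measurable_prod => i.
by move=> _; apply: measurableT_comp => //; exact: measurable_tnth.
Qed.
Lemma cvar_tuple D D' phi J n : measurable (D : set (measurableTypeR R)) -> measurable (D' : set (measurableTypeR R)) ->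
  measurable_fun setT (phi : measurableTypeR R -> measurableTypeR R) -> measurable_fun setT (J : measurableTypeR R -> R) ->
  (forall t, D t -> 0 <= J t)%R ->
  cvar leb D (phi : measurableTypeR R -> measurableTypeR R) J leb D' ->
  cvar (tmu n) (tset D n) (@tmap phi n) (fun x => \prod_(i < n) J (tnth x i))%R (tmu n) (tset D' n).
Proof.
move=> mD mD' mphi mJ J0 cv; elim: n => [|n IH] f mf f0.
  rewrite (_ : tset D 0 = setT); last by apply/seteqP; split => // x _ [].
  rewrite (_ : tset D' 0 = setT); last by apply/seteqP; split => // x _ [].
  rewrite !tmu_rec0//; first by rewrite big_ord0 mule1 (_ : tmap _ _ = [tuple])//; exact: val_inj.
  apply: emeasurable_funM; first by apply: measurableT_comp => //; exact: measurable_tmap.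
  by apply/measurable_EFinP; exact: measurable_tprod.
have mfJ m (g : T m -> \bar R) : measurable_fun setT g ->
    measurable_fun setT (fun x => g (tmap phi x) * (\prod_(i < m) J (tnth x i))%:E).
  move=> mg; apply: emeasurable_funM; first by apply: measurableT_comp => //; exact: measurable_tmap.
  by apply/measurable_EFinP; exact: measurable_tprod.
rewrite tmu_recl_set//; last 2 first.
- by apply: measurable_funTS; exact: mfJ.
- by move=> x Dx; rewrite mule_ge0// lee_fin prodr_ge0// => i _; exact/J0/Dx.
rewrite tmu_recl_set//; last exact: measurable_funTS.
(* The inner integral as a function of the head coordinate: the one-dimensional substitution [cv]
   acts on it, and the induction hypothesis acts inside it. *)
pose g (u : measurableTypeR R) := \int[tmu n]_(s in tset D' n) f (consT (u, s)).
have mDn := @measurable_tset D n mD; have mDn' := @measurable_tset D' n mD'.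
rewrite -(cv g); last 2 first.
- rewrite (_ : g = fun u => \int[tmu n]_s (fun x => f x * (\1_(tset D' n) (behT x))%:E) (consT (u, s))).
    apply: (@measurable_int_section n (fun x => f x * (\1_(tset D' n) (behT x))%:E)).
      apply: emeasurable_funM => //; apply/measurable_EFinP.
      by apply: measurableT_comp => //; exact: measurable_behead.
    by move=> x; rewrite mule_ge0// lee_fin.
  apply/funext => u; rewrite /g integral_mkcond; apply: eq_integral => s _.
  rewrite behTE.
  by rewrite /patch indicE; case: ifPn; rewrite ?mule1 ?mule0.
- by move=> y; apply: integral_ge0.
apply: eq_integral => t /set_mem Dt.
have := IH (fun s => f (consT (phi t, s))) (@measurable_section _ _ (phi t) mf) (fun s => f0 _).
rewrite -/(g (phi t)) => <-.
rewrite -ge0_integralZr//; last 3 first.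
- by apply: measurable_funTS; apply: (mfJ _ (fun s => f (consT (phi t, s)))); exact: measurable_section.
- by move=> s Ds; rewrite mule_ge0// lee_fin prodr_ge0// => i _; exact/J0/Ds.
- exact: J0.
apply: eq_integral => s _; rewrite tmap_cons big_ord_recl/= EFinM muleA muleAC; congr (_ * _ * _).
by congr EFin; apply: eq_bigr => i _; rewrite tnthS.
Qed.

Definition permt n (s : 'S_n) (x : T n) : T n := [tuple tnth x (s i) | i < n].
Lemma measurable_permt n s : measurable_fun setT (@permt n s).
Proof.
apply/measurable_fun_tnthP => i.
rewrite (_ : _ \o _ = (fun x => tnth x (s i))); first exact: measurable_tnth.
by apply/funext => x /=; rewrite tnth_mktuple.
Qed.
Lemma permt1 n (x : T n) : permt 1 x = x.
Proof. by apply: eq_from_tnth => i; rewrite tnth_mktuple perm1. Qed.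
Lemma permtM n s t (x : T n) : permt s (permt t x) = permt (s * t)%g x.
Proof. by apply: eq_from_tnth => i; rewrite !tnth_mktuple permM. Qed.
Definition pinv n (s : 'S_n) := forall f : T n -> \bar R, measurable_fun setT f -> (forall y, 0 <= f y) ->
  \int[tmu n]_x f (permt s x) = \int[tmu n]_x f x.
Lemma pinvM n (s t : 'S_n) : pinv s -> pinv t -> pinv (s * t)%g.
Proof.
move=> hs ht f mf f0; rewrite -(hs f)// -(ht (fun x => f (permt s x)))//.
  by apply: eq_integral => x _; rewrite permtM.
by apply: measurableT_comp => //; exact: measurable_permt.
Qed.
Lemma pinv_tail n (i j : 'I_n) : pinv (tperm i j) -> pinv (tperm (lift ord0 i) (lift ord0 j)).
Proof.
move=> h f mf f0; rewrite tmu_recl//; last by apply: measurableT_comp => //; exact: measurable_permt.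
rewrite [RHS]tmu_recl//; apply: eq_integral => t _.
rewrite -[RHS](h (fun s => f (consT (t, s))))//; last exact: measurable_section.
apply: eq_integral => s _; congr f; apply: eq_from_tnth => l.
rewrite tnth_mktuple; case: (unliftP ord0 l) => [l' ->|->].
  rewrite tnthS /= tnth_mktuple.
  case: (tpermP i j l') => [->|->|/eqP li /eqP lj]; rewrite ?tpermL ?tpermR ?tpermD ?tnthS//.
    by rewrite (inj_eq lift_inj) eq_sym.
  by rewrite (inj_eq lift_inj) eq_sym.
by rewrite tpermD.
Qed.
(** Exchanging the first two coordinates is Tonelli's theorem for the two outer integrals; the
    invariance under all other permutations is generated from this one and from the tail. *)
Lemma pinv01 n : pinv (tperm (ord0 : 'I_n.+2) (lift ord0 ord0)).
Proof.
move=> f mf f0; rewrite tmu_recl//; last by apply: measurableT_comp => //; exact: measurable_permt.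
rewrite [RHS]tmu_recl//.
have mf2 : measurable_fun setT (fun p : (measurableTypeR R * measurableTypeR R) * T n => f (consT (p.1.1, consT (p.1.2, p.2)))).
  apply: measurableT_comp => //; apply: (measurableT_comp (@measurable_consT n.+1)) => /=.
  apply: measurable_fun_pair => /=; first exact: measurableT_comp.
  apply: (measurableT_comp (@measurable_consT n)) => /=.
  by apply: measurable_fun_pair => /=; [exact: measurableT_comp|].
pose g (p : measurableTypeR R * measurableTypeR R) := \int[tmu n]_s f (consT (p.1, consT (p.2, s))).
have mg : measurable_fun setT g.
  exact: (@measurable_fun_fubini_tonelli_F _ _ _ _ _ (tmu n) _ mf2).
have g0 p : 0 <= g p by exact: integral_ge0.
transitivity (\int[leb]_t \int[leb]_u g (u, t)).
  apply: eq_integral => t _; rewrite tmu_recl//; last first.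
    by apply: (@measurable_section _ (fun x => f (permt _ x))); apply: measurableT_comp => //; exact: measurable_permt.
  apply: eq_integral => u _; apply: eq_integral => s _; congr f.
  apply: eq_from_tnth => l; rewrite tnth_mktuple.
  case: (unliftP ord0 l) => [l' ->|->].
    case: (unliftP ord0 l') => [l'' ->|->]; last by rewrite tpermR.
    by rewrite tpermD ?(inj_eq lift_inj) ?neq_lift// !tnthS.
  by rewrite tpermL.
transitivity (\int[leb]_u \int[leb]_t g (u, t)).
  by apply/esym; apply: fubini_tonelli.
by apply: eq_integral => t _; rewrite tmu_recl//; exact: measurable_section.
Qed.

(** Induction on n. Transpositions fixing 0 act on the tail, and (0 l) = (0 1) (1 l) (0 1) reduces
    those moving 0 to the two previous lemmas. *)
Lemma pinv_tperm n (i j : 'I_n) : pinv (tperm i j).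
Proof.
elim: n i j => [|n IH]; first by case.
have key (l : 'I_n) : pinv (tperm ord0 (lift ord0 l)).
  case: n IH l => [|n] IH l; first by case: l.
  case: (unliftP ord0 l) => [l' ->|->]; last exact: pinv01.
  have -> : tperm ord0 (lift ord0 (lift ord0 l')) =
    (tperm ord0 (lift ord0 ord0) * tperm (lift ord0 ord0) (lift ord0 (lift ord0 l')) * tperm ord0 (lift ord0 ord0) :> 'S_n.+2)%g.
    rewrite -{1}(tpermV ord0 (lift ord0 ord0)) -mulgA -/(conjg _ _) tpermJ tpermR tpermD//.
  by apply: pinvM; [apply: pinvM; [exact: pinv01|apply: pinv_tail; exact: IH]|exact: pinv01].
move=> i j; case: (unliftP ord0 i) => [i' ->|->]; case: (unliftP ord0 j) => [j' ->|->].
- by apply: pinv_tail; exact: IH.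
- by rewrite tpermC; exact: key.
- exact: key.
- by rewrite tperm1 => f mf f0; apply: eq_integral => x _; rewrite permt1.
Qed.
Lemma pinvT n (s : 'S_n) : pinv s.
Proof.
have [ts -> _] := prod_tpermP s.
elim: ts => [|[i j] ts IH].
  by rewrite big_nil => f mf f0; apply: eq_integral => x _; rewrite permt1.
by rewrite big_cons; apply: pinvM => //; exact: pinv_tperm.
Qed.
Lemma cvar_permt n (s : 'S_n) D : measurable (D : set (measurableTypeR R)) ->
  cvar (tmu n) (tset D n) (permt s) (fun=> 1%R) (tmu n) (tset D n).
Proof.
move=> mD f mf f0; have mDn := @measurable_tset D n mD.
rewrite [RHS]integral_mkcond -(pinvT s); last 2 first.
- by apply/(measurable_restrictT _ mDn); exact: measurable_funTS.
- by move=> y; rewrite /patch; case: ifPn.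
rewrite [LHS]integral_mkcond; apply: eq_integral => x _; rewrite /patch mule1.
rewrite (_ : (x \in tset D n) = (permt s x \in tset D n))//.
apply/idP/idP => /set_mem h; apply/mem_set => i; first by rewrite tnth_mktuple; exact: h.
by have := h (s^-1%g i); rewrite tnth_mktuple permKV.
Qed.
End tmeasure.

Section cvar_cint.
Context d d' (X : measurableType d) (Y : measurableType d') (R : realType).
Variables (mu : {measure set X -> \bar R}) (D : set X) (phi : X -> Y) (J : X -> R).
Variables (mu' : {measure set Y -> \bar R}) (D' : set Y).
Hypotheses (mD : measurable D) (mD' : measurable D') (mphi : measurable_fun setT phi)
  (mJ : measurable_fun setT J) (J0 : forall x, D x -> 0 <= J x) (phiD : forall x, D x -> D' (phi x)).
Hypothesis cv : cvar mu D phi J mu' D'.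
Local Open Scope ereal_scope.
Lemma cvar_ge0 (f : Y -> \bar R) : measurable_fun D' f -> (forall y, D' y -> 0 <= f y) ->
  \int[mu]_(x in D) (f (phi x) * (J x)%:E) = \int[mu']_(y in D') f y.
Proof.
move=> mf f0.
rewrite [RHS](_ : _ = \int[mu']_(y in D') (f \_ D') y); last first.
  by apply: eq_integral => y yD; rewrite /patch yD.
rewrite -cv.
- by apply: eq_integral => x /set_mem xD; rewrite /patch mem_set//; exact: phiD.
- exact/(measurable_restrictT _ mD').
- by move=> y; rewrite /patch; case: ifPn => // /set_mem; exact: f0.
Qed.
Lemma cvar_int (f : Y -> R) : mu'.-integrable D' (EFin \o f) ->
  mu.-integrable D (EFin \o (fun x => f (phi x) * J x)%R) /\
  (\int[mu]_(x in D) (f (phi x) * J x) = \int[mu']_(y in D') f y)%R.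
Proof.
move=> fi; have /integrableP [mf fy] := fi.
have mfJ : measurable_fun D (fun x => (f (phi x) * J x)%R).
  have : measurable_fun setT (fun x => ((f \_ D')%R (phi x) * J x)%R).
    apply: measurable_funM => //; apply: measurableT_comp => //.
    by apply/(measurable_restrictT _ mD'); exact/measurable_EFinP.
  move/(measurable_funS measurableT (@subsetT _ D)); apply: eq_measurable_fun => x /set_mem xD.
  by rewrite /patch mem_set//; exact: phiD.
have part (g : Y -> \bar R) (h : X -> \bar R) : measurable_fun D' g -> (forall y, 0 <= g y) ->
   (forall x, D x -> h x = g (phi x) * (J x)%:E) -> \int[mu]_(x in D) h x = \int[mu']_(y in D') g y.
  move=> mg g0 gh; rewrite -cvar_ge0//; by apply: eq_integral => x /set_mem xD; rewrite gh.
split.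
  apply/integrableP; split; first exact/measurable_EFinP.
  rewrite (part (fun y => `|(EFin \o f) y|)); [exact: fy|exact: measurableT_comp|by []|].
  by move=> x xD /=; rewrite normrM EFinM (ger0_norm (J0 xD)).
rewrite /Rintegral; congr fine; rewrite integralE [RHS]integralE; congr (_ - _).
  apply: part; [exact: measurable_funepos|exact: funepos_ge0|].
  by move=> x xD; rewrite !funeposE /= -!EFin_max -EFinM maxr_pMl ?J0// mul0r.
apply: part; [exact: measurable_funeneg|exact: funeneg_ge0|].
by move=> x xD; rewrite !funenegE /= -!EFin_max -EFinM maxr_pMl ?J0// mul0r mulNr.
Qed.
Lemma cvar_cint (F : Y -> CC R) : cintble mu' D' F ->
  cintble mu D (fun x => F (phi x) * RC (J x))%R /\
  (cint mu D (fun x => F (phi x) * RC (J x)) = cint mu' D' F)%R.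
Proof.
move=> [a b]; have [a1 a2] := cvar_int a; have [b1 b2] := cvar_int b.
split.
  split.
    by apply: eq_integrable a1 => // x _ /=; rewrite cReM cReRC cImRC mulr0 subr0.
  by apply: eq_integrable b1 => // x _ /=; rewrite cImM cReRC cImRC mulr0 add0r.
rewrite /cint -a2 -b2; congr Complex; apply: eq_Rintegral => x _.
  by rewrite cReM cReRC cImRC mulr0 subr0.
by rewrite cImM cReRC cImRC mulr0 add0r.
Qed.
End cvar_cint.

Section cvar_indic.
Local Open Scope ereal_scope.
Context d d' (X : measurableType d) (Y : measurableType d') (R : realType).
Variables (mu : {measure set X -> \bar R}) (D : set X) (phi : X -> Y) (J : X -> R).
Variables (mu' : {measure set Y -> \bar R}) (D' : set Y).
Hypotheses (mD : measurable D) (mD' : measurable D') (mphi : measurable_fun setT phi)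
  (mJ : measurable_fun setT J) (J0 : forall x, (0 <= J x)%R).
Import HBNNSimple.
(** Approximation by nonnegative simple functions and monotone convergence, on both sides. *)
Lemma cvar_indic :
  (forall A, measurable A -> \int[mu]_(x in D) (\1_A (phi x) * J x)%:E = mu' (A `&` D')) ->
  cvar mu D phi J mu' D'.
Proof.
move=> H f mf f0.
pose f_ := nnsfun_approx measurableT mf.
have f_cvg y : (EFin \o f_ ^~ y) @ \oo --> f y by apply: cvg_nnsfun_approx.
have mfJ n : measurable_fun setT (fun x => (f_ n (phi x) * J x)%R).
  apply: measurable_funM => //; apply: measurableT_comp => //.
transitivity (limn (fun n => \int[mu]_(x in D) (f_ n (phi x) * J x)%:E)).
  rewrite -monotone_convergence//.
  - apply: eq_integral => x xD; apply/esym/cvg_lim => //=.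
    under eq_fun do rewrite EFinM.
    by apply: cvgeZr => //; exact: f_cvg.
  - by move=> n; apply/measurable_EFinP; exact: measurable_funTS.
  - by move=> n x _; rewrite lee_fin mulr_ge0.
  - move=> x _ m n mn; rewrite lee_fin ler_wpM2r//; exact/lefP/nd_nnsfun_approx.
transitivity (limn (fun n => \int[mu']_(y in D') (f_ n y)%:E)); last first.
  rewrite -monotone_convergence//.
  - by apply: eq_integral => x xD; apply/cvg_lim => //; exact: f_cvg.
  - by move=> n; apply/measurable_EFinP; exact: measurable_funTS.
  - by move=> n x _; rewrite lee_fin.
  - by move=> x _ m n mn; rewrite lee_fin; exact/lefP/nd_nnsfun_approx.
congr (limn _); apply/funext => n.
have mA r : measurable (f_ n @^-1` [set r]) by [].
have m1 r : measurable_fun setT (fun x => (\1_(f_ n @^-1` [set r]) (phi x) : R)).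
  by apply: (measurableT_comp _ mphi); exact: measurable_indic.
have r0 r x : (0 <= r * \1_(f_ n @^-1` [set r]) x)%R by rewrite indicE; case: (boolP (x \in _)) => [/set_mem <-|_]; rewrite ?mulr1 ?mulr0.
transitivity (\sum_(r \in range (f_ n)) \int[mu]_(x in D) ((r * \1_(f_ n @^-1` [set r]) (phi x)) * J x)%:E).
  rewrite -ge0_integral_fsum//.
  - apply: eq_integral => x xD; rewrite fsumEFin//; congr EFin.
    by rewrite (fimfunE (f_ n)) mulr_fsuml.
  - move=> r; apply/measurable_EFinP; apply: measurable_funTS; apply: measurable_funM => //.
    exact: measurable_funM.
  - by move=> r x Dx; rewrite lee_fin mulr_ge0.
transitivity (\sum_(r \in range (f_ n)) \int[mu']_(y in D') (r * \1_(f_ n @^-1` [set r]) y)%:E); last first.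
  rewrite -ge0_integral_fsum//.
  - by apply: eq_integral => x xD; rewrite fsumEFin//; congr EFin; rewrite (fimfunE (f_ n)).
  - by move=> r; apply/measurable_EFinP; apply: measurable_funTS; exact: measurable_funM.
  - by move=> r x Dx; rewrite lee_fin.
apply: eq_fsbigr => r /set_mem [y0 _ ry0].
have rge0 : (0 <= r)%R by rewrite -ry0.
rewrite (_ : (fun x => _) = (fun x => r%:E * (\1_(f_ n @^-1` [set r]) (phi x) * J x)%:E)); last first.
  by apply/funext => x; rewrite -EFinM mulrA.
rewrite ge0_integralZl//; last 2 first.
- by apply/measurable_EFinP; apply: measurable_funTS; exact: measurable_funM.
- by move=> x _; rewrite lee_fin mulr_ge0.
under [RHS]eq_integral do rewrite EFinM.
rewrite ge0_integralZl//; last first.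
  by apply/measurable_EFinP; exact: measurable_funTS.
by rewrite H// integral_indic.
Qed.
End cvar_indic.

Section cvar1.
Variable R : realType.
Local Notation leb := (@lebesgue_measure R).
Local Open Scope ereal_scope.
Variables (D D' : set (measurableTypeR R)) (phi : measurableTypeR R -> measurableTypeR R) (J : measurableTypeR R -> R).
Hypotheses (mD : measurable D) (mD' : measurable D') (mphi : measurable_fun setT phi)
  (mJ : measurable_fun setT J) (J0 : forall x, (0 <= J x)%R) (phiD : forall x, D x -> D' (phi x)).
Hypothesis key : forall a b : R, (a < b)%R ->
  \int[leb]_(x in D `&` phi @^-1` `]a, b]%classic) (J x)%:E = leb (`]a, b]%classic `&` D').
Let m1 (A : set (measurableTypeR R)) : \bar R := \int[leb]_(x in D `&` phi @^-1` A) (J x)%:E.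
Let mpre A : measurable A -> measurable (D `&` phi @^-1` A).
Proof. by move=> mA; apply: measurableI => //; rewrite -[X in measurable X]setTI; exact: mphi. Qed.
Let m10 : m1 set0 = 0. Proof. by rewrite /m1 preimage_set0 setI0 integral_set0. Qed.
Let m1ge0 A : 0 <= m1 A. Proof. by apply: integral_ge0 => x _; rewrite lee_fin. Qed.
Let m1sa : semi_sigma_additive m1.
Proof.
move=> F mF tF mUF; rewrite /m1.
rewrite (_ : D `&` phi @^-1` (\bigcup_n F n) = \bigcup_n (D `&` phi @^-1` F n)); last first.
  by rewrite preimage_bigcup setI_bigcupr.
rewrite ge0_integral_bigcup//.
- by apply: is_cvg_nneseries => n _ _; exact: m1ge0.
- by move=> n; exact: mpre.
- by apply/measurable_EFinP; exact: measurable_funTS.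
- by move=> x _; rewrite lee_fin.
- apply/trivIsetP => i j _ _ ij; rewrite setIACA setIid -preimage_setI.
  by move/trivIsetP : tF => /(_ i j I I ij) ->; rewrite preimage_set0 setI0.
Qed.
HB.instance Definition _ := isMeasure.Build _ _ _ m1 m10 m1ge0 m1sa.
(** The image measure A |-> int of J over D and phi in A lives on D'. Adding Lebesgue measure
    restricted to the complement of D' gives a measure on the whole line that agrees with Lebesgue
    measure on the intervals ]a, b], hence equals it. *)
Lemma cvar1 : cvar leb D phi J leb D'.
Proof.
have mDC : measurable (~` D') by exact: measurableC.
have madd B : measure_add m1 (mrestr leb mDC) B = m1 B + leb (B `&` ~` D').
  by rewrite /measure_add /= /msum !big_ord_recl big_ord0 adde0.
have E A : measurable A -> leb A = m1 A + leb (A `&` ~` D').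
  move=> mA; rewrite (@lebesgue_measure_unique _ (measure_add m1 (mrestr leb mDC)))//; last first.
    move=> _ [[a b] _ <-].
    transitivity (m1 `]a, b]%classic + leb (`]a, b]%classic `&` ~` D')); last exact/esym/madd.
    rewrite /m1.
    have [ab|ba] := ltP a b; last by rewrite set_itv_ge ?bnd_simp -?leNgt// preimage_set0 !setI0 !set0I integral_set0 measure0 adde0.
    rewrite key// -measureU//.
    - by rewrite -setIUr setUv setIT.
    - exact: measurableI.
    - exact: measurableI.
    - by rewrite setIACA setICr setI0.
  exact: madd.
apply: cvar_indic => // A mA.
transitivity (m1 (A `&` D')); last first.
  have e := E (A `&` D') (measurableI _ _ mA mD').
  rewrite -setIA setICr setI0 measure0 adde0 in e; exact/esym/e.
have m1D : m1 (A `&` ~` D') = 0.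
  rewrite /m1 (_ : _ `&` _ = set0) ?integral_set0//.
  by apply/seteqP; split => // x [Dx [_]]; apply; exact: phiD.
transitivity (m1 A); last first.
  rewrite -[in LHS](setIT A) -[in LHS](setUv D') setIUr measureU.
  - by rewrite [X in _ + X]m1D adde0.
  - exact: measurableI.
  - exact: measurableI.
  - by rewrite setIACA setICr setI0.
rewrite /m1 [RHS]integral_mkcondr; apply: eq_integral => x xD.
rewrite /patch indicE; have -> : (phi x \in A) = (x \in phi @^-1` A) by apply/idP/idP => /set_mem ?; apply/mem_set.
by case: ifPn; rewrite ?mul1r ?mul0r.
Qed.
End cvar1.

Section cvar_examples.
Variable R : realType.
Local Notation leb := (@lebesgue_measure R).
Local Notation pos := (`]0%R, +oo[%classic : set (measurableTypeR R)).
Lemma cvar_preimage d d' (X : measurableType d) (Y : measurableType d') (mu : {measure set X -> \bar R}) (phi : X -> Y) (J : X -> R)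
  (mu' : {measure set Y -> \bar R}) (D' : set Y) : measurable D' ->
  cvar mu setT phi J mu' setT -> cvar mu (phi @^-1` D') phi J mu' D'.
Proof.
move=> mD' H f mf f0; rewrite [RHS]integral_mkcond -H.
- rewrite [LHS]integral_mkcond; apply: eq_integral => x _.
  rewrite /patch; have -> : (phi x \in D') = (x \in phi @^-1` D') by apply/idP/idP => /set_mem ?; apply/mem_set.
  by case: ifPn; rewrite ?mul0e.
- by apply/(measurable_restrictT _ mD'); exact: measurable_funTS.
- by move=> y; rewrite /patch; case: ifPn.
Qed.
Lemma cvar_affine (a c : R) (D' : set (measurableTypeR R)) : 0 < c -> measurable D' ->
  cvar leb ((fun u => a + c * u) @^-1` D') ((fun u => a + c * u) : measurableTypeR R -> measurableTypeR R) (fun=> c) leb D'.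
Proof.
move=> c0 mD'; apply: cvar_preimage => //.
have mphi : measurable_fun setT ((fun u => a + c * u) : measurableTypeR R -> measurableTypeR R).
  by apply: measurable_funD => //; exact: measurable_funM.
apply: cvar1 => //; first by move=> _; exact: ltW.
move=> p q pq; rewrite setTI setIT integral_cst; last by rewrite -[X in measurable X]setTI; exact: mphi.
rewrite (_ : _ @^-1` _ = `](p - a) / c, (q - a) / c]%classic); last first.
  apply/seteqP; split => u /=; rewrite !in_itv/= ltr_pdivrMr// ler_pdivlMr// ltrBlDl lerBrDl (mulrC u)//.
have E x y : x < y -> leb `]x, y]%classic = (y - x)%:E.
  by move=> xy; rewrite lebesgue_measure_itv /= lte_fin xy.
transitivity (c%:E * ((q - a) / c - (p - a) / c)%:E)%E.
  by congr (_ * _)%E; apply: E; rewrite ltr_pM2r ?invr_gt0// ltrD2r.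
by rewrite E// -EFinM -mulrBl mulrCA divff ?gt_eqF// mulr1 opprB addrA subrK.
Qed.
Lemma integral_inv_sqr (c : R) : 0 < c -> (\int[leb]_(x in `[c, +oo[) ((x ^+ 2)^-1)%:E = (c^-1)%:E)%E.
Proof.
move=> c0; have d x : c < x -> is_derive x 1 (fun x : R => - x^-1) ((x ^+ 2)^-1).
  move=> cx; have x0 : x != 0 by rewrite gt_eqF// (lt_trans c0).
  have h := is_deriveN (is_deriveV x0 (is_derive_id x 1)).
  by apply: (is_derive_eq h); rewrite scaleNr opprK /GRing.scale /= mulr1.
rewrite (@ge0_continuous_FTC2y _ _ (fun x => - x^-1) c 0).
- by rewrite -EFinB sub0r opprK.
- by move=> x _; rewrite invr_ge0 sqr_ge0.
- apply: continuous_in_subspaceT => x /set_mem /=; rewrite in_itv/= andbT => cx.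
  apply: cvgV; first by rewrite expf_neq0// gt_eqF// (lt_le_trans c0).
  exact: exprn_continuous.
- apply/cvgrPdist_le => e e0; near=> x.
  have ex : e^-1 <= x by near: x; apply: nbhs_pinfty_ge; rewrite num_real.
  have x0 : 0 < x by apply: lt_le_trans ex; rewrite invr_gt0.
  by rewrite sub0r opprK gtr0_norm ?invr_gt0// -[e]invrK lef_pV2// posrE ?invr_gt0.
- by move=> x cx; have [] := d x cx.
- apply: cvgN; apply: cvg_at_right_filter; apply: cvgV; [by rewrite gt_eqF|exact: cvg_id].
- by move=> x; rewrite in_itv/= andbT => cx; rewrite derive1E; have [_] := d x cx.
Unshelve. all: by end_near. Qed.
Lemma measurable_inv : measurable_fun setT (fun x : measurableTypeR R => x^-1 : measurableTypeR R).
Proof.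
rewrite (_ : setT = [set (0 : R)] `|` ~` [set (0 : R)]); last by rewrite setUv.
apply/(measurable_funU _ (measurable_set1 _) (measurableC (measurable_set1 _))); split.
  exact: measurable_fun_set1.
apply: open_continuous_measurable_fun; first by apply: closed_openC; apply: accessible_closed_set1; apply: hausdorff_accessible; exact: norm_hausdorff.
by move=> x /set_mem /= /eqP x0; apply: inv_continuous.
Qed.
Lemma cvar_inv : cvar leb pos ((fun x => x^-1) : measurableTypeR R -> measurableTypeR R) (fun x => (x ^+ 2)^-1) leb pos.
Proof.
have mJ : measurable_fun setT ((fun x => (x ^+ 2)^-1) : measurableTypeR R -> R).
  by apply: (measurableT_comp measurable_inv); exact: exprn_measurable.
have J0 x : 0 <= (x ^+ 2)^-1 :> R by rewrite invr_ge0 sqr_ge0.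
apply: cvar1 => //.
- exact: measurable_inv.
- by move=> x /=; rewrite !in_itv/= !andbT invr_gt0.
move=> a b ab.
have [b0|b0] := leP b 0.
  rewrite (_ : _ `&` _ = set0); last first.
    apply/seteqP; split => // x /= []; rewrite !in_itv/= andbT => x0 /andP[_ xb].
    have x1 : 0 < x^-1 by rewrite invr_gt0.
    by have := lt_le_trans x1 (le_trans xb b0); rewrite ltxx.
  rewrite integral_set0 (_ : _ `&` _ = set0) ?measure0//.
  apply/seteqP; split => // x /= []; rewrite !in_itv/= andbT => /andP[_ xb] x0.
  by have := lt_le_trans x0 (le_trans xb b0); rewrite ltxx.
have [a0|a0] := leP a 0.
  rewrite (_ : pos `&` _ = `[b^-1, +oo[%classic); last first.
    apply/seteqP; split => x /=; rewrite !in_itv/= !andbT.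
      by move=> [x0 /andP[_ xb]]; rewrite -[x]invrK lef_pV2// ?posrE ?invr_gt0.
    move=> bx; have x0 : 0 < x by apply: lt_le_trans bx; rewrite invr_gt0.
    split => //; apply/andP; split; first by apply: (le_lt_trans a0); rewrite invr_gt0.
    by rewrite -[b]invrK lef_pV2// ?posrE ?invr_gt0.
  rewrite integral_inv_sqr ?invr_gt0// invrK (_ : _ `&` _ = `]0, b]%classic).
    by rewrite lebesgue_measure_itv /= lte_fin b0 oppr0 adde0.
  apply/seteqP; split => x /=; rewrite !in_itv/= !andbT.
    by move=> [/andP[_ xb] x0]; rewrite x0.
  by move=> /andP[x0 xb]; rewrite x0 xb (le_lt_trans a0).
have ba : b^-1 < a^-1 by rewrite ltf_pV2// posrE.
rewrite (_ : pos `&` _ = `[b^-1, a^-1[%classic); last first.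
  apply/seteqP; split => x /=; rewrite !in_itv/= !andbT.
    by move=> [x0 /andP[xa xb]]; rewrite -[x]invrK lef_pV2 ?ltf_pV2 ?posrE ?invr_gt0// xb xa.
  move=> /andP[bx xa]; have x0 : 0 < x by apply: lt_le_trans bx; rewrite invr_gt0.
  by rewrite x0; split => //; rewrite -[a]invrK -[b]invrK ltf_pV2 ?lef_pV2 ?posrE ?invr_gt0// xa.
rewrite (_ : `]a, b]%classic `&` _ = `]a, b]%classic); last first.
  apply/seteqP; split => x /=; rewrite !in_itv/= !andbT; first by case.
  by move=> /andP[ax xb]; rewrite ax xb (lt_trans a0).
(* The integral over the bounded interval is obtained by subtracting two half-lines, for which the
   value is known; both are finite, so the subtraction is legitimate. *)
have := integral_inv_sqr (c := b^-1); rewrite invr_gt0 => /(_ b0).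
rewrite (@itv_bndbnd_setU _ _ (BLeft b^-1) (BLeft a^-1) +oo%O) ?bnd_simp ?ltW//.
rewrite ge0_integral_setU//=; last 3 first.
- by apply/measurable_EFinP; exact: measurable_funTS.
- by move=> x _; rewrite lee_fin.
- by apply/disj_setPS => x /= []; rewrite !in_itv/= andbT => /andP[_ xa] ax; move: (lt_le_trans xa ax); rewrite ltxx.
rewrite integral_inv_sqr ?invr_gt0// !invrK => /esym/eqP.
move=> h; have -> : leb `]a, b]%classic = (b - a)%:E by rewrite lebesgue_measure_itv /= lte_fin ab.
move: h; case: (\int[leb]_(x in `[b^-1%R, a^-1%R[) _)%E => [r| |] //; rewrite -EFinD => /eqP [->]; by rewrite addrK.
Qed.
End cvar_examples.

(** * Integrability of powers against exponentials *)

Section integrability.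
Variable R : realType.
Local Notation leb := (@lebesgue_measure R).
Local Notation pos := (`]0%R, +oo[%classic : set (measurableTypeR R)).
(** Concavity of the logarithm: ln y <= ln K + y / K, with K so large that M / K <= eta. The
    constant is C = K^M. *)
Lemma powR_le_expR (M eta : R) : 0 <= M -> 0 < eta ->
  exists2 C, 0 < C & forall y, 0 < y -> y `^ M <= C * expR (eta * y).
Proof.
move=> M0 e0; have [K K0 MK] : exists2 K, 0 < K & M / K <= eta.
  exists ((M + 1) / eta); first by rewrite divr_gt0// ltr_wpDl.
  by rewrite invf_div mulrCA ger_pMr// ler_pdivrMr ?ltr_wpDl// mul1r lerDl.
exists (expR (M * ln K)); first exact: expR_gt0.
move=> y y0; rewrite /powR gt_eqF// -expRD ler_expR.
have h : ln y <= ln K + y / K.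
  have -> : ln y = ln K + ln (y / K) by rewrite [ln (y / K)]lnM ?posrE ?invr_gt0// lnV ?posrE// addrC subrK.
  rewrite lerD2l; apply: le_trans (_ : y / K - 1 <= _); last by rewrite gerBl.
  by rewrite lerBrDr; have := @expR_ge1Dx R (ln (y / K)); rewrite lnK ?posrE ?divr_gt0// addrC.
apply: le_trans (_ : M * (ln K + y / K) <= _); first exact: ler_wpM2l.
rewrite mulrDr lerD2l mulrCA mulrC; apply: ler_wpM2r => //; exact: ltW.
Qed.
Lemma expR_integrable (delta : R) (c : R) : 0 < delta ->
  leb.-integrable (`[c, +oo[%classic : set (measurableTypeR R)) (EFin \o (fun t => expR (- (delta * t)))).
Proof.
move=> d0.
have mf : measurable_fun (`[c, +oo[%classic : set (measurableTypeR R)) (fun t : measurableTypeR R => expR (- (delta * t))).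
  apply: measurable_funTS; apply: measurableT_comp => //; apply: measurableT_comp => //; exact: measurable_funM.
have d (x : R) : is_derive x 1 (fun x : R => - (delta^-1 * expR (- (delta * x)))) (expR (- (delta * x))).
  by apply: is_derive_eq; rewrite /GRing.scale /=; field; rewrite gt_eqF.
apply/integrableP; split; first exact/measurable_EFinP.
under eq_integral do rewrite /= ger0_norm ?expR_ge0//.
rewrite (@ge0_continuous_FTC2y _ _ (fun x => - (delta^-1 * expR (- (delta * x)))) c 0).
- by rewrite ltry.
- by move=> x _; exact: expR_ge0.
- apply: continuous_subspaceT => x; apply: continuous_comp; last exact: continuous_expR.
  by apply: cvgN; apply: cvgM; [exact: cvg_cst|exact: cvg_id].
- rewrite -oppr0 -(mulr0 delta^-1); apply: cvgN; apply: cvgMr.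
  apply/cvgrPdist_le => e e0; near=> x.
  have xe : - ln e / delta <= x by near: x; apply: nbhs_pinfty_ge; rewrite num_real.
  rewrite sub0r normrN ger0_norm ?expR_ge0// -[leRHS](lnK (x := e)) ?posrE// ler_expR lerNl.
  by rewrite mulrC -ler_pdivrMr.
- by move=> x _; have [] := d x.
- by apply: cvg_at_right_filter; have [/derivable1_diffP/differentiable_continuous] := d c; exact.
- by move=> x _; rewrite derive1E; have [_] := d x.
Unshelve. all: by end_near. Qed.
Lemma measurable_powRl (a : R) : measurable_fun setT (fun t : measurableTypeR R => t `^ a).
Proof. exact: measurable_powR. Qed.
(** The inversion t -> 1/t sends the singularity at 0 to infinity, where the fundamental theorem of
    calculus on a half-line applies to t^(-a-1). *)
Lemma powR_integrable (a : R) : 0 < a ->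
  (\int[leb]_(t in (`]0%R, 1%R]%classic : set (measurableTypeR R))) (t `^ (a - 1))%:E < +oo)%E.
Proof.
move=> a0.
pose f (t : R) : \bar R := (t `^ (a - 1) * \1_(`]0%R, 1%R]%classic : set (measurableTypeR R)) t)%:E.
have m1 : measurable_fun setT (\1_(`]0%R, 1%R]%classic : set (measurableTypeR R)) : measurableTypeR R -> R) by exact: measurable_indic.
rewrite (_ : (\int[_]_(t in _) _)%E = (\int[leb]_(t in pos) f t)%E); last first.
  rewrite [LHS]integral_mkcond [RHS]integral_mkcond; apply: eq_integral => t _.
  rewrite /patch /f indicE; case: ifPn => h; case: ifPn => h' //; rewrite ?mulr1 ?mulr0//.
  by case/negP: h'; move: h => /set_mem /=; rewrite !in_itv/= => /andP[h _]; apply/mem_set; rewrite /= in_itv/= h.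
rewrite -(cvar_inv (R := R)); last 2 first.
- by apply/measurable_EFinP; apply: measurable_funM => //; exact: measurable_powRl.
- by move=> t; rewrite lee_fin mulr_ge0// powR_ge0.
have -> : (\int[leb]_(x in pos) (f (x^-1)%R * ((x ^+ 2)^-1)%:E))%E = (\int[leb]_(x in `[1%R, +oo[) (x `^ (- a - 1))%:E)%E.
  rewrite [LHS]integral_mkcond [RHS]integral_mkcond; apply: eq_integral => t _.
  rewrite /patch /f indicE; case: ifPn => [/set_mem|] h; case: ifPn => [/set_mem|] h' //.
  - move: h h'; rewrite /= !in_itv/= !andbT => t0 t1.
    rewrite mem_set ?mulr1; last by rewrite /= in_itv/= invr_gt0 t0 invf_le1.
    rewrite -EFinM; congr EFin; rewrite -powR_inv1 ?(ltW t0)// -powRrM.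
    rewrite (_ : (t ^+ 2)^-1 = t `^ (- 2%:R)); last by rewrite powRN powR_mulrn ?ltW.
    rewrite -powRD; last by apply/implyP => _; rewrite gt_eqF.
    by congr (_ `^ _); ring.
  - rewrite memNset ?mulr0 ?mul0e// /= in_itv/= => /andP[_]; move: h; rewrite /= in_itv/= andbT => t0.
    rewrite invf_le1// => t1; case/negP: h'; apply/mem_set; rewrite /= in_itv/= t1//.
  - case/negP: h; apply/mem_set; move: h'; rewrite /= !in_itv/= !andbT; exact: lt_le_trans.
have d (x : R) : 0 < x -> is_derive x 1 (fun x : R => - (a^-1 * x `^ (- a))) (x `^ (- a - 1)).
  move=> x0; have h := is_derive1_powR (- a) x0.
  apply: is_derive_eq; rewrite /GRing.scale /= mulrA mulrN mulVf ?gt_eqF// mulN1r opprK//.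
rewrite (@ge0_continuous_FTC2y _ _ (fun x => - (a^-1 * x `^ (- a))) 1 0).
- by rewrite ltry.
- by move=> x _; exact: powR_ge0.
- apply: continuous_in_subspaceT => x /set_mem /=; rewrite in_itv/= andbT => x1.
  apply/differentiable_continuous/derivable1_diffP; have [] // := is_derive1_powR (- a - 1) (lt_le_trans ltr01 x1).
- rewrite -oppr0 -(mulr0 a^-1); apply: cvgN; apply: cvgMr.
  apply/cvgrPdist_le => e e0; near=> x.
  have x0 : 0 < x by near: x; apply: nbhs_pinfty_gt; rewrite num_real.
  have xe : e^-1 `^ (a^-1) <= x by near: x; apply: nbhs_pinfty_ge; rewrite num_real.
  rewrite sub0r normrN ger0_norm ?powR_ge0// powRN -[e]invrK lef_pV2 ?posrE ?powR_gt0 ?invr_gt0//.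
  have aV : a^-1 * a = 1 by rewrite mulVf// gt_eqF.
  rewrite -[leLHS]powRr1 ?invr_ge0 ?(ltW e0)// -aV powRrM.
  by apply: ge0_ler_powR => //; rewrite ?nnegrE ?powR_ge0 ?(ltW a0) ?(ltW x0).
- by move=> x x1; have [] := d x (lt_trans ltr01 x1).
- by apply: cvg_at_right_filter; have [/derivable1_diffP/differentiable_continuous] := d 1 ltr01; exact.
- by move=> x; rewrite in_itv/= andbT => x1; rewrite derive1E; have [_] := d x (lt_trans ltr01 x1).
Unshelve. all: by end_near. Qed.
Lemma gamma_integrable (a delta : R) : 0 < a -> 0 < delta ->
  leb.-integrable pos (EFin \o (fun t => t `^ (a - 1) * expR (- (delta * t)))).
Proof.
move=> a0 d0.
have mf : measurable_fun setT (fun t : measurableTypeR R => t `^ (a - 1) * expR (- (delta * t))).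
  apply: measurable_funM; first exact: measurable_powRl.
  by apply: measurableT_comp => //; apply: measurableT_comp => //; exact: measurable_funM.
have [C C0 HC] := powR_le_expR (normr_ge0 (a - 1)) (divr_gt0 d0 (ltr0n _ 2)).
apply/integrableP; split; first by apply/measurable_EFinP; exact: measurable_funTS.
under eq_integral do rewrite /= ger0_norm ?mulr_ge0 ?expR_ge0 ?powR_ge0//.
rewrite (@itv_bndbnd_setU _ _ (BRight 0) (BRight 1) +oo%O) ?bnd_simp//.
rewrite ge0_integral_setU//=; last 3 first.
- by apply/measurable_EFinP; exact: measurable_funTS.
- by move=> x _; rewrite lee_fin mulr_ge0 ?expR_ge0 ?powR_ge0.
- by apply/disj_setPS => x /= []; rewrite !in_itv/= andbT => /andP[_ xa] ax; move: (lt_le_trans ax xa); rewrite ltxx.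
apply: lte_add_pinfty.
  apply: le_lt_trans (powR_integrable a0); apply: ge0_le_integral => //.
  - by move=> x _; rewrite lee_fin mulr_ge0 ?expR_ge0 ?powR_ge0.
  - by apply/measurable_EFinP; exact: measurable_funTS.
  - by apply/measurable_EFinP; apply: measurable_funTS; exact: measurable_powRl.
  - move=> x; rewrite /= in_itv/= => /andP[x0 _]; rewrite lee_fin ler_piMr ?powR_ge0//.
    by rewrite -expR0 ler_expR oppr_le0 mulr_ge0// ltW.
have /integrableP[_ fin] := expR_integrable 1 (divr_gt0 d0 (ltr0n R 2)).
apply: (@le_lt_trans _ _ (\int[leb]_(x in `]1%R, +oo[) (C%:E * (EFin \o (fun t => expR (- (delta / 2 * t)))) x))%E).
  apply: ge0_le_integral => //.
  - by move=> x _; rewrite lee_fin mulr_ge0 ?expR_ge0 ?powR_ge0.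
  - by apply/measurable_EFinP; exact: measurable_funTS.
  - apply/measurable_EFinP; apply: measurable_funTS; apply: measurable_funM => //.
    by apply: measurableT_comp => //; apply: measurableT_comp => //; exact: measurable_funM.
  - move=> x; rewrite /= in_itv/= andbT => x1; rewrite lee_fin; have x0 := lt_trans ltr01 x1.
    (* The net effect of the two rewritings is to split the exponent into two halves; one of them
       absorbs the power of x. *)
    have -> : - (delta * x) = delta / 2 * x - delta * x - delta / 2 * x + delta / 2 * x - delta / 2 * x + (delta / 2 * x - delta / 2 * x) by field.
    have -> : delta / 2 * x - delta * x - delta / 2 * x + delta / 2 * x - delta / 2 * x + (delta / 2 * x - delta / 2 * x) = - (delta / 2 * x) + - (delta / 2 * x) by field.
    rewrite expRD mulrA ler_wpM2r ?expR_ge0// expRN ler_pdivrMr ?expR_gt0//.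
    apply: le_trans (HC x x0); apply: ler_powR => //; [exact: ltW|exact: ler_norm].
rewrite ge0_integralZl//; last 3 first.
- apply/measurable_EFinP; apply: measurable_funTS.
  by apply: measurableT_comp => //; apply: measurableT_comp => //; exact: measurable_funM.
- by move=> x _; rewrite lee_fin expR_ge0.
- by rewrite lee_fin ltW.
apply: lte_mul_pinfty; rewrite ?lee_fin ?(ltW C0)//.
apply: le_lt_trans fin; under [leRHS]eq_integral do rewrite /= ger0_norm ?expR_ge0//.
apply: ge0_subset_integral => //.
- apply/measurable_EFinP; apply: measurable_funTS.
  by apply: measurableT_comp => //; apply: measurableT_comp => //; exact: measurable_funM.
- by move=> x _; rewrite lee_fin expR_ge0.
- by move=> x /=; rewrite !in_itv/= !andbT => /ltW.
Qed.
End integrability.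

(** * Dunkl operators *)
Section rvnorm.
Variables (R : realType) (n : nat).
Local Notation V := ('rV[CC R]_n).
Lemma coord_le_norm (x : V) i : `|x 0 i| <= `|x|.
Proof.
rewrite /Num.norm/= mx_normE.
have : (`|x 0 i|%:nng <= \big[Order.max/0%:nng]_i `|x i.1 i.2|%:nng)%R.
  by apply/bigmax_geP; right; exists (0, i).
by [].
Qed.
Lemma norm_le_coord (x : V) (r : CC R) : 0 <= r -> (forall i, `|x 0 i| <= r) -> `|x| <= r.
Proof.
move=> r0 h; rewrite /Num.norm/= mx_normE.
have : (\big[Order.max/0%:nng]_i `|x i.1 i.2|%:nng <= NngNum r0)%R.
  apply/bigmax_leP; split; first by rewrite -num_le /=.
  by move=> [i j] _; rewrite -num_le /= (ord1 i).
by [].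
Qed.
Lemma permvM (T : Type) (s t : 'S_n) (x : 'rV[T]_n) : permv s (permv t x) = permv (s * t)%g x.
Proof. by apply/rowP => i; rewrite !mxE permM. Qed.
Lemma permv1 (T : Type) (x : 'rV[T]_n) : permv 1 x = x.
Proof. by apply/rowP => i; rewrite !mxE perm1. Qed.
Lemma swapvE (T : Type) i j (x : 'rV[T]_n) : swapv i j x = permv (tperm i j) x. Proof. by []. Qed.
Lemma permvD s (x y : V) : permv s (x + y) = permv s x + permv s y.
Proof. by apply/rowP => i; rewrite !mxE. Qed.
Lemma permvZ s a (x : V) : permv s (a *: x) = a *: permv s x.
Proof. by apply/rowP => i; rewrite !mxE. Qed.
Lemma norm_permv_le s (x : V) : `|permv s x| <= `|x|.
Proof. by apply: norm_le_coord => // i; rewrite mxE coord_le_norm. Qed.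
Lemma norm_permv s (x : V) : `|permv s x| = `|x|.
Proof.
apply/eqP; rewrite eq_le norm_permv_le /= -{1}(permv1 x) -(mulVg s) -permvM.
exact: norm_permv_le.
Qed.
Lemma permv_evec s i : permv s (evec i : V) = evec (s^-1%g i).
Proof. by apply/rowP => l; rewrite !mxE /= (can2_eq (permK s) (permKV s)). Qed.
End rvnorm.

Section cder.
Variables (R : realType) (V : normedModType (CC R)).
Implicit Types (f L : V -> CC R) (z h : V).
(** Frechet differentiability at one point, unfolded to epsilon and delta. In contrast to [qr] it
    carries no majorant; it is the form in which products, permutations of coordinates and
    restriction to a neighbourhood are elementary. [cder_diff] and [diff_cder] give the equivalence
    with [differentiable]. *)
Definition cder f z L := [/\ clinear L, exists2 M, 0 <= M & forall h, `|L h| <= M * `|h| &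
  forall eps : CC R, 0 < eps -> exists2 del : CC R, 0 < del & forall h, `|h| <= del -> `|f (z + h) - f z - L h| <= eps * `|h|].
Lemma qr_cder f z L rho g : 0 < rho -> qr f z L rho g -> cder f z L.
Proof.
move=> r0 H; have g0 := qr_ge0 r0 H; have lb h := qr_lin_le h r0 H.
case: H => l H; split => //.
  exists (2%:R * g / rho); first by rewrite !mulr_ge0// invr_ge0 ltW.
  by move=> h; rewrite mulrAC ler_pdivlMr// mulrC -mulrA (mulrC g); exact: lb.
move=> eps e0.
have d0 : 0 < eps * rho ^+ 2 / (g + 1) by rewrite divr_gt0 ?mulr_gt0 ?exprn_gt0// ltr_wpDl.
pose del := Num.min rho (eps * rho ^+ 2 / (g + 1)).
have rr : rho >=< eps * rho ^+ 2 / (g + 1) by apply: real_comparable; apply: ger0_real; exact: ltW.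
exists del; first by rewrite /del comparable_lt_min// r0 d0.
move=> h; rewrite /del comparable_le_min// => /andP[xr xe].
have [_ _ c] := H h xr.
rewrite -(ler_pM2l (x := rho ^+ 2)) ?exprn_gt0//; apply: le_trans c _.
rewrite expr2 -mulrA mulrCA mulrC [leRHS]mulrA (mulrC (rho ^+ 2)); apply: ler_wpM2r => //.
rewrite ler_pdivlMr ?ltr_wpDl// in xe; apply: le_trans xe.
by rewrite ler_wpM2l// lerDl.
Qed.
Lemma cder_diff f z L : cder f z L -> differentiable f z /\ forall v, 'D_v f z = L v.
Proof.
move=> [lL [M M0 bM] H].
have lL' : linear L by move=> a u v; exact: lL.
pose isl := GRing.isLinear.Build _ _ _ _ L lL'.
pose l' : {linear V -> CC R} := HB.pack L isl.
have lc : continuous l'.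
  apply: bounded_linear_continuous; apply/linear_boundedP.
  exists M; split; first by rewrite ger0_real.
  by move=> M' hM x; apply: le_trans (bM x) _; rewrite ler_wpM2r// ltW.
have e : f \o shift z = cst (f z) + l' +o_ 0 id.
  apply/eqaddoP => eps e0; have [del d0 Hd] := H eps e0; near=> x.
  rewrite /= -[(_ - _) x]/(f (x + z) - (f z + L x)) opprD addrA (addrC x).
  by apply: Hd; near: x; apply: nbhs0_le.
have d : 'd f z = l' :> (V -> CC R) := diff_unique lc e.
have df : differentiable f z by apply/diff_locallyP; rewrite d; split; [exact: lc|exact: e].
by split; [exact: df|move=> v; rewrite deriveE// d].
Unshelve. all: by end_near. Qed.
Lemma diff_cder f z : differentiable f z -> cder f z (fun v => 'D_v f z).
Proof.
move=> df.
have E : (fun v => 'D_v f z) = 'd f z by apply/funext => v; rewrite deriveE.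
rewrite E; split.
- by move=> a u v; rewrite linearP.
- have dc : continuous ('d f z) := diff_continuous df.
  have /linear_bounded_continuous/linear_boundedP [M [Mr HM]] := dc.
  exists (`|M| + 1); first by rewrite addr_ge0.
  move=> h; apply: HM; apply: le_lt_trans (real_ler_norm Mr) _; by rewrite ltrDl.
- move=> eps e0; have /diff_locallyP [_ /eqaddoP /(_ eps e0)] := df.
  move=> /nbhs_norm0P [d /= d0 Hd]; exists (d / 2%:R); first by rewrite divr_gt0.
  move=> h hd; have := Hd h; rewrite /= -[(_ - _) h]/(f (h + z) - (f z + 'd f z h)) opprD addrA (addrC h).
  apply; apply: le_lt_trans hd _; by rewrite ltr_pdivrMr// mulr_natr mulr2n ltrDl.
Qed.
Lemma cder_local f g z L (r : CC R) : 0 < r -> (forall h, `|h| <= r -> f (z + h) = g (z + h)) -> cder f z L -> cder g z L.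
Proof.
move=> r0 fg [l m H]; split => // eps e0; have [del d0 Hd] := H eps e0.
have rr : r >=< del by apply: real_comparable; apply: ger0_real; exact: ltW.
exists (Num.min r del); first by rewrite comparable_lt_min// r0 d0.
move=> h; rewrite comparable_le_min// => /andP[hr hd].
have := fg 0; rewrite normr0 addr0 => /(_ (ltW r0)) <-; rewrite -fg//; exact: Hd.
Qed.
Lemma cder_cst c z : cder (fun=> c) z (fun=> 0).
Proof.
split; first by move=> a u v; rewrite mulr0 addr0.
  by exists 0 => // h; rewrite normr0 mul0r.
by move=> eps e0; exists 1 => // h _; rewrite !subrr normr0 mulr_ge0// ltW.
Qed.
Lemma cderD f g z L M : cder f z L -> cder g z M -> cder (fun x => f x + g x) z (fun v => L v + M v).
Proof.
move=> [l [K K0 b] H] [l' [K' K0' b'] H']; split.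
- by move=> a u v; rewrite l l'; ring.
- exists (K + K'); first exact: addr_ge0.
  by move=> h; rewrite mulrDl; apply: le_trans (ler_normD _ _) (lerD (b h) (b' h)).
- move=> eps e0; have e2 : 0 < eps / 2%:R by rewrite divr_gt0.
  have [d d0 Hd] := H _ e2; have [d' d0' Hd'] := H' _ e2.
  have rr : d >=< d' by apply: real_comparable; apply: ger0_real; exact: ltW.
  exists (Num.min d d'); first by rewrite comparable_lt_min// d0 d0'.
  move=> h; rewrite comparable_le_min// => /andP[hr hd].
  have -> : f (z + h) + g (z + h) - (f z + g z) - (L h + M h) = (f (z + h) - f z - L h) + (g (z + h) - g z - M h) by ring.
  apply: le_trans (ler_normD _ _) _; apply: le_trans (lerD (Hd h hr) (Hd' h hd)) _.
  by rewrite -mulrDl -splitr.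
Qed.
Lemma cderZ c f z L : cder f z L -> cder (fun x => c * f x) z (fun v => c * L v).
Proof.
move=> [l [K K0 b] H]; split.
- by move=> a u v; rewrite l; ring.
- exists (`|c| * K); first by rewrite mulr_ge0.
  by move=> h; rewrite normrM -mulrA ler_wpM2l.
- move=> eps e0; have c1 : 0 < `|c| + 1 by rewrite ltr_wpDl.
  have [d d0 Hd] := H _ (divr_gt0 e0 c1); exists d => // h hd.
  rewrite -!mulrBr normrM; apply: le_trans (_ : `|c| * (eps / (`|c| + 1) * `|h|) <= _).
    by rewrite ler_wpM2l// Hd.
  rewrite mulrA ler_wpM2r// mulrA ler_pdivrMr// mulrC ler_wpM2l//; first exact: ltW.
  by rewrite lerDl.
Qed.
Lemma cder_lin L z : clinear L -> (exists2 M, 0 <= M & forall h, `|L h| <= M * `|h|) -> cder L z L.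
Proof.
move=> l m; split => // eps e0; exists 1 => // h _.
by rewrite (clinearD l) (addrC (L z)) addrK subrr normr0 mulr_ge0// ltW.
Qed.
Lemma cderM f g z L M : cder f z L -> cder g z M -> cder (fun x => f x * g x) z (fun v => L v * g z + f z * M v).
Proof.
move=> [l [K K0 b] H] [l' [K' K0' b'] H']; split.
- by move=> a u v; rewrite l l'; ring.
- exists (K * `|g z| + `|f z| * K'); first by rewrite addr_ge0 ?mulr_ge0.
  move=> h; apply: le_trans (ler_normD _ _) _; rewrite !normrM mulrDl mulrAC -mulrA; apply: lerD.
    by rewrite mulrA ler_wpM2r.
  by rewrite -mulrA ler_wpM2l.
- move=> eps e0.
  pose A := `|g z| + `|f z| + (K + 1) * (K' + 1).
  have A0 : 0 <= A by rewrite !addr_ge0// mulr_ge0// addr_ge0.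
  have A1 : 0 < A + 1 by rewrite ltr_wpDl.
  have e1 : 0 < eps / (A + 1) by rewrite divr_gt0.
  have [d d0 Hd] := H _ e1; have [d' d0' Hd'] := H' _ e1.
  have [u u0 Hu] := H 1 ltr01; have [u' u0' Hu'] := H' 1 ltr01.
  pose m := [:: d; d'; u; u'; eps / (A + 1)].
  have [D D0 hD] : exists2 D, 0 < D & all (fun x => D <= x) m.
    have rr (x y : CC R) : 0 < x -> 0 < y -> exists2 w, 0 < w & (w <= x) && (w <= y).
      move=> x0 y0; exists (Num.min x y); have xy : x >=< y by apply: real_comparable; apply: ger0_real; exact: ltW.
        by rewrite comparable_lt_min// x0 y0.
      by rewrite -comparable_le_min.
    have [w1 w10 /andP[a1 a2]] := rr _ _ d0 d0'; have [w2 w20 /andP[a3 a4]] := rr _ _ u0 u0'.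
    have [w3 w30 /andP[a5 a6]] := rr _ _ w10 w20; have [w4 w40 /andP[a7 a8]] := rr _ _ w30 e1.
    exists w4 => //=; rewrite a8 !(le_trans a7)//=; [exact: le_trans a6 a4|exact: le_trans a6 a3|exact: le_trans a5 a2|exact: le_trans a5 a1].
  move: hD => /and5P[D1 D2 D3 D4 /andP[D5 _]]; exists D => // h hh.
  have -> : f (z + h) * g (z + h) - f z * g z - (L h * g z + f z * M h) =
    g z * (f (z + h) - f z - L h) + (f z * (g (z + h) - g z - M h) + (f (z + h) - f z) * (g (z + h) - g z)) by ring.
  have bf : `|f (z + h) - f z| <= (K + 1) * `|h|.
    rewrite -[X in `|X| <= _](subrK (L h)) mulrDl mul1r [leRHS]addrC; apply: le_trans (ler_normD _ _) _; apply: lerD => //.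
    by rewrite -[leRHS]mul1r; apply: Hu; exact: le_trans hh D3.
  have bg : `|g (z + h) - g z| <= (K' + 1) * `|h|.
    rewrite -[X in `|X| <= _](subrK (M h)) mulrDl mul1r [leRHS]addrC; apply: le_trans (ler_normD _ _) _; apply: lerD => //.
    by rewrite -[leRHS]mul1r; apply: Hu'; exact: le_trans hh D4.
  apply: le_trans (ler_normD _ _) _; apply: le_trans (lerD (lexx _) (ler_normD _ _)) _.
  rewrite !normrM.
  apply: (@le_trans _ _ (`|g z| * (eps / (A + 1) * `|h|) + (`|f z| * (eps / (A + 1) * `|h|) + (K + 1) * `|h| * ((K' + 1) * (eps / (A + 1)))))).
    apply: lerD; first by rewrite ler_wpM2l// Hd// (le_trans hh).
    apply: lerD; first by rewrite ler_wpM2l// Hd'// (le_trans hh).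
    apply: ler_pM => //; apply: le_trans bg _; rewrite ler_wpM2l ?addr_ge0//.
    exact: le_trans hh D5.
  have -> : `|g z| * (eps / (A + 1) * `|h|) + (`|f z| * (eps / (A + 1) * `|h|) + (K + 1) * `|h| * ((K' + 1) * (eps / (A + 1)))) =
    eps * (A / (A + 1)) * `|h| by rewrite /A; field; rewrite gt_eqF.
  rewrite ler_wpM2r// ler_piMr ?(ltW e0)// ler_pdivrMr// mul1r lerDl//.
Qed.
Lemma cder_comp_le f z L (P : V -> V) : (forall u v, P (u + v) = P u + P v) -> (forall a u, P (a *: u) = a *: P u) ->
  (forall v, `|P v| <= `|v|) -> cder f (P z) L -> cder (fun v => f (P v)) z (fun v => L (P v)).
Proof.
move=> PD PZ Pn [l [M M0 b] H]; split.
- by move=> a u v; rewrite PD PZ l.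
- by exists M => // h; apply: le_trans (b _) _; rewrite ler_wpM2l.
- move=> eps e0; have [d d0 Hd] := H eps e0; exists d => // h hd.
  by rewrite PD; apply: le_trans (Hd _ _) _; [exact: le_trans (Pn h) hd|rewrite ler_wpM2l// ltW].
Qed.
Lemma cder_shift f z L c : cder f (z + c) L -> cder (fun v => f (v + c)) z L.
Proof.
move=> [l m H]; split => // eps e0; have [d d0 Hd] := H eps e0; exists d => // h hd.
by rewrite (addrAC z); exact: Hd.
Qed.
End cder.

Section dunkl.
Variables (R : realType) (n : nat) (k : R).
Local Notation V := ('rV[CC R]_n).
Implicit Types (f g L : V -> CC R) (z h : V).

(** A Dunkl operator at z depends on f only through its derivative, its value and its values at the
    reflected points. With these as separate arguments the expression is linear in them, which
    allows it to be exchanged with integrals. *)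
Definition dunkl_form (L : V -> CC R) (i : 'I_n) (z : V) (v0 : CC R) (v : 'I_n -> CC R) : CC R :=
  L (evec i) + RC k * \sum_(j < n | j != i)
    (if z 0 i == z 0 j then L (evec i) - L (evec j) else (v0 - v j) / (z 0 i - z 0 j)).
Lemma dunklAE f i z : dunklA k i f z = dunkl_form (fun v => 'D_v f z) i z (f z) (fun j => f (swapv i j z)).
Proof. by []. Qed.
Lemma dunklA_cder f L i z : cder f z L -> dunklA k i f z = dunkl_form L i z (f z) (fun j => f (swapv i j z)).
Proof.
move=> /cder_diff [_ D]; rewrite dunklAE /dunkl_form D; congr (_ + _ * _).
by apply: eq_bigr => j _; rewrite !D.
Qed.
Lemma swapv_same (T : eqType) i j (x : 'rV[T]_n) : x 0 i = x 0 j -> swapv i j x = x.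
Proof. by move=> e; apply/rowP => l; rewrite mxE; case: tpermP => [->|->|]. Qed.

Lemma cder_permv f s z L : cder f (permv s z) L -> cder (fun v => f (permv s v)) z (fun v => L (permv s v)).
Proof.
apply: cder_comp_le; [exact: permvD|exact: permvZ|by move=> v; rewrite norm_permv].
Qed.
Lemma cder_coord l z : cder (fun x : V => x 0 l) z (fun x : V => x 0 l).
Proof.
apply: cder_lin; first by move=> a u v; rewrite !mxE.
by exists 1 => // h; rewrite mul1r coord_le_norm.
Qed.
Lemma cder_mulX f l z L : cder f z L -> cder (fun x : V => x 0 l * f x) z (fun v : V => v 0 l * f z + z 0 l * L v).
Proof. by move=> H; apply: cderM => //; exact: cder_coord. Qed.

Definition S_ i j f : V -> CC R := fun z => f (swapv i j z).
(** The commutator [T_i, x_l] applied to f. *)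
Definition dunkl_commX i l f : V -> CC R := fun z =>
  if l == i then f z + RC k * \sum_(j < n | j != i) f (swapv i j z) else - (RC k * f (swapv i l z)).

Lemma dunkl_mulX f L i l z : cder f z L ->
  dunklA k i (fun x => x 0 l * f x) z = z 0 l * dunklA k i f z + dunkl_commX i l f z.
Proof.
move=> H; rewrite (dunklA_cder i (cder_mulX l H)) (dunklA_cder i H) /dunkl_form /dunkl_commX.
have E j : j != i -> (if z 0 i == z 0 j then (evec i : V) 0 l * f z + z 0 l * L (evec i) - ((evec j : V) 0 l * f z + z 0 l * L (evec j))
   else (z 0 l * f z - (swapv i j z) 0 l * f (swapv i j z)) / (z 0 i - z 0 j)) =
  z 0 l * (if z 0 i == z 0 j then L (evec i) - L (evec j) else (f z - f (swapv i j z)) / (z 0 i - z 0 j))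
  + ((l == i)%:R - (l == j)%:R) * f (swapv i j z).
  move=> ji; case: eqVneq => [e|ne].
    by rewrite (swapv_same e) !mxE /=; ring.
  have d0 : z 0 i - z 0 j != 0 by rewrite subr_eq0.
  rewrite mxE; case: tpermP => [->|->|/eqP li /eqP lj].
  - by rewrite eqxx [i == j]eq_sym (negPf ji) /=; field.
  - by rewrite eqxx (negPf ji) /=; field.
  - by rewrite (negPf li) (negPf lj) /=; field.
rewrite (eq_bigr _ E) big_split /= -mulr_sumr !mxE /=.
rewrite mulrDr [in LHS]addrACA.
case: (eqVneq l i) => [->|li].
  under [in X in _ + (_ + X) = _]eq_bigr => j ji do rewrite eq_sym (negPf ji) subr0 mul1r.
  rewrite mul1r; ring.
have -> : \sum_(j < n | j != i) ((false : nat)%:R - (l == j)%:R) * f (swapv i j z) = - f (swapv i l z).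
  rewrite (bigD1 l)//= eqxx big1 ?addr0 ?sub0r ?mulN1r// => j /andP[_ jl].
  by rewrite eq_sym (negPf jl) subrr mul0r.
by rewrite mul0r; ring.
Qed.
Lemma dunklD f g L M i z : cder f z L -> cder g z M ->
  dunklA k i (fun x => f x + g x) z = dunklA k i f z + dunklA k i g z.
Proof.
move=> Hf Hg; rewrite (dunklA_cder i (cderD Hf Hg)) (dunklA_cder i Hf) (dunklA_cder i Hg) /dunkl_form.
rewrite addrACA -mulrDr -big_split /=; congr (_ + _ * _); apply: eq_bigr => j _.
by case: ifP => _; [ring|rewrite -mulrDl; congr (_ / _); ring].
Qed.
Lemma dunklZ c f L i z : cder f z L -> dunklA k i (fun x => c * f x) z = c * dunklA k i f z.
Proof.
move=> Hf; rewrite (dunklA_cder i (cderZ c Hf)) (dunklA_cder i Hf) /dunkl_form.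
rewrite [RHS]mulrDr [in RHS]mulrCA [in RHS]mulr_sumr; congr (_ + _ * _); apply: eq_bigr => j _.
by case: ifP => _; [ring|rewrite mulrA -mulrBr].
Qed.
Lemma dunkl_cst c i z : dunklA k i (fun=> c) z = 0.
Proof.
rewrite (dunklA_cder i (cder_cst c z)) /dunkl_form add0r big1 ?mulr0// => j _.
by rewrite !subrr mul0r; case: ifP.
Qed.
(** T_i is not a local operator: besides a neighbourhood of z, the reflected points s_ij z must be
    controlled. Agreement on an open set stable under transpositions is therefore enough. *)
Lemma dunkl_local (f g : V -> CC R) i z (r : CC R) : 0 < r -> (forall h, `|h| <= r -> f (z + h) = g (z + h)) ->
  (forall j, f (swapv i j z) = g (swapv i j z)) -> differentiable f z -> dunklA k i f z = dunklA k i g z.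
Proof.
move=> r0 fg fgs /diff_cder Hf; rewrite (dunklA_cder i Hf) (dunklA_cder i (cder_local r0 fg Hf)).
rewrite /dunkl_form; congr (_ + _ * _); apply: eq_bigr => j _; rewrite fgs.
by have := fg 0; rewrite normr0 addr0 => -> //; exact: ltW.
Qed.
Lemma dunkl_permv f s i z L : cder f (permv s z) L ->
  dunklA k i (fun x => f (permv s x)) z = dunklA k (s^-1%g i) f (permv s z).
Proof.
move=> H; rewrite (dunklA_cder i (cder_permv H)) (dunklA_cder _ H) /dunkl_form.
rewrite permv_evec; congr (_ + _ * _).
rewrite [RHS](reindex_inj (@perm_inj _ (s^-1%g))) /=.
apply: eq_big => [j|j ji]; first by rewrite (inj_eq perm_inj).
rewrite permv_evec !mxE !permKV; case: ifP => // _; congr ((_ - f _) / _).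
rewrite !swapvE !permvM; congr permv.
by rewrite -(tpermJ i j s^-1%g) conjgE invgK mulgA mulgKV.
Qed.
Lemma dunkl_swap f i j L z : cder f (swapv i j z) L -> dunklA k i (S_ i j f) z = S_ i j (dunklA k j f) z.
Proof. by move=> H; rewrite (dunkl_permv i H) tpermV tpermL. Qed.
Lemma dunkl_swap0 f i j l L z : i != j -> i != l -> cder f (swapv j l z) L -> dunklA k i (S_ j l f) z = S_ j l (dunklA k i f) z.
Proof. by move=> ij il H; rewrite (dunkl_permv i H) tpermV tpermD// eq_sym. Qed.

Inductive hpoly : nat -> (V -> CC R) -> Prop :=
| hpoly0 m : hpoly m (fun=> 0)
| hpoly_cst c : hpoly 0 (fun=> c)
| hpolyX m l f : hpoly m f -> hpoly m.+1 (fun z => z 0 l * f z)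
| hpolyD m f g : hpoly m f -> hpoly m g -> hpoly m (fun z => f z + g z).
Lemma hpoly_cder m f z : hpoly m f -> cder f z (fun v => 'D_v f z).
Proof.
move=> H; suff [L HL] : exists L, cder f z L by have [d _] := cder_diff HL; exact: diff_cder.
elim: H => {m f} [m|c|m l f _ [L HL]|m f g _ [L HL] _ [M HM]].
- by exists (fun=> 0); exact: cder_cst.
- by exists (fun=> 0); exact: cder_cst.
- by exists (fun v : V => v 0 l * f z + z 0 l * L v); exact: cder_mulX.
- by exists (fun v => L v + M v); exact: cderD.
Qed.
Lemma hpolyZ m c f : hpoly m f -> hpoly m (fun z => c * f z).
Proof.
elim => {m f} [m|c'|m l f _ IH|m f g _ IH _ IH'].
- by rewrite (_ : (fun _ => _) = (fun=> 0)); [exact: hpoly0|apply/funext => z; rewrite mulr0].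
- exact: hpoly_cst.
- rewrite (_ : (fun _ => _) = (fun z => z 0 l * (c * f z))); first exact: hpolyX.
  by apply/funext => z; rewrite mulrCA.
- rewrite (_ : (fun _ => _) = (fun z => c * f z + c * g z)); first exact: hpolyD.
  by apply/funext => z; rewrite mulrDr.
Qed.
Lemma hpoly_sum I (r : seq I) (P : pred I) m (F : I -> V -> CC R) : (forall i, P i -> hpoly m (F i)) ->
  hpoly m (fun z => \sum_(i <- r | P i) F i z).
Proof.
move=> H; elim: r => [|i r IH].
  by rewrite (_ : (fun _ => _) = (fun=> 0)); [exact: hpoly0|apply/funext => z; rewrite big_nil].
case Pi: (P i).
  rewrite (_ : (fun _ => _) = (fun z => F i z + \sum_(j <- r | P j) F j z)); first by apply: hpolyD => //; exact: H.
  by apply/funext => z; rewrite big_cons Pi.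
by rewrite (_ : (fun _ => _) = (fun z => \sum_(j <- r | P j) F j z))//; apply/funext => z; rewrite big_cons Pi.
Qed.
Lemma hpoly_permv m f s : hpoly m f -> hpoly m (fun z => f (permv s z)).
Proof.
elim => {m f} [m|c|m l f _ IH|m f g _ IH _ IH'].
- exact: hpoly0.
- exact: hpoly_cst.
- rewrite (_ : (fun _ => _) = (fun z => z 0 (s l) * f (permv s z))); first exact: hpolyX.
  by apply/funext => z; rewrite mxE.
- exact: hpolyD.
Qed.
Lemma hpolyN m f : hpoly m f -> hpoly m (fun z => - f z).
Proof. by move=> /(hpolyZ (-1)); rewrite (_ : (fun _ => _) = (fun z => - f z))//; apply/funext => z; rewrite mulN1r. Qed.
Lemma hpolyB m f g : hpoly m f -> hpoly m g -> hpoly m (fun z => f z - g z).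
Proof. by move=> hf hg; apply: hpolyD => //; exact: hpolyN. Qed.
Lemma hpoly_C m f i l : hpoly m f -> hpoly m (dunkl_commX i l f).
Proof.
move=> hf; rewrite /dunkl_commX; case: (l == i).
  apply: hpolyD => //; apply: hpolyZ; apply: hpoly_sum => j _; exact: hpoly_permv.
by apply: hpolyN; apply: hpolyZ; exact: hpoly_permv.
Qed.
Lemma dunkl_hpoly_mulX m f i l : hpoly m f ->
  dunklA k i (fun x => x 0 l * f x) = (fun z => z 0 l * dunklA k i f z + dunkl_commX i l f z).
Proof. by move=> hf; apply/funext => z; apply: dunkl_mulX; exact: hpoly_cder hf. Qed.
Lemma dunkl_hpolyD m m' f g i : hpoly m f -> hpoly m' g ->
  dunklA k i (fun x => f x + g x) = (fun z => dunklA k i f z + dunklA k i g z).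
Proof. by move=> hf hg; apply/funext => z; apply: dunklD; [exact: hpoly_cder hf|exact: hpoly_cder hg]. Qed.
Lemma dunkl_hpolyZ m f c i : hpoly m f -> dunklA k i (fun x => c * f x) = (fun z => c * dunklA k i f z).
Proof. by move=> hf; apply/funext => z; apply: dunklZ; exact: hpoly_cder hf. Qed.
Lemma dunkl_hpolyN m f i : hpoly m f -> dunklA k i (fun x => - f x) = (fun z => - dunklA k i f z).
Proof.
move=> hf; rewrite -[RHS](_ : (fun z => -1 * dunklA k i f z) = _); last by apply/funext => z; rewrite mulN1r.
by rewrite -(dunkl_hpolyZ _ _ hf); congr dunklA; apply/funext => z; rewrite mulN1r.
Qed.
Lemma dunkl_hpoly_sum I (r : seq I) (P : pred I) m (F : I -> V -> CC R) i : (forall j, P j -> hpoly m (F j)) ->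
  dunklA k i (fun z => \sum_(j <- r | P j) F j z) = (fun z => \sum_(j <- r | P j) dunklA k i (F j) z).
Proof.
move=> H; elim: r => [|j r IH].
  rewrite (_ : (fun _ => _) = (fun=> 0)); last by apply/funext => z; rewrite big_nil.
  by apply/funext => z; rewrite dunkl_cst big_nil.
case Pj: (P j).
  rewrite (_ : (fun _ => _) = (fun z => F j z + \sum_(j <- r | P j) F j z)); last by apply/funext => z; rewrite big_cons Pj.
  rewrite (dunkl_hpolyD _ (H _ Pj) (hpoly_sum _ H)) IH; apply/funext => z; by rewrite big_cons Pj.
rewrite (_ : (fun _ => _) = (fun z => \sum_(j <- r | P j) F j z)); last by apply/funext => z; rewrite big_cons Pj.
by rewrite IH; apply/funext => z; rewrite big_cons Pj.
Qed.
Lemma dunkl_hpoly m f i : hpoly m f -> hpoly m.-1 (dunklA k i f) /\ (m = 0%N -> dunklA k i f = fun=> 0).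
Proof.
elim => {m f} [m|c|m l f hf [IH IH0]|m f g hf [IH IH0] hg [IH' IH0']].
- have E : dunklA k i (fun _ : V => 0) = (fun=> 0) by apply/funext => z; rewrite dunkl_cst.
  by rewrite E; split => //; exact: hpoly0.
- have E : dunklA k i (fun _ : V => c) = (fun=> 0) by apply/funext => z; rewrite dunkl_cst.
  by rewrite E; split => //; exact: hpoly0.
- split => //; rewrite (dunkl_hpoly_mulX _ _ hf) /=; apply: hpolyD; last exact: hpoly_C.
  case: m hf IH IH0 => [|m] hf IH IH0; last exact: hpolyX.
  by rewrite IH0// (_ : (fun _ => _) = (fun=> 0)); [exact: hpoly0|apply/funext => z; rewrite mulr0].
- rewrite (dunkl_hpolyD _ hf hg); split; first exact: hpolyD.
  by move=> m0; rewrite IH0// IH0'//; apply/funext => z; rewrite addr0.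
Qed.
Lemma hpoly_euler m f z : hpoly m f -> \sum_i z 0 i * 'D_(evec i) f z = m%:R * f z.
Proof.
elim => {m f} [m|c|m l f hf IH|m f g hf IH hg IH'].
- rewrite mulr0 big1// => i _; have [_ ->] := cder_diff (cder_cst 0 z); by rewrite mulr0.
- rewrite mul0r big1// => i _; have [_ ->] := cder_diff (cder_cst c z); by rewrite mulr0.
- have [_ D] := cder_diff (cder_mulX l (hpoly_cder z hf)).
  under eq_bigr do rewrite D mulrDr.
  rewrite big_split /= (bigD1 l)//= big1 ?addr0; last first.
    by move=> i il; rewrite mxE /= eq_sym (negPf il) mul0r mulr0.
  under eq_bigr do rewrite mulrCA.
  by rewrite -mulr_sumr IH !mxE /= eqxx -natr1 /=; ring.
- have [_ D] := cder_diff (cderD (hpoly_cder z hf) (hpoly_cder z hg)).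
  under eq_bigr do rewrite D mulrDr.
  transitivity (m%:R * f z + m%:R * g z); last exact/esym/mulrDr.
  by rewrite -IH -IH' -big_split.
Qed.
(* pairing the terms (i, j) and (j, i) removes the denominators *)
Lemma dunkl_euler f z c : \sum_i (z 0 i - c) * dunklA k i f z =
  \sum_i (z 0 i - c) * 'D_(evec i) f z + RC (k / 2) * \sum_(i < n) \sum_(j < n) (f z - f (swapv i j z)).
Proof.
under eq_bigr do rewrite /dunklA mulrDr.
rewrite big_split /=; congr (_ + _).
pose q i j := (z 0 i - c) * dunkl_quot f i j z.
have q0 i : dunkl_quot f i i z = 0 by rewrite /dunkl_quot eqxx subrr.
transitivity (RC k * \sum_(i < n) \sum_(j < n) q i j).
  rewrite mulr_sumr; apply: eq_bigr => i _; rewrite mulrCA; congr (_ * _).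
  by rewrite mulr_sumr [RHS](bigD1 i)//= /q q0 mulr0 add0r.
have -> : RC k = RC (k / 2) * 2%:R by rewrite -(rmorph_nat (@RC R)) -rmorphM /= divfK// pnatr_eq0.
rewrite -mulrA; congr (_ * _); rewrite mulr_natl mulr2n {2}exchange_big /= -big_split /=.
apply: eq_bigr => i _; rewrite -big_split /=; apply: eq_bigr => j _.
rewrite /q /dunkl_quot [z 0 j == _]eq_sym; case: eqVneq => [e|ne].
  rewrite (swapv_same e) e; move: ('D_(evec i) f z) ('D_(evec j) f z) => A B.
  by rewrite subrr -(opprB A B) mulrN subrr.
have -> : swapv j i z = swapv i j z by rewrite /swapv tpermC.
have d0 : z 0 i - z 0 j != 0 by rewrite subr_eq0.
have d1 : z 0 j - z 0 i != 0 by rewrite subr_eq0 eq_sym.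
by field; rewrite d0 d1.
Qed.

(** Induction on the polynomial. For x_l f the hypothesis disposes of x_l T_i T_j f, and what must
    be symmetric in i and j is [T_i, x_l] T_j f + T_i [T_j, x_l] f. If l differs from i and j this
    is immediate from equivariance; the case l = i ([cross]) needs the full commutator, and l = j is
    its mirror image. *)
Lemma dunkl_comm m f i j : hpoly m f -> dunklA k i (dunklA k j f) = dunklA k j (dunklA k i f).
Proof.
move=> hf; have [->//|ij] := eqVneq i j.
elim: hf => {m f} [m|c|m l f hf IH|m f g hf IH hg IH'].
- have E a : dunklA k a (fun _ : V => 0) = (fun=> 0) by apply/funext => z; rewrite dunkl_cst.
  by rewrite !E.
- have E c' a : dunklA k a (fun _ : V => c') = (fun=> 0) by apply/funext => z; rewrite dunkl_cst.
  by rewrite !E.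
- have hT a : hpoly m.-1 (dunklA k a f) by have [] := dunkl_hpoly a hf.
  have step a b : dunklA k a (dunklA k b (fun z => z 0 l * f z)) =
      (fun z => z 0 l * dunklA k a (dunklA k b f) z + (dunkl_commX a l (dunklA k b f) z + dunklA k a (dunkl_commX b l f) z)).
    rewrite (dunkl_hpoly_mulX b l hf).
    case: m hf hT {IH} => [|m] hf hT.
      have -> : dunklA k b f = (fun=> 0) by have [_ ->] := dunkl_hpoly b hf.
      rewrite (_ : (fun z : V => z 0 l * 0 + _) = (fun z => dunkl_commX b l f z)); last by apply/funext => z; rewrite mulr0 add0r.
      apply/funext => z; rewrite dunkl_cst mulr0 add0r /dunkl_commX -[LHS]add0r; congr (_ + _).
      by case: (l == a); rewrite ?big1 ?mulr0 ?addr0 ?oppr0.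
    rewrite (dunkl_hpolyD _ (hpolyX l (hT b)) (hpoly_C b l hf)) (dunkl_hpoly_mulX _ _ (hT b)).
    by apply/funext => z; exact/esym/addrA.
  rewrite (step i j) (step j i) IH; apply/funext => z.
  apply: (f_equal (fun u => z 0 l * dunklA k j (dunklA k i f) z + u)).
  have TN a (f0 : V -> CC R) m0 : hpoly m0 f0 -> dunklA k a (fun x => - (RC k * f0 x)) z = - (RC k * dunklA k a f0 z).
    by move=> h; rewrite (dunkl_hpolyN _ (hpolyZ (RC k) h)) (dunkl_hpolyZ _ _ h).
  have TS a b f0 m0 : hpoly m0 f0 -> dunklA k a (fun x => f0 (swapv a b x)) z = dunklA k b f0 (swapv a b z).
    by move=> h; exact: (dunkl_swap (hpoly_cder _ h)).
  have TS' a b f0 m0 : hpoly m0 f0 -> dunklA k b (fun x => f0 (swapv a b x)) z = dunklA k a f0 (swapv a b z).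
    by move=> h; have := @TS b a f0 m0 h; rewrite /swapv tpermC.
  have TS0 a b c f0 m0 : a != b -> a != c -> hpoly m0 f0 -> dunklA k a (fun x => f0 (swapv b c x)) z = dunklA k a f0 (swapv b c z).
    by move=> ab ac h; exact: (dunkl_swap0 ab ac (hpoly_cder _ h)).
  have hS a b := hpoly_permv (tperm a b) hf.
  have diag a b : a != b ->
    dunklA k b (dunkl_commX a a f) z = dunklA k b f z + RC k * (\sum_(j < n | (j != a) && (j != b)) dunklA k b f (swapv a j z) + dunklA k a f (swapv a b z)).
    move=> ab; rewrite /dunkl_commX eqxx.
    rewrite (dunkl_hpolyD b hf (hpolyZ (RC k) (hpoly_sum _ (fun j _ => hS a j)))).
    rewrite (dunkl_hpolyZ _ _ (hpoly_sum _ (fun j _ => hS a j))) (dunkl_hpoly_sum _ _ (fun j _ => hS a j)).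
    congr (_ + _ * _); rewrite (bigD1 b) 1?eq_sym//= addrC (TS' a b f m hf); congr (_ + _).
    apply: eq_bigr => c /andP[ca cb]; apply: TS0 hf; by rewrite eq_sym.
  have cross a b : a != b -> dunkl_commX a a (dunklA k b f) z + dunklA k a (dunkl_commX b a f) z = dunkl_commX b a (dunklA k a f) z + dunklA k b (dunkl_commX a a f) z.
    move=> ab; rewrite diag// /dunkl_commX eqxx (negPf ab) (TN _ _ m (hS b a)) (TS' b a f m hf).
    rewrite (bigD1 b) 1?eq_sym//= /swapv (tpermC b a).
    by ring.
  have [li|li] := eqVneq l i; first by rewrite li cross.
  have [lj|lj] := eqVneq l j; first by rewrite lj -cross// eq_sym.
  rewrite /dunkl_commX (negPf li) (negPf lj) (TN _ _ m (hS j l)) (TN _ _ m (hS i l)).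
  have [il jl] : i != l /\ j != l by rewrite ![_ == l]eq_sym.
  have ji : j != i by rewrite eq_sym.
  rewrite (TS0 i j l f m ij il hf) (TS0 j i l f m ji jl hf).
  by rewrite addrC.
- have hT a : hpoly m.-1 (dunklA k a f) by have [] := dunkl_hpoly a hf.
  have hT' a : hpoly m.-1 (dunklA k a g) by have [] := dunkl_hpoly a hg.
  by rewrite !(dunkl_hpolyD _ hf hg) (dunkl_hpolyD _ (hT _) (hT' _)) (dunkl_hpolyD _ (hT _) (hT' _)) IH IH'.
Qed.
End dunkl.

(** * A discrete maximum principle *)

Section maxprinciple.
Variable R : realType.
(** At a point where U is minimal every difference U p - U (a i p) is nonpositive, so the hypothesis
    forces m U p >= 0 there. *)
Lemma laplacian_min (Q I : finType) (a : I -> Q -> Q) (m c : R) (U : Q -> R) : 0 < m -> 0 <= c ->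
  (forall p, 0 <= m * U p + c * \sum_i (U p - U (a i p))) -> forall p, 0 <= U p.
Proof.
move=> m0 c0 H p.
pose p0 := [arg min_(q < p) U q]%O.
have hp0 q : U p0 <= U q by rewrite /p0; case: arg_minP => // i _; exact.
apply: le_trans (hp0 p); have := H p0.
have : c * \sum_i (U p0 - U (a i p0)) <= 0.
  by rewrite mulr_ge0_le0// sumr_le0// => i _; rewrite subr_le0.
move=> h h'; have : 0 <= m * U p0 by apply: le_trans h' _; rewrite gerDl.
by rewrite pmulr_rge0.
Qed.
Lemma laplacian_zero (Q I : finType) (a : I -> Q -> Q) (m c : R) (U : Q -> R) : 0 < m -> 0 <= c ->
  (forall p, m * U p + c * \sum_i (U p - U (a i p)) = 0) -> forall p, U p = 0.
Proof.
move=> m0 c0 H p; apply/eqP; rewrite eq_le; apply/andP; split; last first.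
  by apply: (laplacian_min m0 c0 (a := a)) => q; rewrite H.
rewrite -oppr_ge0; apply: (laplacian_min (U := fun p => - U p) m0 c0 (a := a)) => q.
have -> : m * - U q + c * \sum_i (- U q - - U (a i q)) = - (m * U q + c * \sum_i (U q - U (a i q))).
  rewrite opprD -!mulrN -sumrN; congr (_ + _ * _); apply: eq_bigr => i _; ring.
by rewrite H oppr0.
Qed.
Lemma laplacian_zeroC (Q I : finType) (a : I -> Q -> Q) (m c : R) (U : Q -> CC R) : 0 < m -> 0 <= c ->
  (forall p, RC m * U p + RC c * \sum_i (U p - U (a i p)) = 0) -> forall p, U p = 0.
Proof.
move=> m0 c0 H p; apply: CCP.
  apply: (laplacian_zero (U := fun p => cRe (U p)) (a := a) m0 c0) => q; have := congr1 cRe (H q).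
  rewrite raddfD /= !cReM !cReRC !cImRC !mul0r !subr0 raddf_sum /= => e.
  rewrite -[RHS]e; congr (_ + _ * _); apply: eq_bigr => i _; by rewrite raddfB.
apply: (laplacian_zero (U := fun p => cIm (U p)) (a := a) m0 c0) => q; have := congr1 cIm (H q).
rewrite raddfD /= !cImM !cReRC !cImRC !mul0r !addr0 raddf_sum /= => e.
by rewrite -[RHS]e; congr (_ + _ * _); apply: eq_bigr => i _; rewrite raddfB.
Qed.
End maxprinciple.

(** * The Dunkl kernel *)
Section resolvent.
Variables (R : realType) (n : nat) (k : R).
Hypothesis k0 : 0 <= k.
Implicit Types (s t u : 'S_n).
(* [sum_i z_i T_i] acts on the degree-m part as [m + k * sum_tau (1 - tau)], tau running over the transpositions; [rsv m] is the convolution kernel of the inverse of [m+1 + k * sum_tau (1 - tau)]. By the maximum principle it is nonnegative. *)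
Definition rsv_eq (m : nat) (r : 'S_n -> R) := forall s,
  m.+1%:R * r s + k / 2 * \sum_(p : 'I_n * 'I_n) (r s - r (s * tperm p.1 p.2)%g) = (s == 1%g)%:R.
Lemma rsv_uniq m r r' : rsv_eq m r -> rsv_eq m r' -> r =1 r'.
Proof.
move=> h h' s; apply/eqP; rewrite -subr_eq0; apply/eqP.
apply: (@laplacian_zero R _ _ (fun (p : 'I_n * 'I_n) s => s * tperm p.1 p.2)%g m.+1%:R (k / 2) (fun s => r s - r' s)) => //.
- exact: divr_ge0.
- move=> u; rewrite mulrBr (eq_bigr (fun p : 'I_n * 'I_n => (r u - r (u * tperm p.1 p.2)%g) - (r' u - r' (u * tperm p.1 p.2)%g))); last by move=> p _; ring.
  by rewrite sumrB mulrBr addrACA -opprD h h' subrr.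
Qed.
(** The operator is injective by the maximum principle, hence invertible on the finite-dimensional
    space of functions on the group. *)
Lemma rsv_exists m : exists r, rsv_eq m r.
Proof.
pose T := {ffun 'S_n -> R^o}.
pose phi (r : T) : T := [ffun s => m.+1%:R * r s + k / 2 * \sum_(p : 'I_n * 'I_n) (r s - r (s * tperm p.1 p.2)%g)].
have phiL : linear phi.
  move=> a u v; apply/ffunP => s; rewrite !ffunE.
  rewrite (eq_bigr (fun p : 'I_n * 'I_n => a * (u s - u (s * tperm p.1 p.2)%g) + (v s - v (s * tperm p.1 p.2)%g))); last first.
    by move=> p _; rewrite !ffunE /GRing.scale /=; ring.
  by rewrite big_split /= -mulr_sumr /GRing.scale /=; ring.
pose lp := GRing.isLinear.Build _ _ _ _ phi phiL.
pose phi' : {linear T -> T} := HB.pack phi lp.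
have ker0 : lker (linfun phi') == 0%VS.
  apply/lker0P => u v; rewrite !lfunE => e; apply/ffunP => s.
  have e0 : forall s, phi u s = phi v s by move=> s0; exact: (congr1 (fun f : T => f s0) e).
  apply/eqP; rewrite -subr_eq0; apply/eqP.
  apply: (@laplacian_zero R _ _ (fun (p : 'I_n * 'I_n) s => s * tperm p.1 p.2)%g m.+1%:R (k / 2) (fun s => u s - v s)) => //.
    exact: divr_ge0.
  move=> w; rewrite mulrBr (eq_bigr (fun p : 'I_n * 'I_n => (u w - u (w * tperm p.1 p.2)%g) - (v w - v (w * tperm p.1 p.2)%g))); last by move=> p _; ring.
  have := e0 w; rewrite !ffunE => ew.
  by rewrite sumrB mulrBr addrACA -opprD ew subrr.
pose r := ((linfun phi')^-1)%VF ([ffun s => (s == 1%g)%:R] : T).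
have : linfun phi' r = [ffun s => (s == 1%g)%:R] by apply: lker0_lfunVK.
rewrite lfunE => e; exists r => s; have := congr1 (fun f : T => f s) e.
by rewrite !ffunE.
Qed.
Definition rsv m : 'S_n -> R := projT1 (cid (rsv_exists m)).
Lemma rsvP m : rsv_eq m (rsv m). Proof. exact: projT2 (cid (rsv_exists m)). Qed.
Lemma rsv_ge0 m s : 0 <= rsv m s.
Proof.
apply: (@laplacian_min R _ _ (fun (p : 'I_n * 'I_n) s => s * tperm p.1 p.2)%g m.+1%:R (k / 2)) => //.
  exact: divr_ge0.
by move=> u; rewrite rsvP ler0n.
Qed.
(** Summation over the group kills the Laplacian. This total mass produces the factorials in [EF_le]
    and [EF_const]. *)
Lemma rsv_sum m : \sum_s rsv m s = m.+1%:R^-1.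
Proof.
have : \sum_s (m.+1%:R * rsv m s + k / 2 * \sum_(p : 'I_n * 'I_n) (rsv m s - rsv m (s * tperm p.1 p.2)%g)) = 1.
  rewrite (eq_bigr (fun s => (s == 1%g)%:R)); last by move=> s _; exact: rsvP.
  by rewrite -natr_sum sum1dep_card || rewrite (bigD1 1%g)//= eqxx big1 ?addr0// => s /negPf ->.
rewrite big_split /= -!mulr_sumr [X in _ + _ * X]exchange_big /= [X in _ + _ * X]big1 ?mulr0 ?addr0.
  by move=> h; rewrite -[LHS](mulKf (x := m.+1%:R)) ?h ?mulr1 ?pnatr_eq0.
move=> p _; rewrite sumrB [X in _ - X](reindex_inj (mulIg (tperm p.1 p.2)^-1%g)) /=.
by rewrite [X in _ - X](eq_bigr (rsv m)) ?subrr// => s _; rewrite mulgKV.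
Qed.
Lemma sum_tperm_conj (A : zmodType) (F : 'S_n -> A) u : \sum_(p : 'I_n * 'I_n) F (tperm p.1 p.2 ^ u)%g = \sum_(p : 'I_n * 'I_n) F (tperm p.1 p.2).
Proof.
rewrite [RHS](reindex (fun p : 'I_n * 'I_n => (u p.1, u p.2))) /=.
  by apply: eq_bigr => p _; rewrite tpermJ.
exists (fun p => (u^-1%g p.1, u^-1%g p.2)) => -[a b] _ /=; by rewrite ?permK ?permKV.
Qed.
(** The family of transpositions is stable under conjugation, so the conjugated function solves the
    same equation and uniqueness applies. Invariance under conjugation makes E equivariant; together
    with [rsvV] it makes E symmetric in its two arguments. *)
Lemma rsv_conj m s u : rsv m (s ^ u)%g = rsv m s.
Proof.
apply: (rsv_uniq (m := m) (r := fun s => rsv m (s ^ u)%g)) => [t|]; last exact: rsvP.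
rewrite (eq_bigr (fun p : 'I_n * 'I_n => rsv m (t ^ u)%g - rsv m (t ^ u * (tperm p.1 p.2) ^ u)%g)); last by move=> p _; rewrite conjMg.
rewrite (sum_tperm_conj (fun v => rsv m (t ^ u)%g - rsv m (t ^ u * v)%g)) rsvP.
by rewrite conjg_eq1.
Qed.
Lemma rsvV m s : rsv m s^-1%g = rsv m s.
Proof.
apply: (rsv_uniq (m := m) (r := fun s => rsv m s^-1%g)) => [t|]; last exact: rsvP.
rewrite (eq_bigr (fun p : 'I_n * 'I_n => rsv m t^-1%g - rsv m (t^-1 * (tperm p.1 p.2 ^ t^-1))%g)); last first.
  by move=> p _; rewrite invMg tpermV conjgE invgK !mulgA mulVg mul1g.
rewrite (sum_tperm_conj (fun v => rsv m t^-1%g - rsv m (t^-1 * v)%g)) rsvP.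
have -> // : (t^-1 == 1)%g = (t == 1)%g.
by apply/eqP/eqP => [h|->]; [rewrite -[t]invgK h invg1|rewrite invg1].
Qed.

Local Notation V := ('rV[CC R]_n).
Definition pair_ (l z : V) : CC R := \sum_i l 0 i * z 0 i.
Lemma pair_permv s l z : pair_ (permv s l) (permv s z) = pair_ l z.
Proof.
rewrite /pair_ [RHS](reindex_inj (@perm_inj _ s)) /=.
by apply: eq_bigr => i _; rewrite !mxE.
Qed.
Lemma pairC l z : pair_ l z = pair_ z l.
Proof. by apply: eq_bigr => i _; rewrite mulrC. Qed.
Lemma pair_permvr s l z : pair_ l (permv s z) = pair_ (permv s^-1%g l) z.
Proof. by rewrite -(pair_permv s^-1%g) permvM mulVg permv1. Qed.
(* The degree-m part of the Dunkl kernel E^A(l, z). *)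
Fixpoint EF (m : nat) (l z : V) : CC R :=
  match m with
  | 0 => 1
  | m'.+1 => \sum_s RC (rsv m' s) * (pair_ l (permv s z) * EF m' l (permv s z))
  end.
Lemma EF_inv m s l z : EF m (permv s l) (permv s z) = EF m l z.
Proof.
elim: m l z => [//|m IH] l z /=.
rewrite [RHS](reindex_inj (@conjg_inj _ s)) /=; apply: eq_bigr => t _.
rewrite rsv_conj; congr (_ * _); have e : permv t (permv s z) = permv s (permv (t ^ s)%g z).
  by rewrite !permvM conjgE !mulgA mulgV mul1g.
by rewrite e pair_permv IH.
Qed.
Lemma EF_sym m l z : EF m l z = EF m z l.
Proof.
elim: m l z => [//|m IH] l z /=.
rewrite [RHS](reindex_inj invg_inj) /=; apply: eq_bigr => s _.
rewrite rsvV; congr (_ * _).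
rewrite (pair_permvr s) (pairC z); congr (_ * _).
by rewrite -(EF_inv m s z) permvM mulgV permv1 IH.
Qed.
(** The equation of [rsv m], convolved with the orbit of <l, z> f_m. The sum runs over ordered
    pairs, diagonal pairs contributing 0 and every transposition occurring twice; hence k/2. By
    Euler's identities it is the radial equation sum_i z_i T_i f_(m+1) = <l, z> f_m. *)
Lemma EF_resolvent m l z :
  m.+1%:R * EF m.+1 l z + RC (k / 2) * \sum_(p : 'I_n * 'I_n) (EF m.+1 l z - EF m.+1 l (permv (tperm p.1 p.2) z))
  = pair_ l z * EF m l z.
Proof.
pose G s := pair_ l (permv s z) * EF m l (permv s z).
have E t : EF m.+1 l (permv t z) = \sum_s RC (rsv m (s * t^-1)%g) * G s.
  rewrite /= (reindex_inj (mulIg t^-1%g)) /=; apply: eq_bigr => s _.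
  by rewrite permvM mulgKV.
have E1 : EF m.+1 l z = \sum_s RC (rsv m s) * G s by [].
rewrite (eq_bigr (fun p : 'I_n * 'I_n => \sum_s RC (rsv m s - rsv m (s * tperm p.1 p.2)%g) * G s)); last first.
  move=> p _; rewrite E E1 -sumrB; apply: eq_bigr => s _.
  by rewrite tpermV rmorphB mulrBl.
rewrite E1 mulr_sumr exchange_big /= mulr_sumr -big_split /=.
transitivity (\sum_s (s == 1%g)%:R * G s).
  apply: eq_bigr => s _; rewrite -mulr_suml; move: (G s) => g; rewrite !mulrA -mulrDl; congr (_ * _).
  have := congr1 (@RC R) (rsvP m s); rewrite rmorphD /= (rmorphM _ m.+1%:R) (rmorphM _ (k / 2)) /= !rmorph_nat rmorph_sum /=.
  exact.
rewrite (bigD1 1%g)//= eqxx mul1r big1 ?addr0 ?/G ?permv1// => s /negPf ->.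
by rewrite mul0r.
Qed.
Lemma EF_hpoly m l : hpoly m (EF m l).
Proof.
elim: m => [|m IH]; first exact: hpoly_cst.
apply: hpoly_sum => s _; apply: hpolyZ.
apply: (hpoly_permv s (f := fun z => pair_ l z * EF m l z)).
rewrite (_ : (fun z : V => _) = (fun z : V => \sum_i z 0 i * (l 0 i * EF m l z))); last first.
  by apply/funext => z; rewrite /pair_ mulr_suml; apply: eq_bigr => i _; ring.
by apply: hpoly_sum => i _; apply: hpolyX; exact: hpolyZ.
Qed.

Lemma sum_star (A : zmodType) (w : 'I_n -> 'I_n -> A) j :
  (forall a b, a != j -> b != j -> w a b = 0) -> w j j = 0 -> (forall a b, w a b = w b a) ->
  \sum_a \sum_b w a b = (\sum_(a | a != j) w j a) *+ 2.
Proof.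
move=> w0 wjj wC; rewrite (bigD1 j)//= [X in X + _](bigD1 j)//= wjj add0r mulr2n; congr (_ + _).
by apply: eq_bigr => a aj; rewrite (bigD1 j)//= wC big1 ?addr0// => b bj; exact: w0.
Qed.
(** The construction only guarantees the radial combination of these n equations. The defects u_j =
    T_j f - l_j g of the individual ones, evaluated at all permuted points, satisfy a homogeneous
    equation of the type of [laplacian_zero], and therefore vanish. The induction over degrees
    supplies the compatibility l_i T_j g = l_j T_i g. *)
Lemma dunkl_EF m i l : dunklA k i (EF m.+1 l) = fun z => l 0 i * EF m l z.
Proof.
have hf m' := EF_hpoly m' l.
suff key : forall m, (forall i j z, l 0 i * dunklA k j (EF m l) z = l 0 j * dunklA k i (EF m l) z) ->
    forall i, dunklA k i (EF m.+1 l) = fun z => l 0 i * EF m l z.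
  apply: (key m); elim: m => [|m IH] a b z.
    by have := dunkl_hpoly k a (hf 0%N); have := dunkl_hpoly k b (hf 0%N) => -[_ ->]// [_ ->]//; rewrite !mulr0.
  by rewrite !(key m IH); exact: mulrCA.
move=> {}m IH {}i; set f := EF m.+1 l; set g := EF m l.
pose u j : V -> CC R := fun z => dunklA k j f z - l 0 j * g z.
have hT j : hpoly m (dunklA k j f) by have [] := dunkl_hpoly k j (hf m.+1).
have hu j : hpoly m (u j) by apply: hpolyB => //; exact: hpolyZ.
have Df (z : V) : \sum_a z 0 a * dunklA k a f z = \sum_a z 0 a * (l 0 a * g z).
  transitivity (pair_ l z * g z); last by rewrite /pair_ mulr_suml; apply: eq_bigr => a _; ring.
  have := dunkl_euler k f z 0; under eq_bigr do rewrite subr0.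
  under [in X in _ = X -> _]eq_bigr do rewrite subr0.
  move=> ->; rewrite (hpoly_euler z (hf m.+1)) -EF_resolvent; congr (_ + _ * _).
  by rewrite pair_big.
(* T_j is applied to the radial identity [Df]. Moving it past x_a by the commutator formula and past
   T_a by commutativity, and using the compatibility of g, leaves an equation in the defects
   alone. *)
have key j (z : V) : \sum_a z 0 a * dunklA k a (u j) z + \sum_a dunkl_commX k j a (u a) z = 0.
  have e1 : dunklA k j (fun z : V => \sum_a z 0 a * dunklA k a f z) z =
     \sum_a (z 0 a * dunklA k j (dunklA k a f) z + dunkl_commX k j a (dunklA k a f) z).
    rewrite (dunkl_hpoly_sum k _ j (fun a _ => hpolyX a (hT a))).
    by apply: eq_bigr => a _; rewrite (dunkl_hpoly_mulX k _ _ (hT a)).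
  have e2 : dunklA k j (fun z : V => \sum_a z 0 a * (l 0 a * g z)) z =
     \sum_a (z 0 a * (l 0 a * dunklA k j g z) + dunkl_commX k j a (fun z => l 0 a * g z) z).
    rewrite (dunkl_hpoly_sum k _ j (fun a _ => hpolyX a (hpolyZ (l 0 a) (hf m)))).
    by apply: eq_bigr => a _; rewrite (dunkl_hpoly_mulX k _ _ (hpolyZ (l 0 a) (hf m))) (dunkl_hpolyZ k _ _ (hf m)).
  have e : dunklA k j (fun z : V => \sum_a z 0 a * dunklA k a f z) z = dunklA k j (fun z : V => \sum_a z 0 a * (l 0 a * g z)) z.
    by congr (dunklA k j _ z); apply/funext => x; exact: Df.
  move: e; rewrite e1 e2 => /eqP; rewrite -subr_eq0 -sumrB => /eqP e0; rewrite -[RHS]e0 -big_split /=.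
  apply: eq_bigr => a _.
  have du : dunklA k a (u j) z = dunklA k a (dunklA k j f) z - l 0 j * dunklA k a g z.
    rewrite (dunkl_hpolyD k a (hT j) (hpolyN (hpolyZ (l 0 j) (hf m)))) (dunkl_hpolyN k a (hpolyZ (l 0 j) (hf m))).
    by rewrite (dunkl_hpolyZ k _ _ (hf m)).
  have Cu : dunkl_commX k j a (u a) z = dunkl_commX k j a (dunklA k a f) z - dunkl_commX k j a (fun z => l 0 a * g z) z.
    rewrite /dunkl_commX /u; case: (a == j); last by ring.
    by rewrite sumrB; ring.
  rewrite du Cu (dunkl_comm k a j (hf m.+1)) -(IH a j).
  move: (dunklA k j (dunklA k a f) z) (dunklA k j g z) (dunkl_commX k j a _ z) (dunkl_commX k j a _ z) => A B C D; ring.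
have uE j z : u j z = dunklA k j f z - l 0 j * g z by [].
clearbody u.
have vlap j (z : V) : m.+1%:R * u j z + RC (k / 2) * \sum_(p : 'I_n * 'I_n) (u j z - u (tperm p.1 p.2 j) (permv (tperm p.1 p.2) z)) = 0.
  rewrite -[RHS](key j z).
  have := dunkl_euler k (u j) z 0; under eq_bigr do rewrite subr0.
  under [in X in _ = X -> _]eq_bigr do rewrite subr0.
  move=> ->; rewrite (hpoly_euler z (hu j)).
  have -> : \sum_a dunkl_commX k j a (u a) z = u j z + RC (k / 2) * \sum_(p : 'I_n * 'I_n) ((u j (permv (tperm p.1 p.2) z)) - u (tperm p.1 p.2 j) (permv (tperm p.1 p.2) z)).
    rewrite (bigD1 j)//= {1}/dunkl_commX eqxx -addrA; congr (_ + _).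
    under eq_bigr => a aj do rewrite /dunkl_commX (negPf aj).
    rewrite sumrN -mulr_sumr -mulrBr -sumrB -(pair_big xpredT xpredT (fun a b => u j (permv (tperm a b) z) - u (tperm a b j) (permv (tperm a b) z))) /=.
    pose w a b := u j (permv (tperm a b) z) - u (tperm a b j) (permv (tperm a b) z).
    have w0 a b : a != j -> b != j -> w a b = 0 by move=> aj bj; rewrite /w tpermD// subrr.
    have wjj : w j j = 0 by rewrite /w tperm1 perm1 subrr.
    have wC a b : w a b = w b a by rewrite /w tpermC.
    rewrite (sum_star w0 wjj wC).
    have -> : RC k = RC (k / 2) * 2%:R by rewrite -(rmorph_nat (@RC R)) -rmorphM /= divfK// pnatr_eq0.
    by rewrite -mulrA mulr_natl; congr (_ * (_ *+ 2)); apply: eq_bigr => a aj; rewrite /w tpermL.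
  rewrite pair_big /= -natr1 mulrDl mul1r -[LHS]addrA [RHS]addrACA -mulrDr -big_split /=.
  rewrite addrAC addrA; congr (_ + _ * _ + _) || (rewrite -!addrA; congr (_ + _); rewrite addrC; congr (_ * _ + _)).
  by apply: eq_bigr => p _; rewrite addrA subrK.
apply/funext => z.
suff /(_ (i, 1%g)) : forall q : 'I_n * 'S_n, u q.1 (permv q.2 z) = 0.
  by rewrite /= permv1 uE => /eqP; rewrite subr_eq0 => /eqP.
(* A transposition moves the index j and the evaluation point simultaneously, so the maximum
   principle is applied on the finite set of pairs of an index and a permutation. *)
apply: (@laplacian_zeroC R _ _ (fun (p : 'I_n * 'I_n) (q : 'I_n * 'S_n) => (tperm p.1 p.2 q.1, tperm p.1 p.2 * q.2)%g) m.+1%:R (k / 2)) => //.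
  exact: divr_ge0.
move=> [j s] /=; rewrite rmorph_nat -[RHS](vlap j (permv s z)); congr (_ + _ * _).
by apply: eq_bigr => p _; rewrite permvM.
Qed.
End resolvent.

(** * Series as integrals for the counting measure *)

Section csum.
Variable R : realType.
Implicit Types (u v : nat -> CC R).
Local Notation cnt := (@counting nat R).
(** Treating a series as an integral makes domination, linearity and [qr_cint] available for the
    kernel series without a separate theory. *)
Definition csummable u := cintble cnt setT u.
Definition csum u := cint cnt setT u.
Lemma cmeas_nat u : cmeas setT u. Proof. by split. Qed.
Lemma csummable_dom u (b : nat -> R) : (forall m, `|u m| <= RC (b m)) -> cvgn (series b) -> csummable u.
Proof.
move=> ub cb; apply: (@cintble_dom _ _ _ cnt setT measurableT u (fun m => RC (b m))); last by move=> m _.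
  exact: cmeas_nat.
apply: cintble_RC; apply/integrableP; split; first by [].
have b0 m : 0 <= b m by rewrite -RC_ge0; exact: le_trans (ub m).
rewrite ge0_integral_count//.
rewrite (_ : (fun _ => _) = (EFin \o (series b))); last first.
  by apply/funext => N /=; rewrite /series /= -sumEFin; apply: eq_bigr => m _; rewrite ger0_norm.
by rewrite EFin_lim// ltry.
Qed.
Lemma csum_delta c j : cintble cnt setT (fun m => if m == j then c else 0) /\ csum (fun m => if m == j then c else 0) = c.
Proof.
have E (r : R) : (fun m => (if m == j then r else 0)%:E) = (fun m => r%:E * (\1_[set j] m)%:E)%E.
  apply/funext => m; rewrite indicE; case: eqVneq => [->|mj].
    by rewrite mem_set// mule1.
  by rewrite memNset ?mule0//= => /eqP; rewrite (negPf mj).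
have c1 : cnt [set j] = 1%E.
  by rewrite /counting asboolT; [rewrite fset_set1 finmap.cardfs1|exact: finite_set1].
have i1 : cnt.-integrable setT (EFin \o (\1_[set j] : nat -> R)).
  apply/integrableP; split; first by [].
  under eq_integral do rewrite /= ger0_norm//.
  by rewrite integral_indic// setIT [X in (X < _)%E]c1 ltry.
have I (r : R) : cnt.-integrable setT (EFin \o (fun m => if m == j then r else 0)) /\ \int[cnt]_(m in setT) (if m == j then r else 0) = r.
  have e := E r; split.
    rewrite [X in cnt.-integrable _ X](_ : _ = (fun m => r%:E * (EFin \o (\1_[set j] : nat -> R)) m)%E) //.
    exact: integrableZl.
  rewrite /Rintegral (eq_integral (fun m => r%:E * (EFin \o (\1_[set j] : nat -> R)) m)%E); last by move=> m _; exact: (congr1 (@^~ m) e).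
  by rewrite integralZl// integral_indic// setIT [X in (_ * X)%E]c1 mule1.
have [iR eR] := I (cRe c); have [iI eI] := I (cIm c).
have eqR : (fun m : nat => cRe (if m == j then c else 0)) = (fun m => if m == j then cRe c else 0) by apply/funext => m; case: ifP.
have eqI : (fun m : nat => cIm (if m == j then c else 0)) = (fun m => if m == j then cIm c else 0) by apply/funext => m; case: ifP.
rewrite /cintble /csum /cint.
rewrite (_ : (cRe \o _) = (fun m => if m == j then cRe c else 0)) //.
rewrite (_ : (cIm \o _) = (fun m => if m == j then cIm c else 0)) //.
split; first by split.
apply: CCP; rewrite [LHS]/=; [rewrite -[RHS]eR|rewrite -[RHS]eI]; apply: eq_Rintegral => m _; by case: ifP.
Qed.
(** Partial sums are integrals of truncations, so this is dominated convergence. *)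
Lemma csum_partial u : csummable u ->
  (fun N => cRe (\sum_(0 <= m < N) u m)) @ \oo --> cRe (csum u) /\ (fun N => cIm (\sum_(0 <= m < N) u m)) @ \oo --> cIm (csum u).
Proof.
move=> su.
pose F (N m : nat) : CC R := if (m < N)%N then u m else 0.
have E N : csum (F N) = \sum_(0 <= m < N) u m.
  have -> : F N = fun m => \sum_(0 <= j < N) (if m == j then u j else 0).
    apply/funext => m; rewrite /F; case: ltnP => mN.
      rewrite (bigD1_seq m) ?mem_index_iota ?iota_uniq//= eqxx big1 ?addr0// => j jm.
      by rewrite eq_sym (negPf jm).
    rewrite big_nat big1// => j /andP[_ jN]; case: eqVneq => // mj; by move: mN; rewrite mj leqNgt jN.
  rewrite /csum cint_sum//; first by apply: eq_bigr => j _; have [] := csum_delta (u j) j.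
  by move=> j _; have [] := csum_delta (u j) j.
have [||||_ cR cI] := @cint_dct _ _ _ cnt setT measurableT F u (fun m => `|u m|).
- by move=> N; exact: cmeas_nat.
- exact: cintble_norm.
- by move=> N m _; rewrite /F; case: ifP => // _; rewrite normr0.
- move=> m _; split; apply: cvg_near_cst; near=> N; rewrite /F ifT//; near: N; exact: nbhs_infty_gt.
split; first by rewrite (_ : (fun N => cRe _) = (fun N => cRe (csum (F N))))//; apply/funext => N; rewrite E.
by rewrite (_ : (fun N => cIm _) = (fun N => cIm (csum (F N))))//; apply/funext => N; rewrite E.
Unshelve. all: by end_near. Qed.
Lemma CC_lim_uniq (u : nat -> CC R) a b :
  (fun n => cRe (u n)) @ \oo --> cRe a -> (fun n => cIm (u n)) @ \oo --> cIm a ->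
  (fun n => cRe (u n)) @ \oo --> cRe b -> (fun n => cIm (u n)) @ \oo --> cIm b -> a = b.
Proof.
move=> a1 a2 b1 b2; apply: CCP.
  by rewrite -(cvg_lim (@Rhausdorff R) a1) -(cvg_lim (@Rhausdorff R) b1).
by rewrite -(cvg_lim (@Rhausdorff R) a2) -(cvg_lim (@Rhausdorff R) b2).
Qed.
Lemma csum_recl u : csummable u -> csummable (fun m => u m.+1) -> csum u = u 0%N + csum (fun m => u m.+1).
Proof.
move=> su su1; have [a b] := csum_partial su; have [a1 b1] := csum_partial su1.
rewrite -cvg_shiftS in a; rewrite -cvg_shiftS in b.
have E N : \sum_(0 <= m < N.+1) u m = u 0%N + \sum_(0 <= m < N) u m.+1 by rewrite big_nat_recl.
apply: (CC_lim_uniq a b).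
  rewrite raddfD /= (_ : (fun n => _) = (fun n => cRe (u 0%N) + cRe (\sum_(0 <= m < n) u m.+1))); first by apply: cvgD => //; exact: cvg_cst.
  by apply/funext => N; rewrite E raddfD.
rewrite raddfD /= (_ : (fun n => _) = (fun n => cIm (u 0%N) + cIm (\sum_(0 <= m < n) u m.+1))); first by apply: cvgD => //; exact: cvg_cst.
by apply/funext => N; rewrite E raddfD.
Qed.
Lemma csum_ge0_term0 u : csummable u -> (forall m, 0 <= u m) -> u 0%N <= csum u.
Proof.
move=> su u0; have su1 : csummable (fun m => if m == 0%N then u 0%N else 0) by have [] := csum_delta (u 0%N) 0%N.
have [_ <-] := csum_delta (u 0%N) 0%N; apply: le_cint => //.
by move=> m _; case: eqP => [->|_].
Qed.
Lemma csum_exp (x : R) : csummable (fun m => RC (exp_coeff x m)) /\ csum (fun m => RC (exp_coeff x m)) = RC (expR x).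
Proof.
have s : csummable (fun m => RC (exp_coeff x m)).
  apply: (csummable_dom (b := exp_coeff `|x|)); last exact: is_cvg_series_exp_coeff.
  by move=> m; rewrite RC_norm /exp_coeff /= normrM normrX (ger0_norm (x := (m`!%:R)^-1)) ?invr_ge0.
split => //; have [a b] := csum_partial s.
have E N : \sum_(0 <= m < N) RC (exp_coeff x m) = RC (series (exp_coeff x) N) by rewrite /series /= rmorph_sum.
apply: (CC_lim_uniq a b).
  rewrite (_ : (fun n => _) = series (exp_coeff x)); first exact: is_cvg_series_exp_coeff.
  by apply/funext => N; rewrite E.
rewrite (_ : (fun n => _) = (fun=> 0)); first exact: cvg_cst.
by apply/funext => N; rewrite E.
Qed.
End csum.

Section qrmore.
Variable R : realType.
Section gen.
Variable V : normedModType (CC R).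
Implicit Types (f L : V -> CC R) (p h : V).
Lemma qrZ c f p L rho g : 0 <= c -> qr f p L rho g -> qr (fun v => c * f v) p (fun v => c * L v) rho (c * g).
Proof.
move=> c0 [l H]; split; first by move=> a u v; rewrite l; ring.
move=> h hr; have [a b d] := H h hr; rewrite -!mulrBr !normrM ger0_norm//; split.
- exact: ler_wpM2l.
- by rewrite mulrCA [leRHS]mulrCA ler_wpM2l.
- by rewrite mulrCA [leRHS]mulrCA ler_wpM2l.
Qed.
Lemma qr_sum I (r : seq I) (f L : I -> V -> CC R) p rho (g : I -> CC R) : 0 < rho -> (forall i, qr (f i) p (L i) rho (g i)) ->
  qr (fun v => \sum_(i <- r) f i v) p (fun v => \sum_(i <- r) L i v) rho (\sum_(i <- r) g i).
Proof.
move=> r0 H; elim: r => [|i r IH].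
  rewrite big_nil; have h := @qr_cst R V 0 p rho 0; apply: (qr_eq _ _ (h _)); rewrite ?normr0// => v; by rewrite big_nil.
rewrite big_cons; apply: (qr_eq _ _ (qrD r0 (H i) IH)) => v; by rewrite big_cons.
Qed.
(* A sharp product rule: unlike [qrM] it does not lose a constant factor. *)
Lemma qr_mul_lin P f p L rho g pL pD : 0 < rho -> clinear P -> `|P p| <= pL -> 0 <= pD -> (forall h, rho * `|P h| <= `|h| * pD) ->
  qr f p L rho g -> qr (fun v => P v * f v) p (fun h => P h * f p + P p * L h) rho ((pL + pD) * g).
Proof.
move=> r0 lP bP pD0 bP' Hf; have g0 := qr_ge0 r0 Hf; have r1 := ltW r0; case: Hf => l H.
have pL0 : 0 <= pL by apply: le_trans bP.
split; first by move=> a u v; rewrite l lP; ring.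
move=> h hr; have [a b d] := H h hr; have Ph := bP' h.
have Ph' : `|P h| <= pD by rewrite -(ler_pM2l r0); apply: le_trans Ph _; rewrite ler_wpM2r.
split.
- rewrite (clinearD lP) normrM; apply: ler_pM => //; apply: le_trans (ler_normD _ _) _; exact: lerD.
- rewrite (clinearD lP).
  have -> : (P p + P h) * f (p + h) - P p * f p = P p * (f (p + h) - f p) + P h * f (p + h) by ring.
  apply: (@le_trans _ _ (`|P p| * (rho * `|f (p + h) - f p|) + (rho * `|P h|) * `|f (p + h)|)).
    set A := `|f (p + h) - f p|.
    have -> : `|P p| * (rho * A) + rho * `|P h| * `|f (p + h)| = rho * (`|P p * (f (p + h) - f p)| + `|P h * f (p + h)|).
      by rewrite !normrM -/A; ring.
    by rewrite ler_wpM2l// ler_normD.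
  have -> : `|h| * ((pL + pD) * g) = pL * (`|h| * g) + `|h| * pD * g by ring.
  by apply: lerD; apply: ler_pM; rewrite ?mulr_ge0.
- rewrite (clinearD lP).
  have -> : (P p + P h) * f (p + h) - P p * f p - (P h * f p + P p * L h) = P p * (f (p + h) - f p - L h) + P h * (f (p + h) - f p) by ring.
  apply: (@le_trans _ _ (`|P p| * (rho ^+ 2 * `|f (p + h) - f p - L h|) + (rho * `|P h|) * (rho * `|f (p + h) - f p|))).
    set A := `|f (p + h) - f p - L h|; set B := `|f (p + h) - f p|.
    have -> : `|P p| * (rho ^+ 2 * A) + rho * `|P h| * (rho * B) = rho ^+ 2 * (`|P p * (f (p + h) - f p - L h)| + `|P h * (f (p + h) - f p)|).
      by rewrite !normrM -/A -/B; ring.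
    by rewrite ler_wpM2l ?exprn_ge0// ler_normD.
  have -> : `|h| ^+ 2 * ((pL + pD) * g) = pL * (`|h| ^+ 2 * g) + `|h| * pD * (`|h| * g) by ring.
  by apply: lerD; apply: ler_pM; rewrite ?mulr_ge0 ?exprn_ge0.
Qed.
Lemma qr_comp f p L rho g (P : V -> V) q : (forall u v, P (u + v) = P u + P v) -> (forall a u, P (a *: u) = a *: P u) ->
  (forall v, `|P v| = `|v|) -> qr f (q + P p) L rho g -> qr (fun v => f (q + P v)) p (fun v => L (P v)) rho g.
Proof.
move=> PD PZ Pn [l H]; split; first by move=> a u v; rewrite PD PZ l.
by move=> h hr; rewrite PD addrA; have := H (P h); rewrite Pn; exact.
Qed.
Lemma qr_deriveE f p L rho g : 0 < rho -> qr f p L rho g -> qr f p (fun v => 'D_v f p) rho g.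
Proof. by move=> r0 H; apply: (qr_eq _ _ H) => // v; rewrite (qr_derive v r0 H). Qed.
End gen.

Variables (n : nat) (k : R).
Hypothesis k0 : 0 <= k.
Local Notation V := ('rV[CC R]_n).
Definition vabs (z : V) : V := map_mx (fun c => `|c|) z.
Definition l1norm (z : V) : CC R := \sum_i `|z 0 i|.
Local Notation EF := (EF k0).
Implicit Types (l z h v w : V) (m : nat) (s : 'S_n).
Lemma permvS (s : 'S_n) (z : V) c : permv s (z + const_mx c) = permv s z + const_mx c.
Proof. by apply/rowP => i; rewrite !mxE. Qed.
Lemma permv_vabs (s : 'S_n) (z : V) : permv s (vabs z) = vabs (permv s z).
Proof. by apply/rowP => i; rewrite !mxE. Qed.
Lemma n1_permv s z : l1norm (permv s z) = l1norm z.
Proof. by rewrite /l1norm [RHS](reindex_inj (@perm_inj _ s)) /=; apply: eq_bigr => i _; rewrite mxE. Qed.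
Lemma n1_ge0 z : 0 <= l1norm z. Proof. by apply: sumr_ge0 => i _. Qed.
Lemma pair_le l z : `|pair_ l z| <= l1norm l * l1norm z.
Proof.
apply: le_trans (ler_norm_sum _ _ _) _; rewrite /l1norm mulr_suml; apply: ler_sum => i _.
rewrite normrM ler_wpM2l//; apply: (@ler_sum_idem _ _ _) || (rewrite (bigD1 i)//= lerDl sumr_ge0//).
Qed.
Lemma EF_le m l z : `|EF m l z| <= (l1norm l * l1norm z) ^+ m / (m`!)%:R.
Proof.
elim: m z => [|m IH] z; first by rewrite normr1 expr0 fact0 divr1.
apply: le_trans (ler_norm_sum _ _ _) _.
apply: (@le_trans _ _ (\sum_s RC (rsv k0 m s) * ((l1norm l * l1norm z) ^+ m.+1 / (m`!)%:R))).
  apply: ler_sum => s _; rewrite normrM ger0_norm ?RC_ge0 ?rsv_ge0//; apply: ler_wpM2l; first by rewrite RC_ge0 rsv_ge0.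
  rewrite normrM exprS -mulrA; apply: ler_pM => //; first by apply: le_trans (pair_le _ _) _; rewrite n1_permv.
  by apply: le_trans (IH _) _; rewrite n1_permv.
rewrite -mulr_suml -rmorph_sum /= rsv_sum RC_inv rmorph_nat factS natrM invfM mulrCA mulrA.
by rewrite -!mulrA (mulrC (_%:R)^-1 (_%:R)^-1).
Qed.
Lemma EF_le_coeff m l z : `|EF m l z| <= RC (exp_coeff (cRe (l1norm l * l1norm z)) m).
Proof.
apply: le_trans (EF_le m l z) _; rewrite /exp_coeff /= rmorphM rmorphXn /= RC_inv rmorph_nat -RC_real//.
by rewrite mulr_ge0 ?n1_ge0.
Qed.
Lemma EF_summable l z : csummable (fun m => EF m l z).
Proof. by apply: csummable_dom (is_cvg_series_exp_coeff (cRe (l1norm l * l1norm z))) => m; exact: EF_le_coeff. Qed.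

Fixpoint dEF (m : nat) (l z h : V) : CC R :=
  match m with
  | 0 => 0
  | m'.+1 => \sum_s RC (rsv k0 m' s) * (pair_ l (permv s h) * EF m' l (permv s z) + pair_ l (permv s z) * dEF m' l (permv s z) (permv s h))
  end.
Lemma clinear_pair l : clinear (pair_ l).
Proof. by move=> a u v; rewrite /pair_ mulr_sumr -big_split /=; apply: eq_bigr => i _; rewrite !mxE; ring. Qed.
(** Because the coefficients are nonnegative, the majorant is f_m itself at |l| and |z| + rho. No
    constant is lost from degree to degree, so the majorants sum to a value of the kernel and not to
    a larger function. *)
Lemma EF_qr m l z rho : 0 < rho -> qr (EF m l) z (dEF m l z) rho (EF m (vabs l) (vabs z + const_mx rho)).
Proof.
move=> r0; elim: m z => [|m IH] z; first by apply: qr_cst; rewrite normr1.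
apply: qr_sum => // s; apply: qrZ; first by rewrite RC_ge0 rsv_ge0.
have pE : pair_ (vabs l) (permv s (vabs z + const_mx rho)) = pair_ (vabs l) (permv s (vabs z)) + rho * l1norm l.
  by rewrite permvS /pair_ /l1norm mulr_sumr -big_split /=; apply: eq_bigr => i _; rewrite !mxE; ring.
rewrite pE.
have H := @qr_mul_lin _ (pair_ l) (EF m l) (permv s z) (dEF m l (permv s z)) rho (EF m (vabs l) (permv s (vabs z + const_mx rho)))
  (pair_ (vabs l) (permv s (vabs z))) (rho * l1norm l) r0 (clinear_pair l).
have := @qr_comp _ (fun v => pair_ l v * EF m l v) z (fun h => pair_ l h * EF m l (permv s z) + pair_ l (permv s z) * dEF m l (permv s z) h)
  rho ((pair_ (vabs l) (permv s (vabs z)) + rho * l1norm l) * EF m (vabs l) (permv s (vabs z + const_mx rho))) (permv s) 0 (permvD s) (permvZ s) (norm_permv s).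
rewrite add0r; move=> H'; apply: (qr_eq _ _ (H' _)) => //; first by move=> v; rewrite add0r.
apply: H.
- apply: le_trans (ler_norm_sum _ _ _) _; apply: ler_sum => i _; by rewrite normrM !mxE.
- by rewrite mulr_ge0 ?n1_ge0 ?ltW.
- move=> h; rewrite mulrCA ler_pM2l//; apply: le_trans (ler_norm_sum _ _ _) _; rewrite mulrC /l1norm mulr_suml.
  by apply: ler_sum => i _; rewrite normrM ler_wpM2l// coord_le_norm.
- by rewrite permvS permv_vabs; exact: IH.
Qed.
Lemma EF_ge0 m l z : (forall i, 0 <= l 0 i) -> (forall i, 0 <= z 0 i) -> 0 <= EF m l z.
Proof.
move=> l0; elim: m z => [//|m IH] z z0 /=; apply: sumr_ge0 => s _; rewrite !mulr_ge0 ?RC_ge0 ?rsv_ge0//.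
  by apply: sumr_ge0 => i _; rewrite mulr_ge0// mxE.
by apply: IH => i; rewrite mxE.
Qed.
Lemma EF_maj m l z l' z' : (forall i, `|l 0 i| <= l' 0 i) -> (forall i, `|z 0 i| <= z' 0 i) -> `|EF m l z| <= EF m l' z'.
Proof.
move=> ll; elim: m z z' => [|m IH] z z' zz /=; first by rewrite normr1.
apply: le_trans (ler_norm_sum _ _ _) _; apply: ler_sum => s _; rewrite normrM ger0_norm ?RC_ge0 ?rsv_ge0//.
apply: ler_wpM2l; first by rewrite RC_ge0 rsv_ge0.
rewrite normrM; apply: ler_pM => //; last by apply: IH => i; rewrite !mxE.
by apply: le_trans (ler_norm_sum _ _ _) _; apply: ler_sum => i _; rewrite normrM !mxE; apply: ler_pM.
Qed.
Lemma EF_hom m l z : EF m (- l) (- z) = EF m l z.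
Proof.
elim: m z => [//|m IH] z /=; apply: eq_bigr => s _; congr (_ * _).
have -> : permv s (- z) = - permv s z by apply/rowP => i; rewrite !mxE.
by rewrite IH; congr (_ * _); apply: eq_bigr => i _; rewrite !mxE; ring.
Qed.
(** Constant vectors are fixed by all permutations, so only the total mass of [rsv m] enters, and
    E(l, c 1) is the exponential series. *)
Lemma EF_const m l c : EF m l (const_mx c) = (c * \sum_i l 0 i) ^+ m / (m`!)%:R.
Proof.
elim: m => [|m IH] /=; first by rewrite expr0 fact0 divr1.
have e s : permv s (const_mx c : V) = const_mx c by apply/rowP => i; rewrite !mxE.
under eq_bigr do rewrite e IH.
rewrite -mulr_suml -rmorph_sum /= rsv_sum RC_inv rmorph_nat.
have -> : pair_ l (const_mx c) = c * \sum_i l 0 i by rewrite /pair_ mulr_sumr; apply: eq_bigr => i _; rewrite mxE mulrC.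
by rewrite factS natrM invfM exprS; ring.
Qed.
End qrmore.

Section dunkl_cint.
Context d (T : measurableType d) (R : realType).
Variable mu : {measure set T -> \bar R}.
Variable D : set T.
Hypothesis mD : measurable D.
Variables (n : nat) (k : R).
Local Notation V := ('rV[CC R]_n).
Lemma dunkl_form_cint (L : T -> V -> CC R) i (z : V) (v0 : T -> CC R) (v : T -> 'I_n -> CC R) :
  (forall h, cintble mu D (fun x => L x h)) -> cintble mu D v0 -> (forall j, cintble mu D (fun x => v x j)) ->
  cint mu D (fun x => dunkl_form k (L x) i z (v0 x) (v x)) =
  dunkl_form k (fun h => cint mu D (fun x => L x h)) i z (cint mu D v0) (fun j => cint mu D (fun x => v x j)).
Proof.
move=> iL i0 iv; rewrite /dunkl_form.
have iq j : cintble mu D (fun x => if z 0 i == z 0 j then L x (evec i) - L x (evec j) else (v0 x - v x j) / (z 0 i - z 0 j)).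
  case: (z 0 i == z 0 j); first exact: cintbleB.
  apply: eq_cintble (cintbleZ mD (z 0 i - z 0 j)^-1 (cintbleB mD i0 (iv j))) => // x _; exact: mulrC.
rewrite cintD//; last by apply: cintbleZ => //; apply: cintble_sum.
rewrite cintZ//; last exact: cintble_sum.
rewrite cint_sum//; congr (_ + _ * _); apply: eq_bigr => j _.
case: ifP => _; first by rewrite cintB.
rewrite [RHS]mulrC -cintB// -cintZ//; last exact: cintbleB.
by apply: eq_cint => x _; rewrite mulrC.
Qed.
End dunkl_cint.

Section EE.
Variables (R : realType) (n : nat) (k : R).
Hypothesis k0 : 0 <= k.
Local Notation V := ('rV[CC R]_n).
Implicit Types (l z h v w : V) (s : 'S_n).
Local Notation EF := (EF k0).
Definition EE l z : CC R := csum (fun m => EF m l z).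
Lemma EE_qr l z rho : 0 < rho -> qr (EE l) z (fun h => csum (fun m => dEF k0 m l z h)) rho (EE (vabs l) (vabs z + const_mx rho)) /\
  forall h, csummable (fun m => dEF k0 m l z h).
Proof.
move=> r0; apply: (@qr_cint _ _ R (@counting nat R) setT measurableT _ (fun m => EF m l) (fun m => dEF k0 m l z)) => //.
- exact: EF_summable.
- by move=> m _; exact: EF_qr.
Qed.
Lemma EE_cder l z : cder (EE l) z (fun h => csum (fun m => dEF k0 m l z h)).
Proof. exact: qr_cder ltr01 (EE_qr l z ltr01).1. Qed.
Lemma EE_dunkl l i z : dunklA k i (EE l) z = l 0 i * EE l z.
Proof.
rewrite (dunklA_cder k i (EE_cder l z)).
rewrite -(dunkl_form_cint measurableT k i z (EE_qr l z ltr01).2 (EF_summable k0 l z) (fun j => EF_summable k0 l (swapv i j z))).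
have E m : dunkl_form k (dEF k0 m l z) i z (EF m l z) (fun j => EF m l (swapv i j z)) = dunklA k i (EF m l) z.
  by rewrite (dunklA_cder k i (qr_cder ltr01 (EF_qr k0 m l z ltr01))).
have E' m : dunklA k i (EF m.+1 l) z = l 0 i * EF m l z by rewrite dunkl_EF.
have s1 : csummable (fun m => dunklA k i (EF m.+1 l) z).
  by rewrite (_ : (fun m => _) = (fun m => l 0 i * EF m l z)); [apply: cintbleZ => //; exact: EF_summable|apply/funext].
have E0 : dunklA k i (EF 0 l) z = 0 by exact: dunkl_cst.
(* Summability of the T_i f_m is read off the shifted sequence, where T_i f_(m+1) = l_i f_m is
   dominated by an exponential series. *)
have s : csummable (fun m => dunklA k i (EF m l) z).
  apply: (csummable_dom (b := fun m => cRe `|dunklA k i (EF m l) z|)).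
    by move=> m; rewrite -RC_real.
  apply/cvg_ex; pose b (m : nat) := cRe (`|l 0 i|) * exp_coeff (cRe (l1norm l * l1norm z)) m.
  have cb : cvgn (series b) by apply: is_cvg_seriesZ; exact: is_cvg_series_exp_coeff.
  suff : cvgn (series (fun m => cRe `|dunklA k i (EF m l) z|)) by move/cvg_ex.
  rewrite -(is_cvg_series_restrict 1).
  have -> : (fun n0 => \sum_(1 <= k0 < n0) cRe `|dunklA k i (EF k0 l) z|) = (fun n0 => series (fun m => cRe `|dunklA k i (EF m.+1 l) z|) n0.-1).
    apply/funext => -[|N]; first by rewrite /series /= !big_geq.
    by rewrite /series /= big_add1.
  apply/cvg_ex; have : cvgn (series (fun m => cRe `|dunklA k i (EF m.+1 l) z|)).
    apply: series_le_cvg cb => m; rewrite ?cRe_ge0// /b ?E'.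
      by rewrite mulr_ge0 ?cRe_ge0// /exp_coeff /= mulr_ge0 ?invr_ge0// exprn_ge0// cRe_ge0// mulr_ge0 ?n1_ge0.
    have -> : cRe `|l 0 i * EF m l z| = cRe `|l 0 i| * cRe `|EF m l z| by rewrite normrM (RC_real (normr_ge0 (l 0 i))) (RC_real (normr_ge0 (EF m l z))) -rmorphM.
    rewrite ler_wpM2l ?cRe_ge0// -[leRHS]cReRC; apply: cRe_le; exact: EF_le_coeff.
  move=> /cvg_ex [a ca]; exists a; rewrite -cvg_shiftS /=; exact: ca.
transitivity (csum (fun m => dunklA k i (EF m l) z)); first by apply: eq_cint => m _; rewrite E.
rewrite (csum_recl s s1) E0 add0r /EE /csum -cintZ//; last exact: EF_summable.
by apply: eq_cint => m _; rewrite E'.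
Qed.
Lemma EE_sym l z : EE l z = EE z l.
Proof. by apply: eq_cint => m _; rewrite EF_sym. Qed.
Lemma EE_inv s l z : EE (permv s l) (permv s z) = EE l z.
Proof. by apply: eq_cint => m _; rewrite EF_inv. Qed.
Lemma EE_hom l z : EE (- l) (- z) = EE l z.
Proof. by apply: eq_cint => m _; rewrite EF_hom. Qed.
Lemma EE_0 l : EE l 0 = 1.
Proof.
rewrite /EE (_ : (fun m => EF m l 0) = (fun m => if m == 0%N then 1 else 0)).
  by have [_ ->] := csum_delta (1 : CC R) 0%N.
apply/funext => m; rewrite (_ : 0 = const_mx 0); last by apply/rowP => i; rewrite !mxE.
by rewrite EF_const mul0r expr0n; case: m => [|m] /=; rewrite ?fact0 ?divr1 ?mul0r.
Qed.
Lemma EE_is l : is_EA k l (EE l).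
Proof.
split; first by move=> z; have [] := cder_diff (EE_cder l z).
by split; [exact: EE_dunkl|exact: EE_0].
Qed.
Lemma EE_ge1 l z : (forall i, 0 <= l 0 i) -> (forall i, 0 <= z 0 i) -> 1 <= EE l z.
Proof.
move=> l0 z0; apply: (csum_ge0_term0 (u := fun m => EF m l z)); first exact: EF_summable.
by move=> m; exact: EF_ge0.
Qed.
Lemma EE_maj l z l' z' : (forall i, `|l 0 i| <= l' 0 i) -> (forall i, `|z 0 i| <= z' 0 i) -> `|EE l z| <= EE l' z'.
Proof.
move=> ll zz; have s := EF_summable k0 l z.
apply: le_trans (norm_cint measurableT s) _; apply: le_cint => //; [exact: cintble_norm|exact: EF_summable|].
by move=> m _; exact: EF_maj.
Qed.
Lemma EE_const (l : 'rV[R]_n) c : EE (rv2C l) (const_mx (RC c)) = RC (expR (c * \sum_i l 0 i)).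
Proof.
have [_ <-] := csum_exp (c * \sum_i l 0 i); apply: eq_cint => m _.
rewrite EF_const /exp_coeff /= rmorphM rmorphXn rmorphM fmorphV /= rmorph_nat rmorph_sum /=.
by congr ((_ * _) ^+ _ / _); apply: eq_bigr => i _; rewrite mxE.
Qed.

Lemma is_derive_near (F : R -> R) (t0 l : R) :
  (forall e : R, 0 < e -> \forall u \near 0^', `|l - u^-1 * (F (u + t0) - F t0)| <= e) -> is_derive t0 1 F l.
Proof.
move=> H; have E : (fun u : R => u^-1 *: (F (u *: 1 + t0) - F t0)) @ 0^' --> l.
  apply/cvgrPdist_le => e e0; near=> u; rewrite [u *: 1]mulr1; near: u; exact: H.
apply: DeriveDef; first by apply/cvg_ex; exists l; exact: E.
by apply: cvg_lim => //; exact: E.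
Unshelve. all: by end_near. Qed.
Lemma cder_real (f L : V -> CC R) (p h : V) (t0 : R) (q : {additive CC R -> R}) : (forall c : CC R, `|q c| <= cmod c) ->
  (forall (r : R) (c : CC R), q (RC r * c) = r * q c) ->
  cder f (p + RC t0 *: h) L -> is_derive t0 1 (fun t : R => q (f (p + RC t *: h))) (q (L h)).
Proof.
move=> qle qZ [lL _ H]; apply: is_derive_near => e e0.
have N1 : 0 < cRe `|h| + 1 by rewrite ltr_wpDl// cRe_ge0.
have [del d0 Hd] := H (RC (e / (cRe `|h| + 1))) ltac:(by rewrite RC_gt0 divr_gt0).
have dr : 0 < cRe del by move: d0; rewrite CC_lt => /andP[].
have dE : del = RC (cRe del) by apply: RC_real; exact: ltW.
near=> u.
have u0 : u != 0 by near: u; exact: nbhs_dnbhs_neq.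
have ud : `|u| <= cRe del / (cRe `|h| + 1).
  near: u; apply: dnbhs0_le; exact: divr_gt0.
have hu : `|RC u *: h| <= del.
  rewrite normrZ RC_norm (RC_real (normr_ge0 h)) -rmorphM dE RC_le /=.
  apply: le_trans (_ : `|u| * (cRe `|h| + 1) <= _); first by rewrite ler_wpM2l// lerDl.
  by rewrite -ler_pdivlMr.
have := Hd _ hu; set z0 := p + RC t0 *: h.
have -> : z0 + RC u *: h = p + RC (u + t0) *: h by rewrite /z0 rmorphD scalerDl -addrA (addrC (RC u *: h)).
rewrite (clinearZ lL) normrZ RC_norm => Hu.
have alg (A B C : R) : C - u^-1 * (A - B) = - (u^-1 * (A - B - u * C)) by rewrite [u^-1 * (A - B - _)]mulrBr mulKf// opprB.
have qB x y : q (x - y) = q x - q y := raddfB q x y.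
rewrite alg -qZ -!qB normrN normrM normfV ler_pdivrMl ?normr_gt0//.
apply: le_trans (qle _) _; rewrite -RC_le -CC_norm; apply: le_trans Hu _.
rewrite (RC_real (normr_ge0 h)) -!rmorphM RC_le /= mulrC -mulrA ler_wpM2l// mulrC mulrAC ler_pdivrMr//.
by rewrite ler_wpM2l ?(ltW e0)// lerDl.
Unshelve. all: by end_near. Qed.

(** Left multiplication by a transposition is an involution; averaging the sum with its reindexed
    copy gives a sum of squares. *)
Lemma sum_dirichlet (U : 'S_n -> R) :
  0 <= \sum_s \sum_(p : 'I_n * 'I_n) U s * (U s - U (tperm p.1 p.2 * s)%g).
Proof.
rewrite exchange_big /=; apply: sumr_ge0 => p _.
set t := tperm p.1 p.2.
have E : \sum_s U s * (U s - U (t * s)%g) = \sum_s U (t * s)%g * (U (t * s)%g - U s).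
  rewrite [RHS](reindex_inj (mulgI t)) /=; apply: eq_bigr => s _.
  by rewrite mulgA tperm2 mul1g.
have : 0 <= \sum_s U s * (U s - U (t * s)%g) + \sum_s U s * (U s - U (t * s)%g).
  rewrite {2}E -big_split /=; apply: sumr_ge0 => s _.
  have -> : U s * (U s - U (t * s)%g) + U (t * s)%g * (U (t * s)%g - U s) = (U s - U (t * s)%g) ^+ 2 by ring.
  exact: sqr_ge0.
by rewrite -mulr2n pmulrn_lge0.
Qed.

(** At P_s(t) = c 1 + t s.h, Euler's identity for the T_i, centred at c, reads t D = t <l, s.h>
    f(P_s) - (k/2) sum_p (f(P_s) - f(P_ps)), with D the derivative of t |-> f(P_s(t)). For H = sum_s
    |f(P_s)|^2 the reflection terms contribute minus a Dirichlet form, so H' <= 2 C H with C = |l|_1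
    |h|_1, and H(0) = 0. The equations are required only on the orbit of the open segment, which
    suits functions defined on a half-space. *)
Lemma dunkl_gronwall (f : V -> CC R) l (c : CC R) h :
  (forall (t : R) s, 0 <= t <= 1 -> differentiable f (const_mx c + RC t *: permv s h)) ->
  (forall (t : R) s i, 0 < t < 1 -> dunklA k i f (const_mx c + RC t *: permv s h) = l 0 i * f (const_mx c + RC t *: permv s h)) ->
  f (const_mx c) = 0 -> f (const_mx c + h) = 0.
Proof.
move=> df Tf f0.
pose P s (t : R) : V := const_mx c + RC t *: permv s h.
pose a s (t : R) := cRe (f (P s t)); pose b s (t : R) := cIm (f (P s t)).
pose Dv s t := 'D_(permv s h) f (P s t).
have qRe (r : R) (z : CC R) : cRe (RC r * z) = r * cRe z by rewrite cReM cReRC cImRC mul0r subr0.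
have qIm (r : R) (z : CC R) : cIm (RC r * z) = r * cIm z by rewrite cImM cReRC cImRC mul0r addr0.
have addRe (x y : CC R) : cRe (x + y) = cRe x + cRe y by exact: raddfD.
have addIm (x y : CC R) : cIm (x + y) = cIm x + cIm y by exact: raddfD.
have sumRe (F : 'I_n * 'I_n -> CC R) : cRe (\sum_p F p) = \sum_p cRe (F p) by exact: raddf_sum.
have sumIm (F : 'I_n * 'I_n -> CC R) : cIm (\sum_p F p) = \sum_p cIm (F p) by exact: raddf_sum.
have da s (t : R) : 0 <= t <= 1 -> is_derive t 1 (a s) (cRe (Dv s t)).
  move=> ht; apply: (@cder_real f _ (const_mx c) (permv s h) t cRe) => //; first exact: cRe_le_norm.
  exact: diff_cder (df t s ht).
have db s (t : R) : 0 <= t <= 1 -> is_derive t 1 (b s) (cIm (Dv s t)).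
  move=> ht; apply: (@cder_real f _ (const_mx c) (permv s h) t cIm) => //; first exact: cIm_le_norm.
  exact: diff_cder (df t s ht).
pose H (t : R) := \sum_s (a s t ^+ 2 + b s t ^+ 2).
pose H' (t : R) := \sum_s (2 * a s t * cRe (Dv s t) + 2 * b s t * cIm (Dv s t)).
have dH (t : R) : 0 <= t <= 1 -> is_derive t 1 H (H' t).
  move=> ht; have ds s : is_derive t 1 (fun t => a s t ^+ 2 + b s t ^+ 2) (2 * a s t * cRe (Dv s t) + 2 * b s t * cIm (Dv s t)).
    have h1 := da s t ht; have h2 := db s t ht.
    rewrite (_ : (fun t => _) = a s ^+ 2 + b s ^+ 2); last first.
      by apply/funext => u; rewrite !expr2.
    apply: (is_derive_eq (is_deriveD (is_deriveX 2 h1) (is_deriveX 2 h2))); rewrite /GRing.scale [2.-1]/= !expr1; move: (cRe (Dv s t)) (cIm (Dv s t)) (a s t) (b s t) => A B C D /=; ring.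
  rewrite /H /H'; have := @is_derive_sum _ _ _ #|'S_n| (fun i t => a (enum_val i) t ^+ 2 + b (enum_val i) t ^+ 2) t 1 _ (fun i => ds (enum_val i)).
  rewrite (_ : (\sum_i (fun t => _)) = (fun t => \sum_s (a s t ^+ 2 + b s t ^+ 2))).
    by rewrite (_ : \sum_(i < #|'S_n|) _ = \sum_s (2 * a s t * cRe (Dv s t) + 2 * b s t * cIm (Dv s t)))//; rewrite [RHS](reindex _ (onW_bij _ (enum_val_bij 'S_n))).
  by apply/funext => u; rewrite fct_sumE [RHS](reindex _ (onW_bij _ (enum_val_bij 'S_n))).
pose C : R := cRe (l1norm l * l1norm h).
have C0 : 0 <= C by rewrite cRe_ge0// mulr_ge0 ?n1_ge0.
have H0 t : 0 <= H t by apply: sumr_ge0 => s _; rewrite addr_ge0 ?sqr_ge0.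
have key t : 0 < t < 1 -> H' t <= 2 * C * H t.
  move=> ht; have /andP[t0 _] := ht.
  have eq s : RC t * Dv s t + RC (k / 2) * \sum_(p : 'I_n * 'I_n) (f (P s t) - f (P (tperm p.1 p.2 * s)%g t)) = RC t * pair_ l (permv s h) * f (P s t).
    have := dunkl_euler k f (P s t) c.
    have -> : \sum_i (P s t 0 i - c) * dunklA k i f (P s t) = RC t * pair_ l (permv s h) * f (P s t).
      rewrite /pair_ mulr_sumr mulr_suml; apply: eq_bigr => i _; rewrite Tf//.
      by rewrite /P !mxE -/(P s t) addrAC subrr add0r -/(P s t); move: (f _) (l 0 i) (h 0 (s i)) (RC t) => A B C0' D; ring.
    move=> ->; congr (_ + _ * _).
      have [lD _ _] := diff_cder (df t s ltac:(by case/andP: ht => /ltW -> /ltW ->)).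
      rewrite /Dv [permv s h in LHS]row_sum_delta.
      have sumD (r : seq 'I_n) (F : 'I_n -> V) : 'D_(\sum_(i <- r) F i) f (P s t) = \sum_(i <- r) 'D_(F i) f (P s t).
        elim: r => [|i r IH]; first by rewrite !big_nil (clinear0 lD).
        by rewrite !big_cons (clinearD lD) IH.
      rewrite sumD mulr_sumr; apply: eq_bigr => i _; rewrite (clinearZ lD) mulrA; congr (_ * _).
      by rewrite /P !mxE addrAC subrr add0r.
    rewrite pair_big /=; apply: eq_bigr => p _; congr (_ - f _).
    apply/rowP => i; by rewrite !mxE permM.
  (* The imaginary part of <l, s.h> rotates f(P_s) and cancels between the real and the imaginary
     equation; what remains is the growth rate Re <l, s.h> and two Dirichlet forms. *)
  have tH : t * H' t = \sum_s 2 * t * cRe (pair_ l (permv s h)) * (a s t ^+ 2 + b s t ^+ 2)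
    - k * (\sum_s \sum_(p : 'I_n * 'I_n) a s t * (a s t - a (tperm p.1 p.2 * s)%g t) + \sum_s \sum_(p : 'I_n * 'I_n) b s t * (b s t - b (tperm p.1 p.2 * s)%g t)).
    rewrite /H' mulr_sumr -big_split /= mulr_sumr -sumrB; apply: eq_bigr => s _.
    have eR := congr1 cRe (eq s); have eI := congr1 cIm (eq s).
    rewrite addRe !qRe sumRe -[X in _ = cRe X]mulrA qRe cReM in eR.
    rewrite addIm !qIm sumIm -[X in _ = cIm X]mulrA qIm cImM in eI.
    have sR : \sum_(p : 'I_n * 'I_n) cRe (f (P s t) - f (P (tperm p.1 p.2 * s)%g t)) = \sum_(p : 'I_n * 'I_n) (a s t - a (tperm p.1 p.2 * s)%g t).
      by apply: eq_bigr => p _; rewrite raddfB.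
    have sI : \sum_(p : 'I_n * 'I_n) cIm (f (P s t) - f (P (tperm p.1 p.2 * s)%g t)) = \sum_(p : 'I_n * 'I_n) (b s t - b (tperm p.1 p.2 * s)%g t).
      by apply: eq_bigr => p _; rewrite raddfB.
    rewrite -!mulr_sumr; rewrite sR -/(a s t) -/(b s t) in eR; rewrite sI -/(a s t) -/(b s t) in eI.
    set SR := \sum_p (a s t - _) in eR *; set SI := \sum_p (b s t - _) in eI *.
    have eR' : t * cRe (Dv s t) = t * (cRe (pair_ l (permv s h)) * a s t - cIm (pair_ l (permv s h)) * b s t) - k / 2 * SR by rewrite -eR addrK.
    have eI' : t * cIm (Dv s t) = t * (cRe (pair_ l (permv s h)) * b s t + cIm (pair_ l (permv s h)) * a s t) - k / 2 * SI by rewrite -eI addrK.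
    have -> : t * (2 * a s t * cRe (Dv s t) + 2 * b s t * cIm (Dv s t)) = 2 * a s t * (t * cRe (Dv s t)) + 2 * b s t * (t * cIm (Dv s t)) by ring.
    by rewrite eR' eI'; field.
  rewrite -(ler_pM2l t0) tH.
  apply: (@le_trans _ _ (\sum_s 2 * t * cRe (pair_ l (permv s h)) * (a s t ^+ 2 + b s t ^+ 2))).
    by rewrite gerBl mulr_ge0// addr_ge0// sum_dirichlet.
  rewrite /H !mulr_sumr; apply: ler_sum => s _.
  rewrite (mulrA t) ler_wpM2r ?addr_ge0 ?sqr_ge0// -mulrA (mulrCA t) ler_wpM2l// ler_wpM2l ?(ltW t0)//.
  apply: le_trans (ler_norm _) _; apply: le_trans (cRe_le_norm _) _.
  rewrite -RC_le -CC_norm /C -RC_real ?mulr_ge0 ?n1_ge0//.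
  by apply: le_trans (pair_le _ _) _; rewrite n1_permv.
pose G (t : R) := expR (- (2 * C * t)) * H t.
have dG (t : R) : 0 <= t <= 1 -> is_derive t 1 G (expR (- (2 * C * t)) * (H' t - 2 * C * H t)).
  move=> ht; have h1 := dH t ht.
  apply: is_derive_eq; rewrite /GRing.scale /=; ring.
have cG : {within `[0, 1]%classic, continuous G}.
  apply: derivable_within_continuous => t; rewrite in_itv /= => ht; exact: (@ex_derive _ _ _ _ _ _ _ (dG t ht)).
have [t tI e] := @MVT R G (fun t => expR (- (2 * C * t)) * (H' t - 2 * C * H t)) 0 1 ltr01
  (fun t ht => dG t ltac:(by move: ht; rewrite in_itv/= => /andP[/ltW -> /ltW ->])) cG.
have G0 : G 0 = 0.
  rewrite /G /H big1 ?mulr0// => s _; rewrite /a /b /P (rmorph0 (@RC R)) scale0r addr0 f0.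
  by rewrite -[cRe 0]/(0 : R) -[cIm 0]/(0 : R) expr0n addr0.
have G1 : G 1 <= 0.
  move: e; rewrite G0 !subr0 mulr1 => ->; rewrite pmulr_rle0 ?expR_gt0// subr_le0; apply: key.
  by move: tI; rewrite in_itv.
have H1 : H 1 = 0.
  by apply/eqP; rewrite eq_le H0 andbT; move: G1; rewrite /G pmulr_rle0 ?expR_gt0.
have /eqP := H1; rewrite psumr_eq0; last by move=> s _; rewrite addr_ge0 ?sqr_ge0.
move=> /allP /(_ 1%g); rewrite mem_index_enum => /(_ isT); rewrite paddr_eq0 ?sqr_ge0// !sqrf_eq0 => /andP[/eqP a1 /eqP b1].
by move: a1 b1; rewrite /a /b /P permv1 (rmorph1 (@RC R)) scale1r => a1 b1; apply: CCP; rewrite ?a1 ?b1.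
Qed.
Lemma is_EA_uniq l f g : is_EA k l f -> is_EA k l g -> f = g.
Proof.
move=> [df [Tf f0]] [dg [Tg g0]]; apply/funext => z.
have E x : cder (fun x => f x + -1 * g x) x (fun v => 'D_v f x + -1 * 'D_v g x).
  by apply: cderD; [exact: diff_cder|apply: cderZ; exact: diff_cder].
have := @dunkl_gronwall (fun x => f x + -1 * g x) l 0 z.
rewrite (_ : const_mx 0 = 0); last by apply/rowP => i; rewrite !mxE.
rewrite !add0r => h; apply/eqP; rewrite -subr_eq0 -mulN1r; apply/eqP; apply: h.
- by move=> t s _; have [] := cder_diff (E (0 + RC t *: permv s z)).
- move=> t s i _; rewrite (dunklD k i (diff_cder (df _)) (cderZ (-1) (diff_cder (dg _)))) (dunklZ k _ i (diff_cder (dg _))) Tf Tg.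
  ring.
- by rewrite f0 g0 mulr1 subrr.
Qed.
(** [get] selects some solution of the defining problem; uniqueness identifies it with the
    series. *)
Lemma EA_EE l : EA k l = EE l.
Proof. by apply: (is_EA_uniq (l := l)); [apply: (@getPex _ [set f | is_EA k l f]); exists (EE l); exact: EE_is|exact: EE_is]. Qed.
Lemma dunkl_shift f i z (c : CC R) L : cder f (z + const_mx c) L -> dunklA k i (fun v => f (v + const_mx c)) z = dunklA k i f (z + const_mx c).
Proof.
move=> H; rewrite (dunklA_cder k i (cder_shift H)) (dunklA_cder k i H) /dunkl_form; congr (_ + _ * _).
apply: eq_bigr => j _; rewrite !mxE (inj_eq (addIr c)).
have -> : swapv i j (z + const_mx c) = swapv i j z + const_mx c by apply/rowP => m; rewrite !mxE.
by congr (if _ then _ else _ / _); rewrite opprD addrACA subrr addr0.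
Qed.
(** T_i commutes with translations along the diagonal, so the translated kernel, normalised to be 1
    at the origin, solves the same defining problem. *)
Lemma EE_shift (l : 'rV[R]_n) z c : EE (rv2C l) (z + const_mx (RC c)) = RC (expR (c * \sum_i l 0 i)) * EE (rv2C l) z.
Proof.
set e := RC (expR _); have e0 : e != 0 by rewrite gt_eqF// /e RC_gt0 expR_gt0.
suff E : EE (rv2C l) = fun z => e^-1 * EE (rv2C l) (z + const_mx (RC c)) by rewrite [in RHS]E mulVKf.
apply: (is_EA_uniq (l := rv2C l)); first exact: EE_is.
split; [|split].
- by move=> x; have [] := cder_diff (cderZ e^-1 (cder_shift (EE_cder (rv2C l) (x + const_mx (RC c))))).
- move=> i x; rewrite (dunklZ k _ i (cder_shift (EE_cder (rv2C l) (x + const_mx (RC c))))) (dunkl_shift i (EE_cder _ _)) EE_dunkl; ring.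
- by rewrite add0r EE_const mulVf.
Qed.
End EE.

Section cadd.
Variable R : realType.
Implicit Types z w : CC R.
Lemma cReD z w : cRe (z + w) = cRe z + cRe w. Proof. exact: raddfD. Qed.
Lemma cImD z w : cIm (z + w) = cIm z + cIm w. Proof. exact: raddfD. Qed.
Lemma cReB z w : cRe (z - w) = cRe z - cRe w. Proof. exact: raddfB. Qed.
Lemma cImB z w : cIm (z - w) = cIm z - cIm w. Proof. exact: raddfB. Qed.
Lemma cReN z : cRe (- z) = - cRe z. Proof. exact: raddfN. Qed.
Variables x y : R.
Lemma RCM : RC (x * y) = RC x * RC y. Proof. exact: rmorphM. Qed.
Lemma RCD : RC (x + y) = RC x + RC y. Proof. exact: rmorphD. Qed.
Lemma RCB : RC (x - y) = RC x - RC y. Proof. exact: rmorphB. Qed.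
Lemma RCN : RC (- x) = - RC x. Proof. exact: rmorphN. Qed.
Lemma RC1 : RC (1 : R) = 1. Proof. by []. Qed.
Lemma RC0 : RC (0 : R) = 0. Proof. by []. Qed.
End cadd.
(** * Exponential bounds for the kernel *)
Section negexp.
Variables (R : realType) (n : nat) (k : R).
Hypothesis k0 : 0 <= k.
Local Notation V := ('rV[CC R]_n).
Local Notation EE := (EE k0).
Implicit Types (z w : V) (x y t c : 'rV[R]_n).
Definition vsum (x : 'rV[R]_n) : R := \sum_i x 0 i.
Definition vge0 (x : 'rV[R]_n) : Prop := forall i, 0 <= x 0 i.

Lemma vsum_ge0 x : vge0 x -> 0 <= vsum x.
Proof. by move=> x0; apply: sumr_ge0. Qed.
Lemma rv2C_coord x i : rv2C x 0 i = RC (x 0 i). Proof. by rewrite mxE. Qed.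
Lemma rv2CB x y : rv2C (x - y) = rv2C x - rv2C y.
Proof. by apply/rowP => i; rewrite !mxE rmorphB. Qed.
Lemma rv2C_const (a : R) : rv2C (const_mx a : 'rV[R]_n) = const_mx (RC a).
Proof. by apply/rowP => i; rewrite !mxE. Qed.

(* The shift reduces the exponentially decaying kernel to the power series with nonnegative coefficients. *)
Lemma EE_neg_shift x z d : EE (- rv2C x) z = RC (expR (- (d * vsum x))) * EE (rv2C x) (const_mx (RC d) - z).
Proof.
rewrite -EE_hom opprK addrC EE_shift mulrA -rmorphM /= -expRD -/(vsum x) addNr expR0.
by rewrite [RC 1]rmorph1 mul1r.
Qed.
(** Squared, |d - w_i| <= d - c_i becomes (|w_i|^2 - c_i^2) / (2 (Re w_i - c_i)) <= d, which holds
    for d large. A sum over all coordinates provides one d for all of them. *)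
Lemma choose_shift w c : (forall i, c 0 i < cRe (w 0 i)) ->
  exists d, forall i, `|RC d - w 0 i| <= RC (d - c 0 i).
Proof.
move=> cw.
pose q i := `|c 0 i| + `|(cRe (w 0 i) ^+ 2 + cIm (w 0 i) ^+ 2 - c 0 i ^+ 2) / (2 * (cRe (w 0 i) - c 0 i))|.
exists (\sum_i q i) => i; set d := \sum_i _.
have qd : q i <= d by rewrite /d (bigD1 i)//= lerDl sumr_ge0// => j _; rewrite addr_ge0.
have h := cw i; move: qd; rewrite /q.
set a := cRe _ in h *; set b := cIm _; set e := c 0 i in h * => qd.
have ed : e <= d by apply: le_trans (ler_norm e) _; apply: le_trans qd; rewrite lerDl.
have qd' : (a ^+ 2 + b ^+ 2 - e ^+ 2) / (2 * (a - e)) <= d.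
  apply: le_trans (ler_norm _) _; apply: le_trans qd; by rewrite lerDr.
rewrite CC_norm RC_le /cmod.
rewrite cReB cImB cReRC cImRC sub0r -/a -/b.
rewrite -(ler_pXn2r (ltn0Sn 1)) ?nnegrE ?sqrtr_ge0 ?subr_ge0// sqr_sqrtr ?addr_ge0 ?sqr_ge0//.
rewrite ler_pdivrMr ?mulr_gt0 ?subr_gt0// in qd'.
by move: qd'; move: a b e d {h ed qd} => a b e d; nra.
Qed.
(** After the shift both sides carry the same exponential factor, and |d - w_i| <= d - c_i makes the
    inequality an instance of the monotonicity [EE_maj]. *)
Lemma EE_neg_le x w c : vge0 x -> (forall i, c 0 i < cRe (w 0 i)) -> `|EE (- rv2C x) w| <= EE (- rv2C x) (rv2C c).
Proof.
move=> x0 cw; have [d hd] := choose_shift cw.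
rewrite (EE_neg_shift x w d) (EE_neg_shift x (rv2C c) d) normrM RC_norm (ger0_norm (expR_ge0 _)).
apply: ler_wpM2l; first by rewrite RC_ge0 expR_ge0.
apply: EE_maj => i; first by rewrite rv2C_coord RC_norm RC_le ger0_norm.
by rewrite !mxE; apply: le_trans (hd i) _; rewrite rmorphB.
Qed.
Lemma EE_neg_const x d : EE (- rv2C x) (const_mx (RC d)) = RC (expR (- (d * vsum x))).
Proof. by rewrite (EE_neg_shift x _ d) subrr EE_0 mulr1. Qed.
Lemma EE_neg_exp x w d : vge0 x -> (forall i, d < cRe (w 0 i)) -> `|EE (- rv2C x) w| <= RC (expR (- (d * vsum x))).
Proof.
move=> x0 dw; rewrite -EE_neg_const -rv2C_const; apply: EE_neg_le => // i; by rewrite mxE.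
Qed.
Lemma EE_neg_gt0 x y : vge0 x -> 0 < EE (- rv2C x) (rv2C y).
Proof.
move=> x0; rewrite (EE_neg_shift x _ (\sum_i `|y 0 i|)) mulr_gt0 ?RC_gt0 ?expR_gt0//.
apply: lt_le_trans ltr01 _; apply: EE_ge1 => i; first by rewrite rv2C_coord RC_ge0.
rewrite !mxE -rmorphB RC_ge0 subr_ge0; apply: le_trans (ler_norm _) _.
by rewrite (bigD1 i)//= lerDl sumr_ge0.
Qed.
Lemma EE_neg_le1 x y : vge0 x -> vge0 y -> EE (- rv2C x) (rv2C y) <= 1.
Proof.
move=> x0 y0; set d := \sum_i `|y 0 i|.
have h : EE (rv2C x) (const_mx (RC d) - rv2C y) <= EE (rv2C x) (const_mx (RC d)).
  rewrite -[leLHS]ger0_norm; last first.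
    apply: le_trans ler01 _; apply: EE_ge1 => i; first by rewrite rv2C_coord RC_ge0.
    rewrite !mxE -rmorphB RC_ge0 subr_ge0; apply: le_trans (ler_norm _) _.
    by rewrite /d (bigD1 i)//= lerDl sumr_ge0.
  apply: EE_maj => i; first by rewrite rv2C_coord RC_norm RC_le ger0_norm.
  have yd : y 0 i <= d by apply: le_trans (ler_norm _) _; rewrite /d (bigD1 i)//= lerDl sumr_ge0.
  by rewrite !mxE -rmorphB RC_norm RC_le ger0_norm ?subr_ge0// gerBl.
rewrite (EE_neg_shift x _ d); apply: (@le_trans _ _ (RC (expR (- (d * vsum x))) * EE (rv2C x) (const_mx (RC d)))).
  by rewrite ler_wpM2l// RC_ge0 expR_ge0.
by rewrite EE_const -rmorphM /= -expRD -/(vsum x) addNr expR0 [RC 1]rmorph1.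
Qed.
(** [EE_neg_le] needs a strict inequality of real parts, so it is used at Re w - eta. The diagonal
    shift by eta costs only the factor e^(eta vsum x), which tends to 1 with eta. *)
Lemma EE_neg_le_Re x w : vge0 x -> `|EE (- rv2C x) w| <= EE (- rv2C x) (rvRe w).
Proof.
move=> x0; pose r : 'rV[R]_n := map_mx cRe w.
have -> : rvRe w = rv2C r by apply/rowP => i; rewrite !mxE.
have E (eta : R) : EE (- rv2C x) (rv2C r - const_mx (RC eta)) = RC (expR (eta * vsum x)) * EE (- rv2C x) (rv2C r).
  rewrite (EE_neg_shift x (rv2C r) 0) mul0r oppr0 expR0 [RC 1]rmorph1 mul1r.
  rewrite (EE_neg_shift x _ 0) mul0r oppr0 expR0 [RC 1]rmorph1 mul1r -EE_shift; congr (EE _ _).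
  by rewrite opprB addrA addrAC.
have [e0|] := boolP (0 <= EE (- rv2C x) (rv2C r)); last by rewrite ltW// EE_neg_gt0.
have b (eta : R) : 0 < eta -> cmod (EE (- rv2C x) w) <= expR (eta * vsum x) * cRe (EE (- rv2C x) (rv2C r)).
  move=> eta0; have := @EE_neg_le x w (r - const_mx eta) x0.
  rewrite rv2CB rv2C_const E CC_norm {1}(RC_real e0) -rmorphM RC_le; apply.
  by move=> i; rewrite !mxE ltrBlDr ltrDl.
rewrite CC_norm (RC_real e0) RC_le.
set A := cmod _ in b *; set B := cRe _ in b *; have s0 := vsum_ge0 x0.
have B0 : 0 <= B by exact: cRe_ge0.
apply/ler_addgt0Pr => e e_gt0; pose u := e / (B + 1).
have u0 : 0 < u by rewrite divr_gt0// ltr_wpDl.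
have l0 : 0 < ln (1 + u) by rewrite ln_gt0// ltrDl.
have s1 : 0 < vsum x + 1 by rewrite ltr_wpDl.
(* This eta makes e^(eta vsum x) at most 1 + u, and u was chosen with u B <= e; the denominators are
   increased by 1 to remain positive. *)
apply: le_trans (b (ln (1 + u) / (vsum x + 1)) (divr_gt0 l0 s1)) _.
apply: (@le_trans _ _ ((1 + u) * B)).
  rewrite ler_wpM2r// -[leRHS]lnK ?posrE ?addr_gt0// ler_expR mulrAC ler_pdivrMr//.
  by rewrite ler_wpM2l ?(ltW l0)// lerDl.
rewrite mulrDl mul1r lerD2l /u mulrAC ler_pdivrMr ?ltr_wpDl// ler_wpM2l ?(ltW e_gt0)//.
by rewrite lerDl.
Qed.

(** The margin rho in the hypothesis pays for the ball of radius rho: since |d - w_i| + rho <= d -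
    delta, the majorant of the shifted kernel is at most E(x, (d - delta) 1) = e^((d - delta) vsum
    x), and the shift factor turns it into e^(-delta vsum x). *)
Lemma EE_neg_qr w (delta rho : R) x : 0 < rho -> (forall i, delta + rho < cRe (w 0 i)) -> vge0 x ->
  qr (EE (- rv2C x)) w (fun v => 'D_v (EE (- rv2C x)) w) (RC rho) (RC (expR (- (delta * vsum x)))).
Proof.
move=> r0 dw x0; have [d hd] := @choose_shift w (const_mx (delta + rho)) ltac:(by move=> i; rewrite mxE).
have r1 : 0 < RC rho by rewrite RC_gt0.
have H := (EE_qr k0 (rv2C x) (const_mx (RC d) - w) r1).1.
have {}H := qr_comp (P := fun v : V => - v) (p := w) (q := const_mx (RC d)) (@opprD _) (fun a u => esym (scalerN a u)) (@normrN _ _) H.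
have e0 : 0 <= RC (expR (- (d * vsum x))) by rewrite RC_ge0 expR_ge0.
have {}H := qrZ e0 H.
apply: (qr_deriveE r1); apply: qr_eq (qr_le _ H) => //; first by move=> v /=; rewrite -EE_neg_shift.
apply: (@le_trans _ _ (RC (expR (- (d * vsum x))) * EE (rv2C x) (const_mx (RC (d - delta))))).
  apply: ler_wpM2l => //; rewrite -[leLHS]ger0_norm; last first.
    apply: le_trans ler01 _; apply: EE_ge1 => i; rewrite !mxE ?addr_ge0//; exact: ltW.
  apply: EE_maj => i; first by rewrite !mxE normr_id RC_norm RC_le ger0_norm.
  rewrite !mxE ger0_norm ?addr_ge0 ?(ltW r1)//.
  have := hd i; rewrite mxE => h; apply: le_trans (lerD h (lexx _)) _.
  by rewrite -rmorphD RC_le opprD addrA subrK.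
rewrite EE_const -rmorphM RC_le /= -expRD ler_expR -/(vsum x); lra.
Qed.

Lemma expR_lip (u : R) : `|expR u - 1| <= `|u| * expR `|u|.
Proof.
have h (v : R) : 0 <= v -> expR v - 1 <= v * expR v.
  move=> v0; have := expR_ge1Dx (- v); rewrite expRN => h.
  have e0 := expR_gt0 v; rewrite -(ler_pM2r e0) mulVf ?gt_eqF// in h.
  lra.
have [u0|u0] := leP 0 u.
  by rewrite (ger0_norm u0) ger0_norm ?h// subr_ge0 -[leLHS]expR0 ler_expR.
rewrite ler0_norm; last by rewrite subr_le0 -[leRHS]expR0 ler_expR ltW.
rewrite opprB; have := expR_ge1Dx u => h1.
apply: (@le_trans _ _ (- u)); first by lra.
rewrite (ltr0_norm u0) ler_peMr ?oppr_ge0 ?(ltW u0)// -[leLHS]expR0 ler_expR oppr_ge0; exact: ltW.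
Qed.
Lemma rv2C_norm_le x (r : R) : 0 <= r -> (forall i, `|x 0 i| <= r) -> `|rv2C x| <= RC r.
Proof. by move=> r0 h; apply: norm_le_coord => [|i]; rewrite ?RC_ge0// rv2C_coord RC_norm RC_le. Qed.
Lemma EE_vsum_le x y (r : R) : (forall i, `|x 0 i - y 0 i| <= r) -> `|vsum x - vsum y| <= n%:R * r.
Proof.
move=> h; rewrite /vsum -sumrB; apply: le_trans (ler_norm_sum _ _ _) _.
apply: le_trans (ler_sum _ (fun i _ => h i)) _; by rewrite sumr_const card_ord mulr_natl.
Qed.
(** Lipschitz dependence on the spectral variable x, with exponential decay retained. In E(-x, w) =
    e^(-d vsum x) E(x, W) the second factor is differentiated in x through the symmetry of E. *)
Lemma EE_neg_lip w (delta : R) : (forall i, delta < cRe (w 0 i)) ->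
  exists2 C : R, 0 <= C & forall (x y : 'rV[R]_n) (r : R), 0 <= r -> vge0 x -> vge0 y -> (forall i, `|x 0 i - y 0 i| <= r) ->
    `|EE (- rv2C x) w - EE (- rv2C y) w| <= RC (C * r * (expR (- (delta * vsum x)) + expR (- (delta * vsum y)))).
Proof.
move=> dw; have [d hd] := @choose_shift w (const_mx delta) ltac:(by move=> i; rewrite mxE).
pose W := const_mx (RC d) - w; pose B := cRe (\sum_i `|W 0 i|).
have B0 : RC B = \sum_i `|W 0 i| by rewrite -RC_real// sumr_ge0.
pose N : R := n%:R.
have d0 : 0 <= `|d| by [].
pose C := 1 + expR (`|d| * N) * expR B + `|d| * N * expR (`|d| * N).
have C0 : 0 <= C by rewrite /C !addr_ge0 ?mulr_ge0 ?expR_ge0 ?ler0n.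
have C1 : 1 <= C by rewrite /C -addrA lerDl addr_ge0 ?mulr_ge0 ?expR_ge0 ?ler0n.
exists C => // x y r r0 x0 y0 xyr.
have ex := EE_neg_exp x0 dw; have ey := EE_neg_exp y0 dw.
(* The derivative estimate is used with radius 1; for larger distances the sum of the two sizes is
   already enough, as C >= 1. *)
have [r1|r1] := ltP 1 r.
  apply: le_trans (ler_normB _ _) _; apply: le_trans (lerD ex ey) _.
  rewrite -rmorphD RC_le ler_peMl ?addr_ge0 ?expR_ge0//.
  by rewrite -[leLHS]mulr1; apply: ler_pM => //; exact: ltW.
have vab : vabs W = rv2C (\row_i cmod (W 0 i)) by apply/rowP => i; rewrite !mxE CC_norm.
have hP : `|EE (rv2C x) W| <= RC (expR ((d - delta) * vsum x)).
  rewrite -(EE_const k0); apply: EE_maj => i; first by rewrite rv2C_coord RC_norm RC_le ger0_norm.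
  by have := hd i; rewrite !mxE.
have hd2 : `|EE (rv2C x) W - EE (rv2C y) W| <= RC (r * (expR B * expR ((d - delta) * vsum x))).
  have [_ H] := (EE_qr k0 W (rv2C x) ltr01).1.
  have nh : `|rv2C y - rv2C x| <= RC r.
    by rewrite -rv2CB; apply: rv2C_norm_le => // i; rewrite !mxE distrC.
  have [_ b _] := H (rv2C y - rv2C x) ltac:(by apply: le_trans nh _; rewrite -(rmorph1 (@RC R)) RC_le).
  rewrite (EE_sym k0 (rv2C x)) (EE_sym k0 (rv2C y)) distrC; rewrite mul1r [rv2C x + _]addrC subrK in b.
  apply: le_trans b _; rewrite rmorphM; apply: ler_pM => //.
    apply: le_trans ler01 _; apply: EE_ge1 => i; rewrite !mxE ?addr_ge0//.
  rewrite -(rmorph1 (@RC R)) vab EE_shift -vab rmorphM; apply: ler_pM.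
  - by rewrite RC_ge0 expR_ge0.
  - by apply: le_trans ler01 _; apply: EE_ge1 => i; rewrite !mxE.
  - rewrite RC_le mul1r ler_expR -RC_le B0 rmorph_sum /=; apply: ler_sum => i _.
    by rewrite !mxE CC_norm.
  - rewrite -[leRHS]/(RC _) EE_sym -(EE_const k0) -[leLHS]ger0_norm; last first.
      by apply: le_trans ler01 _; apply: EE_ge1 => i; rewrite !mxE.
    apply: EE_maj => i; first by rewrite !mxE normr_id RC_norm RC_le ger0_norm.
    by have := hd i; rewrite !mxE normr_id.
have vxy := EE_vsum_le xyr.
have dXY : `|d * (vsum x - vsum y)| <= `|d| * N * r by rewrite normrM -mulrA ler_wpM2l.
have dXY1 : `|d| * N * r <= `|d| * N by rewrite ler_piMr// mulr_ge0 ?ler0n.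
rewrite (EE_neg_shift x w d) (EE_neg_shift y w d) -/W.
set a := expR (- (d * vsum x)); set c := expR (- (d * vsum y)).
set Px := EE _ W in hP hd2 *; set Py := EE _ W in hd2 *.
have -> : RC a * Px - RC c * Py = RC c * (Px - Py) + RC (a - c) * Px by rewrite RCB mulrBr mulrBl [RHS]addrC addrA subrK.
have cE : c = a * expR (d * (vsum x - vsum y)) by rewrite /c /a -expRD; congr expR; ring.
have a0 : 0 <= a by exact: expR_ge0.
have cle : c <= a * expR (`|d| * N).
  rewrite cE ler_wpM2l// ler_expR; apply: le_trans (ler_norm _) _; exact: le_trans dXY1.
have ace : `|a - c| <= a * (`|d| * N * r * expR (`|d| * N)).
  rewrite cE -{1}[a]mulr1 -mulrBr normrM ger0_norm// ler_wpM2l// distrC.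
  apply: le_trans (expR_lip _) _; apply: ler_pM; rewrite ?expR_ge0// ler_expR; exact: le_trans dXY1.
have aE : a * expR ((d - delta) * vsum x) = expR (- (delta * vsum x)) by rewrite /a -expRD; congr expR; ring.
apply: le_trans (ler_normD _ _) _; rewrite !normrM !RC_norm.
apply: (@le_trans _ _ (RC (a * expR (`|d| * N)) * RC (r * (expR B * expR ((d - delta) * vsum x))) +
   RC (a * (`|d| * N * r * expR (`|d| * N))) * RC (expR ((d - delta) * vsum x)))).
  by apply: lerD; apply: ler_pM => //; rewrite ?RC_ge0 ?RC_le// ger0_norm// expR_ge0.
rewrite -!rmorphM -rmorphD RC_le.
have -> : a * expR (`|d| * N) * (r * (expR B * expR ((d - delta) * vsum x))) + a * (`|d| * N * r * expR (`|d| * N)) * expR ((d - delta) * vsum x)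
  = (expR (`|d| * N) * expR B + `|d| * N * expR (`|d| * N)) * r * (a * expR ((d - delta) * vsum x)).
  by move: (expR _) (expR B) (expR (_ * vsum x)) => E1 E2 E3; ring.
rewrite aE; apply: ler_pM; rewrite ?mulr_ge0 ?addr_ge0 ?mulr_ge0 ?expR_ge0 ?ler0n//.
  by rewrite ler_wpM2r// /C -[X in _ <= X]addrA lerDr.
by rewrite lerDl expR_ge0.
Qed.

End negexp.

Arguments tset {R} D n.

(** * Iterated integrals as integrals over tuples *)

Section iint_tmu.
Variable R : realType.
Local Notation T n := (n.-tuple (measurableTypeR R)).
Local Notation leb := (@lebesgue_measure R).
Variables (D : set R) (h : R -> R).
Hypotheses (mD : measurable (D : set (measurableTypeR R))) (mh : measurable_fun setT (h : measurableTypeR R -> R)).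
Hypotheses (h0 : forall t, 0 <= h t) (ih : leb.-integrable (D : set (measurableTypeR R)) (EFin \o h)).
Let mDn n : measurable (tset D n) := @measurable_tset R D n mD.

Lemma tset0 : tset D 0 = setT. Proof. by apply/seteqP; split => // x _ []. Qed.
Lemma measurable_sec n d (Y : measurableType d) (F : T n.+1 -> Y) t : measurable_fun (tset D n.+1) F -> D t ->
  measurable_fun (tset D n) (fun s => F (consT (t, s))).
Proof.
move=> mF Dt; apply: (measurable_comp (F := tset D n.+1)) => //; first exact: mDn.
  by move=> _ [s Ds <-]; apply/tset_cons.
apply: measurable_funTS; apply: (measurableT_comp (@measurable_consT R n)); exact: measurable_pair1.
Qed.
Lemma iint_absE n (F : seq R -> R) : measurable_fun (tset D n) (fun s : T n => F s) ->
  iint_abs D n F = (\int[tmu R n]_(s in tset D n) (`|F s|)%:E)%E.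
Proof.
elim: n F => [|n IH] F mF.
  rewrite tset0 tmu_rec0//; apply/measurable_EFinP; apply: measurableT_comp => //; by rewrite -tset0.
rewrite tmu_recl_set//; last by apply/measurable_EFinP; apply: measurableT_comp.
by apply: eq_integral => t /set_mem Dt; apply: IH; exact: (measurable_sec mF).
Qed.
Lemma measurable_prod_seq n (E : set (T n)) : measurable_fun E (fun s : T n => \prod_(t <- s) h t).
Proof.
rewrite (_ : (fun s : T n => _) = (fun s : T n => \prod_(i < n) h (tnth s i))); first by apply: measurable_funTS; exact: measurable_tprod.
by apply/funext => s; rewrite big_tuple.
Qed.
Lemma prod_seq_ge0 (s : seq R) : 0 <= \prod_(t <- s) h t.
Proof. by apply: prodr_ge0. Qed.
Lemma int_prod_lty n : (\int[tmu R n]_(s in tset D n) (\prod_(t <- s) h t)%:E < +oo)%E.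
Proof.
elim: n => [|n IH].
  by rewrite tset0 tmu_rec0 ?big_nil ?ltry//; apply/measurable_EFinP; exact: measurable_prod_seq.
rewrite tmu_recl_set//; last 2 first.
- by apply/measurable_EFinP; exact: measurable_prod_seq.
- by move=> x _; rewrite lee_fin prod_seq_ge0.
have -> : (\int[leb]_(t in D) \int[tmu R n]_(s in tset D n) (\prod_(u <- consT (t, s)) h u)%:E = \int[leb]_(t in D) ((\int[tmu R n]_(s in tset D n) (\prod_(u <- s) h u)%:E) * (h t)%:E))%E.
  apply: eq_integral => t _; rewrite muleC -ge0_integralZl//.
  - by apply: eq_integral => s _; rewrite -EFinM big_cons.
  - exact: mDn.
  - by apply/measurable_EFinP; exact: measurable_prod_seq.
  - by move=> s _; rewrite lee_fin prod_seq_ge0.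
  - by rewrite lee_fin.
have I0 : (0 <= \int[tmu R n]_(s in tset D n) (\prod_(t <- s) h t)%:E)%E by apply: integral_ge0 => s _; rewrite lee_fin prod_seq_ge0.
have -> : (\int[tmu R n]_(s in tset D n) (\prod_(t <- s) h t)%:E = (fine (\int[tmu R n]_(s in tset D n) (\prod_(t <- s) h t)%:E))%:E)%E.
  by rewrite fineK// ge0_fin_numE.
rewrite ge0_integralZl//; last 3 first.
- by apply/measurable_EFinP; exact: measurable_funTS.
- by move=> t _; rewrite lee_fin.
- by rewrite lee_fin fine_ge0.
have /integrableP [_ hy] := ih; apply: lte_mul_pinfty => //.
  by rewrite lee_fin fine_ge0.
by under eq_integral do rewrite -(ger0_norm (h0 _)).
Qed.
Lemma tintegrable n (F : T n -> R) (C : R) : measurable_fun (tset D n) F ->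
  (forall s : T n, tset D n s -> `|F s| <= C * \prod_(t <- s) h t) -> (tmu R n).-integrable (tset D n) (EFin \o F).
Proof.
move=> mF FC; apply/integrableP; split; first exact/measurable_EFinP.
apply: (@le_lt_trans _ _ (\int[tmu R n]_(s in tset D n) (`|C|%:E * (\prod_(t <- s) h t)%:E))%E).
  apply: ge0_le_integral => //.
  - exact: mDn.
  - by apply/measurable_EFinP; apply: measurableT_comp.
  - by apply: measurable_funeM; apply/measurable_EFinP; exact: measurable_prod_seq.
  - move=> s Ds; rewrite /= lee_fin; apply: le_trans (FC s Ds) _.
    by rewrite ler_wpM2r ?prod_seq_ge0// ler_norm.
rewrite ge0_integralZl//; last 3 first.
- exact: mDn.
- by apply/measurable_EFinP; exact: measurable_prod_seq.
- by move=> s _; rewrite lee_fin prod_seq_ge0.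
by apply: lte_mul_pinfty => //; exact: int_prod_lty.
Qed.
Lemma tintegrable_lty n (F : T n -> R) (C : R) : measurable_fun (tset D n) F ->
  (forall s : T n, tset D n s -> 0 <= F s <= C * \prod_(t <- s) h t) -> (\int[tmu R n]_(s in tset D n) (F s)%:E < +oo)%E.
Proof.
move=> mF FC; have /integrableP[_] := @tintegrable n F C mF (fun s Ds => ltac:(by have /andP[a b] := FC s Ds; rewrite ger0_norm)).
rewrite (eq_integral (fun s => (F s)%:E))// => s /set_mem Ds /=.
by have /andP[a b] := FC s Ds; rewrite ger0_norm.
Qed.
(** The real-valued integral of an infinite quantity is 0, so each inner integral must be known to
    be finite. A product majorant is preserved by taking sections, with C replaced by C h(t), and
    provides this at every level. *)
Lemma iint_ge0 n (F : seq R -> R) (C : R) : measurable_fun (tset D n) (fun s : T n => F s) ->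
  (forall s : T n, tset D n s -> 0 <= F s <= C * \prod_(t <- s) h t) ->
  (iint D n F)%:E = (\int[tmu R n]_(s in tset D n) (F s)%:E)%E.
Proof.
elim: n F C => [|n IH] F C mF FC.
  by rewrite tset0 tmu_rec0//; apply/measurable_EFinP; rewrite -tset0.
have ly := tintegrable_lty mF FC; have ge : (0 <= \int[tmu R n.+1]_(s in tset D n.+1) (F s)%:E)%E.
  by apply: integral_ge0 => s Ds; rewrite lee_fin; have /andP[] := FC s Ds.
have E : (\int[tmu R n.+1]_(s in tset D n.+1) (F s)%:E = \int[leb]_(t in D) (iint D n (fun s => F (t :: s)))%:E)%E.
  rewrite tmu_recl_set//; last 2 first.
  - exact/measurable_EFinP.
  - by move=> s Ds; rewrite lee_fin; have /andP[] := FC s Ds.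
  apply: eq_integral => t /set_mem Dt; rewrite (IH (fun s => F (t :: s)) (C * h t))//; first exact: (measurable_sec mF).
  move=> s Ds; have := FC (consT (t, s)); rewrite /= big_cons mulrA; apply; exact/tset_cons.
by rewrite /= /Rintegral -E fineK// ge0_fin_numE.
Qed.
Lemma measurable_iint n (F : seq R -> R) (C : R) : measurable_fun (tset D n.+1) (fun s : T n.+1 => F s) ->
  (forall s : T n.+1, tset D n.+1 s -> 0 <= F s <= C * \prod_(t <- s) h t) ->
  measurable_fun (D : set (measurableTypeR R)) (fun t => iint D n (fun s => F (t :: s))).
Proof.
move=> mF FC; apply/measurable_EFinP.
pose G : T n.+1 -> \bar R := ((fun s : T n.+1 => (F s)%:E) \_ (tset D n.+1))%E.
have mE : measurable_fun (tset D n.+1) (fun s : T n.+1 => (F s)%:E) by exact/measurable_EFinP.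
have mG : measurable_fun setT G.
  have [H _] := measurable_restrictT (fun s : T n.+1 => (F s)%:E) (@measurable_tset R D n.+1 mD); exact (H mE).
have G0 s : (0 <= G s)%E by rewrite /G /patch; case: ifPn => // /set_mem Ds; rewrite lee_fin; have /andP[] := FC s Ds.
apply: (eq_measurable_fun (fun t => \int[tmu R n]_s G (consT (t, s)))%E); last first.
  by apply: measurable_funTS; apply: measurable_int_section.
move=> t Dt; rewrite /= (iint_ge0 (C := C * h t)).
- rewrite [RHS]integral_mkcond; apply: eq_integral => s _; by rewrite /G restrict_consE Dt.
- apply: (measurable_sec mF); exact: set_mem.
- move=> s Ds; have := FC (consT (t, s)); rewrite /= big_cons mulrA; apply; apply/tset_cons; split => //; exact: set_mem.
Qed.
Lemma iintB n (F1 F2 : seq R -> R) (C : R) :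
  measurable_fun (tset D n) (fun s : T n => F1 s) -> measurable_fun (tset D n) (fun s : T n => F2 s) ->
  (forall s : T n, tset D n s -> 0 <= F1 s <= C * \prod_(t <- s) h t) ->
  (forall s : T n, tset D n s -> 0 <= F2 s <= C * \prod_(t <- s) h t) ->
  iint D n (fun s => F1 s - F2 s) = iint D n F1 - iint D n F2.
Proof.
elim: n F1 F2 C => [//|n IH] F1 F2 C m1 m2 b1 b2 /=.
have int (F : seq R -> R) : measurable_fun (tset D n.+1) (fun s : T n.+1 => F s) -> (forall s : T n.+1, tset D n.+1 s -> 0 <= F s <= C * \prod_(t <- s) h t) ->
   leb.-integrable (D : set (measurableTypeR R)) (fun t : measurableTypeR R => (iint D n (fun s => F (t :: s)))%:E).
  move=> m b; apply/integrableP; split; first by apply/measurable_EFinP; exact: measurable_iint b.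
  have E t : D t -> (iint D n (fun s => F (t :: s)))%:E = (\int[tmu R n]_(s in tset D n) (F (t :: s))%:E)%E.
    move=> Dt; apply: (iint_ge0 (C := C * h t)); first exact: (measurable_sec m).
    move=> s Ds; have := b (consT (t, s)); rewrite /= big_cons mulrA; apply; exact/tset_cons.
  have -> : (\int[leb]_(t in D) `|(iint D n (fun s => F (t :: s)))%:E| = \int[leb]_(t in D) \int[tmu R n]_(s in tset D n) (F (consT (t, s)))%:E)%E.
    apply: eq_integral => t /set_mem Dt; rewrite [in LHS]E// gee0_abs// integral_ge0// => s Ds.
    by rewrite lee_fin; have /andP[] := b (consT (t, s)) ltac:(exact/tset_cons).
  have mE : measurable_fun (tset D n.+1) (fun s : T n.+1 => (F s)%:E) by exact/measurable_EFinP.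
  have := tmu_recl_set mD mE (fun s Ds => ltac:(by rewrite lee_fin; have /andP[] := b s Ds)).
  by move=> <-; exact: tintegrable_lty b.
rewrite -RintegralB//; [|exact: int|exact: int].
apply: eq_Rintegral => t /set_mem Dt; apply: (IH _ _ (C * h t)).
- exact: (measurable_sec m1).
- exact: (measurable_sec m2).
- by move=> s Ds; have := b1 (consT (t, s)); rewrite /= big_cons mulrA; apply; exact/tset_cons.
- by move=> s Ds; have := b2 (consT (t, s)); rewrite /= big_cons mulrA; apply; exact/tset_cons.
Qed.
(** Adding the product majorant B makes the integrand nonnegative; F = (F + B) - B then reduces the
    statement to the Tonelli case. *)
Lemma iintE n (F : seq R -> R) (C : R) : measurable_fun (tset D n) (fun s : T n => F s) ->
  (forall s : T n, tset D n s -> `|F s| <= C * \prod_(t <- s) h t) ->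
  iint D n F = \int[tmu R n]_(s in tset D n) (F s).
Proof.
move=> mF FC; pose B (s : seq R) := C * \prod_(t <- s) h t.
have mB : measurable_fun (tset D n) (fun s : T n => B s) by apply: measurable_funM => //; exact: measurable_prod_seq.
have m1 : measurable_fun (tset D n) (fun s : T n => F s + B s) by exact: measurable_funD.
have b2 (s : T n) : tset D n s -> 0 <= B s <= (2 * C) * \prod_(t <- s) h t.
  move=> Ds; have := FC s Ds; rewrite -/(B s) => h1; have B0 : 0 <= B s := le_trans (normr_ge0 _) h1.
  by rewrite B0 -mulrA ler_peMl// ler1n.
have b1 (s : T n) : tset D n s -> 0 <= F s + B s <= (2 * C) * \prod_(t <- s) h t.
  move=> Ds; have := FC s Ds; rewrite -mulrA -/(B s) ler_norml => /andP[l1 l2].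
  by rewrite -lerBlDr sub0r l1 /= mulr_natl mulr2n lerD2r.
have e1 := @iint_ge0 n (fun s => F s + B s) _ m1 b1; have e2 := iint_ge0 mB b2.
have -> : F = (fun s => (F s + B s) - B s) by apply/funext => s; rewrite addrK.
rewrite (iintB m1 mB b1 b2) RintegralB//.
- by rewrite /Rintegral -e1 -e2.
- exact: mDn.
- by apply: (tintegrable (C := 2 * C)) => // s Ds; have /andP[a b] := b1 s Ds; rewrite ger0_norm.
- by apply: (tintegrable (C := 2 * C)) => // s Ds; have /andP[a b] := b2 s Ds; rewrite ger0_norm.
Qed.
End iint_tmu.

(** * Complex powers *)
Section cmodlemmas.
Variable R : realType.
Implicit Types z w : CC R.
Lemma RC_inj : injective (@RC R). Proof. by move=> x y []. Qed.
Lemma cmodM z w : cmod (z * w) = cmod z * cmod w.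
Proof. by apply: RC_inj; rewrite RCM -!CC_norm normrM. Qed.
Lemma cmodD z w : cmod (z + w) <= cmod z + cmod w.
Proof. by rewrite -RC_le RCD -!CC_norm ler_normD. Qed.
Lemma cmodN z : cmod (- z) = cmod z.
Proof. by apply: RC_inj; rewrite -!CC_norm normrN. Qed.
Lemma cmod_RC (x : R) : cmod (RC x) = `|x|.
Proof. by apply: RC_inj; rewrite -!CC_norm RC_norm. Qed.
Lemma cmod_eq0 z : (cmod z == 0) = (z == 0).
Proof. by rewrite -(inj_eq RC_inj) -CC_norm RC0 normr_eq0. Qed.
Lemma cmod_leP z (r : R) : (`|z| <= RC r) = (cmod z <= r).
Proof. by rewrite CC_norm RC_le. Qed.
Lemma cmod_dist z w : `|cmod z - cmod w| <= cmod (z - w).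
Proof.
have key (x y : CC R) : cmod x <= cmod (x - y) + cmod y by rewrite -{1}(subrK y x); exact: cmodD.
rewrite ler_norml; apply/andP; split; last by rewrite lerBlDr.
by rewrite lerNl opprB lerBlDr -(cmodN (z - w)) opprB.
Qed.
End cmodlemmas.
Section cexp.
Variable R : realType.
Implicit Types z w : CC R.
Lemma cRe_cexp z : cRe (cexp z) = expR (cRe z) * cos (cIm z). Proof. by []. Qed.
Lemma cIm_cexp z : cIm (cexp z) = expR (cRe z) * sin (cIm z). Proof. by []. Qed.
Lemma cRe_cLog z : cRe (cLog z) = ln (cmod z). Proof. by []. Qed.
Lemma cIm_cLog z : cIm (cLog z) = carg z. Proof. by []. Qed.
Lemma cexpD z w : cexp (z + w) = cexp z * cexp w.
Proof.
apply: CCP; rewrite ?cReM ?cImM /cexp /cRe /cIm /= -/(cRe _) -/(cIm _) cReD cImD expRD.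
  by rewrite cosD; ring.
by rewrite sinD; ring.
Qed.
Lemma cexp_RC (x : R) : cexp (RC x) = RC (expR x).
Proof. by apply: CCP; rewrite /cexp /cRe /cIm /= ?cos0 ?sin0 ?mulr1 ?mulr0. Qed.
Lemma cexp0 : cexp (0 : CC R) = 1.
Proof. by rewrite -RC0 cexp_RC expR0. Qed.
Lemma cmod_cexp z : cmod (cexp z) = expR (cRe z).
Proof.
rewrite /cmod /cexp {1}/cRe {2}/cIm /= !exprMn -mulrDr cos2Dsin2 mulr1 sqrtr_sqr ger0_norm// expR_ge0.
Qed.
Lemma cexp_neq0 z : cexp z != 0.
Proof. by rewrite -cmod_eq0 cmod_cexp gt_eqF// expR_gt0. Qed.
Lemma mvt01 (f f' : R -> R) (M : R) : (forall t : R, 0 <= t <= 1 -> is_derive t 1 f (f' t)) ->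
  (forall t, 0 <= t <= 1 -> `|f' t| <= M) -> `|f 1 - f 0| <= M.
Proof.
move=> df bf; have cf : {within `[0, 1]%classic, continuous f}.
  apply: derivable_within_continuous => t; rewrite in_itv /= => ht; exact: (@ex_derive _ _ _ _ _ _ _ (df t ht)).
have [t tI ->] := @MVT R f f' 0 1 ltr01
  (fun t ht => df t ltac:(by move: ht; rewrite in_itv/= => /andP[/ltW -> /ltW ->])) cf.
by rewrite subr0 mulr1 bf//; move: tI; rewrite in_itv /= => /andP[/ltW -> /ltW ->].
Qed.
Lemma cmod_tz (t : R) z : 0 <= t <= 1 -> cmod (cexp (RC t * z)) <= expR (cmod z).
Proof.
move=> /andP[t0 t1]; rewrite cmod_cexp ler_expR cReM cReRC cImRC mul0r subr0.
apply: le_trans (_ : t * cmod z <= _).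
  by rewrite ler_wpM2l// (le_trans (ler_norm _))// cRe_le_norm.
by rewrite ler_piMl// cmod_ge0.
Qed.
Lemma cexp_dRe z (t : R) : is_derive t 1 (fun t : R => cRe (cexp (RC t * z))) (cRe (z * cexp (RC t * z))).
Proof.
rewrite (_ : (fun t : R => _) = (fun t : R => expR (t * cRe z) * cos (t * cIm z))); last first.
  by apply/funext => u; rewrite cRe_cexp cReM cImM !cReRC !cImRC !mul0r subr0 addr0.
apply: is_derive_eq; rewrite cReM cRe_cexp cIm_cexp cReM cImM !cReRC !cImRC !mul0r subr0 addr0 /GRing.scale /=.
by move: (expR _) (cos _) (sin _) => A B C; ring.
Qed.
Lemma cexp_dIm z (t : R) : is_derive t 1 (fun t : R => cIm (cexp (RC t * z))) (cIm (z * cexp (RC t * z))).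
Proof.
rewrite (_ : (fun t : R => _) = (fun t : R => expR (t * cRe z) * sin (t * cIm z))); last first.
  by apply/funext => u; rewrite cIm_cexp cReM cImM !cReRC !cImRC !mul0r subr0 addr0.
apply: is_derive_eq; rewrite cImM cRe_cexp cIm_cexp cReM cImM !cReRC !cImRC !mul0r subr0 addr0 /GRing.scale /=.
by move: (expR _) (cos _) (sin _) => A B C; ring.
Qed.
(** The mean value theorem is a real statement; it is applied to the real and the imaginary part of
    e^(tz) on [0, 1], whence the factor 2 here and 4 in the second-order bound. *)
Lemma cexp_bound1 z : cmod (cexp z - 1) <= 2 * (cmod z * expR (cmod z)).
Proof.
have z1 : RC 1 * z = z by rewrite mul1r.
have z0 : cexp (RC 0 * z) = 1 by rewrite mul0r cexp0.
apply: le_trans (cmod_le _) _; rewrite cReB cImB mulr_natl mulr2n; apply: lerD.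
  have := @mvt01 (fun t : R => cRe (cexp (RC t * z))) _ (cmod z * expR (cmod z)) (fun t _ => cexp_dRe z t).
  rewrite z1 z0; apply => t ht; apply: le_trans (cRe_le_norm _) _; rewrite cmodM ler_wpM2l ?cmod_ge0//; exact: cmod_tz.
have := @mvt01 (fun t : R => cIm (cexp (RC t * z))) _ (cmod z * expR (cmod z)) (fun t _ => cexp_dIm z t).
rewrite z1 z0; apply => t ht; apply: le_trans (cIm_le_norm _) _; rewrite cmodM ler_wpM2l ?cmod_ge0//; exact: cmod_tz.
Qed.
Lemma cexp_bound2 z : cmod (cexp z - 1 - z) <= 4 * (cmod z ^+ 2 * expR (cmod z)).
Proof.
have z1 : RC 1 * z = z by rewrite mul1r.
have z0 : cexp (RC 0 * z) = 1 by rewrite mul0r cexp0.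
have b (t : R) : 0 <= t <= 1 -> cmod (z * cexp (RC t * z) - z) <= 2 * (cmod z ^+ 2 * expR (cmod z)).
  move=> ht; rewrite -[X in _ - X]mulr1 -mulrBr cmodM; have [t0 t1] := andP ht.
  apply: (@le_trans _ _ (cmod z * (2 * (cmod z * expR (cmod z))))); last by rewrite expr2; lra.
  rewrite ler_wpM2l ?cmod_ge0//; apply: le_trans (cexp_bound1 _) _.
  have tz : cmod (RC t * z) <= cmod z by rewrite cmodM cmod_RC ger0_norm// ler_piMl// cmod_ge0.
  by rewrite ler_wpM2l//; apply: ler_pM; rewrite ?cmod_ge0 ?expR_ge0 ?ler_expR.
have -> : 4 * (cmod z ^+ 2 * expR (cmod z)) = 2 * (cmod z ^+ 2 * expR (cmod z)) + 2 * (cmod z ^+ 2 * expR (cmod z)) by ring.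
apply: le_trans (cmod_le _) _; rewrite !cReB !cImB; apply: lerD.
  have d (t : R) : 0 <= t <= 1 -> is_derive t 1 ((fun t : R => cRe (cexp (RC t * z))) - (fun t : R => t * cRe z)) (cRe (z * cexp (RC t * z)) - cRe z).
    move=> _; apply: (is_derive_eq (is_deriveB (cexp_dRe z t) (is_deriveM (is_derive_id t 1) (is_derive_cst (cRe z) t 1)))).
    by rewrite /GRing.scale /= mulr1 mulr0 add0r.
  have := mvt01 d; rewrite /= [X in `|X|](_ : _ = cRe (cexp z) - cRe 1 - cRe z); last first.
    by rewrite -[LHS]/((cRe (cexp (RC 1 * z)) - 1 * cRe z) - (cRe (cexp (RC 0 * z)) - 0 * cRe z)) z1 z0 mul1r mul0r subr0 addrAC.
  by apply => t ht; rewrite -cReB; apply: le_trans (cRe_le_norm _) (b t ht).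
have d (t : R) : 0 <= t <= 1 -> is_derive t 1 ((fun t : R => cIm (cexp (RC t * z))) - (fun t : R => t * cIm z)) (cIm (z * cexp (RC t * z)) - cIm z).
  move=> _; apply: (is_derive_eq (is_deriveB (cexp_dIm z t) (is_deriveM (is_derive_id t 1) (is_derive_cst (cIm z) t 1)))).
    by rewrite /GRing.scale /= mulr1 mulr0 add0r.
have := mvt01 d; rewrite /= [X in `|X|](_ : _ = cIm (cexp z) - cIm 1 - cIm z); last first.
  by rewrite -[LHS]/((cIm (cexp (RC 1 * z)) - 1 * cIm z) - (cIm (cexp (RC 0 * z)) - 0 * cIm z)) z1 z0 mul1r mul0r subr0 addrAC.
by apply => t ht; rewrite -cImB; apply: le_trans (cIm_le_norm _) (b t ht).
Qed.

Lemma cmod_gt0 z : 0 < cRe z -> 0 < cmod z.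
Proof. by move=> h; apply: lt_le_trans (cRe_le_norm z); rewrite gtr0_norm. Qed.
Lemma cmod_cRe z : 0 < cRe z -> cmod z = cRe z * Num.sqrt (1 + (cIm z / cRe z) ^+ 2).
Proof.
move=> h; rewrite -{1}(gtr0_norm h) -(sqrtr_sqr (cRe z)) -sqrtrM ?sqr_ge0// /cmod; congr Num.sqrt.
by field; rewrite gt_eqF.
Qed.
(** On the right half-plane the two branches of the arccosine definition merge into a single
    formula, to which the mean value theorem applies. *)
Lemma carg_atan z : 0 < cRe z -> carg z = atan (cIm z / cRe z).
Proof.
move=> h; set u := cIm z / cRe z; have s0 : 0 < Num.sqrt (1 + u ^+ 2) by rewrite sqrtr_gt0 ltr_pwDl// sqr_ge0.
have E : cRe z / cmod z = cos (atan u).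
  by rewrite cos_atan cmod_cRe// invfM mulrA divff ?gt_eqF// mul1r.
have p2 := pihalf_lt2 R; have pp := pi_gt0 R; have a1 := atan_ltpi2 u; have a2 := atan_gtNpi2 u.
rewrite /carg E; case: ifPn => iz.
  have a0 : 0 <= atan u by rewrite -[leLHS]atan0; apply: le_atan; rewrite divr_ge0// ltW.
  rewrite cosK// in_itv /= a0 /=; lra.
have a0 : atan u <= 0.
  by rewrite -[leRHS]atan0; apply: le_atan; rewrite mulr_le0_ge0 ?invr_ge0 ?(ltW h)// ltW// ltNge.
rewrite -cosN cosK ?opprK// in_itv /= oppr_ge0 a0 /=; lra.
Qed.
Lemma cLogK z : 0 < cRe z -> cexp (cLog z) = z.
Proof.
move=> h; have m0 := cmod_gt0 h; have mE := cmod_cRe h; set u := cIm z / cRe z in mE.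
have s0 : 0 < Num.sqrt (1 + u ^+ 2) by rewrite sqrtr_gt0 ltr_pwDl// sqr_ge0.
have sa : sin (atan u) = u * cos (atan u).
  have := atanK u; rewrite /tan => {2}<-; rewrite divfK// cos_atan invr_eq0 gt_eqF//.
apply: CCP; rewrite ?cRe_cexp ?cIm_cexp cRe_cLog cIm_cLog carg_atan// -/u lnK ?posrE// ?sa cos_atan mE.
  by rewrite mulfK// gt_eqF.
by rewrite /u; field; rewrite !gt_eqF.
Qed.
Lemma cLog_RC (x : R) : 0 < x -> cLog (RC x) = RC (ln x).
Proof. by move=> x0; rewrite /cLog carg_atan// cImRC mul0r atan0 cmod_RC gtr0_norm. Qed.
Lemma cLog1 : cLog (1 : CC R) = 0.
Proof. by rewrite -RC1 cLog_RC// ln1. Qed.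
End cexp.

Section cpow.
Variable R : realType.
Implicit Types z w s h : CC R.
Lemma atan_lip (x y : R) : `|atan x - atan y| <= `|x - y|.
Proof.
have key (a b : R) : a < b -> `|atan b - atan a| <= `|b - a|.
  move: a b => {x y} x y xy; have [c _ ->] := @MVT R atan (fun x => (1 + x ^+ 2)^-1) x y xy (fun t _ => is_derive1_atan t)
    ltac:(by apply: continuous_subspaceT; exact: continuous_atan).
  rewrite normrM ler_piMl// ger0_norm ?invr_ge0 ?addr_ge0 ?sqr_ge0// invf_le1 ?ltr_pwDl ?sqr_ge0//.
  by rewrite lerDl sqr_ge0.
have [xy|xy|->] := ltgtP x y; last by rewrite !subrr.
  by rewrite distrC (distrC x); exact: key.
exact: key.
Qed.
Lemma ln_lip (a b m : R) : 0 < m -> m <= a -> m <= b -> `|ln a - ln b| <= `|a - b| / m.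
Proof.
move=> m0; have key (c d : R) : m <= c -> c <= d -> ln d - ln c <= (d - c) / m.
  move: c d => {a b} a b ma ab; have a0 : 0 < a by exact: lt_le_trans ma.
  have b0 : 0 < b by exact: lt_le_trans ab.
  rewrite -ln_div ?posrE//; have -> : b / a = 1 + (b - a) / a by field; rewrite gt_eqF.
  apply: (le_trans (le_ln1Dx _)).
    have h : 0 <= (b - a) / a by rewrite divr_ge0 ?subr_ge0 ?(ltW a0).
    by move: h; move: (_ / a) => q; lra.
  by rewrite ler_wpM2l ?subr_ge0// lef_pV2 ?posrE.
move=> ma mb; have [ab|ab] := leP a b.
  rewrite distrC (distrC a) !ger0_norm ?subr_ge0 ?ler_ln ?posrE ?(lt_le_trans m0)//; exact: key.
rewrite !ger0_norm ?subr_ge0 ?ler_ln ?posrE ?(lt_le_trans m0)// ?(ltW ab)//; apply: key => //; exact: ltW.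
Qed.
Lemma cLog_lip z : 0 < cRe z -> exists2 K, 0 <= K & forall h, cmod h <= cRe z / 2 ->
  0 < cRe (z + h) /\ cmod (cLog (z + h) - cLog z) <= K * cmod h.
Proof.
set x := cRe z; set y := cIm z => x0.
exists (2 / x + (x + `|y|) / (x * (x / 2))).
  by rewrite addr_ge0// divr_ge0 ?addr_ge0 ?mulr_ge0 ?divr_ge0 ?(ltW x0).
move=> h hx; have x2 : 0 < x / 2 by rewrite divr_gt0.
have bR := cRe_le_norm h; have bI := cIm_le_norm h.
have xh : x / 2 <= cRe (z + h).
  rewrite cReD -/x; move: bR; rewrite ler_norml => /andP[l _]; lra.
have xh0 : 0 < cRe (z + h) by exact: lt_le_trans xh.
split => //; apply: le_trans (cmod_le _) _; rewrite cReB cImB !cRe_cLog !cIm_cLog !carg_atan// mulrDl; apply: lerD.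
  apply: le_trans (ln_lip x2 (le_trans xh (le_trans (ler_norm _) (cRe_le_norm _))) _) _.
    by apply: le_trans (cRe_le_norm z); rewrite gtr0_norm// -/x ler_pdivrMr// mulr_natr mulr2n lerDl ltW.
  rewrite invf_div mulrC ler_wpM2l ?divr_ge0 ?(ltW x0)//; apply: le_trans (cmod_dist _ _) _.
  by rewrite addrC addKr.
apply: le_trans (atan_lip _ _) _; rewrite cReD cImD -/x -/y.
have -> : (y + cIm h) / (x + cRe h) - y / x = (x * cIm h - y * cRe h) / (x * (x + cRe h)).
  by rewrite cReD -/x in xh0; field; rewrite !gt_eqF.
rewrite cReD -/x in xh xh0; rewrite normrM normfV (gtr0_norm (mulr_gt0 x0 xh0)) mulrAC.
apply: ler_pM; rewrite ?invr_ge0 ?mulr_ge0 ?(ltW x0) ?(ltW xh0)//.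
  apply: le_trans (ler_normB _ _) _; rewrite !normrM (gtr0_norm x0) mulrDl; apply: lerD; [by rewrite ler_wpM2l ?(ltW x0)|by rewrite ler_wpM2l].
by rewrite lef_pV2 ?posrE ?mulr_gt0// ler_wpM2l// ltW.
Qed.
(** With u = Log (z + h) - Log z one has exactly e^u - 1 = h / z. Hence u - h / z = - (e^u - 1 - u),
    which is quadratic in u, and u is O(h) by [cLog_lip]. *)
Lemma cLog_quad z : 0 < cRe z -> exists r K, [/\ 0 < r, 0 <= K & forall h, cmod h <= r ->
  cmod (cLog (z + h) - cLog z) <= K * cmod h /\ cmod (cLog (z + h) - cLog z - h / z) <= K * cmod h ^+ 2].
Proof.
move=> x0; have [K1 K10 H] := cLog_lip x0; pose r := cRe z / 2.
have r0 : 0 < r by rewrite divr_gt0.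
have A0 : 0 <= 4 * K1 ^+ 2 * expR (K1 * r) by rewrite !mulr_ge0 ?exprn_ge0 ?expR_ge0.
exists r, (K1 + 4 * K1 ^+ 2 * expR (K1 * r)); split => //; first exact: addr_ge0.
move=> h hr; have [zh0 uK] := H h hr; set u := cLog (z + h) - cLog z in uK *.
have z0 : z != 0 by rewrite -cmod_eq0 gt_eqF// cmod_gt0.
have E : h / z = cexp u - 1.
  have : cexp (cLog z + u) = z + h by rewrite /u addrC subrK cLogK.
  by rewrite cexpD cLogK// => e; rewrite -[cexp u](mulKf z0) e mulrDr mulVf// addrC addKr mulrC.
split; first by apply: le_trans uK _; rewrite ler_wpM2r ?cmod_ge0// lerDl.
have -> : u - h / z = - (cexp u - 1 - u) by rewrite E [RHS]opprB.
rewrite cmodN; apply: le_trans (cexp_bound2 _) _; rewrite [leRHS]mulrDl -[leLHS]add0r; apply: lerD.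
  by rewrite mulr_ge0 ?exprn_ge0 ?cmod_ge0.
apply: (@le_trans _ _ (4 * ((K1 * cmod h) ^+ 2 * expR (K1 * r)))); last by rewrite exprMn; lra.
rewrite ler_wpM2l//; apply: ler_pM; rewrite ?exprn_ge0 ?cmod_ge0 ?expR_ge0//.
  by rewrite ler_pXn2r ?nnegrE ?mulr_ge0 ?cmod_ge0.
by rewrite ler_expR; apply: le_trans uK _; rewrite ler_wpM2l.
Qed.
Lemma cpow_quad z s : 0 < cRe z -> exists r K, [/\ 0 < r, 0 <= K & forall h, cmod h <= r ->
  cmod (cpow (z + h) s - cpow z s - s * cpow z s / z * h) <= K * cmod h ^+ 2].
Proof.
move=> /cLog_quad [r [K [r0 K0 H]]]; pose S := cmod s; pose P := cmod (cpow z s).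
have S0 : 0 <= S by exact: cmod_ge0.
have P0 : 0 <= P by exact: cmod_ge0.
exists r, (P * (4 * (S * K) ^+ 2 * expR (S * (K * r)) + S * K)); split => //.
  by rewrite !(mulr_ge0, addr_ge0) ?exprn_ge0 ?expR_ge0 ?mulr_ge0.
move=> h hr; have [b1 b2] := H h hr; set u := cLog (z + h) - cLog z in b1 b2 *.
have -> : cpow (z + h) s = cpow z s * cexp (s * u).
  by rewrite /cpow -cexpD -mulrDr /u [cLog z + _]addrC subrK.
have -> : cpow z s * cexp (s * u) - cpow z s - s * cpow z s / z * h = cpow z s * ((cexp (s * u) - 1 - s * u) + s * (u - h / z)).
  by move: (cpow z s) (cexp _) (z^-1) => A B C; ring.
rewrite cmodM -/P -[leRHS]mulrA ler_wpM2l// mulrDl; apply: le_trans (cmodD _ _) _; apply: lerD.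
  have su : cmod (s * u) <= S * (K * cmod h) by rewrite cmodM ler_wpM2l.
  apply: le_trans (cexp_bound2 _) _.
  apply: (@le_trans _ _ (4 * ((S * (K * cmod h)) ^+ 2 * expR (S * (K * r))))); last by rewrite !exprMn; lra.
  rewrite ler_wpM2l//; apply: ler_pM; rewrite ?exprn_ge0 ?cmod_ge0 ?expR_ge0//.
    by rewrite ler_pXn2r ?nnegrE ?mulr_ge0 ?cmod_ge0.
  by rewrite ler_expR; apply: le_trans su _; rewrite ler_wpM2l// ler_wpM2l.
by rewrite cmodM -mulrA ler_wpM2l.
Qed.
Lemma quad_cder (V : normedModType (CC R)) (f L : V -> CC R) (p : V) (r K : CC R) : 0 < r -> 0 <= K -> clinear L ->
  (exists2 M, 0 <= M & forall v, `|L v| <= M * `|v|) ->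
  (forall v, `|v| <= r -> `|f (p + v) - f p - L v| <= K * `|v| ^+ 2) -> cder f p L.
Proof.
move=> r0 K0 lL bL H; split => // eps e0.
have K1 : 0 < K + 1 by rewrite ltr_wpDl.
have d0 := divr_gt0 e0 K1.
have rr : r >=< eps / (K + 1) by apply: real_comparable; apply: ger0_real; exact: ltW.
exists (Num.min r (eps / (K + 1))); first by rewrite comparable_lt_min// r0 d0.
move=> v; rewrite comparable_le_min// => /andP[vr ve]; apply: le_trans (H v vr) _.
rewrite expr2 mulrA ler_wpM2r//; rewrite ler_pdivlMr// in ve; apply: le_trans ve.
by rewrite mulrC ler_wpM2l// lerDl.
Qed.
Lemma cder_cpow n (i : 'I_n) (w : 'rV[CC R]_n) s : 0 < cRe (w 0 i) ->
  cder (fun v : 'rV[CC R]_n => cpow (v 0 i) s) w (fun v : 'rV[CC R]_n => s * cpow (w 0 i) s / w 0 i * v 0 i).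
Proof.
move=> /(cpow_quad s) [r [K [r0 K0 H]]]; apply: (quad_cder (r := RC r) (K := RC K)); rewrite ?RC_gt0 ?RC_ge0//.
- by move=> a u v; rewrite !mxE; ring.
- exists `|s * cpow (w 0 i) s / w 0 i| => // v; rewrite normrM ler_wpM2l//; exact: coord_le_norm.
- move=> v vr; rewrite mxE; have nv := coord_le_norm v i.
  have h := H (v 0 i) ltac:(by rewrite -cmod_leP; exact: le_trans vr).
  rewrite -cmod_leP in h; apply: le_trans h _.
  by rewrite rmorphM rmorphXn /= -CC_norm ler_wpM2l ?RC_ge0// ler_pXn2r ?nnegrE.
Qed.

Lemma cpowE (t : R) s : 0 < t -> cpow (RC t) s = cexp (s * RC (ln t)).
Proof. by move=> t0; rewrite /cpow cLog_RC. Qed.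
Lemma cmod_cpow (t : R) s : 0 < t -> cmod (cpow (RC t) s) = t `^ cRe s.
Proof. by move=> t0; rewrite cpowE// cmod_cexp /powR gt_eqF// cReM cReRC cImRC mulr0 subr0. Qed.
Lemma cpow_RC (t a : R) : 0 < t -> cpow (RC t) (RC a) = RC (t `^ a).
Proof. by move=> t0; rewrite cpowE// -RCM cexp_RC /powR gt_eqF. Qed.
Lemma cpowD z s s' : cpow z (s + s') = cpow z s * cpow z s'.
Proof. by rewrite /cpow mulrDl cexpD. Qed.
Lemma cpow0 z : cpow z 0 = 1. Proof. by rewrite /cpow mul0r cexp0. Qed.
Lemma cpow_neq0 z s : cpow z s != 0. Proof. exact: cexp_neq0. Qed.
Lemma cpowN z s : cpow z (- s) = (cpow z s)^-1.
Proof. by apply: (mulfI (cpow_neq0 z s)); rewrite -cpowD subrr cpow0 divff// cpow_neq0. Qed.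
Lemma cpow_id z : 0 < cRe z -> cpow z 1 = z.
Proof. by move=> z0; rewrite /cpow mul1r cLogK. Qed.
Lemma cpow_one s : cpow 1 s = 1.
Proof. by rewrite /cpow cLog1 mulr0 cexp0. Qed.
Lemma cpowM (x y : R) s : 0 < x -> 0 < y -> cpow (RC (x * y)) s = cpow (RC x) s * cpow (RC y) s.
Proof. by move=> x0 y0; rewrite !cpowE ?mulr_gt0// lnM ?posrE// RCD mulrDr cexpD. Qed.
Lemma cpow_nat z s m : cpow z (m%:R * s) = cpow z s ^+ m.
Proof.
elim: m => [|m IH]; first by rewrite mul0r cpow0 expr0.
by rewrite exprS -IH -cpowD mulrS mulrDl mul1r.
Qed.
Lemma cpowV (x : R) s : 0 < x -> cpow (RC x^-1) s = cpow (RC x) (- s).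
Proof. by move=> x0; rewrite !cpowE ?invr_gt0// lnV ?posrE// RCN mulrN mulNr. Qed.
End cpow.

Section Deltapow.
Variables (R : realType) (n : nat).
Local Notation V := ('rV[CC R]_n).
Implicit Types (w z : V) (s : CC R) (x y : 'rV[R]_n).
Lemma DeltapowD z s s' : Deltapow z (s + s') = Deltapow z s * Deltapow z s'.
Proof. by rewrite /Deltapow -big_split; apply: eq_bigr => i _; rewrite cpowD. Qed.
Lemma Deltapow0 z : Deltapow z 0 = 1.
Proof. by rewrite /Deltapow big1// => i _; rewrite cpow0. Qed.
Lemma Deltapow_neq0 z s : Deltapow z s != 0.
Proof. by apply/prodf_neq0 => i _; exact: cpow_neq0. Qed.
Lemma DeltapowN z s : Deltapow z (- s) = (Deltapow z s)^-1.
Proof. by apply: (mulfI (Deltapow_neq0 z s)); rewrite -DeltapowD subrr Deltapow0 divff// Deltapow_neq0. Qed.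
Lemma Deltapow_one s : Deltapow (const_mx 1 : V) s = 1.
Proof. by rewrite /Deltapow big1// => i _; rewrite mxE cpow_one. Qed.
Lemma Deltapow_permv (sg : 'S_n) z s : Deltapow (permv sg z) s = Deltapow z s.
Proof. by rewrite /Deltapow [RHS](reindex_inj (@perm_inj _ sg)); apply: eq_bigr => i _; rewrite mxE. Qed.
Lemma Deltapow_real x (a : R) : posv x -> Deltapow (rv2C x) (RC a) = RC (\prod_i x 0 i `^ a).
Proof. by move=> x0; rewrite /Deltapow rmorph_prod; apply: eq_bigr => i _; rewrite mxE cpow_RC. Qed.
Lemma cmod_Deltapow x s : posv x -> cmod (Deltapow (rv2C x) s) = \prod_i x 0 i `^ cRe s.
Proof.
move=> x0; apply: RC_inj; rewrite -CC_norm /Deltapow normr_prod rmorph_prod; apply: eq_bigr => i _.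
by rewrite CC_norm mxE cmod_cpow.
Qed.
Lemma Deltapow_inv x s : posv x -> Deltapow (rv2C (rvinv x)) s = Deltapow (rv2C x) (- s).
Proof. by move=> x0; apply: eq_bigr => i _; rewrite !mxE cpowV. Qed.
Lemma Deltapow_scale (e : R) x s : 0 < e -> posv x -> Deltapow (rv2C (e *: x)) s = cpow (RC e) (n%:R * s) * Deltapow (rv2C x) s.
Proof.
move=> e0 x0; rewrite /Deltapow.
have -> : cpow (RC e) (n%:R * s) = \prod_(i < n) cpow (RC e) s.
  by rewrite prodr_const card_ord cpow_nat.
by rewrite -big_split; apply: eq_bigr => i _; rewrite !mxE cpowM.
Qed.
End Deltapow.

Section pairs.
Variables (R : realType) (n : nat).
(** Products over i < j are awkward to reindex. Their squares run over ordered pairs, where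
    permutations act directly, and for nonnegative factors the square determines the product. *)
Lemma prod_pairs_sqr (F : 'I_n -> 'I_n -> R) : (forall i j, F i j = F j i) ->
  (\prod_(i < n) \prod_(j < n | (i < j)%N) F i j) ^+ 2 = \prod_(i < n) \prod_(j < n | j != i) F i j.
Proof.
move=> Fs.
have E (i : 'I_n) : \prod_(j < n | j != i) F i j = \prod_(j < n | (i < j)%N) F i j * \prod_(j < n | (j < i)%N) F i j.
  rewrite (bigID (fun j : 'I_n => (i < j)%N)) /=.
  by congr (_ * _); apply: eq_bigl => j; rewrite -(inj_eq val_inj) /=; case: ltngtP.
rewrite (eq_bigr _ (fun i _ => E i)) big_split expr2 /=; congr (_ * _).
rewrite (exchange_big_dep xpredT) //=; apply: eq_bigr => j _; apply: eq_bigr => i _; exact: Fs.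
Qed.
Lemma prod_pairs_eq (F : 'I_n -> 'I_n -> R) (c : R) : (forall i j, F i j = F j i) -> (forall i j, 0 <= F i j) -> 0 <= c ->
  \prod_(i < n) \prod_(j < n | j != i) F i j = c ^+ 2 -> \prod_(i < n) \prod_(j < n | (i < j)%N) F i j = c.
Proof.
move=> Fs F0 c0 e; apply/eqP; rewrite -(@eqrXn2 _ 2)//; last by apply: prodr_ge0 => i _; apply: prodr_ge0.
by rewrite prod_pairs_sqr// e.
Qed.
Lemma prod_pairs_perm (F : 'I_n -> 'I_n -> R) (s : 'S_n) : (forall i j, F i j = F j i) -> (forall i j, 0 <= F i j) ->
  \prod_(i < n) \prod_(j < n | (i < j)%N) F (s i) (s j) = \prod_(i < n) \prod_(j < n | (i < j)%N) F i j.
Proof.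
move=> Fs F0; apply: prod_pairs_eq => //; first by apply: prodr_ge0 => i _; apply: prodr_ge0.
rewrite prod_pairs_sqr// [RHS](reindex_inj (@perm_inj _ s)) /=; apply: eq_bigr => i _.
by rewrite [RHS](reindex_inj (@perm_inj _ s)) /=; apply: eq_bigl => j; rewrite (inj_eq perm_inj).
Qed.
Lemma prod_pairs_mul (b : 'I_n -> R) : (forall i, 0 <= b i) ->
  \prod_(i < n) \prod_(j < n | (i < j)%N) (b i * b j) = \prod_(i < n) b i ^+ n.-1.
Proof.
move=> b0; apply: (@prod_pairs_eq (fun i j => b i * b j)) => [i j|i j||]; rewrite ?mulr_ge0//; first exact: mulrC.
  by apply: prodr_ge0 => i _; rewrite exprn_ge0.
have c1 (i : 'I_n) : #|[pred j : 'I_n | j != i]| = n.-1 by rewrite -[in RHS](card_ord n) -(cardC1 i); apply: eq_card.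
have E (i : 'I_n) : \prod_(j < n | j != i) (b i * b j) = b i ^+ n.-1 * \prod_(j < n | j != i) b j.
  by rewrite big_split /= prodr_const c1.
rewrite (eq_bigr _ (fun i _ => E i)) big_split expr2 /=; congr (_ * _).
rewrite (exchange_big_dep xpredT) //=; apply: eq_bigr => j _; rewrite prodr_const -(c1 j); congr (_ ^+ _).
by apply: eq_card => i; rewrite !inE eq_sym.
Qed.
End pairs.

(** * The weight omega and its smoothing *)

Section omega.
Variables (R : realType) (n : nat) (k : R).
Hypothesis k0 : 0 <= k.
Implicit Types x : 'rV[R]_n.
Lemma omegaA_ge0 x : 0 <= omegaA k x.
Proof. by apply: prodr_ge0 => i _; apply: prodr_ge0 => j _; rewrite powR_ge0. Qed.
Lemma omegaA_permv (s : 'S_n) x : omegaA k (permv s x) = omegaA k x.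
Proof.
rewrite /omegaA -[RHS](@prod_pairs_perm _ _ (fun i j => `|x 0 i - x 0 j| `^ (2 * k)) s).
- by apply: eq_bigr => i _; apply: eq_bigr => j _; rewrite !mxE.
- by move=> i j; rewrite distrC.
- by move=> i j; rewrite powR_ge0.
Qed.
Lemma mu0E : mu0 n k = k * n.-1%:R. Proof. by rewrite /mu0 subn1. Qed.
Lemma omegaA_scale (e : R) x : 0 < e -> omegaA k (e *: x) = e `^ (n%:R * mu0 n k) * omegaA k x.
Proof.
move=> e0; have -> : e `^ (n%:R * mu0 n k) = \prod_(i < n) \prod_(j < n | (i < j)%N) (e `^ k * e `^ k).
  rewrite prod_pairs_mul => [|i]; last exact: powR_ge0.
  by rewrite prodr_const card_ord mu0E -!powR_mulrn ?powR_ge0// -!powRrM; congr (_ `^ _); ring.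
rewrite -big_split; apply: eq_bigr => i _; rewrite -big_split; apply: eq_bigr => j _ /=.
rewrite !mxE -mulrBr normrM gtr0_norm// powRM ?(ltW e0)//; congr (_ * _).
have -> : 2 * k = k + k by ring.
by rewrite powRD// (gt_eqF e0) implybT.
Qed.
Lemma omegaA_inv x : posv x -> omegaA k (rvinv x) = omegaA k x * \prod_i x 0 i `^ (- (2 * mu0 n k)).
Proof.
move=> x0; have -> : \prod_i x 0 i `^ (- (2 * mu0 n k)) = \prod_(i < n) \prod_(j < n | (i < j)%N) (x 0 i `^ (- (2 * k)) * x 0 j `^ (- (2 * k))).
  rewrite prod_pairs_mul => [|i]; last exact: powR_ge0.
  by apply: eq_bigr => i _; rewrite mu0E -powR_mulrn ?powR_ge0// -powRrM; congr (_ `^ _); ring.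
rewrite -big_split; apply: eq_bigr => i _; rewrite -big_split; apply: eq_bigr => j _ /=.
have xi := x0 i; have xj := x0 j; rewrite !mxE.
have -> : (x 0 i)^-1 - (x 0 j)^-1 = - (x 0 i - x 0 j) * ((x 0 i)^-1 * (x 0 j)^-1) by field; rewrite !gt_eqF.
rewrite normrM normrN [X in _ * X]ger0_norm ?mulr_ge0 ?invr_ge0 ?(ltW xi) ?(ltW xj)//.
rewrite powRM ?mulr_ge0 ?invr_ge0 ?(ltW xi) ?(ltW xj)// powRM ?invr_ge0 ?(ltW xi) ?(ltW xj)//.
by rewrite -!powR_inv1 ?(ltW xi) ?(ltW xj)// -!powRrM !mulN1r.
Qed.
(* Regularised weight, smooth for [eps > 0]: it makes the integration by parts on the walls x_i = x_j elementary. *)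
Definition omegaE (eps : R) x : R := \prod_(i < n) \prod_(j < n | (i < j)%N) ((x 0 i - x 0 j) ^+ 2 + eps) `^ k.
Lemma omegaE0 x : omegaE 0 x = omegaA k x.
Proof.
by apply: eq_bigr => i _; apply: eq_bigr => j _; rewrite addr0 powRrM powR_mulrn// real_normK// num_real.
Qed.
Lemma omegaE_ge0 eps x : 0 <= omegaE eps x.
Proof. by apply: prodr_ge0 => i _; apply: prodr_ge0 => j _; rewrite powR_ge0. Qed.
Lemma omegaE_permv (s : 'S_n) eps x : omegaE eps (permv s x) = omegaE eps x.
Proof.
rewrite /omegaE -[RHS](@prod_pairs_perm _ _ (fun i j => ((x 0 i - x 0 j) ^+ 2 + eps) `^ k) s).
- by apply: eq_bigr => i _; apply: eq_bigr => j _; rewrite !mxE.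
- by move=> i j; rewrite -sqrrN opprB.
- by move=> i j; rewrite powR_ge0.
Qed.
(** Since (x_i - x_j)^2 + eps <= ((1 + |x_i|) (1 + |x_j|))^2, uniformly in eps <= 1, the weight is
    at most a product of one-variable powers, each absorbed by an exponential. The exponent n + n
    comes from extending the product to all ordered pairs, the additional factors being at least
    1. *)
Lemma omegaE_le (eta : R) : 0 < eta -> exists2 C, 0 < C & forall eps x, 0 <= eps <= 1 -> omegaE eps x <= C * expR (eta * \sum_i `|x 0 i|).
Proof.
move=> e0; pose N : R := (n + n)%:R; have N0 : 0 <= N by rewrite ler0n.
have e1 : 0 < eta / (N + 1) by rewrite divr_gt0// ltr_wpDl.
have [C C0 HC] := powR_le_expR (mulr_ge0 (ler0n R 2) k0) e1.
pose K := C * expR (eta / (N + 1)); have K0 : 0 < K by rewrite mulr_gt0 ?expR_gt0.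
exists ((K ^+ (n + n)) ^+ n); first by rewrite !exprn_gt0.
move=> eps x /andP[eps0 eps1]; pose a i := (1 + `|x 0 i|) `^ (2 * k).
have a1 i : 1 <= a i by rewrite -(powRr0 (1 + `|x 0 i|)) ler_powR ?mulr_ge0// lerDl.
have a0 i : 0 <= a i by exact: powR_ge0.
have ak i : a i <= K * expR (eta / (N + 1) * `|x 0 i|).
  apply: le_trans (HC _ _) _; first by rewrite ltr_pwDl.
  by rewrite /K mulrDr mulr1 expRD mulrA.
apply: (@le_trans _ _ (\prod_(i < n) \prod_(j < n) (a i * a j))).
  apply: ler_prod => i _; rewrite prodr_ge0 /=; last by move=> j _; rewrite powR_ge0.
  rewrite [leRHS](bigID (fun j : 'I_n => (i < j)%N)) /=.
  apply: (@le_trans _ _ (\prod_(j < n | (i < j)%N) (a i * a j))).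
    apply: ler_prod => j _; rewrite powR_ge0 /= /a -powRM ?addr_ge0// powRrM powR_mulrn ?mulr_ge0 ?addr_ge0//.
    apply: ge0_ler_powR => //; rewrite ?nnegrE ?addr_ge0 ?sqr_ge0//.
    have h : (x 0 i - x 0 j) ^+ 2 <= (`|x 0 i| + `|x 0 j|) ^+ 2.
      by rewrite -(real_normK (num_real (x 0 i - x 0 j))) lerXn2r ?nnegrE ?addr_ge0// ler_normB.
    have := normr_ge0 (x 0 i); have := normr_ge0 (x 0 j); move: h; move: (_ ^+ 2) `|x 0 i| `|x 0 j| => D u v h v0 u0.
    have uv : 0 <= u * v by rewrite mulr_ge0.
    have : (u + v + 1) ^+ 2 <= ((1 + u) * (1 + v)) ^+ 2 by rewrite lerXn2r ?nnegrE ?mulr_ge0 ?addr_ge0//; lra.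
    have : D + eps <= (u + v + 1) ^+ 2 by nra.
    exact: le_trans.
  rewrite ler_peMr//; first by apply: prodr_ge0 => j _; rewrite mulr_ge0.
  by apply: (big_ind (fun p => 1 <= p)) => // [u v u1 v1|j _]; rewrite -[leLHS]mulr1; apply: ler_pM.
have -> : \prod_(i < n) \prod_(j < n) (a i * a j) = \prod_i a i ^+ (n + n).
  rewrite (eq_bigr (fun i => a i ^+ n * \prod_j a j)); last by move=> i _; rewrite big_split /= prodr_const card_ord.
  by rewrite big_split /= prodr_const card_ord !prodrXl -exprD.
rewrite mulr_sumr expR_sum.
have -> : (K ^+ (n + n)) ^+ n = \prod_(i < n) K ^+ (n + n) by rewrite prodr_const card_ord.
rewrite -big_split /=; apply: ler_prod => i _; rewrite exprn_ge0//=.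
apply: (@le_trans _ _ ((K * expR (eta / (N + 1) * `|x 0 i|)) ^+ (n + n))).
  by apply: lerXn2r; rewrite ?nnegrE ?mulr_ge0 ?expR_ge0 ?(ltW C0).
rewrite exprMn ler_wpM2l ?exprn_ge0 ?(ltW K0)// -expRM_natl ler_expR -/N.
rewrite mulrA ler_wpM2r// mulrCA ger_pMr// ler_pdivrMr ?ltr_wpDl// mul1r lerDl//.
Qed.
Lemma omegaA_le (eta : R) : 0 < eta -> exists2 C, 0 < C & forall x, omegaA k x <= C * expR (eta * \sum_i `|x 0 i|).
Proof. by move=> /omegaE_le [C C0 H]; exists C => // x; rewrite -omegaE0; apply: H; rewrite lexx ler01. Qed.
End omega.

(** * Measurability and domination on the positive orthant *)

Section vmeas.
Variables (R : realType) (n : nat).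
Local Notation T := (n.-tuple (measurableTypeR R)).
Local Notation V := ('rV[CC R]_n).
Local Notation pos := (`]0%R, +oo[%classic : set (measurableTypeR R)).
Definition tv (s : T) : 'rV[R]_n := vec_of_seq n s.
Lemma tvE (s : T) i : tv s 0 i = tnth s i.
Proof. by rewrite mxE (tnth_nth 0). Qed.
Lemma measurable_pos : measurable pos. Proof. exact: measurable_itv. Qed.
Definition Dpos : set T := tset pos n.
Lemma measurable_Dpos : measurable Dpos. Proof. exact: (measurable_tset measurable_pos). Qed.
Lemma Dpos_posv s : Dpos s <-> posv (tv s).
Proof.
split => h i; have := h i; rewrite tvE /= in_itv /= andbT; exact.
Qed.
Lemma measurable_tv i (E : set T) : measurable_fun E (fun s : T => tv s 0 i).
Proof.
rewrite (_ : (fun s : T => _) = (fun s => tnth s i)); first by apply: measurable_funTS; exact: measurable_tnth.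
by apply/funext => s; rewrite tvE.
Qed.
Lemma tv_tmap (f : R -> R) (s : T) : tv (tmap f s) = map_mx f (tv s).
Proof. by apply/rowP => i; rewrite [RHS]mxE !tvE tnth_map. Qed.
Lemma tv_permt (sg : 'S_n) (s : T) : tv (permt sg s) = permv sg (tv s).
Proof. by apply/rowP => i; rewrite [RHS]mxE !tvE tnth_mktuple. Qed.
Lemma prod_tv (h : R -> R) (s : T) : \prod_(t <- s) h t = \prod_i h (tv s 0 i).
Proof. by rewrite big_tuple; apply: eq_bigr => i _; rewrite tvE. Qed.

Section meas.
Context d (X : measurableType d).
Variables (D : set X) (k : R).
Hypothesis k0 : 0 <= k.
Lemma cmeas_EF m (l z : X -> V) : (forall i, cmeas D (fun x => l x 0 i)) -> (forall i, cmeas D (fun x => z x 0 i)) ->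
  cmeas D (fun x => EF k0 m (l x) (z x)).
Proof.
move=> ml; elim: m z => [|m IH] z mz; first exact: cmeas_cst.
apply: cmeas_sum => s _; apply: cmeasM; first exact: cmeas_cst.
apply: cmeasM; last by apply: IH => i; apply: eq_cmeas (mz (s i)) => x _; rewrite mxE.
by apply: cmeas_sum => i _; apply: cmeasM => //; apply: eq_cmeas (mz (s i)) => x _; rewrite mxE.
Qed.
Lemma cmeas_EE (l z : X -> V) : (forall i, cmeas D (fun x => l x 0 i)) -> (forall i, cmeas D (fun x => z x 0 i)) ->
  cmeas D (fun x => EE k0 (l x) (z x)).
Proof.
move=> ml mz; apply: (cmeas_cvg (F := fun N x => \sum_(0 <= m < N) EF k0 m (l x) (z x))).
  by move=> N; apply: cmeas_sum => m _; exact: cmeas_EF.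
by move=> x _; exact/csum_partial/EF_summable.
Qed.
Lemma cmeas_cpow (f : X -> R) s : measurable_fun D f -> (forall x, D x -> 0 < f x) -> cmeas D (fun x => cpow (RC (f x)) s).
Proof.
move=> mf f0; pose g x : R := ln (f x).
have mg : measurable_fun D g by apply: measurableT_comp => //; exact: measurable_ln.
have me : measurable_fun D (fun x => expR (cRe s * g x)).
  by apply: measurableT_comp => //; apply: measurable_funM.
have E x : x \in D -> Complex (expR (cRe s * g x) * cos (cIm s * g x)) (expR (cRe s * g x) * sin (cIm s * g x)) = cpow (RC (f x)) s :> CC R.
  move=> /set_mem Dx; rewrite cpowE; last exact: f0.
  by rewrite /cexp cReM cImM cReRC cImRC !mulr0 subr0 add0r.
have mc : measurable_fun D (fun x => cos (cIm s * g x)).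
  apply: (measurableT_comp (f := @cos R)); first by apply: continuous_measurable_fun; exact: continuous_cos.
  exact: measurable_funM.
have ms : measurable_fun D (fun x => sin (cIm s * g x)).
  apply: (measurableT_comp (f := @sin R)); first by apply: continuous_measurable_fun; exact: continuous_sin.
  exact: measurable_funM.
by apply: (eq_cmeas E); split; exact: measurable_funM.
Qed.
End meas.
Section measD.
Variables (D : set T) (k : R).
Hypothesis k0 : 0 <= k.
Lemma cmeas_EE_neg w : cmeas D (fun s => EE k0 (- rv2C (tv s)) w).
Proof.
apply: cmeas_EE => i; last exact: cmeas_cst.
apply: eq_cmeas (cmeasN (cmeas_RC (@measurable_tv i D))) => s _; by rewrite !mxE.
Qed.
Lemma cmeas_EE_inv w : cmeas D (fun s => EE k0 (- rv2C (rvinv (tv s))) w).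
Proof.
apply: cmeas_EE => i; last exact: cmeas_cst.
have m : measurable_fun D (fun s => (tv s 0 i)^-1).
  by apply: (measurableT_comp (@measurable_inv R)); exact: measurable_tv.
by apply: eq_cmeas (cmeasN (cmeas_RC m)) => s _; rewrite !mxE.
Qed.
Lemma measurable_omegaA : measurable_fun D (fun s => omegaA k (tv s)).
Proof.
apply: measurable_prod => i _.
have E : (fun s : T => \prod_(j < n | (i < j)%N) `|tv s 0 i - tv s 0 j| `^ (2 * k)) =
  (fun s : T => \prod_(j < n) (if (i < j)%N then `|tv s 0 i - tv s 0 j| `^ (2 * k) else 1)).
  by apply/funext => s; rewrite big_mkcond.
rewrite E; apply: measurable_prod => j _; case: (i < j)%N; last exact: measurable_cst.
apply: (measurableT_comp (f := fun t : measurableTypeR R => t `^ (2 * k))); first exact: measurable_powRl.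
apply: measurableT_comp => //.
by apply: measurable_funB; exact: measurable_tv.
Qed.
End measD.
Lemma measurable_omegaE (D : set T) k eps : measurable_fun D (fun s => omegaE k eps (tv s)).
Proof.
apply: measurable_prod => i _.
have E : (fun s : T => \prod_(j < n | (i < j)%N) ((tv s 0 i - tv s 0 j) ^+ 2 + eps) `^ k) =
  (fun s : T => \prod_(j < n) (if (i < j)%N then ((tv s 0 i - tv s 0 j) ^+ 2 + eps) `^ k else 1)).
  by apply/funext => s; rewrite big_mkcond.
rewrite E; apply: measurable_prod => j _; case: (i < j)%N; last exact: measurable_cst.
apply: (measurableT_comp (f := fun t : measurableTypeR R => t `^ k)); first exact: measurable_powRl.
apply: measurable_funD => //; apply: measurable_funX.
by apply: measurable_funB; exact: measurable_tv.
Qed.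
Lemma cmeas_Deltapow s : cmeas Dpos (fun x => Deltapow (rv2C (tv x)) s).
Proof.
apply: cmeas_prod => i _; have H : cmeas Dpos (fun x => cpow (RC (tv x 0 i)) s).
  apply: cmeas_cpow; first exact: measurable_tv.
  by move=> x /Dpos_posv.
by apply: eq_cmeas H => x _; rewrite rv2C_coord.
Qed.
End vmeas.

Section vint.
Variables (R : realType) (n : nat).
Local Notation T := (n.-tuple (measurableTypeR R)).
Local Notation V := ('rV[CC R]_n).
Local Notation pos := (`]0%R, +oo[%classic : set (measurableTypeR R)).
Implicit Types G : 'rV[R]_n -> CC R.
Definition vmeas G := cmeas (@Dpos R n) (fun s => G (tv s)).
Definition vintble G := cintble (tmu R n) (@Dpos R n) (fun s => G (tv s)).
Definition vint G := cint (tmu R n) (@Dpos R n) (fun s => G (tv s)).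
(** A product of unnormalised Gamma densities; it has the product form required of the majorants for
    iterated integrals. *)
Definition vmaj (a delta : R) (x : 'rV[R]_n) : R := (\prod_i x 0 i `^ (a - 1)) * expR (- (delta * vsum x)).
Lemma vmajE a delta (s : T) : vmaj a delta (tv s) = \prod_(t <- s) (t `^ (a - 1) * expR (- (delta * t))).
Proof.
rewrite prod_tv big_split /vmaj /=; congr (_ * _); rewrite -expR_sum; congr expR.
by rewrite /vsum mulr_sumr -sumrN.
Qed.
Lemma measurable_gmaj (a delta : R) : measurable_fun setT ((fun t => t `^ (a - 1) * expR (- (delta * t))) : measurableTypeR R -> R).
Proof.
apply: measurable_funM; first exact: measurable_powRl.
by apply: measurableT_comp => //; apply: measurableT_comp => //; exact: measurable_funM.
Qed.
Lemma vmaj_ge0 a delta x : 0 <= vmaj a delta x.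
Proof. by rewrite mulr_ge0 ?expR_ge0// prodr_ge0// => i _; exact: powR_ge0. Qed.
Section dominated.
Variables (G : 'rV[R]_n -> CC R) (C a delta : R).
Hypotheses (a0 : 0 < a) (d0 : 0 < delta) (mG : vmeas G).
Hypothesis bG : forall x, posv x -> cmod (G x) <= C * vmaj a delta x.
Let gm0 t : 0 <= t `^ (a - 1) * expR (- (delta * t)) :> R.
Proof. by rewrite mulr_ge0 ?powR_ge0 ?expR_ge0. Qed.
Lemma dom_intble : vintble G.
Proof.
have [mR mI] := mG; split; apply: (tintegrable (@measurable_pos R) (measurable_gmaj a delta) gm0 (gamma_integrable a0 d0) (C := C)) => //.
  by move=> s /Dpos_posv Ds; rewrite -vmajE; apply: le_trans (bG Ds); exact: cRe_le_norm.
by move=> s /Dpos_posv Ds; rewrite -vmajE; apply: le_trans (bG Ds); exact: cIm_le_norm.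
Qed.
Lemma dom_intC : intC_pos n G = vint G.
Proof.
have [mR mI] := mG; rewrite /intC_pos /vint /cint; congr Complex.
  apply: (iintE (@measurable_pos R) (measurable_gmaj a delta) gm0 (gamma_integrable a0 d0) (C := C)) => //.
  by move=> s /Dpos_posv Ds; rewrite -vmajE; apply: le_trans (bG Ds); exact: cRe_le_norm.
apply: (iintE (@measurable_pos R) (measurable_gmaj a delta) gm0 (gamma_integrable a0 d0) (C := C)) => //.
by move=> s /Dpos_posv Ds; rewrite -vmajE; apply: le_trans (bG Ds); exact: cIm_le_norm.
Qed.
Lemma dom_abs : abs_conv_pos n G.
Proof.
have mc := cmeas_cmod mG.
rewrite /abs_conv_pos (iint_absE (@measurable_pos R))//.
have /integrableP [_ h] := tintegrable (@measurable_pos R) (measurable_gmaj a delta) gm0 (gamma_integrable a0 d0) (C := C) mc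
  (fun s Ds => ltac:(by rewrite -vmajE ger0_norm ?cmod_ge0//; apply: bG; apply/Dpos_posv)).
exact: h.
Qed.
End dominated.
End vint.

(** * Integrals over the positive orthant *)
Section vint_cov.
Variables (R : realType) (n : nat).
Local Notation T := (n.-tuple (measurableTypeR R)).
Local Notation pos := (`]0%R, +oo[%classic : set (measurableTypeR R)).
Implicit Types G : 'rV[R]_n -> CC R.
Lemma vintble_eq G G' : (forall x, posv x -> G x = G' x) -> vintble G -> vintble G'.
Proof. by move=> e; apply: (eq_cintble (@measurable_Dpos R n)) => s /set_mem/Dpos_posv/e. Qed.
Lemma vint_eq G G' : (forall x, posv x -> G x = G' x) -> vint G = vint G'.
Proof. by move=> e; apply: eq_cint => s /set_mem/Dpos_posv/e. Qed.
Lemma vintble_dom G G' : vmeas G -> vintble G' -> (forall x, posv x -> `|G x| <= G' x) -> vintble G.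
Proof. by move=> mG iG' b; apply: (cintble_dom (@measurable_Dpos R n) mG iG') => s /Dpos_posv/b. Qed.
Lemma vint_perm (sg : 'S_n) G : vintble G -> vintble (fun x => G (permv sg x)) /\ vint (fun x => G (permv sg x)) = vint G.
Proof.
move=> iG; have mD := @measurable_Dpos R n.
have [a b] := cvar_cint mD mD (@measurable_permt R n sg) (measurable_cst (1 : R)) (fun x _ => ler01)
  (fun x Dx => ltac:(by move=> i; rewrite tnth_mktuple; exact: Dx)) (cvar_permt sg (@measurable_pos R)) iG.
have E : forall s, Dpos s -> G (tv (permt sg s)) * RC 1 = G (permv sg (tv s)) by move=> s _; rewrite mulr1 tv_permt.
split; first by apply: (eq_cintble mD) a => s /set_mem/E.
by rewrite /vint -b; apply: eq_cint => s /set_mem/E.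
Qed.
Lemma cvar_tmapE (f : R -> R) (J : R -> R) G : measurable_fun setT (f : measurableTypeR R -> measurableTypeR R) ->
  measurable_fun setT (J : measurableTypeR R -> R) -> (forall t, 0 < t -> 0 <= J t) -> (forall t, 0 < t -> 0 < f t) ->
  cvar (@lebesgue_measure R) pos (f : measurableTypeR R -> measurableTypeR R) J (@lebesgue_measure R) pos ->
  vintble G -> vintble (fun x => G (map_mx f x) * RC (\prod_i J (x 0 i))) /\ vint (fun x => G (map_mx f x) * RC (\prod_i J (x 0 i))) = vint G.
Proof.
move=> mf mJ J0 f0 cv iG; have mD := @measurable_Dpos R n; have mp := @measurable_pos R.
have J0' t : pos t -> 0 <= J t by rewrite /= in_itv /= andbT; exact: J0.
have [a b] := cvar_cint mD mD (@measurable_tmap R f n mf) (@measurable_tprod R J n mJ)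
  (fun x (Dx : Dpos x) => ltac:(by apply: prodr_ge0 => i _; apply: J0'; exact: Dx))
  (fun x (Dx : Dpos x) => ltac:(by move=> i; rewrite tnth_map; have := Dx i; rewrite /= !in_itv /= !andbT; exact: f0))
  (cvar_tuple mp mp mf mJ J0' cv) iG.
have E : forall s : T, Dpos s -> G (tv (tmap f s)) * RC (\prod_(i < n) J (tnth s i)) = G (map_mx f (tv s)) * RC (\prod_i J (tv s 0 i)).
  by move=> s _; rewrite tv_tmap; congr (_ * RC _); apply: eq_bigr => i _; rewrite tvE.
split; first by apply: (eq_cintble mD) a => s /set_mem/E.
by rewrite /vint -b; apply: eq_cint => s /set_mem/E.
Qed.
Lemma vint_inv G : vintble G -> vintble (fun x => G (rvinv x) * RC (\prod_i (x 0 i ^+ 2)^-1)) /\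
  vint (fun x => G (rvinv x) * RC (\prod_i (x 0 i ^+ 2)^-1)) = vint G.
Proof.
move=> iG; have [] := @cvar_tmapE (fun x => x^-1) (fun x => (x ^+ 2)^-1) G.
- exact: measurable_inv.
- by apply: (measurableT_comp (@measurable_inv R)); exact: exprn_measurable.
- by move=> t _; rewrite invr_ge0 sqr_ge0.
- by move=> t t0; rewrite invr_gt0.
- exact: cvar_inv.
- exact: iG.
have E x : map_mx (fun t : R => t^-1) x = rvinv x :> 'rV_n by apply/rowP => i; rewrite !mxE.
by move=> a b; split; [apply: vintble_eq a => x _|rewrite -b; apply: vint_eq => x _]; rewrite E.
Qed.
Lemma vint_scale (e : R) G : 0 < e -> vintble G -> vintble (fun x => G (e *: x) * RC (e ^+ n)) /\
  vint (fun x => G (e *: x) * RC (e ^+ n)) = vint G.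
Proof.
move=> e0 iG; have [] := @cvar_tmapE (fun x => 0 + e * x) (fun=> e) G.
- by apply: measurable_funD => //; exact: measurable_funM.
- exact: measurable_cst.
- by move=> t _; exact: ltW.
- by move=> t t0; rewrite add0r mulr_gt0.
- have := cvar_affine 0 e0 (@measurable_pos R); rewrite (_ : (fun u => 0 + e * u) @^-1` _ = pos)//.
  by apply/seteqP; split => t /=; rewrite !in_itv /= !andbT add0r pmulr_rgt0.
- exact: iG.
have E x : map_mx (fun t : R => 0 + e * t) x = e *: x :> 'rV_n by apply/rowP => i; rewrite !mxE add0r.
have E' : \prod_(i < n) e = e ^+ n by rewrite prodr_const card_ord.
by move=> a b; split; [apply: vintble_eq a => x _|rewrite -b; apply: vint_eq => x _]; rewrite E E'.
Qed.
End vint_cov.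

Section scale1.
Variable R : realType.
Local Notation T n := (n.-tuple (measurableTypeR R)).
Local Notation leb := (@lebesgue_measure R).
Local Notation pos := (`]0%R, +oo[%classic : set (measurableTypeR R)).
Definition scale_head n (e : R) (x : T n.+1) : T n.+1 := consT (e * thead x : measurableTypeR R, behT x).
Lemma measurable_sc0 n e : measurable_fun setT (@scale_head n e).
Proof.
apply: (measurableT_comp (@measurable_consT R n)); apply/measurable_fun_pairP; split.
  by apply: measurable_funM => //; exact: measurable_tnth.
exact: measurable_behead.
Qed.
Lemma cvar_sc0 n (e : R) : 0 < e -> cvar (tmu R n.+1) (@Dpos R n.+1) (@scale_head n e) (fun=> e) (tmu R n.+1) (@Dpos R n.+1).
Proof.
move=> e0 f mf f0; have mp := @measurable_pos R.
have mfs : measurable_fun setT (fun x => f (scale_head e x) * e%:E)%E.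
  by apply: emeasurable_funM => //; apply: measurableT_comp => //; exact: measurable_sc0.
rewrite tmu_recl_set//; last 2 first.
- exact: measurable_funTS.
- by move=> x _; rewrite mule_ge0// lee_fin ltW.
rewrite [RHS]tmu_recl_set//; last exact: measurable_funTS.
pose g (u : measurableTypeR R) := (\int[tmu R n]_(s in @Dpos R n) f (consT (u, s)))%E.
have mDn := @measurable_Dpos R n.
have cv := cvar_affine 0 e0 mp.
rewrite -[RHS](_ : (\int[leb]_(u in (fun u : measurableTypeR R => 0 + e * u)%R @^-1` pos) (g (0 + e * u)%R * e%:E) = _)%E); last first.
  apply: cv.
  - rewrite (_ : g = fun u => \int[tmu R n]_s (fun x => f x * (\1_(@Dpos R n) (behT x))%:E) (consT (u, s)))%E.
      apply: (@measurable_int_section R n (fun x => f x * (\1_(@Dpos R n) (behT x))%:E)%E).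
        apply: emeasurable_funM => //; apply/measurable_EFinP.
        by apply: measurableT_comp => //; exact: measurable_behead.
      by move=> x; rewrite mule_ge0// lee_fin.
    apply/funext => u; rewrite /g integral_mkcond; apply: eq_integral => s _.
    by rewrite behTE /patch indicE; case: ifPn; rewrite ?mule1 ?mule0.
  - by move=> y; apply: integral_ge0.
rewrite (_ : (fun u => 0 + e * u) @^-1` pos = pos); last first.
  by apply/seteqP; split => t /=; rewrite !in_itv /= !andbT add0r pmulr_rgt0.
apply: eq_integral => t _; rewrite /g -ge0_integralZr//; last 2 first.
- by apply: measurable_funTS; exact: measurable_section.
- by rewrite lee_fin ltW.
by apply: eq_integral => s _; rewrite /scale_head behTE add0r theadE.
Qed.
Definition vscale n (i : 'I_n) (e : R) (x : 'rV[R]_n) : 'rV[R]_n := \row_j (if j == i then e * x 0 j else x 0 j).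
(** For the head coordinate this is one Tonelli step; conjugation by the transposition (0 i) moves
    it to coordinate i. The free parameter e is later differentiated at e = 1. *)
Lemma vint_scale1 n (i : 'I_n) (e : R) (G : 'rV[R]_n -> CC R) : 0 < e -> vintble G ->
  vintble (fun x => G (vscale i e x) * RC e) /\ vint (fun x => G (vscale i e x) * RC e) = vint G.
Proof.
case: n i G => [|n] i G e0 iG; first by case: i.
have [iG1 e1] := vint_perm (tperm ord0 i) iG.
have mD := @measurable_Dpos R n.+1.
have D0 (x : T n.+1) : Dpos x -> Dpos (scale_head e x).
  move=> Dx j; case: (unliftP ord0 j) => [j'|] ->; last first.
    by rewrite tnth0 /=; have := Dx ord0; rewrite /= !in_itv /= !andbT => h; rewrite mulr_gt0.
  by rewrite tnthS tnth_behead; exact: Dx.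
have [a b] := cvar_cint mD mD (@measurable_sc0 n e) (measurable_cst e) (fun x _ => ltW e0) D0 (@cvar_sc0 n e e0) iG1.
have tvsc (s : T n.+1) : tv (scale_head e s) = vscale ord0 e (tv s).
  apply/rowP => j; rewrite [RHS]mxE !tvE; case: (unliftP ord0 j) => [j'|] ->.
    rewrite tnthS tnth_behead (_ : (lift ord0 j' == ord0) = false)//; congr (tnth s _).
    by apply: val_inj; rewrite /= inordK// ltnS.
  by rewrite tnth0 eqxx.
have i2 : vintble (fun x => G (permv (tperm ord0 i) (vscale ord0 e x)) * RC e).
  by apply: (eq_cintble mD) a => s _; rewrite /= tvsc.
have E2 : vint (fun x => G (permv (tperm ord0 i) (vscale ord0 e x)) * RC e) = vint G.
  by rewrite -e1; apply: etrans b; apply: eq_cint => s _; rewrite /= tvsc.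
have [i3 E3] := vint_perm (tperm ord0 i) i2.
have E x : permv (tperm ord0 i) (vscale ord0 e (permv (tperm ord0 i) x)) = vscale i e x.
  apply/rowP => j; rewrite !mxE tpermK -(inj_eq (@perm_inj _ (tperm ord0 i))) tpermK tpermL.
  by [].
split; first by apply: vintble_eq i3 => x _; rewrite E.
by rewrite -E2 -E3; apply: vint_eq => x _; rewrite E.
Qed.
End scale1.

Section bounds.
Variables (R : realType) (n : nat) (k : R).
Hypothesis k0 : 0 <= k.
Local Notation V := ('rV[CC R]_n).
Implicit Types x : 'rV[R]_n.
(** For t >= 1 the power is absorbed by e^(delta t), and for t < 1 by e^(-eta / t), after replacing
    t by 1/t. *)
Lemma two_sided (M eta delta : R) : 0 <= M -> 0 < eta -> 0 < delta ->
  exists2 C, 0 < C & forall t : R, 0 < t -> expR (M * `|ln t|) * expR (- (eta / t)) <= C * expR (delta * t).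
Proof.
move=> M0 e0 d0; have [C1 C10 H1] := powR_le_expR M0 d0; have [C2 C20 H2] := powR_le_expR M0 e0.
exists (C1 + C2) => [|t t0]; first exact: addr_gt0.
have d1 : 1 <= expR (delta * t) by rewrite -expR0 ler_expR mulr_ge0// ltW.
have [l0|l0] := leP 0 (ln t).
  apply: (@le_trans _ _ (C1 * expR (delta * t))); last by rewrite ler_wpM2r ?expR_ge0// lerDl ltW.
  apply: le_trans (H1 t t0); rewrite /powR gt_eqF// ger0_norm// ler_piMr ?expR_ge0//.
  by rewrite -expR0 ler_expR oppr_le0 divr_ge0// ltW.
apply: (@le_trans _ _ (C2 * 1)); last by apply: ler_pM; rewrite ?(ltW C20)// lerDr ltW.
have ti : 0 < t^-1 by rewrite invr_gt0.
have := H2 _ ti; rewrite /powR gt_eqF// lnV ?posrE// ltr0_norm// => h.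
by rewrite expRN ler_pdivrMr ?expR_gt0// mulr1.
Qed.
Lemma prod_expR_ln x (M : R) : \prod_i expR (M * `|ln (x 0 i)|) = expR (M * \sum_i `|ln (x 0 i)|).
Proof. by rewrite mulr_sumr expR_sum. Qed.
Definition lnsum x : R := \sum_i `|ln (x 0 i)|.
Lemma vmaj1 delta x : posv x -> vmaj 1 delta x = expR (- (delta * vsum x)).
Proof. by move=> x0; rewrite /vmaj big1 ?mul1r// => i _; rewrite subrr powRr0. Qed.
Lemma posv_ge0 x : posv x -> vge0 x. Proof. by move=> h i; exact: ltW. Qed.
Lemma posv_inv x : posv x -> posv (rvinv x). Proof. by move=> h i; rewrite mxE invr_gt0. Qed.
(** The factor e^(M lnsum x) dominates powers of Delta of exponent up to M in absolute value, at 0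
    and at infinity alike. Of the rate delta one quarter is spent on it, one quarter on the weight,
    and delta/2 remains. *)
Lemma bessel_majorant_le (M delta eta : R) : 0 <= M -> 0 < delta -> 0 < eta ->
  exists2 C, 0 <= C & forall x, posv x ->
    expR (- (delta * vsum x)) * expR (- (eta * vsum (rvinv x))) * expR (M * lnsum x) * omegaA k x <= C * vmaj 1 (delta / 2) x.
Proof.
move=> M0 d0 e0; have d4 : 0 < delta / 4 by rewrite divr_gt0.
have [C1 C10 H1] := two_sided M0 e0 d4; have [C2 C20 H2] := omegaA_le n k0 d4.
exists (C1 ^+ n * C2) => [|x x0]; first by rewrite mulr_ge0 ?exprn_ge0 ?(ltW C10) ?(ltW C20).
rewrite vmaj1//.
have b1 : expR (- (eta * vsum (rvinv x))) * expR (M * lnsum x) <= C1 ^+ n * expR (delta / 4 * vsum x).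
  rewrite /lnsum -prod_expR_ln /vsum !mulr_sumr -sumrN !expR_sum -big_split /=.
  have -> : C1 ^+ n = \prod_(i < n) C1 by rewrite prodr_const card_ord.
  rewrite -big_split /=; apply: ler_prod => i _; rewrite mulr_ge0 ?expR_ge0//= mulrC mxE.
  exact: H1.
have b2 : omegaA k x <= C2 * expR (delta / 4 * vsum x).
  apply: le_trans (H2 x) _; rewrite (_ : \sum_i `|x 0 i| = vsum x)//.
  by apply: eq_bigr => i _; rewrite gtr0_norm.
have -> : expR (- (delta / 2 * vsum x)) = expR (- (delta * vsum x)) * (expR (delta / 4 * vsum x) * expR (delta / 4 * vsum x)).
  by rewrite -!expRD; congr expR; field.
have as4 (A B E D : R) : A * B * E * D = A * (B * E * D) by ring.
have as5 (Cn D A E : R) : Cn * D * (A * (E * E)) = A * ((Cn * E) * (D * E)) by ring.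
rewrite as4 as5 ler_wpM2l ?expR_ge0//; apply: ler_pM; [by rewrite mulr_ge0 ?expR_ge0|exact: omegaA_ge0|exact: b1|exact: b2].
Qed.
Lemma laplace_majorant_le (a delta : R) : 0 < delta -> exists2 C, 0 <= C & forall x, posv x ->
  expR (- (delta * vsum x)) * (\prod_i x 0 i `^ (a - 1)) * omegaA k x <= C * vmaj a (delta / 2) x.
Proof.
move=> d0; have d2 : 0 < delta / 2 by rewrite divr_gt0.
have [C2 C20 H2] := omegaA_le n k0 d2; exists C2 => [|x x0]; first exact: ltW.
have b2 : omegaA k x <= C2 * expR (delta / 2 * vsum x).
  apply: le_trans (H2 x) _; rewrite (_ : \sum_i `|x 0 i| = vsum x)//.
  by apply: eq_bigr => i _; rewrite gtr0_norm.
have -> : C2 * vmaj a (delta / 2) x = expR (- (delta * vsum x)) * (\prod_i x 0 i `^ (a - 1)) * (C2 * expR (delta / 2 * vsum x)).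
  have -> : expR (- (delta * vsum x)) = expR (- (delta / 2 * vsum x)) * expR (- (delta / 2 * vsum x)) by rewrite -expRD; congr expR; field.
  have E : expR (- (delta / 2 * vsum x)) * expR (delta / 2 * vsum x) = 1 by rewrite -expRD addNr expR0.
  rewrite /vmaj; move: E; move: (expR (- _)) (expR (delta / 2 * vsum x)) (\prod_i _) => A B P E.
  rewrite [RHS](_ : _ = P * A * C2 * (A * B)); last by ring.
  by rewrite E mulr1; ring.
rewrite ler_wpM2l// mulr_ge0 ?expR_ge0// prodr_ge0// => i _; exact: powR_ge0.
Qed.
Lemma prod_powR_le x (b : R) : posv x -> \prod_i x 0 i `^ b <= expR (`|b| * lnsum x).
Proof.
move=> x0; rewrite /lnsum -prod_expR_ln; apply: ler_prod => i _; rewrite powR_ge0 /= /powR gt_eqF// ler_expR -normrM.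
exact: ler_norm.
Qed.
End bounds.

(** * Dunkl operators under the integral sign *)

Section param.
Variables (R : realType) (n : nat) (k : R).
Hypothesis k0 : 0 <= k.
Local Notation V := ('rV[CC R]_n).
Implicit Types (x : 'rV[R]_n) (z w : V).
Lemma RePos_min z : RePos z -> exists2 d : R, 0 < d & forall i, d < cRe (z 0 i).
Proof.
(* 1/(S + 1) lies strictly below every Re z_i, because S >= 1 / Re z_i for each i; this avoids a
   minimum over the indices. *)
move=> z0; pose S := \sum_i (cRe (z 0 i))^-1; have S0 : 0 <= S by apply: sumr_ge0 => i _; rewrite invr_ge0 ltW.
exists (S + 1)^-1; first by rewrite invr_gt0 ltr_wpDl.
have S1 : 0 < S + 1 by rewrite ltr_wpDl.
move=> i; have h := z0 i; rewrite -[ltRHS]invrK ltf_pV2 ?posrE ?invr_gt0//.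
apply: (@le_lt_trans _ _ S); last by rewrite ltrDl.
by rewrite /S (bigD1 i)//= lerDl sumr_ge0// => j _; rewrite invr_ge0; exact: ltW.
Qed.
Lemma RePos_near z (d r : R) h : (forall i, d + r < cRe (z 0 i)) -> `|h| <= RC r -> forall i, d < cRe ((z + h) 0 i).
Proof.
move=> dz hr i; have := le_trans (coord_le_norm h i) hr; rewrite cmod_leP => hi.
rewrite mxE cReD; have := cRe_le_norm (h 0 i); rewrite ler_norml => /andP[l _].
have := dz i; lra.
Qed.
Variable u : 'rV[R]_n -> 'rV[R]_n.
Hypothesis u0 : forall x, posv x -> vge0 (u x).
Hypothesis mu : forall i, measurable_fun (@Dpos R n) (fun s => u (tv s) 0 i).
(* Weights [psi] for which [z |-> int E(-u(x), z) psi(x) dx] may be differentiated under the integral sign. *)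
Definition goodw (psi : 'rV[R]_n -> CC R) := vmeas psi /\ forall d : R, 0 < d -> vintble (fun x => RC (expR (- (d * vsum (u x)))) * `|psi x|).
Lemma vmeas_EEu w : vmeas (fun x => EE k0 (- rv2C (u x)) w).
Proof.
apply: cmeas_EE => i; last exact: cmeas_cst.
by apply: eq_cmeas (cmeasN (cmeas_RC (mu i))) => s _; rewrite !mxE.
Qed.
Section psi.
Variable psi : 'rV[R]_n -> CC R.
Hypothesis gpsi : goodw psi.
Lemma good_intble z : RePos z -> vintble (fun x => EE k0 (- rv2C (u x)) z * psi x).
Proof.
move=> /RePos_min [d d0 dz]; have [mpsi ipsi] := gpsi.
apply: (vintble_dom _ (ipsi d d0)); first by apply: cmeasM => //; exact: vmeas_EEu.
by move=> x x0; rewrite normrM ler_wpM2r// EE_neg_exp//; exact: u0.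
Qed.
(** Applying T_i to the kernel multiplies the weight by -u_i. Half of the exponential absorbs this
    factor, so the class is stable and T_i can be iterated. *)
Lemma good_mulu i : goodw (fun x => - RC (u x 0 i) * psi x).
Proof.
have [mpsi ipsi] := gpsi.
have mui : vmeas (fun x => - RC (u x 0 i)) by apply: cmeasN; apply: cmeas_RC.
split; first exact: cmeasM.
move=> d d0; have d2 : 0 < d / 2 by rewrite divr_gt0.
have i2 : vintble (fun x => RC (2 / d) * (RC (expR (- (d / 2 * vsum (u x)))) * `|psi x|)) by apply: cintbleZ; [exact: measurable_Dpos|exact: ipsi].
have mvs : measurable_fun (@Dpos R n) (fun s => vsum (u (tv s))) by apply: measurable_sum => j; exact: mu.
apply: (vintble_dom _ i2).
  apply: cmeasM; last by apply: cmeas_norm; exact: cmeasM.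
  apply: cmeas_RC; apply: measurableT_comp => //; apply: measurableT_comp => //; exact: measurable_funM.
move=> x /u0 ux0; rewrite !normrM !normr_id normrN !RC_norm [leLHS]mulrA [leRHS]mulrA ler_wpM2r// -!RCM RC_le.
rewrite (ger0_norm (expR_ge0 _)) (ger0_norm (ux0 i)).
have ui : u x 0 i <= vsum (u x) by rewrite /vsum (bigD1 i)//= lerDl sumr_ge0.
have -> : expR (- (d * vsum (u x))) = expR (- (d / 2 * vsum (u x))) * expR (- (d / 2 * vsum (u x))) by rewrite -expRD; congr expR; field.
rewrite -mulrA mulrC ler_wpM2r ?expR_ge0// expRN ler_pdivrMl ?expR_gt0//.
have := expR_ge1Dx (d / 2 * vsum (u x)) => h.
rewrite -ler_pdivrMr ?divr_gt0// invf_div mulrC.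
apply: le_trans (_ : d / 2 * vsum (u x) <= _); first by rewrite ler_wpM2l// ltW.
by apply: le_trans h; rewrite lerDr.
Qed.
(** With u the identity this is an integral transform in the variable w of the Bessel integral or of
    the Laplace transform; with u the inversion x -> 1/x it is the transform in z. *)
Definition Gint (p : 'rV[R]_n -> CC R) z : CC R := vint (fun x => EE k0 (- rv2C (u x)) z * p x).
Lemma Gint_cder z : RePos z ->
  (forall h, vintble (fun x => 'D_h (EE k0 (- rv2C (u x))) z * psi x)) /\
  cder (Gint psi) z (fun h => vint (fun x => 'D_h (EE k0 (- rv2C (u x))) z * psi x)).
Proof.
move=> /RePos_min [d d0 dz]; have [mpsi ipsi] := gpsi; have d2 : 0 < d / 2 by rewrite divr_gt0.
have dz2 i : d / 2 + d / 2 < cRe (z 0 i) by rewrite -splitr.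
have r0 : 0 < RC (d / 2) by rewrite RC_gt0.
have [a b] := @qr_cint _ _ R (tmu R n) (@Dpos R n) (@measurable_Dpos R n) V (fun s z => EE k0 (- rv2C (u (tv s))) z * psi (tv s))
  (fun s h => 'D_h (EE k0 (- rv2C (u (tv s)))) z * psi (tv s)) z (RC (d / 2)) (fun s => RC (expR (- (d / 2 * vsum (u (tv s))))) * `|psi (tv s)|)
  r0 (ipsi _ d2)
  ltac:(move=> s /Dpos_posv/u0 us;
    have H := qrZ (normr_ge0 (psi (tv s))) (EE_neg_qr k0 d2 dz2 us);
    have := EE_neg_qr k0 d2 dz2 us; case=> l H'; split;
    [by move=> c v v'; rewrite l mulrDl mulrA|move=> h hr; have [b1 b2 b3] := H' h hr;
     rewrite -!mulrBl !normrM; split; [by rewrite ler_wpM2r|by rewrite !mulrA ler_wpM2r|by rewrite !mulrA ler_wpM2r]])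
  ltac:(by move=> h hr; apply: cmeasM => //; exact: vmeas_EEu).
by split => //; exact: (qr_cder r0 a).
Qed.
Lemma Gint_dunkl i z : RePos z -> dunklA k i (Gint psi) z = Gint (fun x => - RC (u x 0 i) * psi x) z.
Proof.
move=> z0; have [a b] := Gint_cder z0.
have zs j : RePos (swapv i j z) by move=> l; rewrite mxE; exact: z0.
rewrite (dunklA_cder k i b).
rewrite -(dunkl_form_cint (@measurable_Dpos R n) k i z a (good_intble z0) (fun j => good_intble (zs j))).
apply: eq_cint => s _; have H := EE_cder k0 (- rv2C (u (tv s))) z.
have -> : dunkl_form k (fun h => 'D_h (EE k0 (- rv2C (u (tv s)))) z * psi (tv s)) i z (EE k0 (- rv2C (u (tv s))) z * psi (tv s)) (fun j => EE k0 (- rv2C (u (tv s))) (swapv i j z) * psi (tv s))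
  = dunklA k i (EE k0 (- rv2C (u (tv s)))) z * psi (tv s).
  rewrite dunklAE /dunkl_form mulrDl; congr (_ + _); rewrite -mulrA; congr (_ * _); rewrite mulr_suml.
  by apply: eq_bigr => j _; case: ifP => _; rewrite -?mulrBl// mulrAC.
by rewrite EE_dunkl !mxE; ring.
Qed.
End psi.
Lemma good_prod psi (r : seq 'I_n) : goodw psi -> goodw (fun x => \prod_(i <- r) (- RC (u x 0 i)) * psi x).
Proof.
move=> g; elim: r => [|i r IH].
  by rewrite (_ : (fun x => _) = psi)//; apply/funext => x; rewrite big_nil mul1r.
have := good_mulu IH i; congr goodw; apply/funext => x; by rewrite big_cons mulrA.
Qed.
Lemma Gint_dunkl_seq psi (r : seq 'I_n) z : goodw psi -> RePos z ->
  foldr (fun i g => dunklA k i g) (Gint psi) r z = Gint (fun x => \prod_(i <- r) (- RC (u x 0 i)) * psi x) z.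
Proof.
move=> g; elim: r z => [|i r IH] z z0 /=.
  by congr vint; apply/funext => x; rewrite big_nil mul1r.
have [d d0 dz] := RePos_min z0; have d2 : 0 < d / 2 by rewrite divr_gt0.
have gr := good_prod r g.
have [_ /cder_diff [df _]] := Gint_cder gr z0.
(* The induction hypothesis holds only where all real parts are positive. This region is open and
   stable under transpositions, which is what T_i needs. *)
rewrite -(@dunkl_local R n k (Gint (fun x => \prod_(i <- r) (- RC (u x 0 i)) * psi x)) _ i z (RC (d / 2))) ?RC_gt0//.
- rewrite (Gint_dunkl gr)//; congr vint; apply/funext => x; by rewrite big_cons mulrA.
- move=> h hr; rewrite IH// => l; apply: lt_trans d2 _.
  by apply: (RePos_near _ hr) => j; rewrite -splitr.
- by move=> j; rewrite IH// => l; rewrite mxE; exact: z0.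
Qed.
Lemma goodZ c psi : goodw psi -> goodw (fun x => c * psi x).
Proof.
move=> [mp ip]; split; first by apply: cmeasM => //; exact: cmeas_cst.
move=> d d0; have i2 : vintble (fun x => `|c| * (RC (expR (- (d * vsum (u x)))) * `|psi x|)) by apply: cintbleZ; [exact: measurable_Dpos|exact: ip].
by apply: vintble_eq i2 => x _; rewrite normrM mulrCA.
Qed.
Lemma good_Pu psi : goodw psi -> goodw (fun x => RC (\prod_i u x 0 i) * psi x).
Proof.
move=> g; have := goodZ ((-1) ^+ n) (good_prod (enum 'I_n) g); congr goodw; apply/funext => x.
rewrite big_enum /= prodrN rmorph_prod (_ : #|xpredT| = n) ?cardT ?size_enum_ord// !mulrA -exprD addnn -signr_odd odd_double.
by rewrite mul1r.
Qed.
Lemma Gint_DeltaT psi z : goodw psi -> RePos z ->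
  DeltaT k (Gint psi) z = (-1) ^+ n * Gint (fun x => RC (\prod_i u x 0 i) * psi x) z.
Proof.
move=> g z0; rewrite /DeltaT Gint_dunkl_seq// /Gint.
have E x : \prod_(i <- enum 'I_n) (- RC (u x 0 i)) = (-1) ^+ n * RC (\prod_i u x 0 i).
  by rewrite big_enum /= prodrN rmorph_prod (_ : #|xpredT| = n)// cardT size_enum_ord.
rewrite -cintZ; last 2 first.
- exact: measurable_Dpos.
- by have h := good_intble (good_Pu g) z0; exact: h.
by apply: eq_cint => s _; rewrite E; ring.
Qed.
End param.

Section ccvg.
Variable R : realType.
Implicit Types (u v : nat -> CC R) (l a : CC R).
Definition ccvg u l := (fun n => cRe (u n)) @ \oo --> cRe l /\ (fun n => cIm (u n)) @ \oo --> cIm l.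
Lemma ccvgP u l : (forall e : R, 0 < e -> \forall n \near \oo, cmod (u n - l) <= e) -> ccvg u l.
Proof.
move=> H; split; apply/cvgrPdist_le => e e0; near=> n; rewrite distrC.
  by rewrite -cReB; apply: le_trans (cRe_le_norm _) _; near: n; exact: H.
by rewrite -cImB; apply: le_trans (cIm_le_norm _) _; near: n; exact: H.
Unshelve. all: by end_near. Qed.
Lemma ccvg_cst l : ccvg (fun=> l) l.
Proof. by split; exact: cvg_cst. Qed.
Lemma ccvgD u v l a : ccvg u l -> ccvg v a -> ccvg (fun n => u n + v n) (l + a).
Proof.
move=> [u1 u2] [v1 v2]; split.
  by under eq_fun do rewrite cReD; rewrite cReD; exact: cvgD.
by under eq_fun do rewrite cImD; rewrite cImD; exact: cvgD.
Qed.
Lemma ccvgM u v l a : ccvg u l -> ccvg v a -> ccvg (fun n => u n * v n) (l * a).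
Proof.
move=> [u1 u2] [v1 v2]; split.
  by under eq_fun do rewrite cReM; rewrite cReM; apply: cvgB; exact: cvgM.
by under eq_fun do rewrite cImM; rewrite cImM; apply: cvgD; exact: cvgM.
Qed.
Lemma ccvg_RC (f : nat -> R) (r : R) : f @ \oo --> r -> ccvg (fun n => RC (f n)) (RC r).
Proof. by move=> fr; split; [exact: fr|exact: cvg_cst]. Qed.
Lemma ccvg_sum I (s : seq I) (P : pred I) (u : I -> nat -> CC R) (l : I -> CC R) : (forall i, ccvg (u i) (l i)) ->
  ccvg (fun n => \sum_(i <- s | P i) u i n) (\sum_(i <- s | P i) l i).
Proof.
move=> H; elim: s => [|i s IH].
  by rewrite big_nil; under eq_fun do rewrite big_nil; exact: ccvg_cst.
rewrite big_cons; under eq_fun do rewrite big_cons.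
by case: (P i) => //; exact: ccvgD.
Qed.
Lemma ccvg_prod I (s : seq I) (u : I -> nat -> CC R) (l : I -> CC R) : (forall i, ccvg (u i) (l i)) ->
  ccvg (fun n => \prod_(i <- s) u i n) (\prod_(i <- s) l i).
Proof.
move=> H; elim: s => [|i s IH].
  by rewrite big_nil; under eq_fun do rewrite big_nil; exact: ccvg_cst.
by rewrite big_cons; under eq_fun do rewrite big_cons; exact: ccvgM.
Qed.
Lemma ccvg_uniq u l a : ccvg u l -> ccvg u a -> l = a.
Proof. by move=> [u1 u2] [v1 v2]; exact: (CC_lim_uniq u1 u2 v1 v2). Qed.
Lemma ccvg_eq u v l : (forall n, u n = v n) -> ccvg u l -> ccvg v l.
Proof. by move=> /funext ->. Qed.
Lemma ccvg_cmod u l : ccvg u l -> (fun n => cmod (u n)) @ \oo --> cmod l.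
Proof.
move=> [u1 u2]; apply: (@cvg_comp _ _ _ (fun n => cRe (u n) ^+ 2 + cIm (u n) ^+ 2) Num.sqrt); last exact: sqrt_continuous.
by apply: cvgD; rewrite !expr2; under eq_fun do rewrite expr2; exact: cvgM.
Qed.
Lemma ccvg_le u l (r : R) : ccvg u l -> (forall n, cmod (u n) <= r) -> cmod l <= r.
Proof.
move=> /ccvg_cmod h b; rewrite -(cvg_lim (@Rhausdorff R) h); apply: limr_le; first by apply/cvg_ex; exists (cmod l).
by apply: nearW.
Qed.
Lemma cvg_harm : (fun m : nat => (m.+1%:R : R)^-1) @ \oo --> 0.
Proof. exact: cvg_harmonic. Qed.
Lemma harm_gt0 m : 0 < (m.+1%:R : R)^-1. Proof. by rewrite invr_gt0. Qed.
Lemma harm_le1 m : (m.+1%:R : R)^-1 <= 1. Proof. by rewrite invf_le1// ler1n. Qed.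
Lemma near_harm (e : R) : 0 < e -> \forall m \near \oo, (m.+1%:R : R)^-1 <= e.
Proof.
move=> e0; have /cvgrPdist_le /(_ e e0) h := cvg_harm; near=> m.
have : `|0 - (m.+1%:R : R)^-1| <= e by near: m; exact: h.
by rewrite sub0r normrN gtr0_norm// harm_gt0.
Unshelve. all: by end_near. Qed.
Lemma cder_seq (V : normedModType (CC R)) (f L : V -> CC R) z h : cder f z L ->
  ccvg (fun m => RC (m.+1%:R) * (f (z + RC (m.+1%:R)^-1 *: h) - f z)) (L h).
Proof.
move=> [lL _ H]; apply: ccvgP => e e0.
have N1 : 0 < cRe `|h| + 1 by rewrite ltr_wpDl// cRe_ge0.
have [del d0 Hd] := H (RC (e / (cRe `|h| + 1))) ltac:(by rewrite RC_gt0 divr_gt0).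
have dr : 0 < cRe del by move: d0; rewrite CC_lt => /andP[].
have dE : del = RC (cRe del) by apply: RC_real; exact: ltW.
near=> m; have td : (m.+1%:R : R)^-1 <= cRe del / (cRe `|h| + 1) by near: m; apply: near_harm; rewrite divr_gt0.
set t : R := (m.+1%:R)^-1 in td *; have t0 : 0 < t by exact: harm_gt0.
have nh : `|RC t *: h| = RC (t * cRe `|h|) by rewrite normrZ RC_norm (RC_real (normr_ge0 h)) -RCM gtr0_norm.
have hu : `|RC t *: h| <= del.
  rewrite nh dE RC_le; apply: le_trans (_ : t * (cRe `|h| + 1) <= _); first by rewrite ler_wpM2l ?(ltW t0)// lerDl.
  by rewrite -ler_pdivlMr.
have := Hd _ hu; rewrite nh (clinearZ lL) CC_norm -RCM RC_le => b.
have -> : RC m.+1%:R * (f (z + RC t *: h) - f z) - L h = RC m.+1%:R * (f (z + RC t *: h) - f z - RC t * L h).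
  by rewrite [RHS]mulrBr mulrA -RCM mulfV// mul1r.
rewrite cmodM cmod_RC ger0_norm// -ler_pdivlMl//; apply: le_trans b _; rewrite mulrCA mulrC -/t mulrC ler_wpM2l ?(ltW t0)//.
by rewrite mulrAC ler_pdivrMr// ler_wpM2l ?(ltW e0)// lerDl.
Unshelve. all: by end_near. Qed.
Lemma derive_seq (F : R -> R) (t0 l : R) : is_derive t0 1 F l ->
  (fun m => m.+1%:R * (F (t0 + (m.+1%:R)^-1) - F t0)) @ \oo --> l.
Proof.
move=> dF; have cv : (fun h : R => h^-1 *: (F (h *: 1 + t0) - F t0)) @ 0^' --> l.
  by have := (@ex_derive _ _ _ _ _ _ _ dF); rewrite /derivable => /cvg_ex [l' h]; rewrite -(@derive_val _ _ _ _ _ _ _ dF) /derive (cvg_lim _ h).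
apply/cvgrPdist_le => e e0; move/cvgrPdist_le : cv => /(_ e e0) -[d /= d0 Hd].
near=> m; have td : (m.+1%:R : R)^-1 <= d / 2 by near: m; apply: near_harm; rewrite divr_gt0.
set t : R := (m.+1%:R)^-1 in td *; have t0' : 0 < t by exact: harm_gt0.
have := Hd t; rewrite /= sub0r normrN gtr0_norm// => /(_ _ (lt0r_neq0 t0')).
rewrite invrK /GRing.scale /= mulr1 (addrC t); apply.
by apply: (@le_lt_trans _ _ (d / 2)) => //; rewrite ltr_pdivrMr// mulr_natr mulr2n ltrDl.
Unshelve. all: by end_near. Qed.
End ccvg.

Section omegaE_derive.
Variables (R : realType) (n : nat) (k : R).
Hypothesis k0 : 0 <= k.
Implicit Types x : 'rV[R]_n.
Variable eps : R.
Hypothesis e0 : 0 < eps.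
Let q x a b : R := (x 0 a - x 0 b) ^+ 2 + eps.
Let q0 x a b : 0 < q x a b.
Proof. by rewrite /q ltr_wpDl// sqr_ge0. Qed.
Lemma omegaE_exp x : omegaE k eps x = expR (k * \sum_(a < n) \sum_(b < n) (if (a < b)%N then ln (q x a b) else 0)).
Proof.
rewrite mulr_sumr expR_sum; apply: eq_bigr => a _; rewrite mulr_sumr expR_sum [LHS]big_mkcond; apply: eq_bigr => b _.
case: ifP => _; first by rewrite /powR gt_eqF// q0.
by rewrite mulr0 expR0.
Qed.
(** The derivative in s of log omegaE along s |-> [vscale i s x], taken at y = [vscale i s x]: only
    the i-th coordinate moves, with speed x_i. *)
Definition dlogE i (x y : 'rV[R]_n) : R := k * \sum_(a < n) \sum_(b < n) (if (a < b)%N then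
  2 * (y 0 a - y 0 b) * ((if a == i then x 0 i else 0) - (if b == i then x 0 i else 0)) / q y a b else 0).
Lemma omegaE_deriv i x (s : R) :
  is_derive s 1 (fun s => omegaE k eps (vscale i s x)) (omegaE k eps (vscale i s x) * dlogE i x (vscale i s x)).
Proof.
have dc (a : 'I_n) : is_derive s 1 (fun s : R => (vscale i s x) 0 a) (if a == i then x 0 i else 0).
  rewrite (_ : (fun s : R => _) = (fun s : R => if a == i then s * x 0 a else x 0 a)); last by apply/funext => u; rewrite mxE.
  case: eqP => [->|_]; last exact: is_derive_cst.
  by apply: (is_derive_eq (is_deriveM (is_derive_id s 1) (is_derive_cst (x 0 i) s 1))); rewrite /GRing.scale /= mulr0 add0r mulr1.
have dl (a b : 'I_n) : is_derive s 1 (fun s : R => if (a < b)%N then ln (q (vscale i s x) a b) else 0)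
   (if (a < b)%N then 2 * ((vscale i s x) 0 a - (vscale i s x) 0 b) * ((if a == i then x 0 i else 0) - (if b == i then x 0 i else 0)) / q (vscale i s x) a b else 0).
  case: (a < b)%N; last exact: is_derive_cst.
  have d1 := is_deriveD (is_deriveX 2 (is_deriveB (dc a) (dc b))) (is_derive_cst eps s 1).
  have d2 := @is_derive1_comp R (@ln R) (fun s => q (vscale i s x) a b) s _ _ (is_derive1_ln (q0 (vscale i s x) a b)) d1.
  apply: (is_derive_eq d2); rewrite /GRing.scale /= expr1 addr0.
  by rewrite -[((fun s => vscale i s x 0 a) - (fun s => vscale i s x 0 b)) s]/(vscale i s x 0 a - vscale i s x 0 b); ring.
have ds : is_derive s 1 (fun s => \sum_(a < n) \sum_(b < n) (if (a < b)%N then ln (q (vscale i s x) a b) else 0))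
    (\sum_(a < n) \sum_(b < n) (if (a < b)%N then 2 * ((vscale i s x) 0 a - (vscale i s x) 0 b) * ((if a == i then x 0 i else 0) - (if b == i then x 0 i else 0)) / q (vscale i s x) a b else 0)).
  rewrite (_ : (fun s => _) = \sum_(a < n) (fun s : R => \sum_(b < n) (if (a < b)%N then ln (q (vscale i s x) a b) else 0))); last by apply/funext => u; rewrite fct_sumE.
  apply: is_derive_sum => a.
  rewrite (_ : (fun s => _) = \sum_(b < n) (fun s : R => (if (a < b)%N then ln (q (vscale i s x) a b) else 0))); last by apply/funext => u; rewrite fct_sumE.
  by apply: is_derive_sum => b.
rewrite (_ : (fun s => _) = (fun s => expR (k * \sum_(a < n) \sum_(b < n) (if (a < b)%N then ln (q (vscale i s x) a b) else 0)))); last first.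
  by apply/funext => u; rewrite omegaE_exp.
have d3 := @is_derive1_comp R (@expR R) (fun s => k * \sum_(a < n) \sum_(b < n) (if (a < b)%N then ln (q (vscale i s x) a b) else 0)) s _ _ (is_derive_expR _) (is_deriveM (is_derive_cst k s 1) ds).
apply: (is_derive_eq d3); rewrite /GRing.scale /= mulr0 addr0 omegaE_exp /dlogE; ring.
Qed.
Lemma dlogE_bound i x y : eps <= 1 -> vge0 x -> `|dlogE i x y| <= k * (n%:R * n%:R * (4 / eps)) * x 0 i.
Proof.
move=> e1 x0; rewrite /dlogE normrM (ger0_norm k0) -mulrA ler_wpM2l//; have xi := x0 i.
have b0 : 0 <= 4 / eps * x 0 i by rewrite mulr_ge0// divr_ge0// ltW.
have -> : n%:R * n%:R * (4 / eps) * x 0 i = \sum_(a < n) \sum_(b < n) (4 / eps * x 0 i).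
  by rewrite !sumr_const card_ord -[RHS]mulr_natl -[X in _ = _ * X]mulr_natl; ring.
apply: le_trans (ler_norm_sum _ _ _) _; apply: ler_sum => a _; apply: le_trans (ler_norm_sum _ _ _) _; apply: ler_sum => b _.
case: ifP => _; last by rewrite normr0.
set d := y 0 a - y 0 b.
have h1 : `|d| / q y a b <= eps^-1.
  rewrite ler_pdivrMr ?q0// mulrC -ler_pdivrMr ?invr_gt0// invrK /q -/d.
  have [d1|d1] := leP `|d| 1; first by apply: le_trans (_ : eps <= _); [rewrite ler_piMl ?(ltW e0)|rewrite lerDr sqr_ge0].
  apply: le_trans (_ : d ^+ 2 <= _); last by rewrite lerDl ltW.
  rewrite -(real_normK (num_real d)) expr2 ler_wpM2l//; exact: le_trans (ltW d1).
have h2 : `|(if a == i then x 0 i else 0) - (if b == i then x 0 i else 0)| <= 2 * x 0 i.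
  apply: le_trans (ler_normB _ _) _; rewrite mulr_natl mulr2n; apply: lerD; case: ifP => _; rewrite ?normr0// ger0_norm//.
rewrite !normrM normfV (gtr0_norm (q0 y a b)) (ger0_norm (ler0n R 2)).
rewrite (_ : 2 * `|d| * _ / _ = (`|d| / q y a b) * (2 * `|(if a == i then x 0 i else 0) - (if b == i then x 0 i else 0)|)); last by ring.
have -> : 4 / eps * x 0 i = eps^-1 * (2 * (2 * x 0 i)) by ring.
by apply: ler_pM; rewrite ?divr_ge0 ?(ltW (q0 y a b))// ler_wpM2l.
Qed.
(** Only pairs containing i survive, and the antisymmetry of the summand merges the cases j < i and
    j > i. *)
Lemma dlogE_self i x : dlogE i x x = \sum_(j | j != i) (2 * k * x 0 i * (x 0 i - x 0 j) / ((x 0 i - x 0 j) ^+ 2 + eps)).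
Proof.
pose G (a b : 'I_n) : R := 2 * (x 0 a - x 0 b) * x 0 i / q x a b.
have GN a b : G a b = - G b a.
  by rewrite /G (_ : q x b a = q x a b); [ring|rewrite /q -sqrrN opprB].
have E : \sum_(a < n) \sum_(b < n) (if (a < b)%N then 2 * (x 0 a - x 0 b) * ((if a == i then x 0 i else 0) - (if b == i then x 0 i else 0)) / q x a b else 0)
  = \sum_(b < n) (if (i < b)%N then G i b else 0) + \sum_(a < n) (if (a < i)%N then G i a else 0).
  have S (a b : 'I_n) : (if (a < b)%N then 2 * (x 0 a - x 0 b) * ((if a == i then x 0 i else 0) - (if b == i then x 0 i else 0)) / q x a b else 0)
    = (if a == i then (if (a < b)%N then G a b else 0) else 0) + (if b == i then (if (a < b)%N then - G a b else 0) else 0).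
    by case: ifP => _; case: (a == i); case: (b == i); rewrite /G ?addr0 ?add0r ?subr0 ?sub0r ?subrr ?mulr0 ?mul0r //; ring.
  under eq_bigr do under eq_bigr do rewrite S.
  under eq_bigr do rewrite big_split /=.
  rewrite big_split /=; congr (_ + _).
    rewrite (bigD1 i)//= [X in _ + X]big1 ?addr0; last by move=> a ai; rewrite big1// => b _; rewrite (negPf ai).
    by apply: eq_bigr => b _; rewrite eqxx.
  apply: eq_bigr => a _; rewrite (bigD1 i)//= eqxx big1 ?addr0; last by move=> b bi; rewrite (negPf bi).
  by case: ifP => // _; rewrite -GN.
rewrite /dlogE E -big_split /= mulr_sumr (bigD1 i)//= ltnn addr0 mulr0 add0r; apply: eq_bigr => j ji.
have : (i != j :> nat) by rewrite eq_sym -(inj_eq val_inj) in ji *.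
rewrite /G; case: ltngtP => // _ _; rewrite ?addr0 ?add0r; ring.
Qed.
End omegaE_derive.

(** * The Laplace transform of Delta^b omega *)
Section laplace.
Variables (R : realType) (n : nat) (k : R).
Hypothesis k0 : 0 <= k.
Local Notation V := ('rV[CC R]_n).
Implicit Types (x : 'rV[R]_n).
Variables (w : V) (d : R) (b : CC R).
Hypotheses (d0 : 0 < d) (dw : forall i, d < cRe (w 0 i)) (b1 : -1 < cRe b).
Let Phi x := EE k0 (- rv2C x) w.
Let Db x := Deltapow (rv2C x) b.
(** By symmetry E(-x, w) = E(-w, x), so a derivative in x is a derivative of the kernel in its
    second argument. *)
Definition dPhi (i : 'I_n) x := 'D_(evec i) (EE k0 (- w)) (rv2C x).
Let M x : R := (\prod_i x 0 i `^ cRe b) * expR (- (d / 2 * vsum x)).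
Lemma Phi_alt x : EE k0 (- rv2C x) w = EE k0 (- w) (rv2C x).
Proof. by rewrite EE_sym -EE_hom opprK. Qed.
Lemma one_plus_exp (c s : R) : 0 < c -> 0 <= s -> 1 + s <= (1 + c^-1) * expR (c * s).
Proof.
move=> c0 s0; have h := expR_ge1Dx (c * s); have e1 : 1 <= expR (c * s) by rewrite -expR0 ler_expR mulr_ge0// ltW.
rewrite mulrDl mul1r; apply: lerD => //; rewrite mulrC ler_pdivlMr// mulrC; apply: le_trans h; by rewrite lerDr.
Qed.
Lemma vscale_posv i (s : R) x : 0 < s -> posv x -> posv (vscale i s x).
Proof. by move=> s0 x0 j; rewrite mxE; case: ifP => // _; rewrite mulr_gt0. Qed.
Lemma vscale_diff i (s : R) x j : vge0 x -> 1 <= s -> `|(vscale i s x) 0 j - x 0 j| <= (s - 1) * x 0 i.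
Proof.
move=> x0 s1; rewrite mxE; case: eqP => [->|_]; last by rewrite subrr normr0 mulr_ge0 ?subr_ge0.
by rewrite mulrBl mul1r ger0_norm// subr_ge0 ler_peMl.
Qed.
Lemma vscale_vsum i (s : R) x : vge0 x -> 1 <= s <= 2 -> vsum x <= vsum (vscale i s x) <= 2 * vsum x.
Proof.
move=> x0 /andP[s1 s2]; apply/andP; split; first by apply: ler_sum => j _; rewrite mxE; case: ifP => // _; rewrite ler_peMl.
rewrite /vsum mulr_sumr; apply: ler_sum => j _; rewrite mxE; case: ifP => _; first by rewrite ler_wpM2r.
by rewrite ler_peMl// ler1n.
Qed.
Lemma Deltapow_vscale i (s : R) x c : 0 < s -> posv x -> Deltapow (rv2C (vscale i s x)) c = cpow (RC s) c * Deltapow (rv2C x) c.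
Proof.
move=> s0 x0; rewrite /Deltapow (bigD1 i)//= [in RHS](bigD1 i)//= mulrA; congr (_ * _).
  by rewrite !rv2C_coord mxE eqxx cpowM.
by apply: eq_bigr => j ji; rewrite !rv2C_coord mxE (negPf ji).
Qed.
Definition lap_weight eps x : CC R := EE k0 (- rv2C x) w * Deltapow (rv2C x) b * RC (omegaE k eps x).
Lemma Phi_le x : posv x -> cmod (Phi x) <= expR (- (d * vsum x)).
Proof. by move=> x0; rewrite -cmod_leP; apply: EE_neg_exp => //; exact: posv_ge0. Qed.
Lemma cmod_Db x : posv x -> cmod (Db x) = \prod_i x 0 i `^ cRe b.
Proof. exact: cmod_Deltapow. Qed.
Lemma M_vmaj x : M x = vmaj (cRe b + 1) (d / 2) x.
Proof. by rewrite /M /vmaj addrK. Qed.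
Lemma exponent_gt0 : 0 < cRe b + 1. Proof. by rewrite -ltrBlDr sub0r. Qed.
(** The weight may be taken at another point x' with vsum x' <= 2 vsum x: this covers the dilates by
    s in [1, 2] and the intermediate points of the mean value theorem. The rate d is spent as d/4 on
    the factor 1 + vsum x and d/4 on the weight, leaving the d/2 of [M]. *)
Lemma lap_dom : exists2 C, 0 <= C & forall eps x x' (c : CC R) (K : R), 0 <= eps <= 1 -> posv x -> vge0 x' -> vsum x' <= 2 * vsum x -> 0 <= K ->
  cmod c <= K * (1 + vsum x) * expR (- (d * vsum x)) -> cmod (Db x * (c * RC (omegaE k eps x'))) <= K * C * M x.
Proof.
have d8 : 0 < d / 8 by rewrite divr_gt0. have d4 : 0 < d / 4 by rewrite divr_gt0.
have [C C0 H] := omegaE_le n k0 d8.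
exists ((1 + (d / 4)^-1) * C) => [|eps x x' c K ee x0 x0' xx K0 cK].
  by rewrite mulr_ge0 ?addr_ge0 ?invr_ge0 ?(ltW C0)// ltW.
have s0 : 0 <= vsum x by apply: vsum_ge0; exact: posv_ge0.
rewrite !cmodM cmod_Db// cmod_RC (ger0_norm (omegaE_ge0 _ _ _)) /M [leRHS]mulrCA ler_wpM2l//.
  by apply: prodr_ge0 => i _; exact: powR_ge0.
have oe : omegaE k eps x' <= C * expR (d / 4 * vsum x).
  apply: le_trans (H eps x' ee) _; rewrite ler_wpM2l ?(ltW C0)// ler_expR.
  have -> : \sum_i `|x' 0 i| = vsum x' by apply: eq_bigr => i _; rewrite ger0_norm.
  have -> : d / 4 * vsum x = d / 8 * (2 * vsum x) by field.
  by rewrite ler_wpM2l// ltW.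
apply: (@le_trans _ _ ((K * ((1 + (d / 4)^-1) * expR (d / 4 * vsum x)) * expR (- (d * vsum x))) * (C * expR (d / 4 * vsum x)))).
  apply: ler_pM; rewrite ?cmod_ge0 ?omegaE_ge0//; apply: le_trans cK _.
  by rewrite ler_wpM2r ?expR_ge0// ler_wpM2l// one_plus_exp.
have -> : expR (- (d / 2 * vsum x)) = expR (d / 4 * vsum x) * expR (d / 4 * vsum x) * expR (- (d * vsum x)) by rewrite -!expRD; congr expR; field.
by rewrite le_eqVlt; apply/orP; left; apply/eqP; move: (expR _) (expR _) (_^-1) => A B D; ring.
Qed.
Lemma vmeas_lap_weight eps : vmeas (lap_weight eps).
Proof.
apply: cmeasM; first by apply: cmeasM; [exact: cmeas_EE_neg|exact: cmeas_Deltapow].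
by apply: cmeas_RC; exact: measurable_omegaE.
Qed.
Lemma vintble_dom_laplace (G : 'rV[R]_n -> CC R) (C : R) : vmeas G -> (forall x, posv x -> cmod (G x) <= C * M x) -> vintble G.
Proof. by move=> mG bG; apply: (dom_intble (C := C) exponent_gt0 (divr_gt0 d0 (ltr0n _ 2)) mG) => x /bG; rewrite M_vmaj. Qed.
Lemma lap_weight_int eps : 0 <= eps <= 1 -> vintble (lap_weight eps).
Proof.
move=> ee; have [C C0 H] := lap_dom; apply: (vintble_dom_laplace (C := 1 * C)); first exact: vmeas_lap_weight.
move=> x x0; rewrite /lap_weight mulrAC mulrC; have s0 : 0 <= vsum x by apply: vsum_ge0; exact: posv_ge0.
apply: (H eps x x (Phi x) 1 ee x0) => //; [exact: posv_ge0|by rewrite ler_peMl// ler1n|].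
by rewrite mul1r; apply: le_trans (Phi_le x0) _; rewrite ler_peMl ?expR_ge0// lerDl.
Qed.
(** The derivative of x_i F with respect to x_i for F = [lap_weight eps]; the term 1 + b collects
    the contributions of x_i and of x_i^b. *)
Definition lap_lim eps i x : CC R :=
  Deltapow (rv2C x) b * (RC (omegaE k eps x) * ((1 + b) * EE k0 (- rv2C x) w + RC (x 0 i) * dPhi i x + EE k0 (- rv2C x) w * RC (dlogE k eps i x x))).
(** The difference quotient at s = 1, with step 1/(m+1), of s |-> s F(x with x_i replaced by s x_i),
    whose integral does not depend on s. *)
Definition lap_g eps i m x : CC R :=
  (lap_weight eps (vscale i (1 + (m.+1%:R)^-1) x) * RC (1 + (m.+1%:R)^-1) - lap_weight eps x) * RC m.+1%:R.
Lemma lap_g_split eps i m x : posv x -> let s : R := 1 + (m.+1%:R)^-1 in let x' := vscale i s x in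
  lap_g eps i m x = Db x * ((RC m.+1%:R * (cpow (RC s) (b + 1) - 1)) * Phi x' * RC (omegaE k eps x'))
   + Db x * ((RC m.+1%:R * (Phi x' - Phi x)) * RC (omegaE k eps x'))
   + Db x * (Phi x * RC (m.+1%:R * (omegaE k eps x' - omegaE k eps x))).
Proof.
move=> x0 s x'; have s0 : 0 < s by rewrite addr_gt0// harm_gt0.
rewrite /lap_g -/s /lap_weight -/x' -/(Phi x') -/(Phi x) Deltapow_vscale// -/(Db x).
rewrite cpowD cpow_id// [RC (m.+1%:R * _)]RCM RCB.
have alg (A B C D E F G H : CC R) : (A * (D * C) * G * E - B * C * H) * F = C * (F * (D * E - 1) * A * G) + C * (F * (A - B) * G) + C * (B * (F * (G - H))) by ring.
exact: alg.
Qed.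
Lemma cpow_seq (c : CC R) : ccvg (fun m => RC m.+1%:R * (cpow (RC (1 + (m.+1%:R)^-1)) c - 1)) c.
Proof.
have h1 : 0 < cRe ((const_mx 1 : 'rV[CC R]_1) 0 0) by rewrite mxE; exact: ltr01.
have := cder_seq (const_mx 1) (cder_cpow c h1); rewrite !mxE cpow_one !mulr1 divr1.
by apply: ccvg_eq => m; rewrite !mxE mulr1 RCD.
Qed.
Lemma rv2C_vscale i (s : R) x : rv2C (vscale i (1 + s) x) = rv2C x + RC s *: (RC (x 0 i) *: evec i).
Proof.
apply/rowP => j; rewrite !mxE /=; case: eqP => [->|_]; last by rewrite !mulr0 addr0.
by rewrite mulr1 -RCM -RCD mulrDl mul1r.
Qed.
Lemma Phi_seq i x : ccvg (fun m => RC m.+1%:R * (Phi (vscale i (1 + (m.+1%:R)^-1) x) - Phi x)) (RC (x 0 i) * dPhi i x).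
Proof.
have H := EE_cder k0 (- w) (rv2C x); have [_ D] := cder_diff H; have [lL _ _] := H.
have := cder_seq (RC (x 0 i) *: evec i) H; rewrite (clinearZ lL) -D.
by apply: ccvg_eq => m; rewrite -rv2C_vscale /Phi !Phi_alt.
Qed.
Lemma ccvg_from_quot (u : nat -> CC R) l a : ccvg (fun m => RC m.+1%:R * (u m - l)) a -> ccvg u l.
Proof.
move=> H; have := ccvgD (ccvg_cst l) (ccvgM (ccvg_RC (@cvg_harm R)) H); rewrite RC0 mul0r addr0.
by apply: ccvg_eq => m; rewrite mulrA -RCM mulVf// mul1r addrC subrK.
Qed.
Lemma lap_g_lim eps i x : 0 < eps -> posv x -> ccvg (fun m => lap_g eps i m x) (lap_lim eps i x).
Proof.
move=> e0 x0; have dO := omegaE_deriv k e0 i x 1.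
have v1 : vscale i 1 x = x by apply/rowP => j; rewrite mxE mul1r if_same.
have O1 := derive_seq dO; rewrite v1 in O1.
have O2 := ccvg_RC O1; have P1 := Phi_seq i x.
have P2 := ccvg_from_quot P1.
have O3 : ccvg (fun m => RC (omegaE k eps (vscale i (1 + (m.+1%:R)^-1) x))) (RC (omegaE k eps x)).
  by apply: ccvg_from_quot; apply: ccvg_eq O2 => m; rewrite RCM RCB.
have S := ccvgD (ccvgD (ccvgM (ccvg_cst (Db x)) (ccvgM (ccvgM (cpow_seq (b + 1)) P2) O3)) (ccvgM (ccvg_cst (Db x)) (ccvgM P1 O3)))
  (ccvgM (ccvg_cst (Db x)) (ccvgM (ccvg_cst (Phi x)) O2)).
rewrite (_ : lap_lim eps i x = Db x * ((b + 1) * Phi x * RC (omegaE k eps x)) + Db x * (RC (x 0 i) * dPhi i x * RC (omegaE k eps x))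
   + Db x * (Phi x * RC (omegaE k eps x * dlogE k eps i x x))).
  by apply: ccvg_eq S => m; rewrite lap_g_split.
rewrite /lap_lim -/(Phi x) -/(Db x) [RC (omegaE _ _ _ * _)]RCM.
move: (Phi x) (Db x) (dPhi i x) (RC (x 0 i)) (RC (omegaE k eps x)) (RC (dlogE k eps i x x)) => A B C D E F; ring.
Qed.

Lemma lap_g_int eps i m : 0 <= eps <= 1 -> vintble (lap_g eps i m) /\ vint (lap_g eps i m) = 0.
Proof.
move=> ee; set s : R := 1 + (m.+1%:R)^-1; have s0 : 0 < s by rewrite addr_gt0// harm_gt0.
have mD := @measurable_Dpos R n.
have iF := lap_weight_int ee; have [iS eS] := vint_scale1 i s0 iF.
have iB := cintbleB mD iS iF; have eB := cintB mD iS iF.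
have E x : lap_g eps i m x = RC m.+1%:R * (lap_weight eps (vscale i s x) * RC s - lap_weight eps x) by rewrite mulrC.
have i3 : vintble (fun x => RC m.+1%:R * (lap_weight eps (vscale i s x) * RC s - lap_weight eps x)) := cintbleZ mD (RC m.+1%:R) iB.
split; first by apply: vintble_eq i3 => x _; rewrite E.
rewrite (vint_eq (fun x _ => E x)) /vint (cintZ mD _ iB) eB.
by rewrite -/(vint (fun x => lap_weight eps (vscale i s x) * RC s)) -/(vint (lap_weight eps)) eS subrr mulr0.
Qed.
Lemma cpow_seq_bound (c : CC R) : exists2 C, 0 <= C & forall m, cmod (RC m.+1%:R * (cpow (RC (1 + (m.+1%:R)^-1)) c - 1)) <= C.
Proof.
exists (2 * (cmod c * expR (cmod c))); first by rewrite !mulr_ge0 ?cmod_ge0 ?expR_ge0.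
move=> m; set h : R := (m.+1%:R)^-1; have h0 : 0 < h by exact: harm_gt0.
have h1 : h <= 1 by exact: harm_le1.
rewrite cmodM cmod_RC ger0_norm// -ler_pdivlMl// -/h cpowE; last by rewrite addr_gt0.
have l0 : 0 <= ln (1 + h) by rewrite ln_ge0// lerDl ltW.
have lh : ln (1 + h) <= h by apply: le_ln1Dx; lra.
have b0 : cmod (c * RC (ln (1 + h))) <= cmod c * h by rewrite cmodM cmod_RC ger0_norm// ler_wpM2l// cmod_ge0.
apply: le_trans (cexp_bound1 _) _; have -> : h * (2 * (cmod c * expR (cmod c))) = 2 * (cmod c * h * expR (cmod c)) by ring.
rewrite ler_wpM2l//; apply: ler_pM; rewrite ?cmod_ge0 ?expR_ge0//.
by rewrite ler_expR; apply: le_trans b0 _; rewrite ler_piMr// cmod_ge0.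
Qed.
Lemma lap_g_bound eps i : 0 < eps <= 1 -> exists2 C, 0 <= C & forall m x, posv x -> cmod (lap_g eps i m x) <= C * M x.
Proof.
move=> /andP[e0 e1]; have ee : 0 <= eps <= 1 by rewrite (ltW e0).
have [C C0 HC] := lap_dom; have [C1 C10 H1] := cpow_seq_bound (b + 1); have [C2 C20 H2] := EE_neg_lip k0 dw.
pose K3 : R := k * (n%:R * n%:R * (4 / eps)).
have e4 : 0 <= 4 / eps by rewrite divr_ge0 ?ler0n ?(ltW e0).
have K30 : 0 <= K3 by rewrite mulr_ge0// mulr_ge0.
have C22 : 0 <= 2 * C2 by rewrite mulr_ge0.
exists (C1 * C + (2 * C2) * C + K3 * C).
  have A1 := mulr_ge0 C10 C0; have A2 := mulr_ge0 C22 C0; have A3 := mulr_ge0 K30 C0; lra.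
move=> m x x0; have xg := posv_ge0 x0; rewrite lap_g_split//; set s : R := 1 + (m.+1%:R)^-1; set h : R := (m.+1%:R)^-1 in s *.
have h0 : 0 < h by exact: harm_gt0.
have h1 : h <= 1 by exact: harm_le1.
have s12 : 1 <= s <= 2 by rewrite /s; lra.
have s0 : 0 < s by rewrite /s; lra.
have sh : s - 1 = h by rewrite /s addrAC subrr add0r.
have x'0 := vscale_posv i s0 x0; set x' := vscale i s x in x'0 *.
have /andP[v1 v2] := vscale_vsum i xg s12; rewrite -/x' in v1 v2.
have sx0 := vsum_ge0 xg.
have xi : x 0 i <= vsum x by rewrite /vsum (bigD1 i)//= lerDl sumr_ge0// => j _.
have P' : cmod (Phi x') <= expR (- (d * vsum x)).
  by apply: le_trans (Phi_le x'0) _; rewrite ler_expR lerN2 ler_wpM2l// ltW.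
have one : expR (- (d * vsum x)) <= (1 + vsum x) * expR (- (d * vsum x)) by rewrite ler_peMl ?expR_ge0// lerDl.
have sle : vsum x * expR (- (d * vsum x)) <= (1 + vsum x) * expR (- (d * vsum x)) by rewrite ler_wpM2r ?expR_ge0// lerDr.
rewrite [leRHS]mulrDl [X in _ <= X + _]mulrDl; apply: le_trans (cmodD _ _) _; apply: lerD.
  apply: le_trans (cmodD _ _) _; apply: lerD.
    apply: (HC eps x x' _ C1 ee x0 (posv_ge0 x'0) v2 C10); rewrite cmodM -mulrA; apply: ler_pM; rewrite ?cmod_ge0//.
    exact: le_trans one.
  apply: (HC eps x x' _ (2 * C2) ee x0 (posv_ge0 x'0) v2) => //.
  rewrite cmodM cmod_RC ger0_norm// -ler_pdivlMl// -/h.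
  have := H2 x' x (h * x 0 i) (mulr_ge0 (ltW h0) (xg i)) (posv_ge0 x'0) xg
    ltac:(by move=> j; apply: le_trans (vscale_diff i j xg _) _; [case/andP: s12|rewrite sh]).
  rewrite cmod_leP => /le_trans; apply.
  have e2 : expR (- (d * vsum x')) + expR (- (d * vsum x)) <= 2 * expR (- (d * vsum x)).
    by rewrite mulr_natl mulr2n lerD2r ler_expR lerN2 ler_wpM2l// ltW.
  apply: (@le_trans _ _ (C2 * (h * x 0 i) * (2 * expR (- (d * vsum x))))).
    by rewrite ler_wpM2l ?mulr_ge0 ?(ltW h0).
  rewrite [leLHS](_ : _ = h * (2 * C2 * (x 0 i * expR (- (d * vsum x))))); last by ring.
  rewrite ler_wpM2l ?(ltW h0)// -[leRHS]mulrA ler_wpM2l ?mulr_ge0//; apply: le_trans sle.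
  by rewrite ler_wpM2r ?expR_ge0.
(* The increment of the smoothed weight is estimated at an intermediate dilate y, to which [lap_dom]
   still applies. The constant K3 grows like 1/eps, so this majorant serves for fixed eps only. *)
have mv : exists2 y : 'rV[R]_n, [/\ vge0 y & vsum y <= 2 * vsum x] & `|omegaE k eps x' - omegaE k eps x| <= h * (omegaE k eps y * (K3 * x 0 i)).
  pose f (t : R) := omegaE k eps (vscale i t x).
  have [t tI e] := @MVT R f (fun t => omegaE k eps (vscale i t x) * dlogE k eps i x (vscale i t x)) 1 s ltac:(by rewrite /s ltrDl)
    (fun t _ => omegaE_deriv k e0 i x t)
    ltac:(by apply: derivable_within_continuous => t _; exact: (@ex_derive _ _ _ _ _ _ _ (omegaE_deriv k e0 i x t))).
  have v1x : vscale i 1 x = x by apply/rowP => j; rewrite mxE mul1r if_same.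
  have /andP[t1 t2] : 1 < t < s by move: tI; rewrite in_itv.
  have t12 : 1 <= t <= 2 by case/andP: s12 => _ s2; rewrite (ltW t1) (le_trans (ltW t2)).
  exists (vscale i t x); first by split; [apply/posv_ge0/vscale_posv => //; lra|have /andP[] := vscale_vsum i xg t12].
  move: e; rewrite /f v1x -/x' => ->; rewrite sh normrM (ger0_norm (ltW h0)) mulrC ler_wpM2l ?(ltW h0)//.
  rewrite normrM (ger0_norm (omegaE_ge0 _ _ _)) ler_wpM2l ?omegaE_ge0//; exact: dlogE_bound.
have [y [y0 y2] oy] := mv.
have Kx : 0 <= K3 * x 0 i by rewrite mulr_ge0.
have b2 : cmod (Phi x * RC (K3 * x 0 i)) <= K3 * (1 + vsum x) * expR (- (d * vsum x)).
  rewrite cmodM cmod_RC ger0_norm//.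
  have -> : cmod (Phi x) * (K3 * x 0 i) = K3 * (x 0 i * cmod (Phi x)) by ring.
  rewrite -mulrA ler_wpM2l//; apply: le_trans sle; apply: ler_pM; rewrite ?cmod_ge0//; exact: Phi_le.
have b3 := HC eps x y (Phi x * RC (K3 * x 0 i)) K3 ee x0 y0 y2 K30 b2.
apply: le_trans b3; rewrite -[Phi x * _ * _]mulrA !cmodM ler_wpM2l ?cmod_ge0// ler_wpM2l ?cmod_ge0//.
rewrite !cmod_RC normrM (ger0_norm (ler0n _ _)) -ler_pdivlMl// -/h; apply: le_trans oy _.
rewrite ler_wpM2l ?(ltW h0)// !ger0_norm ?omegaE_ge0//; by rewrite mulrC.
Qed.
(* The integral of d/dx_i (x_i E(-x, w) Delta^b omega_eps) vanishes, obtained by differentiating in [s] the invariance of the integral under x_i -> s x_i. *)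
Lemma lap_ibp eps i : 0 < eps <= 1 -> vintble (lap_lim eps i) /\ vint (lap_lim eps i) = 0.
Proof.
move=> ee; have /andP[e0 e1] := ee; have ee' : 0 <= eps <= 1 by rewrite (ltW e0).
have [C C0 HC] := lap_g_bound i ee.
have iM : vintble (fun x => RC (C * M x)).
  apply: (vintble_dom_laplace (C := C)); last by move=> x _; rewrite cmod_RC ger0_norm// mulr_ge0// M_vmaj vmaj_ge0.
  apply: cmeas_RC; apply: measurable_funM => //; apply: measurable_funM.
    by apply: measurable_prod => j _; apply: (measurableT_comp (f := fun t : measurableTypeR R => t `^ cRe b)); [exact: measurable_powRl|exact: measurable_tv].
  apply: measurableT_comp => //; apply: measurableT_comp => //; apply: measurable_funM => //.
  by apply: measurable_sum => j; exact: measurable_tv.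
have [a c d'] := @cint_dct _ _ _ (tmu R n) (@Dpos R n) (@measurable_Dpos R n) (fun m s => lap_g eps i m (tv s)) (fun s => lap_lim eps i (tv s)) (fun s => RC (C * M (tv s)))
  (fun m => cintble_meas (lap_g_int i m ee').1) iM
  (fun m s Ds => ltac:(by rewrite cmod_leP; apply: HC; apply/Dpos_posv))
  (fun s Ds => ltac:(by apply: lap_g_lim => //; apply/Dpos_posv)).
split; first exact: a.
have E m : cint (tmu R n) (@Dpos R n) (fun s => lap_g eps i m (tv s)) = 0 := (lap_g_int i m ee').2.
apply: (@ccvg_uniq R (fun m => cint (tmu R n) (@Dpos R n) (fun s => lap_g eps i m (tv s)))); first by split; [exact: c|exact: d'].
by apply: ccvg_eq (ccvg_cst 0) => m; rewrite E.
Qed.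
End laplace.

Section vint_alg.
Variables (R : realType) (n : nat).
Implicit Types G H : 'rV[R]_n -> CC R.
Local Notation mD := (@measurable_Dpos R n).
Lemma vintbleD G H : vintble G -> vintble H -> vintble (fun x => G x + H x).
Proof. by move=> iG iH; exact: (cintbleD mD iG iH). Qed.
Lemma vintD G H : vintble G -> vintble H -> vint (fun x => G x + H x) = vint G + vint H.
Proof. by move=> iG iH; exact: (cintD mD iG iH). Qed.
Lemma vintbleB G H : vintble G -> vintble H -> vintble (fun x => G x - H x).
Proof. by move=> iG iH; exact: (cintbleB mD iG iH). Qed.
Lemma vintB G H : vintble G -> vintble H -> vint (fun x => G x - H x) = vint G - vint H.
Proof. by move=> iG iH; exact: (cintB mD iG iH). Qed.
Lemma vintbleZ c G : vintble G -> vintble (fun x => c * G x).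
Proof. by move=> iG; exact: (cintbleZ mD c iG). Qed.
Lemma vintZ c G : vintble G -> vint (fun x => c * G x) = c * vint G.
Proof. by move=> iG; exact: (cintZ mD c iG). Qed.
Lemma vintble_sum I (r : seq I) (P : pred I) (F : I -> 'rV[R]_n -> CC R) : (forall i, P i -> vintble (F i)) ->
  vintble (fun x => \sum_(i <- r | P i) F i x).
Proof. by move=> iF; exact: (cintble_sum mD r iF). Qed.
Lemma vint_sum I (r : seq I) (P : pred I) (F : I -> 'rV[R]_n -> CC R) : (forall i, P i -> vintble (F i)) ->
  vint (fun x => \sum_(i <- r | P i) F i x) = \sum_(i <- r | P i) vint (F i).
Proof. by move=> iF; exact: (cint_sum mD r iF). Qed.
Lemma vint_dct (F : nat -> 'rV[R]_n -> CC R) G (g : 'rV[R]_n -> R) : (forall m, vmeas (F m)) -> vintble (fun x => RC (g x)) ->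
  (forall m x, posv x -> cmod (F m x) <= g x) -> (forall x, posv x -> ccvg (fun m => F m x) (G x)) ->
  vintble G /\ ccvg (fun m => vint (F m)) (vint G).
Proof.
move=> mF ig Fg FG.
have [a c d'] := @cint_dct _ _ _ (tmu R n) (@Dpos R n) mD (fun m s => F m (tv s)) (fun s => G (tv s)) (fun s => RC (g (tv s)))
  mF ig (fun m s Ds => ltac:(by rewrite cmod_leP; apply: Fg; apply/Dpos_posv))
  (fun s Ds => ltac:(by apply: FG => //; apply/Dpos_posv)).
by split; [exact: a|split; [exact: c|exact: d']].
Qed.
Lemma vintble_meas G : vintble G -> vmeas G.
Proof. exact: cintble_meas. Qed.
Lemma vintble_vmaj (a delta C : R) : 0 < a -> 0 < delta -> vintble (fun x : 'rV[R]_n => RC (C * vmaj a delta x)).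
Proof.
move=> a0 d0; apply: (dom_intble (C := `|C|) a0 d0) => [|x _].
  apply: cmeas_RC; apply: measurable_funM => //; apply: measurable_funM.
    by apply: measurable_prod => j _; apply: (measurableT_comp (f := fun t : measurableTypeR R => t `^ (a - 1))); [exact: measurable_powRl|exact: measurable_tv].
  apply: measurableT_comp => //; apply: measurableT_comp => //; apply: measurable_funM => //.
  by apply: measurable_sum => j; exact: measurable_tv.
by rewrite cmod_RC normrM (ger0_norm (vmaj_ge0 _ _ _)).
Qed.
End vint_alg.

Section laplaceB.
Variables (R : realType) (n : nat) (k : R).
Hypothesis k0 : 0 <= k.
Local Notation V := ('rV[CC R]_n).
Implicit Types (x : 'rV[R]_n).
Variables (w : V) (d : R) (b : CC R).
Hypotheses (d0 : 0 < d) (dw : forall i, d < cRe (w 0 i)) (b1 : -1 < cRe b).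
Let Phi x := EE k0 (- rv2C x) w.
Let Db x := Deltapow (rv2C x) b.
Let M x : R := (\prod_i x 0 i `^ cRe b) * expR (- (d / 2 * vsum x)).
Let sw (i j : 'I_n) x := permv (tperm i j) x.
Let q eps x (i j : 'I_n) : R := (x 0 i - x 0 j) ^+ 2 + eps.
(** The contribution of the pair (i, j) to [lap_lim] through the logarithmic derivative of the
    weight; it is integrable for each eps > 0, but with a bound that grows like 1/eps. *)
Definition lapA eps i j x : CC R := Db x * (Phi x * RC (2 * k * x 0 i * (x 0 i - x 0 j) / q eps x i j) * RC (omegaE k eps x)).
(* [lap_lim] symmetrised under x_i <-> x_j: the singular quotient is now bounded uniformly in [eps], so that [eps = 0] may be reached by dominated convergence (at [eps = 0] and x_i = x_j the quotient is 0/0 = 0). *)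
Definition lapS eps i x : CC R :=
  Db x * (((1 + b) * Phi x + RC (x 0 i) * dPhi k0 w i x + \sum_(j | j != i) RC (k * ((x 0 i - x 0 j) / q eps x i j)) * (RC (x 0 i) * Phi x - RC (x 0 j) * Phi (sw i j x)))
    * RC (omegaE k eps x)).
Lemma quot_le (u eps : R) : 0 < eps -> eps <= 1 -> `|u| / (u ^+ 2 + eps) <= eps^-1.
Proof.
move=> e0 e1; have q0 : 0 < u ^+ 2 + eps by rewrite ltr_wpDl ?sqr_ge0.
rewrite ler_pdivrMr// mulrC -ler_pdivrMr ?invr_gt0// invrK.
have [d1|d1] := leP `|u| 1; first by apply: le_trans (_ : eps <= _); [rewrite ler_piMl ?(ltW e0)|rewrite lerDr sqr_ge0].
apply: le_trans (_ : u ^+ 2 <= _); last by rewrite lerDl ltW.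
rewrite -(real_normK (num_real u)) expr2 ler_wpM2l//; exact: le_trans (ltW d1).
Qed.
Lemma coord_le_vsum x i : vge0 x -> x 0 i <= vsum x.
Proof. by move=> xg; rewrite /vsum (bigD1 i)//= lerDl sumr_ge0// => j _. Qed.
Lemma lapA_int eps i j : 0 < eps -> eps <= 1 -> vintble (lapA eps i j).
Proof.
move=> e0 e1; have ee : 0 <= eps <= 1 by rewrite (ltW e0).
have [C C0 HC] := lap_dom n k0 b d0.
have K0 : 0 <= 2 * k * eps^-1 by rewrite mulr_ge0 ?mulr_ge0 ?invr_ge0 ?(ltW e0).
apply: (@vintble_dom_laplace R n d b d0 b1 _ (2 * k * eps^-1 * C)) => //.
  have mI : measurable_fun (@Dpos R n) (fun s => 2 * k * (tv s) 0 i * ((tv s) 0 i - (tv s) 0 j) / q eps (tv s) i j).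
    apply: measurable_funM; first by apply: measurable_funM; [apply: measurable_funM => //; exact: measurable_tv|apply: measurable_funB; exact: measurable_tv].
    apply: (measurableT_comp (f := fun t : measurableTypeR R => t^-1 : measurableTypeR R)); first exact: measurable_inv.
    by apply: measurable_funD => //; apply: measurable_funX; apply: measurable_funB; exact: measurable_tv.
  apply: cmeasM; first exact: cmeas_Deltapow.
  apply: cmeasM; last by apply: cmeas_RC; exact: measurable_omegaE.
  by apply: cmeasM; [exact: cmeas_EE_neg|exact: cmeas_RC].
move=> x x0; have xg := posv_ge0 x0; have sx := vsum_ge0 xg.
apply: (HC eps x x _ _ ee x0 xg) => //; first by rewrite ler_peMl// ler1n.
rewrite cmodM cmod_RC mulrC -!mulrA !normrM mulrA (ger0_norm k0) (ger0_norm (ler0n _ 2)) -!mulrA ler_wpM2l// ler_wpM2l//.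
have P1 := Phi_le k0 dw x0.
have xi := coord_le_vsum i xg.
rewrite normfV (gtr0_norm (_ : 0 < q eps x i j)); last by rewrite ltr_wpDl ?sqr_ge0.
rewrite (ger0_norm (xg i)).
have q1 := quot_le (x 0 i - x 0 j) e0 e1; rewrite -/(q eps x i j) in q1.
have q0 : 0 <= `|x 0 i - x 0 j| / q eps x i j by rewrite divr_ge0// addr_ge0 ?sqr_ge0 ?(ltW e0).
have e2 := expR_ge0 (- (d * vsum x)).
have := ler_pM q0 (mulr_ge0 (xg i) (cmod_ge0 (Phi x))) q1 (ler_pM (xg i) (cmod_ge0 _) xi P1).
have -> : `|x 0 i - x 0 j| / q eps x i j * (x 0 i * cmod (Phi x)) = x 0 i * (`|x 0 i - x 0 j| * ((q eps x i j)^-1 * cmod (Phi x))) by ring.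
move=> /le_trans; apply; rewrite ler_wpM2l ?invr_ge0 ?(ltW e0)//.
by rewrite ler_wpM2r// lerDr.
Qed.
Lemma swap_coord i j x : [/\ (sw i j x) 0 i = x 0 j, (sw i j x) 0 j = x 0 i & sw i j (sw i j x) = x].
Proof.
split; rewrite ?mxE ?tpermL ?tpermR//.
by rewrite /sw permvM tperm2 permv1.
Qed.
Lemma Db_sw i j x : Db (sw i j x) = Db x.
Proof. by rewrite /Db /Deltapow (reindex_inj (@perm_inj _ (tperm i j))) /=; apply: eq_bigr => l _; rewrite !mxE tpermK. Qed.
(** The symmetrised integrand differs from [lap_lim] by half the sum over j of lapA(s_ij x) -
    lapA(x), and each of these differences has integral 0 by invariance under permutations. *)
Lemma lapS_int eps i : 0 < eps -> eps <= 1 -> vintble (lapS eps i) /\ vint (lapS eps i) = 0.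
Proof.
move=> e0 e1; have ee : 0 < eps <= 1 by rewrite e0.
have [iL eL] := lap_ibp k0 d0 dw b1 i ee.
have iA j : vintble (lapA eps i j) := lapA_int i j e0 e1.
pose D j x := lapA eps i j (sw i j x) - lapA eps i j x.
have iD j : vintble (D j) := vintbleB (vint_perm (tperm i j) (iA j)).1 (iA j).
have eD j : vint (D j) = 0 by rewrite (vintB (vint_perm (tperm i j) (iA j)).1 (iA j)) (vint_perm (tperm i j) (iA j)).2 subrr.
have iS : vintble (fun x => \sum_(j | j != i) D j x) by apply: vintble_sum.
have eS : vint (fun x => \sum_(j | j != i) D j x) = 0 by rewrite vint_sum// big1.
have i2 := vintbleZ (RC 2^-1) iS.
have E x : lapS eps i x = lap_lim k0 w b eps i x + RC 2^-1 * \sum_(j | j != i) D j x.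
  rewrite /lapS /lap_lim -/(Phi x) -/(Db x) dlogE_self.
  have RCs (I : Type) (r : seq I) (P : pred I) (f : I -> R) : RC (\sum_(j <- r | P j) f j) = \sum_(j <- r | P j) RC (f j).
    by elim/big_rec2: _ => [|j u v _ <-]; rewrite ?RC0 ?RCD.
  rewrite RCs mulr_sumr mulr_sumr.
  have alg1 (A B C S O : CC R) : A * ((B + C + S) * O) = A * (O * (B + C)) + A * O * S by ring.
  have alg2 (A B C S O : CC R) : A * (O * (B + C + S)) = A * (O * (B + C)) + A * O * S by ring.
  rewrite alg1 alg2 -addrA; congr (_ + _); rewrite !mulr_sumr -big_split /=; apply: eq_bigr => j ji.
  have [s1 s2 s3] := swap_coord i j x.
  rewrite /D /lapA s1 s2 Db_sw omegaE_permv -/(Phi x).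
  have -> : q eps (sw i j x) i j = q eps x i j by rewrite /q s1 s2 -sqrrN opprB.
  rewrite -/(q eps x i j).
  rewrite !RCM !RCB.
  have R2 : RC (2 : R) = 1 + 1 by rewrite -RC1 -RCD.
  have h2 : RC (2^-1 : R) * (1 + 1) = 1 by rewrite -R2 -RCM mulVf// pnatr_eq0.
  rewrite R2.
  have alg (A O K q' a c P P' h : CC R) : h * (1 + 1) = 1 -> A * O * (K * ((a - c) * q') * (a * P - c * P')) =
     A * O * (P * ((1 + 1) * K * a * (a - c) * q')) + h * (A * (P' * ((1 + 1) * K * c * (c - a) * q') * O) - A * (P * ((1 + 1) * K * a * (a - c) * q') * O)).
    move=> ht; apply/eqP; rewrite -subr_eq0; apply/eqP.
    transitivity ((h * (1 + 1) - 1) * (A * O * K * q' * (a - c) * (a * P + c * P'))); first by ring.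
    by rewrite ht subrr mul0r.
  exact: alg.
split; first by apply: vintble_eq (vintbleD iL i2) => x _; rewrite E.
by rewrite (vint_eq (fun x _ => E x)) vintD// eL vintZ// eS mulr0 addr0.
Qed.
(** The Lipschitz estimate bounds the difference quotients uniformly and passes to their limit. *)
Lemma dPhi_bound i : exists2 C, 0 <= C & forall x, posv x -> cmod (RC (x 0 i) * dPhi k0 w i x) <= C * vsum x * expR (- (d * vsum x)).
Proof.
have [C2 C20 H2] := EE_neg_lip k0 dw.
exists (2 * C2) => [|x x0]; first by rewrite mulr_ge0.
apply: (ccvg_le (Phi_seq k0 w i x)) => m; have xg := posv_ge0 x0.
set s : R := 1 + (m.+1%:R)^-1; set h : R := (m.+1%:R)^-1 in s *.
have h0 : 0 < h by exact: harm_gt0.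
have h1 : h <= 1 by exact: harm_le1.
have s12 : 1 <= s <= 2 by rewrite /s; lra.
have s0 : 0 < s by rewrite /s; lra.
have sh : s - 1 = h by rewrite /s addrAC subrr add0r.
have x'0 := vscale_posv i s0 x0; set x' := vscale i s x in x'0 *.
have /andP[v1 v2] := vscale_vsum i xg s12; rewrite -/x' in v1 v2.
rewrite cmodM cmod_RC ger0_norm// -ler_pdivlMl// -/h.
have := H2 x' x (h * x 0 i) (mulr_ge0 (ltW h0) (xg i)) (posv_ge0 x'0) xg
  ltac:(by move=> j; apply: le_trans (vscale_diff i j xg _) _; [case/andP: s12|rewrite sh]).
rewrite cmod_leP => /le_trans; apply.
have e2 : expR (- (d * vsum x')) + expR (- (d * vsum x)) <= 2 * expR (- (d * vsum x)).
  by rewrite mulr_natl mulr2n lerD2r ler_expR lerN2 ler_wpM2l// ltW.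
apply: (@le_trans _ _ (C2 * (h * x 0 i) * (2 * expR (- (d * vsum x))))).
  by rewrite ler_wpM2l// mulr_ge0// mulr_ge0// (ltW h0).
rewrite [leLHS](_ : _ = h * (2 * C2 * x 0 i * expR (- (d * vsum x)))); last by ring.
rewrite ler_wpM2l ?(ltW h0)// ler_wpM2r ?expR_ge0// ler_wpM2l ?mulr_ge0//; exact: coord_le_vsum.
Qed.
Lemma vsum_sw i j x : vsum (sw i j x) = vsum x.
Proof. by rewrite /vsum [RHS](reindex_inj (@perm_inj _ (tperm i j))) /=; apply: eq_bigr => l _; rewrite mxE. Qed.
(** By the Lipschitz estimate x_i Phi(x) - x_j Phi(s_ij x) is of order |x_i - x_j|. Against the
    quotient (x_i - x_j) / ((x_i - x_j)^2 + eps) this is bounded independently of eps, since |u|^2 /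
    (u^2 + eps) <= 1. *)
Lemma lapS_bound i : exists2 C, 0 <= C & forall eps x, 0 < eps -> eps <= 1 -> posv x -> cmod (lapS eps i x) <= C * M x.
Proof.
have [C2 C20 H2] := EE_neg_lip k0 dw; have [C3 C30 H3] := dPhi_bound i.
have [C C0 HC] := lap_dom n k0 b d0.
pose K := cmod (1 + b) + C3 + \sum_(j < n | j != i) k * (1 + 2 * C2).
have k2 : 0 <= k * (1 + 2 * C2) by rewrite mulr_ge0// addr_ge0// mulr_ge0.
have K0 : 0 <= K by rewrite !addr_ge0 ?cmod_ge0// sumr_ge0.
exists (K * C) => [|eps x e0 e1 x0]; first by rewrite mulr_ge0.
have ee : 0 <= eps <= 1 by rewrite (ltW e0).
have xg := posv_ge0 x0; have sx := vsum_ge0 xg.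
apply: (HC eps x x _ K ee x0 xg) => //; first by rewrite ler_peMl// ler1n.
have P1 y : posv y -> cmod (Phi y) <= expR (- (d * vsum y)) := Phi_le k0 dw (x := y).
set e := expR _; have eg : 0 <= e by exact: expR_ge0.
have one : e <= (1 + vsum x) * e by rewrite ler_peMl// lerDl.
have sle : vsum x * e <= (1 + vsum x) * e by rewrite ler_wpM2r// lerDr.
rewrite /K -mulrA [leRHS]mulrDl [X in _ <= X + _]mulrDl; apply: le_trans (cmodD _ _) _; apply: lerD.
  apply: le_trans (cmodD _ _) _; apply: lerD.
    rewrite cmodM ler_wpM2l ?cmod_ge0//; apply: le_trans one; exact: P1.
  by apply: le_trans (H3 x x0) _; rewrite -mulrA ler_wpM2l.
have cs (F : 'I_n -> CC R) : cmod (\sum_(j | j != i) F j) <= \sum_(j | j != i) cmod (F j).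
  elim/big_rec2: _ => [|j u v _ h]; first by rewrite cmod_RC normr0.
  by apply: le_trans (cmodD _ _) _; rewrite lerD2l.
apply: le_trans (cs _) _; rewrite mulr_suml; apply: ler_sum => j ji.
set u := x 0 i - x 0 j.
have q0 : 0 < q eps x i j by rewrite ltr_wpDl ?sqr_ge0.
have -> : RC (x 0 i) * Phi x - RC (x 0 j) * Phi (sw i j x) = RC (x 0 i) * (Phi x - Phi (sw i j x)) + RC u * Phi (sw i j x).
  by rewrite /u RCB; ring.
have u2 : `|u| * `|u| / q eps x i j <= 1.
  by rewrite ler_pdivrMr// mul1r -normrM ger0_norm -?expr2 ?sqr_ge0// lerDl ltW.
have swp : posv (sw i j x) by move=> l; rewrite mxE.
have L1 : cmod (Phi x - Phi (sw i j x)) <= C2 * `|u| * (2 * e).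
  have := H2 x (sw i j x) `|u| (normr_ge0 _) xg (posv_ge0 swp); rewrite vsum_sw -/e cmod_leP => H.
  have -> : 2 * e = e + e by rewrite mulr_natl.
  apply: H => l; rewrite mxE; case: tpermP => [->//|->|_ _]; first by rewrite distrC.
  by rewrite subrr normr0.
have L2 : cmod (RC (x 0 i) * (Phi x - Phi (sw i j x)) + RC u * Phi (sw i j x)) <= `|u| * ((1 + 2 * C2) * ((1 + vsum x) * e)).
  apply: le_trans (cmodD _ _) _; rewrite !cmodM !cmod_RC (ger0_norm (xg i)).
  have h1 := P1 _ swp; rewrite vsum_sw -/e in h1.
  have h3 : x 0 i * cmod (Phi x - Phi (sw i j x)) <= vsum x * (C2 * `|u| * (2 * e)).
    by apply: ler_pM => //; [exact: cmod_ge0|exact: coord_le_vsum].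
  have h4 : `|u| * cmod (Phi (sw i j x)) <= `|u| * e by rewrite ler_wpM2l.
  apply: le_trans (lerD h3 h4) _.
  have -> : vsum x * (C2 * `|u| * (2 * e)) + `|u| * e = `|u| * (e + 2 * C2 * (vsum x * e)) by ring.
  rewrite ler_wpM2l// [leRHS]mulrDl mul1r; apply: lerD => //; by rewrite ler_wpM2l// mulr_ge0.
rewrite cmodM cmod_RC normrM (ger0_norm k0) -!mulrA ler_wpM2l// normrM normfV (gtr0_norm q0).
apply: le_trans (ler_wpM2l _ L2) _; first by rewrite mulr_ge0 ?invr_ge0 ?(ltW q0).
set B := (1 + 2 * C2) * _.
have B0 : 0 <= B by rewrite /B mulr_ge0 ?mulr_ge0 ?addr_ge0 ?mulr_ge0.
rewrite (_ : `|u| / _ * _ = (`|u| * `|u| / q eps x i j) * B); last by ring.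
by rewrite -[leRHS]mul1r ler_wpM2r.
Qed.
Lemma cvg_prodP (I : Type) (r : seq I) (P : pred I) (f : I -> nat -> R) (l : I -> R) : (forall i, f i @ \oo --> l i) ->
  (fun m => \prod_(i <- r | P i) f i m) @ \oo --> \prod_(i <- r | P i) l i.
Proof.
move=> H; elim: r => [|i r IH].
  by rewrite big_nil; under eq_fun do rewrite big_nil; exact: cvg_cst.
rewrite big_cons; under eq_fun do rewrite big_cons.
by case: (P i) => //; exact: cvgM.
Qed.
Lemma powR_eps_lim (u : R) : 0 <= u -> (fun m : nat => (u + (m.+1%:R)^-1) `^ k) @ \oo --> u `^ k.
Proof.
rewrite le_eqVlt => /orP[/eqP <-|u0].
  (* At u = 0 the exponent 0 is separate: 0 to the power 0 is 1 here, so the limit is not 0. *)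
  have [->|kn] := eqVneq k 0; first by under eq_fun do rewrite powRr0; rewrite powRr0; exact: cvg_cst.
  have kp : 0 < k by rewrite lt_def kn.
  rewrite (powR0 kn); apply/cvgrPdist_le => e e0; near=> m.
  rewrite sub0r normrN add0r ger0_norm ?powR_ge0//.
  have h : (m.+1%:R)^-1 <= e `^ k^-1 by near: m; apply: near_harm; rewrite powR_gt0.
  apply: le_trans (ge0_ler_powR k0 _ _ h) _; rewrite ?nnegrE ?powR_ge0// ?invr_ge0//.
  by rewrite -powRrM mulVf// powRr1// ltW.
have E (t : R) : 0 < t -> t `^ k = expR (k * ln t) by move=> t0; rewrite /powR gt_eqF.
rewrite E//; under eq_fun do rewrite E ?addr_gt0 ?harm_gt0//.
apply: continuous_cvg; first exact: continuous_expR.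
apply: cvgM; first exact: cvg_cst.
apply: continuous_cvg; first exact: continuous_ln.
by rewrite -[X in _ --> X]addr0; apply: cvgD; [exact: cvg_cst|exact: cvg_harm].
Unshelve. all: by end_near. Qed.
Lemma lapS_lim i x : ccvg (fun m => lapS (m.+1%:R)^-1 i x) (lapS 0 i x).
Proof.
apply: ccvgM; first exact: ccvg_cst.
apply: ccvgM; last first.
  apply: ccvg_RC; apply: cvg_prodP => a; apply: cvg_prodP => c; rewrite addr0.
  by apply: powR_eps_lim; exact: sqr_ge0.
apply: ccvgD; first exact: ccvg_cst.
apply: ccvg_sum => j; apply: ccvgM; last exact: ccvg_cst.
apply: ccvg_RC; apply: cvgM; first exact: cvg_cst.
rewrite /q; have [->|u0] := eqVneq (x 0 i - x 0 j) 0.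
  by rewrite mul0r; under eq_fun do rewrite mul0r; exact: cvg_cst.
apply: cvgM; first exact: cvg_cst.
apply: cvgV; first by rewrite addr0 sqrf_eq0.
by apply: cvgD; [exact: cvg_cst|exact: cvg_harm].
Qed.
Lemma omegaA_neq0 x (i j : 'I_n) : omegaA k x != 0 -> i != j -> k != 0 -> x 0 i != x 0 j.
Proof.
move=> H ij kn; apply/negP => /eqP e; move/negP: H; apply.
wlog lij : i j ij e / (i < j)%N.
  move=> W; have : (i != j :> nat) by [].
  by rewrite neq_ltn => /orP[l|l]; [exact: (W i j)|apply: (W j i) => //; rewrite eq_sym].
rewrite /omegaA (bigD1 i)//= (bigD1 j)//= e subrr normr0 powR0 ?mul0r// mulf_neq0// pnatr_eq0.
Qed.
(** Where omega does not vanish and k > 0 the quotient is 1 / (x_i - x_j), and the difference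
    quotients together with x_i d/dx_i recombine into x_i T_i E(-w, .) = - w_i x_i E(-w, .); the
    leftover is k times the reflected values. Where omega vanishes both sides are 0, and for k = 0
    the quotient terms carry the factor 0. *)
Lemma lapS0 i x : lapS 0 i x = (1 + b) * (Phi x * (Db x * RC (omegaA k x)))
  + \sum_(j | j != i) RC k * (Phi (sw i j x) * (Db (sw i j x) * RC (omegaA k (sw i j x))))
  - w 0 i * (Phi x * (RC (x 0 i) * (Db x * RC (omegaA k x)))).
Proof.
rewrite /lapS omegaE0; have [oz|on] := eqVneq (omegaA k x) 0; first rewrite oz.
  rewrite RC0 !mulr0 subr0 add0r big1// => j _; by rewrite omegaA_permv oz RC0 !mulr0.
under [in RHS]eq_bigr do rewrite Db_sw omegaA_permv.
have T := EE_dunkl k0 (- w) i (rv2C x).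
have Q j : j != i -> RC (k * ((x 0 i - x 0 j) / q 0 x i j)) * (RC (x 0 i) * Phi x - RC (x 0 j) * Phi (sw i j x)) =
   RC k * Phi (sw i j x) + RC (x 0 i) * (RC k * dunkl_quot (EE k0 (- w)) i j (rv2C x)).
  move=> ji; have [kz|kn] := eqVneq k 0.
    have kC : RC k = 0 :> CC R by rewrite kz RC0.
    by rewrite [RC (k * _)]RCM kC !mul0r mulr0 addr0.
  have u0 : x 0 i - x 0 j != 0 by rewrite subr_eq0 (omegaA_neq0 on)// eq_sym.
  have uC : RC (x 0 i - x 0 j) != 0 by rewrite -RC0; apply: contra u0 => /eqP /RC_inj ->.
  have -> : (x 0 i - x 0 j) / q 0 x i j = (x 0 i - x 0 j)^-1.
    by rewrite /q addr0 expr2 invfM mulrA divff// mul1r.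
  rewrite /dunkl_quot !rv2C_coord.
  rewrite (_ : (RC (x 0 i) == RC (x 0 j)) = false); last first.
    by apply/negP => /eqP /RC_inj e; rewrite e subrr eqxx in u0.
  rewrite -RCB [RC (k * _)]RCM.
  have -> : RC (x 0 i - x 0 j)^-1 = (RC (x 0 i - x 0 j))^-1.
    by apply: (mulfI uC); rewrite divff// -RCM divff.
  have -> : swapv i j (rv2C x) = rv2C (sw i j x) by apply/rowP => l; rewrite !mxE.
  rewrite /Phi !Phi_alt.
  have alg (K D a c P P' U : CC R) : U != 0 -> U = a - c -> K * U^-1 * (a * P - c * P') = K * P' + a * (K * ((P - P') / U)).
    by move=> U0 UE; have -> : a = U + c by [rewrite UE subrK]; field.
  by apply: (alg _ 0) => //; rewrite RCB.
rewrite (eq_bigr _ Q) big_split /=.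
have -> : (\sum_(j | j != i) RC (x 0 i) * (RC k * dunkl_quot (EE k0 (- w)) i j (rv2C x))) = RC (x 0 i) * (- w 0 i * Phi x - dPhi k0 w i x).
  rewrite -mulr_sumr -mulr_sumr; congr (_ * _); rewrite /Phi Phi_alt /dPhi.
  have -> : - w 0 i = (- w) 0 i by rewrite mxE.
  by rewrite -T /dunklA addrAC subrr add0r.
have -> : \sum_(j | j != i) RC k * (Phi (sw i j x) * (Db x * RC (omegaA k x))) = (\sum_(j | j != i) RC k * Phi (sw i j x)) * (Db x * RC (omegaA k x)).
  by rewrite mulr_suml; apply: eq_bigr => j _; rewrite mulrA.
move: (\sum_(j | _) _) (Phi x) (Db x) (RC (omegaA k x)) (dPhi k0 w i x) (RC (x 0 i)) (w 0 i) => S P D O dP X W; ring.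
Qed.
Lemma lap_int_bound (g : 'rV[R]_n -> R) (K : R) : measurable_fun (@Dpos R n) (fun s => g (tv s)) -> 0 <= K ->
  (forall x, posv x -> `|g x| <= K * (1 + vsum x)) -> vintble (fun x => Phi x * (RC (g x) * (Db x * RC (omegaA k x)))).
Proof.
move=> mg K0 gK; have [C C0 HC] := lap_dom n k0 b d0.
apply: (@vintble_dom_laplace R n d b d0 b1 _ (K * C)).
  apply: cmeasM; first exact: cmeas_EE_neg.
  apply: cmeasM; first exact: cmeas_RC.
  by apply: cmeasM; [exact: cmeas_Deltapow|apply: cmeas_RC; exact: measurable_omegaA].
move=> x x0; have xg := posv_ge0 x0; have sx := vsum_ge0 xg.
rewrite (_ : Phi x * _ = Db x * (Phi x * RC (g x) * RC (omegaE k 0 x))); last by rewrite omegaE0; ring.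
apply: (HC 0 x x _ K _ x0 xg) => //; [by rewrite lexx ler01|by rewrite ler_peMl// ler1n|].
by rewrite cmodM mulrC cmod_RC; apply: ler_pM; rewrite ?cmod_ge0 ?gK//; exact: (Phi_le k0 dw).
Qed.
(* In terms of the Dunkl operators this is w_i T_i L = - nu L, with nu = 1 + b + mu0, for the Laplace transform L. *)
Lemma lap_recurrence i : (1 + b + RC (mu0 n k)) * Gint k0 id (fun x => Db x * RC (omegaA k x)) w =
   w 0 i * Gint k0 id (fun x => RC (x 0 i) * (Db x * RC (omegaA k x))) w.
Proof.
have [C C0 HC] := lapS_bound i.
have h0 m : 0 < (m.+1%:R : R)^-1 by exact: harm_gt0.
have h1 m : (m.+1%:R : R)^-1 <= 1 by exact: harm_le1.
have iM : vintble (fun x => RC (C * M x)).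
  by apply: vintble_eq (vintble_vmaj n C (exponent_gt0 b1) (divr_gt0 d0 (ltr0n _ 2))) => x _; rewrite /M M_vmaj.
have [iS cS] := vint_dct (g := fun x => C * M x) (fun m => vintble_meas (lapS_int i (h0 m) (h1 m)).1) iM (fun m x => HC _ x (h0 m) (h1 m)) (fun x _ => lapS_lim i x).
have S0 : vint (lapS 0 i) = 0.
  by apply: (ccvg_uniq cS); apply: ccvg_eq (ccvg_cst 0) => m; rewrite (lapS_int i (h0 m) (h1 m)).2.
have i1 : vintble (fun x => Phi x * (Db x * RC (omegaA k x))).
  apply: vintble_eq (lap_int_bound (g := fun=> 1) (measurable_cst _) ler01 _) => [x _|x x0]; first by rewrite RC1 mul1r.
  by rewrite normr1 mul1r lerDl vsum_ge0//; exact: posv_ge0.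
have i2 : vintble (fun x => Phi x * (RC (x 0 i) * (Db x * RC (omegaA k x)))).
  have b2 (x : 'rV[R]_n) : posv x -> `|x 0 i| <= 1 * (1 + vsum x).
    have := coord_le_vsum i; move=> /(_ x) H x0; have xg := posv_ge0 x0; rewrite mul1r ger0_norm//; apply: le_trans (H xg) _; by rewrite lerDr.
  have H := lap_int_bound (g := fun x : 'rV[R]_n => x 0 i) (measurable_tv i (E := @Dpos R n)) ler01 b2.
  exact: H.
have i3 j := vint_perm (tperm i j) i1.
have i4 : vintble (fun x => \sum_(j | j != i) RC k * (Phi (sw i j x) * (Db (sw i j x) * RC (omegaA k (sw i j x))))).
  by apply: vintble_sum => j _; apply: vintbleZ; exact: (i3 j).1.
move: S0; rewrite (vint_eq (fun x _ => lapS0 i x)).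
rewrite vintB; [|by apply: vintbleD => //; exact: vintbleZ|exact: vintbleZ].
rewrite vintD//; last exact: vintbleZ.
rewrite vint_sum; last by move=> j _; apply: vintbleZ; exact: (i3 j).1.
rewrite !vintZ// (eq_bigr (fun=> RC k * vint (fun x => Phi x * (Db x * RC (omegaA k x))))); last first.
  by move=> j _; rewrite (vintZ _ (i3 j).1) (i3 j).2.
rewrite sumr_const cardC1 card_ord => /eqP; rewrite subr_eq0 => /eqP; rewrite /Gint /= => <-.
rewrite mu0E -[in RHS]mulr_natr RCM.
have -> : RC (n.-1%:R : R) = n.-1%:R by rewrite /RC -[RHS](rmorph_nat (@real_complex R)).
rewrite -/(Phi _).
move: (vint _) => L; ring.
Qed.

End laplaceB.

(** * Dunkl operators on powers of Delta *)

Section dunkl_sym.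
Variables (R : realType) (n : nat) (k : R).
Hypothesis k0 : 0 <= k.
Local Notation V := ('rV[CC R]_n).
Implicit Types (z y h : V) (f g : V -> CC R) (s : CC R).
Lemma dunkl_mul_sym (f g : V -> CC R) L M i z : cder f z L -> cder g z M -> (forall j, g (swapv i j z) = g z) ->
  (forall j, z 0 i = z 0 j -> M (evec i) = M (evec j)) ->
  dunklA k i (fun x => f x * g x) z = dunklA k i f z * g z + f z * M (evec i).
Proof.
move=> cf cg gs Ms; rewrite (dunklA_cder k i (cderM cf cg)) (dunklA_cder k i cf) /dunkl_form.
have E : \sum_(j | j != i) (if z 0 i == z 0 j then L (evec i) * g z + f z * M (evec i) - (L (evec j) * g z + f z * M (evec j))
    else (f z * g z - f (swapv i j z) * g (swapv i j z)) / (z 0 i - z 0 j))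
  = (\sum_(j | j != i) (if z 0 i == z 0 j then L (evec i) - L (evec j) else (f z - f (swapv i j z)) / (z 0 i - z 0 j))) * g z.
  rewrite mulr_suml; apply: eq_bigr => j _; case: eqP => [e|_]; first by rewrite (Ms j e); ring.
  by rewrite gs; ring.
by rewrite E; ring.
Qed.
Lemma dunkl_subc (f : V -> CC R) L c i z : cder f z L -> dunklA k i (fun x => f x - c) z = dunklA k i f z.
Proof.
move=> cf; rewrite (dunklD k i cf (cder_cst (- c) z)) dunkl_cst addr0//.
Qed.
Lemma cder_prod (r : seq 'I_n) (f : 'I_n -> V -> CC R) (m : 'I_n -> V -> CC R) z :
  (forall a, cder (f a) z (fun h => m a h * f a z)) -> cder (fun x => \prod_(a <- r) f a x) z (fun h => (\sum_(a <- r) m a h) * \prod_(a <- r) f a z).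
Proof.
move=> H; elim: r => [|a r IH].
  have -> : (fun x : V => \prod_(a <- [::]) f a x) = fun=> 1 by apply/funext => x; rewrite big_nil.
  have -> : (fun h : V => (\sum_(a <- [::]) m a h) * \prod_(a <- [::]) f a z) = fun=> 0 by apply/funext => x; rewrite !big_nil mul0r.
  exact: cder_cst.
have -> : (fun x : V => \prod_(a <- a :: r) f a x) = fun x => f a x * \prod_(a <- r) f a x by apply/funext => x; rewrite big_cons.
have -> : (fun h : V => (\sum_(b <- a :: r) m b h) * \prod_(b <- a :: r) f b z) =
  fun h => m a h * f a z * \prod_(b <- r) f b z + f a z * ((\sum_(b <- r) m b h) * \prod_(b <- r) f b z).
  by apply/funext => x; rewrite !big_cons; ring.
exact: cderM (H a) IH.
Qed.
Lemma Deltapow_cder z s : RePos z -> cder (fun z => Deltapow z s) z (fun h => (\sum_a s * h 0 a / z 0 a) * Deltapow z s).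
Proof.
move=> z0; have H a := cder_cpow s (z0 a).
have := @cder_prod (index_enum 'I_n) (fun a z => cpow (z 0 a) s) (fun a h => s * h 0 a / z 0 a) z; apply => a.
have := H a; congr cder; apply/funext => h; ring.
Qed.
Lemma Deltapow_evec z s j : (\sum_a s * (evec j : V) 0 a / z 0 a) = s / z 0 j.
Proof.
rewrite (bigD1 j)//= big1 ?addr0 => [|a aj]; first by rewrite mxE !eqxx mulr1.
by rewrite mxE eqxx (negPf aj) mulr0 mul0r.
Qed.
Lemma Deltapow_dunkl (f : V -> CC R) L z s i : RePos z -> cder f z L ->
  dunklA k i (fun x => f x * Deltapow x s) z = (dunklA k i f z + s / z 0 i * f z) * Deltapow z s.
Proof.
move=> z0 cf; rewrite (dunkl_mul_sym cf (Deltapow_cder s z0)).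
- by rewrite Deltapow_evec; ring.
- by move=> j; rewrite swapvE Deltapow_permv.
- by move=> j e; rewrite !Deltapow_evec e.
Qed.
Lemma RePos_local z : RePos z -> exists2 r : CC R, 0 < r & forall h, `|h| <= r -> RePos (z + h).
Proof.
move=> z0; have [d d0 dz] := RePos_min z0; have d2 : 0 < d / 2 by rewrite divr_gt0.
exists (RC (d / 2)); first by rewrite RC_gt0.
move=> h hr l; apply: lt_trans d2 _; by apply: (RePos_near _ hr) => j; rewrite -splitr.
Qed.
Lemma dunkl_eq_RePos f g i z : (forall y, RePos y -> f y = g y) -> RePos z -> differentiable f z -> dunklA k i f z = dunklA k i g z.
Proof.
move=> E z0 df; have [r r0 H] := RePos_local z0.
apply: (@dunkl_local R n k f g i z r) => //; first by move=> h /H h0; exact: E.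
by move=> j; apply: E => l; rewrite mxE; exact: z0.
Qed.
Lemma RePos_neq0 z j : RePos z -> z 0 j != 0.
Proof. by move=> /(_ j) z0; apply/eqP => e; rewrite e ltxx in z0. Qed.
(** Successive operators T_i with distinct indices turn Delta^s into a multiple of this partial
    product of inverses times Delta^s. *)
Definition Pinv (r : seq 'I_n) (z : V) : CC R := \prod_(a <- r) cpow (z 0 a) (-1).
Lemma Pinv_cder r z : RePos z -> cder (Pinv r) z (fun h => (\sum_(a <- r) - h 0 a / z 0 a) * Pinv r z).
Proof.
move=> z0; have H a := cder_cpow (-1) (z0 a).
apply: (@cder_prod r (fun a z => cpow (z 0 a) (-1)) (fun a h => - h 0 a / z 0 a) z) => a.
have := H a; congr cder; apply/funext => h; ring.
Qed.
Lemma cpow_m1 (z : CC R) : 0 < cRe z -> cpow z (-1) = z^-1.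
Proof. by move=> z0; rewrite cpowN cpow_id. Qed.
(** For j in r the reflection s_ij replaces 1/z_j by 1/z_i, and the difference quotient is exactly P
    / z_i; indices outside r contribute nothing. The eigenvalue thus counts the operators already
    applied, the origin of the factors s + k j in [Deltapow_dunkl_seq]. *)
Lemma Pinv_dunkl r i z : RePos z -> uniq r -> i \notin r -> dunklA k i (Pinv r) z = RC (k * (size r)%:R) / z 0 i * Pinv r z.
Proof.
move=> z0 ur ir; rewrite (dunklA_cder k i (Pinv_cder r z0)) /dunkl_form.
have Li j : (\sum_(a <- r) - (evec j : V) 0 a / z 0 a) = if j \in r then - (z 0 j)^-1 else 0.
  have E a : - (evec j : V) 0 a / z 0 a = if a == j then - (z 0 j)^-1 else 0.
    by rewrite mxE eqxx /=; case: eqP => [->|_]; rewrite ?mulN1r ?oppr0 ?mul0r.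
  rewrite (eq_bigr _ (fun a _ => E a)) -big_mkcond /=; case: ifP => jr.
    by rewrite (big_rem j)//= eqxx big1_seq ?addr0// => a /andP[/eqP ->]; rewrite mem_rem_uniq// inE eqxx.
  by rewrite big1_seq// => a /andP[/eqP ->]; rewrite jr.
have S j : j != i -> (if z 0 i == z 0 j then (\sum_(a <- r) - (evec i : V) 0 a / z 0 a) * Pinv r z - (\sum_(a <- r) - (evec j : V) 0 a / z 0 a) * Pinv r z
    else (Pinv r z - Pinv r (swapv i j z)) / (z 0 i - z 0 j)) = if j \in r then Pinv r z / z 0 i else 0.
  move=> ji; rewrite !Li (negPf ir) mul0r sub0r; case: (boolP (j \in r)) => jr; last first.
    rewrite mul0r oppr0 (_ : Pinv r (swapv i j z) = Pinv r z) ?subrr ?mul0r ?if_same//.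
    apply: eq_big_seq => a ar; rewrite mxE tpermD//; [apply: contraNneq ir => ->//|apply: contraNneq jr => ->//].
  case: (eqVneq (z 0 i) (z 0 j)) => [->|ne]; first by rewrite mulNr opprK mulrC.
  have E : Pinv r (swapv i j z) = Pinv r z * z 0 j / z 0 i.
    rewrite /Pinv (big_rem j)//= [in RHS](big_rem j)//= mxE tpermR !cpow_m1//.
    rewrite (_ : \prod_(a <- rem j r) cpow (swapv i j z 0 a) (-1) = \prod_(a <- rem j r) cpow (z 0 a) (-1)).
      by have := RePos_neq0 j z0; have := RePos_neq0 i z0; move: (\prod_(_ <- _) _) (z 0 j) (z 0 i) => P A B B0 A0; field; rewrite B0 A0.
    apply: eq_big_seq => a; rewrite mem_rem_uniq// inE => /andP[aj ar]; rewrite mxE tpermD// eq_sym//.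
    by apply: contraNneq ir => <-.
  rewrite E; have zi := RePos_neq0 i z0; have zj : z 0 i - z 0 j != 0 by rewrite subr_eq0.
  by move: zi zj; move: (Pinv r z) (z 0 j) (z 0 i) => P A B B0 BA; field; rewrite B0 BA.
rewrite (eq_bigr _ S) Li (negPf ir) mul0r add0r -big_mkcondr /=.
rewrite (eq_bigl (fun j => j \in r)) => [|j]; last by apply/andP/idP => [[]//|jr]; split => //; apply: contraNneq ir => <-.
rewrite sumr_const (card_uniqP ur) -[_ *+ size r]mulr_natl RCM.
have -> : RC ((size r)%:R : R) = (size r)%:R by rewrite /RC -[RHS](rmorph_nat (@real_complex R)).
by move: (Pinv r z) ((z 0 i)^-1) => P Q; ring.
Qed.
Lemma Deltapow_dunkl_seq (r : seq 'I_n) (s c : CC R) (f : V -> CC R) z : uniq r -> RePos z -> (forall y, RePos y -> f y = c * Deltapow y s) ->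
  foldr (fun i g => dunklA k i g) f r z = c * (\prod_(j < size r) (s + RC (k * j%:R))) * (Pinv r z * Deltapow z s).
Proof.
move=> + + fE; elim: r z => [|i r IH] z /=; first by move=> _ z0; rewrite fE// big_ord0 mulr1 /Pinv big_nil mul1r.
move=> /andP[ir ur] z0; set K := c * (\prod_(j < size r) (s + RC (k * j%:R))) in IH *.
have cP := cderZ K (cderM (Pinv_cder r z0) (Deltapow_cder s z0)).
rewrite -(@dunkl_eq_RePos (fun y => K * (Pinv r y * Deltapow y s))) //; last 2 first.
- by move=> y y0; rewrite IH.
- exact: (cder_diff cP).1.
rewrite (dunklZ k _ i (cderM (Pinv_cder r z0) (Deltapow_cder s z0))) (Deltapow_dunkl _ _ z0 (Pinv_cder r z0)) Pinv_dunkl//.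
rewrite big_ord_recr /= /Pinv big_cons -/(Pinv r z) cpow_m1// /K.
by move: (\prod_(j < size r) _) (Pinv r z) (Deltapow z s) ((z 0 i)^-1) (RC _) => A B C D E; ring.
Qed.
End dunkl_sym.

(** * The Laplace transform up to a constant *)

Section laplaceC.
Variables (R : realType) (n : nat) (k : R).
Hypothesis k0 : 0 <= k.
Local Notation V := ('rV[CC R]_n).
Implicit Types (x : 'rV[R]_n) (w : V) (s : CC R).
Definition lpsi s x : CC R := Deltapow (rv2C x) (s - RC (mu0 n k) - 1) * RC (omegaA k x).
(* The Laplace transform of Delta^(s - mu0 - 1) omega. *)
Definition Lap s w : CC R := Gint k0 id (lpsi s) w.
Lemma id_ge0 x : posv x -> vge0 (id x). Proof. exact: posv_ge0. Qed.
Lemma id_meas i : measurable_fun (@Dpos R n) (fun t => id (tv t) 0 i). Proof. exact: measurable_tv. Qed.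
Lemma cRe_lpsi s : cRe (s - RC (mu0 n k) - 1) = cRe s - mu0 n k - 1.
Proof. by rewrite !cReB. Qed.
Lemma vmeas_lpsi s : vmeas (lpsi s).
Proof. by apply: cmeasM; [exact: cmeas_Deltapow|apply: cmeas_RC; exact: measurable_omegaA]. Qed.
Lemma good_lpsi s : mu0 n k < cRe s -> goodw id (lpsi s).
Proof.
move=> s0; split; first exact: vmeas_lpsi.
move=> d d0; have [C C0 H] := @laplace_majorant_le R n k k0 (cRe s - mu0 n k) d d0.
have a0 : 0 < cRe s - mu0 n k by rewrite subr_gt0.
apply: (dom_intble (C := C) a0 (divr_gt0 d0 (ltr0n _ 2))) => [|x x0].
  apply: cmeasM; last by apply: cmeas_norm; exact: vmeas_lpsi.
  apply: cmeas_RC; apply: measurableT_comp => //; apply: measurableT_comp => //; apply: measurable_funM => //.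
  by apply: measurable_sum => j; exact: measurable_tv.
apply: le_trans (H x x0); rewrite cmodM cmod_RC ger0_norm ?expR_ge0// -mulrA ler_wpM2l ?expR_ge0//.
have -> : cmod `|lpsi s x| = cmod (lpsi s x) by rewrite CC_norm cmod_RC ger0_norm ?cmod_ge0.
by rewrite /lpsi cmodM cmod_Deltapow// cmod_RC ger0_norm ?omegaA_ge0// cRe_lpsi.
Qed.
Lemma Lap_dunkl s w i : mu0 n k < cRe s -> RePos w -> w 0 i * dunklA k i (Lap s) w = - s * Lap s w.
Proof.
move=> s0 w0; have g := good_lpsi s0; have [d d0 dw] := RePos_min w0.
have b1 : -1 < cRe (s - RC (mu0 n k) - 1) by rewrite cRe_lpsi; lra.
have := lap_recurrence k0 d0 dw b1 i.
rewrite (_ : 1 + (s - RC (mu0 n k) - 1) + RC (mu0 n k) = s); last by ring.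
rewrite /Lap (Gint_dunkl k0 id_ge0 id_meas g i w0) mulNr -/(lpsi s) => ->; rewrite -mulrN; congr (_ * _).
have h0 := good_intble k0 id_ge0 id_meas (good_mulu id_ge0 id_meas g i) w0.
have h : vintble (fun x => EE k0 (- rv2C (id x)) w * (RC (x 0 i) * lpsi s x)).
  by apply: vintble_eq (vintbleZ (-1) h0) => x _; ring.
rewrite /Gint -mulN1r -/(lpsi s) -(vintZ (-1) h); apply: vint_eq => x _ /=; rewrite -/(lpsi s x).
by move: (EE _ _ _) (lpsi s x) (RC _) => A B C; ring.
Qed.
Lemma Lap_cder s w : mu0 n k < cRe s -> RePos w -> exists L, cder (Lap s) w L.
Proof. by move=> s0 w0; exists (fun h => vint (fun x => 'D_h (EE k0 (- rv2C (id x))) w * lpsi s x)); exact: (Gint_cder k0 id_ge0 id_meas (good_lpsi s0) w0).2. Qed.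
Lemma RePos_const1 : RePos (const_mx 1 : V).
Proof. by move=> i; rewrite mxE; exact: ltr01. Qed.
(** The region Re w > 0 does not contain the origin, so the Gronwall lemma is centred at the
    diagonal point 1. By convexity all points 1 + t s.(w - 1) stay in the region, and L Delta^s -
    L(1) is annihilated there by every T_i, which is the case l = 0. *)
Lemma Lap_formula s w : mu0 n k < cRe s -> RePos w -> Lap s w = Lap s (const_mx 1) * Deltapow w (- s).
Proof.
move=> s0 w0; pose f (z : V) : CC R := Lap s z * Deltapow z s - Lap s (const_mx 1).
have pos (t : R) (g : 'S_n) : 0 <= t <= 1 -> RePos (const_mx 1 + RC t *: permv g (w - const_mx 1)).
  move=> /andP[t0 t1] l; rewrite !mxE cReD cReM.
  have -> : cRe (RC t) = t by []. have -> : cIm (RC t) = 0 by [].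
  rewrite mul0r subr0 cReB; have -> : cRe (1 : CC R) = 1 by []. have := w0 (g l).
  move=> wl; have [->|tn] := eqVneq t 0; first by rewrite mul0r addr0.
  have t' : 0 < t by rewrite lt_def tn.
  have := mulr_gt0 t' wl; lra.
have cf z : RePos z -> exists L, cder (fun z => Lap s z * Deltapow z s) z L.
  by move=> z0; have [L HL] := Lap_cder s0 z0; eexists; exact: cderM HL (Deltapow_cder s z0).
have f1 : f (const_mx 1) = 0 by rewrite /f Deltapow_one mulr1 subrr.
have := @dunkl_gronwall R n k k0 f 0 1 (w - const_mx 1) _ _ f1.
have -> : const_mx 1 + (w - const_mx 1) = w by rewrite addrC subrK.
move=> /(_ _ _)/eqP; rewrite /f subr_eq0 => H; rewrite DeltapowN; apply: (mulIf (Deltapow_neq0 w s)).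
rewrite mulfVK ?Deltapow_neq0//; apply/eqP; apply: H.
  move=> t g t01; have [L HL] := cf _ (pos t g t01).
  exact: (cder_diff (cderD HL (cder_cst (- Lap s (const_mx 1)) _))).1.
move=> t g i /andP[t0 t1]; rewrite mxE mul0r; have zp : RePos (const_mx 1 + RC t *: permv g (w - const_mx 1)) by apply: pos; rewrite !ltW.
move: zp; move: (const_mx 1 + _) => z zp; have [L HL] := cf z zp; have [L' HL'] := Lap_cder s0 zp.
rewrite (dunkl_subc k _ i HL) (Deltapow_dunkl k s i zp HL').
have zi := RePos_neq0 i zp; apply/eqP; rewrite mulf_eq0 (negPf (Deltapow_neq0 _ _)) orbF.
rewrite -(inj_eq (mulfI zi)) mulr0 mulrDr Lap_dunkl// mulrA mulrCA divff// mulr1 mulNr addNr//.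
Qed.
Lemma prod_RC x : posv x -> Deltapow (rv2C x) 1 = RC (\prod_i x 0 i).
Proof.
move=> x0; rewrite -RC1 Deltapow_real//; congr RC; apply: eq_bigr => i _; by rewrite powRr1// ltW.
Qed.
Lemma lpsi_succ s x : posv x -> RC (\prod_i x 0 i) * lpsi s x = lpsi (s + 1) x.
Proof.
by move=> x0; rewrite /lpsi -prod_RC// mulrA -DeltapowD; congr (Deltapow _ _ * _); ring.
Qed.
Lemma Lap_rec s : mu0 n k < cRe s -> Lap (s + 1) (const_mx 1) = (\prod_(j < n) (s - RC (k * j%:R))) * Lap s (const_mx 1).
Proof.
move=> s0; have g := good_lpsi s0; have z0 := RePos_const1.
have E1 := Gint_DeltaT k0 id_ge0 id_meas g z0.
have E2 := @Deltapow_dunkl_seq R n k (enum 'I_n) (- s) (Lap s (const_mx 1)) (Lap s) (const_mx 1) (enum_uniq _) z0 (fun y => @Lap_formula s y s0).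
rewrite /DeltaT E2 Deltapow_one mulr1 in E1.
have P1 : Pinv (enum 'I_n) (const_mx 1 : V) = 1 by rewrite /Pinv big1// => a _; rewrite mxE cpow_one.
rewrite P1 mulr1 size_enum_ord in E1.
have -> : Lap (s + 1) (const_mx 1) = Gint k0 id (fun x => RC (\prod_i (id x) 0 i) * lpsi s x) (const_mx 1).
  by apply: vint_eq => x x0; rewrite lpsi_succ.
have sg : (-1) ^+ n * (-1) ^+ n = 1 :> CC R by rewrite -exprD addnn -signr_odd odd_double.
move: E1; move: (Gint _ _ _ _) => G E1.
have alg (e A P L : CC R) : e * e = 1 -> L * A = e * G -> e * A = P -> G = P * L.
  by move=> ee LA <-; rewrite -[LHS]mul1r -ee -mulrA -LA mulrA mulrAC.
apply: alg sg E1 _.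
have -> : (-1) ^+ n = \prod_(j < n) (-1) :> CC R by rewrite prodr_const card_ord.
by rewrite -big_split /=; apply: eq_bigr => j _; rewrite mulN1r opprD opprK.
Qed.
End laplaceC.

(** * Stirling asymptotics and the constant *)
Section stirling1.
Variable R : realType.
Implicit Types (u v p t : R).
Local Notation leb := (@lebesgue_measure R).
(** With r = sqrt (1 + v), ln (1 + v) = 2 ln r <= 2 (r - 1) and 2 (r - 1) - v = - (r - 1)^2. Finally
    v = (r - 1)(r + 1) and (r + 1)^2 <= 4 (1 + |v|). *)
Lemma ln_sub_bound v : -1 < v -> ln (1 + v) - v <= - (v ^+ 2 / (4 * (1 + `|v|))).
Proof.
move=> v1; have v0 : 0 < 1 + v by rewrite addrC -ltrBlDr sub0r.
pose r := Num.sqrt (1 + v); have r0 : 0 < r by rewrite sqrtr_gt0.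
have r2 : r ^+ 2 = 1 + v by rewrite sqr_sqrtr// ltW.
have l1 : ln (1 + v) = 2 * ln r by rewrite -r2 lnXn// mulr_natl.
have l2 : ln r <= r - 1 by have := @le_ln1Dx R (r - 1); rewrite [1 + _]addrC subrK; apply; lra.
have V : v = r ^+ 2 - 1 by rewrite r2 addrAC subrr add0r.
apply: (@le_trans _ _ (- (r - 1) ^+ 2)).
  by rewrite l1 V; nra.
rewrite lerN2 ler_pdivrMr; last by rewrite mulr_gt0// ltr_wpDr.
have -> : v ^+ 2 = (r - 1) ^+ 2 * (r + 1) ^+ 2 by rewrite V; ring.
rewrite ler_wpM2l ?sqr_ge0//.
have := ler_norm v; have := normr_ge0 v; rewrite V; move: (`|_|) => a a0 av; have := sqr_ge0 (r - 1); nra.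
Qed.
(** The quadratic decay degrades to linear decay once |u| is large compared with p. Since u^2 / (1 +
    |u|) >= |u| - 1, a linear bound holds uniformly in p >= 1, which is enough for domination. *)
Lemma stirling_exp_bound p u : 1 <= p -> 0 < p + u -> p ^+ 2 * (ln (1 + u / p) - u / p) <= (1 - `|u|) / 4.
Proof.
move=> p1 pu; have p0 : 0 < p by apply: lt_le_trans p1.
have v1 : -1 < u / p by rewrite ltr_pdivlMr// mulN1r -subr_gt0 opprK addrC.
have v := ln_sub_bound v1; apply: le_trans (ler_wpM2l (sqr_ge0 p) v) _.
rewrite mulrN lerNl -mulNr opprB normrM normfV (gtr0_norm p0).
have -> : p ^+ 2 * ((u / p) ^+ 2 / (4 * (1 + `|u| / p))) = u ^+ 2 / (4 * (1 + `|u| / p)).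
  have p2 : p ^+ 2 != 0 by rewrite sqrf_eq0 gt_eqF.
  by rewrite expr_div_n mulrA mulrCA divff// mulr1.
rewrite ler_pdivlMr; last by rewrite mulr_gt0// ltr_wpDr// divr_ge0// ltW.
have up : `|u| / p <= `|u| by rewrite ler_piMr// invf_le1.
have up0 : 0 <= `|u| / p by rewrite divr_ge0// ltW.
rewrite -(real_normK (num_real u)).
move: up up0 (normr_ge0 u); move: (`|u| / p) (`|u|) => b a ba b0 a0.
have [a1|a1] := leP a 1; last by nra.
apply: (@le_trans _ _ 0); last exact: sqr_ge0.
rewrite mulr_le0_ge0// ?mulr_ge0 ?addr_ge0//; lra.
Qed.
Lemma ln_taylor2 v : `|v| <= 1 / 2 -> `|ln (1 + v) - v + v ^+ 2 / 2| <= 2 * `|v| ^+ 3.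
Proof.
move=> vh; pose f t := ln (1 + t * v) - t * v + (t * v) ^+ 2 / 2.
pose f' t := v * ((t * v) ^+ 2 / (1 + t * v)).
have pos t : 0 <= t <= 1 -> `|t * v| <= `|v| /\ 1 / 2 <= 1 + t * v.
  move=> /andP[t0 t1]; have h : `|t * v| <= `|v| by rewrite normrM ger0_norm// ler_piMl.
  split => //; have := le_trans h vh; rewrite ler_norml => /andP[a _]; lra.
have := @mvt01 R f f' (2 * `|v| ^+ 3).
rewrite /f !mul1r !mul0r addr0 ln1 subrr expr0n /= mul0r addr0 subr0; apply => t t01; have [h1 h2] := pos t t01.
  have q0 : 0 < 1 + t * v by lra.
  have d1 : is_derive t 1 (fun s : R => s * v) v.
    by apply: (is_derive_eq (is_deriveM (is_derive_id t 1) (is_derive_cst v t 1))); rewrite /GRing.scale /= mulr0 mulr1 add0r.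
  have d2 : is_derive t 1 (fun s : R => 1 + s * v) v.
    by apply: (is_derive_eq (is_deriveD (is_derive_cst (1 : R) t 1) d1)); rewrite add0r.
  have d3 := @is_derive1_comp R (@ln R) (fun s : R => 1 + s * v) t _ _ (is_derive1_ln q0) d2.
  have d4 : is_derive t 1 (fun s : R => (s * v) ^+ 2 / 2) (t * v * v).
    rewrite (_ : (fun s : R => (s * v) ^+ 2 / 2) = fun s : R => (s * v) * (s * v) * 2^-1); last by apply/funext => s; rewrite expr2.
    by apply: (is_derive_eq (is_deriveM (is_deriveM d1 d1) (is_derive_cst (2^-1 : R) t 1))); rewrite /GRing.scale /=; field.
  have d5 := is_deriveD (is_deriveB d3 d1) d4.
  by apply: (is_derive_eq d5); rewrite /f'; field; rewrite gt_eqF.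
have q0 : 0 < 1 + t * v by lra.
rewrite /f' normrM [X in _ <= X](_ : _ = `|v| * (`|v| ^+ 2 * 2)); last by ring.
rewrite ler_wpM2l// normrM normfV (gtr0_norm q0); apply: ler_pM => //; first by rewrite invr_ge0 ltW.
  by rewrite normrX lerXn2r ?nnegrE.
by rewrite -[leRHS]invrK lef_pV2 ?posrE ?invr_gt0//; lra.
Qed.
Lemma stirling_exp_lim u : (fun m : nat => m.+1%:R ^+ 2 * (ln (1 + u / m.+1%:R) - u / m.+1%:R)) @ \oo --> - (u ^+ 2 / 2).
Proof.
apply/cvgrPdist_le => e e0; near=> m.
have h0 : 0 < (m.+1%:R : R)^-1 by exact: harm_gt0.
have hu : (m.+1%:R)^-1 <= 1 / (2 * (`|u| + 1)).
  by near: m; apply: near_harm; rewrite divr_gt0// mulr_gt0// ltr_wpDl.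
have he : (m.+1%:R)^-1 <= e / (2 * `|u| ^+ 3 + 1).
  by near: m; apply: near_harm; rewrite divr_gt0// ltr_wpDl// mulr_ge0// exprn_ge0.
set h : R := (m.+1%:R)^-1 in h0 hu he *; have pe : (m.+1%:R : R) = h^-1 by rewrite invrK.
have uh : `|u * h| <= 1 / 2.
  rewrite normrM (gtr0_norm h0); apply: le_trans (ler_wpM2l (normr_ge0 u) hu) _.
  rewrite mulrA ler_pdivrMr; last by rewrite mulr_gt0// ltr_wpDl.
  by have := normr_ge0 u; lra.
have T := ln_taylor2 uh.
have -> : - (u ^+ 2 / 2) - m.+1%:R ^+ 2 * (ln (1 + u * h) - u * h) = - (h^-1 ^+ 2 * (ln (1 + u * h) - u * h + (u * h) ^+ 2 / 2)).
  by rewrite pe; field; rewrite gt_eqF.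
rewrite normrN normrM (ger0_norm (sqr_ge0 _)); apply: le_trans (ler_wpM2l (sqr_ge0 _) T) _.
rewrite normrM (gtr0_norm h0).
have -> : h^-1 ^+ 2 * (2 * (`|u| * h) ^+ 3) = (2 * `|u| ^+ 3) * h by field; rewrite gt_eqF.
have c0 : 0 < 2 * `|u| ^+ 3 + 1 by rewrite ltr_wpDl// mulr_ge0// exprn_ge0.
move: he; rewrite ler_pdivlMr// => he; apply: le_trans he; rewrite mulrC ler_wpM2l ?(ltW h0)//; lra.
Unshelve. all: by end_near. Qed.
Lemma integrable_exp_norm (d : R) : 0 < d -> leb.-integrable setT (EFin \o (fun u : measurableTypeR R => expR (- (d * `|u|)))).
Proof.
move=> d0; have c : continuous (fun u : R => expR (- (d * `|u|))).
  move=> u; apply: continuous_comp; last exact: continuous_expR.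
  by apply: cvgN; apply: cvgM; [exact: cvg_cst|exact: norm_continuous].
have mf : measurable_fun [set: R] (fun u : R => expR (- (d * `|u|))) by exact: continuous_measurable_fun.
apply/integrableP; split; first exact/measurable_EFinP.
have -> : (\int[leb]_x `|(EFin \o (fun u : measurableTypeR R => expR (- (d * `|u|)))) x| = \int[leb]_x (expR (- (d * `|x|)))%:E)%E.
  by apply: eq_integral => x _ /=; rewrite ger0_norm// expR_ge0.
rewrite (ge0_symfun_integralT (fun x => expR_ge0 _) c); last by move=> x /=; rewrite normrN.
have i := @expR_integrable R d 0 d0.
rewrite (_ : [set x | (0 <= x)%R] = `[0, +oo[%classic); last first.
  by apply/seteqP; split => x/=; rewrite in_itv/= andbT.
have /integrableP[_ fin] := i.
rewrite (_ : \int[leb]_(x in `[0%R, +oo[) (expR (- (d * `|x|)))%:E = \int[leb]_(x in `[0%R, +oo[) `|(EFin \o (fun x => expR (- (d * x)))) x|)%E; last first.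
  apply: eq_integral => x /set_mem; rewrite /= in_itv /= andbT => x0; by rewrite ger0_norm ?expR_ge0// ger0_norm.
by rewrite lte_mul_pinfty.
Qed.
End stirling1.

Section stirlingn.
Variables (R : realType).
Implicit Types (c : CC R) (p t : R).
Local Notation T n := (n.-tuple (measurableTypeR R)).
Local Notation leb := (@lebesgue_measure R).
(* Factor left in exp(-t) t^(p^2 + c) after the substitution t = p^2 + p u of Stirling's formula; [Zst] collects the normalising constants. *)
Definition sfac p c t : CC R := RC (expR (p ^+ 2 * (ln (1 + t / p) - t / p))) * cpow (RC (1 + t / p)) c.
(** The preimage of the positive half-line under the substitution: the half-line t > -p (for p > 0),
    which exhausts the real line as p grows. *)
Definition shalf p : set (measurableTypeR R) := (fun t => p ^+ 2 + p * t) @^-1` `]0, +oo[%classic.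
Lemma shalfP p t : 0 < p -> shalf p t <-> 0 < 1 + t / p.
Proof.
move=> p0; have E : p ^+ 2 + p * t = p ^+ 2 * (1 + t / p) by field; rewrite gt_eqF.
by rewrite /shalf /= in_itv /= andbT E pmulr_rgt0 ?exprn_gt0.
Qed.
Lemma measurable_shalf p : measurable (shalf p).
Proof.
have m : measurable_fun setT ((fun t => p ^+ 2 + p * t) : measurableTypeR R -> measurableTypeR R).
  by apply: measurable_funD => //; exact: measurable_funM.
by rewrite /shalf -[X in measurable X]setTI; apply: m => //; exact: measurable_itv.
Qed.
(** Of the rate 1/4 of [stirling_exp_bound], 1/16 absorbs the power (1 + t/p)^c, leaving 3/16; the
    constants 1/4 and 1/16 add up to 5/16. *)
Lemma sfac_bound c : 0 <= cRe c -> exists2 C, 0 <= C & forall p t, 1 <= p -> 0 < 1 + t / p ->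
  cmod (sfac p c t) <= C * expR (- (3 / 16 * `|t|)).
Proof.
move=> c0; have [C C0 H] := powR_le_expR c0 (divr_gt0 ltr01 (ltr0n R 16)).
exists (C * expR (5 / 16)) => [|p t p1 v0]; first by rewrite mulr_ge0 ?expR_ge0 ?ltW.
have p0 : 0 < p by apply: lt_le_trans p1.
have pt : 0 < p + t.
  have -> : p + t = p * (1 + t / p) by field; rewrite gt_eqF.
  by rewrite mulr_gt0.
rewrite /sfac cmodM cmod_RC ger0_norm ?expR_ge0// cmod_cpow//.
have b1 := stirling_exp_bound p1 pt.
have tp : 1 + t / p <= 1 + `|t|.
  rewrite lerD2l; apply: le_trans (ler_norm _) _; rewrite normrM normfV (gtr0_norm p0).
  by rewrite ler_piMr// invf_le1.
have t0 : 0 < 1 + `|t| by rewrite ltr_wpDr.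
have b2 : (1 + t / p) `^ cRe c <= C * expR (1 / 16 * (1 + `|t|)).
  apply: le_trans (H _ t0); apply: ge0_ler_powR => //; rewrite nnegrE ltW//.
apply: (@le_trans _ _ (expR ((1 - `|t|) / 4) * (C * expR (1 / 16 * (1 + `|t|))))).
  by apply: ler_pM; rewrite ?expR_ge0 ?powR_ge0// ler_expR.
have -> : expR ((1 - `|t|) / 4) * (C * expR (1 / 16 * (1 + `|t|))) = C * (expR ((1 - `|t|) / 4) * expR (1 / 16 * (1 + `|t|))) by ring.
rewrite -[leRHS]mulrA ler_wpM2l ?(ltW C0)// -!expRD ler_expR; lra.
Qed.
Lemma ccvg_near (u v : nat -> CC R) l : (\forall m \near \oo, u m = v m) -> ccvg u l -> ccvg v l.
Proof.
move=> uv [a b]; split; [apply: cvg_trans a|apply: cvg_trans b]; apply: near_eq_cvg; near=> m; congr (_ _); near: m; exact: uv.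
Unshelve. all: by end_near. Qed.
Lemma near_harm_lt (a : R) : \forall m \near \oo, `|a| / m.+1%:R < 1.
Proof.
near=> m; have h : (m.+1%:R)^-1 <= (`|a| + 1)^-1 by near: m; apply: near_harm; rewrite invr_gt0 ltr_wpDl.
apply: le_lt_trans (ler_wpM2l (normr_ge0 a) h) _; rewrite ltr_pdivrMr ?mul1r; last by rewrite ltr_wpDl.
by rewrite ltrDl.
Unshelve. all: by end_near. Qed.
Lemma near_pos n (x : 'rV[R]_n) : \forall m \near \oo, forall i, 0 < 1 + x 0 i / m.+1%:R.
Proof.
near=> m; have h : `|\sum_j `|x 0 j| | / m.+1%:R < 1 by near: m; exact: near_harm_lt.
move=> i; have m0 : 0 < (m.+1%:R : R)^-1 by exact: harm_gt0.
have E : `|x 0 i / m.+1%:R| < 1.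
  rewrite normrM (gtr0_norm m0); apply: le_lt_trans h; rewrite ler_pM2r// [leRHS]ger0_norm ?sumr_ge0//.
  by rewrite (bigD1 i)//= lerDl sumr_ge0.
move: E; rewrite ltr_norml; move: (x 0 i / _) => v /andP[a _]; lra.
Unshelve. all: by end_near. Qed.
Lemma sfac_lim c t : ccvg (fun m => sfac m.+1%:R c t) (RC (expR (- (t ^+ 2 / 2)))).
Proof.
rewrite -[X in ccvg _ X]mulr1; apply: ccvgM.
  by apply: ccvg_RC; apply: continuous_cvg; [exact: continuous_expR|exact: stirling_exp_lim].
have L : (fun m : nat => ln (1 + t / m.+1%:R)) @ \oo --> (0 : R).
  rewrite -(@ln1 R); apply: continuous_cvg; first exact: continuous_ln.
  rewrite -[X in _ --> X]addr0 -[X in _ --> _ + X](mulr0 t).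
  by apply: cvgD; [exact: cvg_cst|apply: cvgM; [exact: cvg_cst|exact: cvg_harm]].
apply: (@ccvg_near (fun m => cexp (c * RC (ln (1 + t / m.+1%:R))))).
  near=> m; rewrite cpowE//.
  have h : forall i, 0 < 1 + (const_mx t : 'rV[R]_1) 0 i / m.+1%:R by near: m; exact: near_pos.
  by have := h 0; rewrite mxE.
have LR q : (fun m : nat => q * ln (1 + t / m.+1%:R)) @ \oo --> (0 : R).
  by rewrite -[X in _ --> X](mulr0 q); apply: cvgM => //; exact: cvg_cst.
have rE m : cRe (c * RC (ln (1 + t / m.+1%:R))) = cRe c * ln (1 + t / m.+1%:R) by rewrite cReM cReRC cImRC mulr0 subr0.
have iE m : cIm (c * RC (ln (1 + t / m.+1%:R))) = cIm c * ln (1 + t / m.+1%:R) by rewrite cImM cReRC cImRC mulr0 add0r.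
have e1 : (fun m : nat => expR (cRe c * ln (1 + t / m.+1%:R))) @ \oo --> (1 : R).
  by rewrite -[X in _ --> X](@expR0 R); apply: continuous_cvg; [exact: continuous_expR|exact: LR].
have c1 : (fun m : nat => cos (cIm c * ln (1 + t / m.+1%:R))) @ \oo --> (1 : R).
  by rewrite -[X in _ --> X](@cos0 R); apply: continuous_cvg; [exact: continuous_cos|exact: LR].
have s1 : (fun m : nat => sin (cIm c * ln (1 + t / m.+1%:R))) @ \oo --> (0 : R).
  by rewrite -[X in _ --> X](@sin0 R); apply: continuous_cvg; [exact: continuous_sin|exact: LR].
have ec := cvgM e1 c1; have es := cvgM e1 s1; rewrite mulr1 in ec; rewrite mulr0 in es.
split; first by under eq_fun do rewrite cRe_cexp rE iE; exact: ec.
by under eq_fun do rewrite cIm_cexp rE iE; exact: es.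
Unshelve. all: by end_near. Qed.
Section patch.
Context d (X : measurableType d) (mu : {measure set X -> \bar R}) (D : set X).
Hypothesis mD : measurable D.
Lemma cmeas_patch (F : X -> CC R) : cmeas D F -> cmeas setT (fun s => if s \in D then F s else 0).
Proof.
move=> [a b]; split.
  rewrite (_ : _ \o _ = (cRe \o F) \_ D); first exact/(measurable_restrictT _ mD).
  by apply/funext => s; rewrite /patch /=; case: ifP.
rewrite (_ : _ \o _ = (cIm \o F) \_ D); first exact/(measurable_restrictT _ mD).
by apply/funext => s; rewrite /patch /=; case: ifP.
Qed.
Lemma cint_patch (F : X -> CC R) : cint mu setT (fun s => if s \in D then F s else 0) = cint mu D F.
Proof.
rewrite /cint [in RHS]Rintegral_mkcond [X in _ = Complex _ X]Rintegral_mkcond; congr Complex; apply: eq_Rintegral => s _; rewrite /patch; by case: ifP.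
Qed.
End patch.
Variables (n : nat) (k : R).
Hypothesis k0 : 0 <= k.
Lemma tsetT : tset setT n = [set: T n].
Proof. by apply/seteqP; split. Qed.
Definition sint p c (s : T n) : CC R := (\prod_i sfac p c (tv s 0 i)) * RC (omegaA k (tv s)).
(** 1/8 = 3/16 - 1/16 is the rate left once 1/16 has been spent on the weight omega. *)
Let h8 (t : R) : R := expR (- (1 / 8 * `|t|)).
Lemma sint_bound c : 0 <= cRe c -> exists2 C, 0 <= C & forall p s, 1 <= p -> tset (shalf p) n s -> cmod (sint p c s) <= C * \prod_(t <- s) h8 t.
Proof.
move=> c0; have [C C0 H] := sfac_bound c0.
have [C1 C10 H1] := omegaA_le n k0 (divr_gt0 ltr01 (ltr0n R 16)).
exists (C ^+ n * C1) => [|p s p1 Ds]; first by rewrite mulr_ge0 ?exprn_ge0 ?(ltW C10).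
have p0 : 0 < p by apply: lt_le_trans p1.
have cp (r : seq 'I_n) (f : 'I_n -> CC R) : cmod (\prod_(i <- r) f i) = \prod_(i <- r) cmod (f i).
  by elim/big_rec2: _ => [|i u v _ <-]; rewrite ?cmodM// cmod_RC normr1.
rewrite /sint cmodM cp cmod_RC ger0_norm ?omegaA_ge0// prod_tv.
apply: (@le_trans _ _ ((\prod_i (C * expR (- (3 / 16 * `|tv s 0 i|)))) * (C1 * expR (1 / 16 * \sum_i `|tv s 0 i|)))).
  apply: ler_pM; rewrite ?omegaA_ge0 ?prodr_ge0//.
    by move=> i _; exact: cmod_ge0.
  by apply: ler_prod => i _; rewrite cmod_ge0 /=; apply: H => //; rewrite -shalfP// tvE.
rewrite big_split /= prodr_const card_ord.
have as1 (a b d e : R) : a * b * (d * e) = (a * d) * (b * e) by ring.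
rewrite as1 ler_wpM2l ?mulr_ge0 ?exprn_ge0 ?(ltW C10)//.
have -> : expR (1 / 16 * \sum_i `|tv s 0 i|) = \prod_i expR (1 / 16 * `|tv s 0 i|).
  by rewrite -expR_sum; congr expR; rewrite mulr_sumr.
rewrite -big_split /=; apply: ler_prod => i _; rewrite mulr_ge0 ?expR_ge0//= -expRD /h8 ler_expR; lra.
Qed.
Definition sgauss (s : T n) : R := expR (- (\sum_(i < n) tv s 0 i ^+ 2) / 2) * omegaA k (tv s).
Lemma measurable_sgauss : measurable_fun setT sgauss.
Proof.
apply: measurable_funM; last exact: measurable_omegaA.
apply: measurableT_comp => //; apply: measurable_funM => //; apply: measurableT_comp => //.
by apply: measurable_sum => i; apply: measurable_funX; exact: measurable_tv.
Qed.
Lemma measurable_h8 : measurable_fun setT (h8 : measurableTypeR R -> R).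
Proof.
apply: measurableT_comp => //; apply: measurableT_comp => //; apply: measurable_funM => //; exact: normr_measurable.
Qed.
Lemma h8_int : leb.-integrable (setT : set (measurableTypeR R)) (EFin \o h8).
Proof. by apply: integrable_exp_norm; rewrite divr_gt0. Qed.
Lemma sgauss_cA : cint (tmu R n) setT (fun s => RC (sgauss s)) = RC (cA n k).
Proof.
rewrite /cint /=; apply: CCP => /=; last by rewrite Rintegral_cst ?mul0r//; exact: measurableT.
have [C C0 H1] := omegaA_le n k0 (divr_gt0 ltr01 (ltr0n R 8)).
rewrite /cA; symmetry.
have := @iintE R setT h8 measurableT measurable_h8 (fun t => expR_ge0 _) h8_int n
 (fun s => let x := vec_of_seq n s in expR (- (\sum_(i < n) x 0 i ^+ 2) / 2) * omegaA k x) (C * expR (1 / 8) ^+ n).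
rewrite tsetT; apply; first exact: measurable_sgauss.
move=> s _; rewrite -[vec_of_seq n s]/(tv s) ger0_norm ?mulr_ge0 ?expR_ge0 ?omegaA_ge0// prod_tv.
apply: le_trans (ler_wpM2l (expR_ge0 _) (H1 (tv s))) _.
rewrite [leLHS]mulrCA -[leRHS]mulrA ler_wpM2l ?(ltW C0)// -expRD.
rewrite -[n in expR _ ^+ n]card_ord -prodr_const -big_split /= /h8.
rewrite [leRHS](eq_bigr (fun i => expR (1 / 8 + - (1 / 8 * `|tv s 0 i|)))) => [|i _]; last by rewrite expRD.
rewrite -expR_sum ler_expR mulr_sumr mulNr mulr_suml -sumrN -big_split /=; apply: ler_sum => i _.
rewrite -(real_normK (num_real (tv s 0 i))); move: (`|_|) => a; have := sqr_ge0 (a - 1 / 4); nra.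
Qed.
Lemma stirling_lim c : 0 <= cRe c -> ccvg (fun m => cint (tmu R n) (tset (shalf m.+1%:R) n) (sint m.+1%:R c)) (RC (cA n k)).
Proof.
move=> c0; have [C C0 H] := sint_bound c0; rewrite -sgauss_cA.
have mD m : measurable (tset (shalf m.+1%:R) n) := @measurable_tset R _ n (@measurable_shalf m.+1%:R).
have p1 m : 1 <= (m.+1%:R : R) by rewrite ler1n.
have p0 m : 0 < (m.+1%:R : R) by rewrite ltr0n.
have ih : cintble (tmu R n) setT (fun s => RC (C * \prod_(t <- s) h8 t)).
  apply: cintble_RC; have := @tintegrable R setT h8 measurableT measurable_h8 (fun t => expR_ge0 _) h8_int n (fun s => C * \prod_(t <- s) h8 t) C.
  rewrite tsetT; apply; first by apply: measurable_funM => //; exact: (measurable_prod_seq measurable_h8).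
  by move=> s _; rewrite ger0_norm// mulr_ge0// prodr_ge0// => t _; exact: expR_ge0.
have meas m : cmeas (tset (shalf m.+1%:R) n) (sint m.+1%:R c).
  apply: cmeasM; last by apply: cmeas_RC; exact: measurable_omegaA.
  have m1 i : measurable_fun (tset (shalf m.+1%:R) n) (fun s : T n => 1 + tv s 0 i / m.+1%:R).
    by apply: measurable_funD => //; apply: measurable_funM => //; exact: measurable_tv.
  apply: cmeas_prod => i _; apply: cmeasM; last by apply: cmeas_cpow => // s Ds; rewrite -shalfP// tvE.
  apply: cmeas_RC; apply: measurableT_comp => //; apply: measurable_funM => //; apply: measurable_funB.
    by apply: (measurableT_comp (f := @ln R)) => //; exact: measurable_ln.
  by apply: measurable_funM => //; exact: measurable_tv.
(* The domains depend on m; extension by 0 puts all integrands on the full space, as dominated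
   convergence requires. A given point lies in the domain for all large m. *)
pose F m (s : T n) : CC R := if s \in tset (shalf m.+1%:R) n then sint m.+1%:R c s else 0.
have h80 (s : T n) : 0 <= \prod_(t <- s) h8 t by rewrite prodr_ge0// => t _; exact: expR_ge0.
have bF m s : [set: T n] s -> `|F m s| <= RC (C * \prod_(t <- s) h8 t).
  by move=> _; rewrite cmod_leP /F; case: ifPn => [/set_mem Ds|_]; [exact: H|rewrite cmod_RC normr0 mulr_ge0].
have lF s : [set: T n] s -> ccvg (fun m => F m s) (RC (sgauss s)).
  move=> _; apply: (@ccvg_near (fun m => sint m.+1%:R c s)).
    near=> m; rewrite /F mem_set// => i; apply/shalfP => //; rewrite -tvE; move: i; near: m; exact: near_pos.
  rewrite /sgauss RCM; apply: ccvgM; last exact: ccvg_cst.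
  have -> : RC (expR (- (\sum_(i < n) tv s 0 i ^+ 2) / 2)) = \prod_i RC (expR (- (tv s 0 i ^+ 2 / 2))).
    by rewrite -rmorph_prod -expR_sum mulNr mulr_suml sumrN.
  by apply: ccvg_prod => i; exact: sfac_lim.
have [_ a b] := @cint_dct _ _ _ (tmu R n) setT measurableT F (fun s => RC (sgauss s)) (fun s => RC (C * \prod_(t <- s) h8 t))
   (fun m => cmeas_patch (mD m) (meas m)) ih bF lF.
have E m : cint (tmu R n) (tset (shalf m.+1%:R) n) (sint m.+1%:R c) = cint (tmu R n) setT (fun s => if s \in tset (shalf m.+1%:R) n then sint m.+1%:R c s else 0).
  by rewrite cint_patch.
by apply: (@ccvg_eq R (fun m => cint (tmu R n) setT (F m))) => [m|]; [rewrite E|split].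
Unshelve. all: by end_near. Qed.
Lemma omegaA_shift (a e : R) (x : 'rV[R]_n) : 0 < e -> omegaA k (map_mx (fun t => a + e * t) x) = e `^ (n%:R * mu0 n k) * omegaA k x.
Proof.
move=> e0; rewrite -omegaA_scale// /omegaA; apply: eq_bigr => i _; apply: eq_bigr => j _.
by rewrite !mxE opprD addrACA subrr add0r.
Qed.
Definition Zst p c : CC R := (RC (p * expR (- p ^+ 2)) * cpow (RC (p ^+ 2)) c) ^+ n * RC (p `^ (n%:R * mu0 n k)).
Lemma stirling_factor p c t : 0 < p -> 0 < 1 + t / p ->
  RC (expR (- (p ^+ 2 + p * t))) * cpow (RC (p ^+ 2 + p * t)) (c + RC (p ^+ 2)) * RC p =
  RC (p * expR (- p ^+ 2)) * cpow (RC (p ^+ 2)) (c + RC (p ^+ 2)) * sfac p c t.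
Proof.
move=> p0 v0; have E : p ^+ 2 + p * t = p ^+ 2 * (1 + t / p) by field; rewrite gt_eqF.
rewrite {2}E cpowM ?exprn_gt0// [cpow (RC (1 + t / p)) _]cpowD cpow_RC// /sfac.
have e1 : (1 + t / p) `^ (p ^+ 2) = expR (p ^+ 2 * ln (1 + t / p)) by rewrite /powR gt_eqF.
have e2 : expR (- (p ^+ 2 + p * t)) * expR (p ^+ 2 * ln (1 + t / p)) = expR (- p ^+ 2) * expR (p ^+ 2 * (ln (1 + t / p) - t / p)).
  by rewrite -!expRD; congr expR; field; rewrite gt_eqF.
have e3 := congr1 (@RC R) e2; rewrite !RCM in e3; rewrite e1 RCM.
have alg (a b d e f g h q : CC R) : a * e = f * g -> a * (b * (d * e)) * q = q * f * b * (g * d).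
  by move=> ae; transitivity ((a * e) * b * d * q); [ring|rewrite ae; ring].
exact: (alg _ _ _ _ _ _ 0).
Qed.
Lemma Zst_neq0 p c : 0 < p -> Zst p c != 0.
Proof.
move=> p0; have RC_neq0 (a : R) : 0 < a -> RC a != 0.
  by move=> a0; rewrite -RC0; apply/eqP => /RC_inj e; rewrite e ltxx in a0.
rewrite mulf_neq0 ?expf_neq0 ?mulf_neq0 ?cpow_neq0 ?RC_neq0 ?mulr_gt0 ?expR_gt0// powR_gt0//.
Qed.
(** Stirling's substitution t = N + sqrt N u in every coordinate, along the subsequence N = (m+1)^2,
    for which sqrt N = p = m + 1. The weight is invariant under the translation by N and homogeneous
    under the dilation by p. *)
Lemma stirling_cvar c m : 0 <= cRe c -> let p : R := m.+1%:R in
  vint (fun x : 'rV[R]_n => RC (expR (- (1 * vsum x))) * (Deltapow (rv2C x) (c + ((m.+1 ^ 2)%N)%:R) * RC (omegaA k x))) =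
  Zst p (c + ((m.+1 ^ 2)%N)%:R) * cint (tmu R n) (tset (shalf p) n) (sint p c).
Proof.
move=> c0 p; have p0 : 0 < p by rewrite ltr0n.
set N := (m.+1 ^ 2)%N; have NE : (N%:R : R) = p ^+ 2 by rewrite natrX.
pose phi (t : R) := p ^+ 2 + p * t.
have mphi : measurable_fun setT (phi : measurableTypeR R -> measurableTypeR R).
  by apply: measurable_funD => //; exact: measurable_funM.
have mD := @measurable_tset R _ n (@measurable_shalf p).
have mDp := @measurable_Dpos R n.
have phiD (s : T n) : tset (shalf p) n s -> Dpos (tmap phi s).
  by move=> Ds i; rewrite tnth_map; exact: Ds.
set G := fun x : 'rV[R]_n => _.
have iG : vintble G.
  have cN : mu0 n k < cRe (c + N%:R + RC (mu0 n k) + 1).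
    have rN : cRe (N%:R : CC R) = N%:R by rewrite (_ : N%:R = RC N%:R) // rmorph_nat.
    by rewrite !cReD rN !cReRC; have : (0 : R) <= N%:R by []; rewrite /=; lra.
  have [_ h] := good_lpsi k0 cN; have := h 1 ltr01 => {h} h.
  apply: (vintble_dom _ h) => [|x x0].
    apply: cmeasM; last by apply: cmeasM; [exact: cmeas_Deltapow|apply: cmeas_RC; exact: measurable_omegaA].
    apply: cmeas_RC; apply: measurableT_comp => //; apply: measurableT_comp => //; apply: measurable_funM => //.
    by apply: measurable_sum => j; exact: measurable_tv.
  rewrite /G normrM (ger0_norm (_ : 0 <= RC _)) ?RC_ge0 ?expR_ge0// ler_wpM2l ?RC_ge0 ?expR_ge0//.
  by rewrite /lpsi (_ : _ - _ - 1 = c + N%:R)//; ring.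
have [a E] := cvar_cint mD mDp (@measurable_tmap R phi n mphi) (@measurable_tprod R (fun=> p) n (measurable_cst _))
  (fun x Dx => @prodr_ge0 _ _ _ _ _ (fun _ _ => ltW p0)) phiD (cvar_tuple (@measurable_shalf p) (@measurable_pos R) mphi (measurable_cst p) (fun _ _ => ltW p0) (cvar_affine (p ^+ 2) p0 (@measurable_pos R))) iG.
have Z0 := Zst_neq0 (c + N%:R) p0.
have NC : N%:R = RC (p ^+ 2) :> CC R by rewrite -NE rmorph_nat.
have pt (s : T n) : tset (shalf p) n s -> G (tv (tmap phi s)) * RC (\prod_(i < n) p) = Zst p (c + N%:R) * sint p c s.
  move=> Ds; rewrite /G tv_tmap omegaA_shift// /sint.
  have v0 i : 0 < 1 + tv s 0 i / p by rewrite -shalfP// tvE; exact: Ds.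
  have -> : RC (expR (- (1 * vsum (map_mx phi (tv s))))) = \prod_i RC (expR (- (p ^+ 2 + p * tv s 0 i))).
    by rewrite -rmorph_prod -expR_sum mul1r /vsum sumrN; congr (RC (expR (- _))); apply: eq_bigr => i _; rewrite mxE.
  have -> : Deltapow (rv2C (map_mx phi (tv s))) (c + N%:R) = \prod_i cpow (RC (p ^+ 2 + p * tv s 0 i)) (c + RC (p ^+ 2)).
    by rewrite NC; apply: eq_bigr => i _; rewrite !mxE.
  have P : (\prod_i RC (expR (- (p ^+ 2 + p * tv s 0 i)))) * (\prod_i cpow (RC (p ^+ 2 + p * tv s 0 i)) (c + RC (p ^+ 2))) * RC (\prod_(i < n) p)
    = (RC (p * expR (- p ^+ 2)) * cpow (RC (p ^+ 2)) (c + N%:R)) ^+ n * \prod_i sfac p c (tv s 0 i).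
    transitivity (\prod_(i < n) (RC (expR (- (p ^+ 2 + p * tv s 0 i))) * cpow (RC (p ^+ 2 + p * tv s 0 i)) (c + RC (p ^+ 2)) * RC p)).
      by rewrite !big_split /= rmorph_prod.
    rewrite (eq_bigr _ (fun i _ => stirling_factor c p0 (v0 i))).
    by rewrite big_split /= prodr_const card_ord NC.
  rewrite /Zst; rewrite [RC (_ * omegaA _ _)]RCM; move: P; move: (\prod_i RC (expR _)) (\prod_i cpow _ _) (RC (\prod_(i < n) p)) (_ ^+ n) (\prod_i sfac _ _ _) (RC (_ `^ _)) (RC (omegaA _ _)) => A B D F S W O P.
  by transitivity (A * B * D * (W * O)); [ring|rewrite P; ring].
have iS : cintble (tmu R n) (tset (shalf p) n) (sint p c).
  apply: (eq_cintble mD) (cintbleZ mD (Zst p (c + N%:R))^-1 a) => s /set_mem Ds.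
  by rewrite pt// mulrA mulVf// mul1r.
rewrite /vint -E -(cintZ mD _ iS); apply: eq_cint => s /set_mem Ds; exact: pt.
Qed.
End stirlingn.

(** * The constant in the Laplace transform *)

Section gamma_const.
Variable R : realType.
Local Notation leb := (@lebesgue_measure R).
Section rec.
Variables (n : nat) (k : R).
Hypothesis k0 : 0 <= k.
Implicit Types (s c : CC R) (x : 'rV[R]_n).
Local Notation one := (const_mx 1 : 'rV[CC R]_n).
Lemma natr_RC (m : nat) : m%:R = RC m%:R :> CC R.
Proof. by rewrite rmorph_nat. Qed.
Lemma cReNat s (m : nat) : cRe (s + m%:R) = cRe s + m%:R.
Proof. by rewrite natr_RC cReD cReRC. Qed.
Lemma Lap_one s : Lap k0 s one = vint (fun x => RC (expR (- (1 * vsum x))) * lpsi k s x).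
Proof. by apply: vint_eq => x x0; rewrite -(EE_neg_const k0). Qed.
Lemma Lap_stir s m : mu0 n k + 1 <= cRe s -> let p : R := m.+1%:R in let c := s - RC (mu0 n k) - 1 in
  Lap k0 (s + ((m.+1 ^ 2)%N)%:R) one = Zst n k p (c + ((m.+1 ^ 2)%N)%:R) * cint (tmu R n) (tset (shalf p) n) (sint k p c).
Proof.
move=> s0 p c; rewrite -stirling_cvar//; last by rewrite /c !cReB !cReRC /=; lra.
rewrite Lap_one; apply: vint_eq => x _; rewrite /lpsi; congr (_ * (Deltapow _ _ * _)); rewrite /c; ring.
Qed.
End rec.
(** Euler's integral is the Laplace transform for n = 1, k = 0, so the functional equation and the
    asymptotics of the Gamma function are instances of the general results. *)
Lemma cGamma_Lap (s : CC R) : 0 < cRe s -> cGamma s = @Lap R 1 0 (lexx 0) s (const_mx 1).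
Proof.
move=> s0; pose G (x : 'rV[R]_1) : CC R := RC (expR (- (1 * vsum x))) * lpsi 0 s x.
have z0 : mu0 1 (0 : R) < cRe s by rewrite /mu0 mul0r.
have [mG iG] := good_lpsi (lexx (0 : R)) z0.
have o1 (x : 'rV[R]_1) : omegaA 0 x = 1.
  by rewrite /omegaA big1// => i _; rewrite big1// => j _; rewrite mulr0 powRr0.
have E (x : 'rV[R]_1) : posv x -> G x = cpow (RC (x 0 0)) (s - 1) * RC (expR (- x 0 0)).
  move=> x0; rewrite /G mul1r /vsum big_ord1 /lpsi o1 RC1 mulr1 /Deltapow big_ord1 mxE mulrC.
  by rewrite /mu0 mul0r RC0 subr0.
have d1 : 0 < (1 : R) / 2 by rewrite divr_gt0.
have mGG : vmeas G.
  apply: cmeasM => //; apply: cmeas_RC; apply: measurableT_comp => //; apply: measurableT_comp => //; apply: measurable_funM => //.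
  by apply: measurable_sum => j; exact: measurable_tv.
have bG (x : 'rV[R]_1) : posv x -> cmod (G x) <= 1 * vmaj (cRe s) (1 / 2) x.
  move=> x0; rewrite E// cmodM cmod_cpow// cmod_RC ger0_norm ?expR_ge0// /vmaj big_ord1 /vsum big_ord1 mul1r cReB.
  rewrite ler_wpM2l ?powR_ge0// ler_expR lerN2; have := x0 0; lra.
rewrite Lap_one -(dom_intC (C := 1) s0 d1 mGG bG) /intC_pos /=; congr Complex; apply: eq_Rintegral => t /set_mem; rewrite /= in_itv /= andbT => t0.
  have vt : posv (vec_of_seq 1 [:: t]) by move=> i; rewrite mxE ord1.
  by rewrite E// !mxE.
have vt : posv (vec_of_seq 1 [:: t]) by move=> i; rewrite mxE ord1.
by rewrite E// !mxE.
Qed.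
Lemma cA_gauss : cA 1 (0 : R) = (2 * pi) `^ (1 / 2).
Proof.
rewrite /cA /=.
transitivity (\int[leb]_(t in setT) expR (- t ^+ 2 / 2)).
  apply: eq_Rintegral => t _ /=; rewrite big_ord1 mxE /= /omegaA big1 ?mulr1// => i _.
  by rewrite big1// => j _; rewrite mulr0 powRr0.
have s1 : (1 : R) != 0 by [].
have I := integral_normal_pdf (0 : R) 1.
have pk : 0 < normal_peak (1 : R) by exact: normal_peak_gt0.
have I2 : (\int[leb]_x (normal_peak (1 : R) * expR (- x ^+ 2 / 2))%:E = 1%E)%E.
  rewrite -I; apply: eq_integral => x _; rewrite normal_pdfE// /normal_fun subr0 expr1n.
  by congr (_ * expR _)%:E; rewrite mulNr.
have mE : measurable_fun [set: measurableTypeR R] (fun x : measurableTypeR R => expR (- x ^+ 2 / 2)).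
  apply: measurableT_comp => //; apply: measurable_funM => //; apply: measurableT_comp => //; exact: exprn_measurable.
have I3 : (\int[leb]_x (expR (- x ^+ 2 / 2))%:E = ((normal_peak (1 : R))^-1)%:E)%E.
  move: I2; under eq_integral do rewrite EFinM.
  rewrite ge0_integralZl; [|exact: measurableT|exact/measurable_EFinP|by move=> x _; rewrite lee_fin expR_ge0|by rewrite lee_fin ltW].
  set J := (\int[_]_(_ in _) _)%E => H.
  have : ((normal_peak (1 : R))^-1%:E * ((normal_peak 1)%:E * J) = (normal_peak (1 : R))^-1%:E)%E by rewrite H mule1.
  by rewrite muleA -EFinM mulVf ?gt_eqF// mul1e.
rewrite /Rintegral I3 /= /normal_peak invrK expr1n mul1r -mulr_natl.
by rewrite [1 / 2]mul1r powR12_sqrt// mulr_ge0// pi_ge0.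
Qed.
Section const.
Variables (n : nat) (k : R).
Hypothesis k0 : 0 <= k.
Implicit Types (s c : CC R).
Local Notation one := (const_mx 1 : 'rV[CC R]_n).
Definition Gprod s : CC R := \prod_(j < n) cGamma (s - RC (k * j%:R)).
Lemma kj_le (j : 'I_n) : k * j%:R <= mu0 n k.
Proof. by rewrite mu0E ler_wpM2l// ler_nat; case: j => j /= jn; case: n jn. Qed.
Lemma cRe_kj s (j : 'I_n) : cRe (s - RC (k * j%:R)) = cRe s - k * j%:R.
Proof. by rewrite cReB. Qed.
Lemma cGamma_rec s : 0 < cRe s -> cGamma (s + 1) = s * cGamma s.
Proof.
move=> s0; have s1 : 0 < cRe (s + 1) by rewrite cReD; have -> : cRe (1 : CC R) = 1 by []; lra.
rewrite !cGamma_Lap//.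
rewrite Lap_rec; last by rewrite /mu0 mul0r.
by rewrite big_ord1 mul0r subr0.
Qed.
Lemma Gprod_rec s : mu0 n k < cRe s -> Gprod (s + 1) = (\prod_(j < n) (s - RC (k * j%:R))) * Gprod s.
Proof.
move=> s0; rewrite /Gprod -big_split /=; apply: eq_bigr => j _; rewrite -cGamma_rec; first by congr cGamma; ring.
by rewrite cRe_kj subr_gt0; apply: le_lt_trans s0; exact: kj_le.
Qed.
(* Both [Lap s 1] and [Gprod s] are multiplied by prod_j (s - k j) under s -> s + 1. *)
Lemma Lap_cross s N : mu0 n k < cRe s -> Lap k0 (s + N%:R) one * Gprod s = Lap k0 s one * Gprod (s + N%:R).
Proof.
move=> s0; elim: N => [|N IH]; first by rewrite addr0.
have h : mu0 n k < cRe (s + N%:R) by rewrite cReNat; apply: lt_le_trans s0 _; rewrite lerDl.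
rewrite -[N.+1]addn1 natrD addrA (Lap_rec k0 h) (Gprod_rec h) -mulrA IH; ring.
Qed.
Lemma sum_ord_nat (m : nat) : 2 * (\sum_(j < m) (j%:R : R)) = m%:R * m.-1%:R.
Proof.
elim: m => [|m IH]; first by rewrite big_ord0 mulr0 mul0r.
rewrite big_ord_recr /= mulrDr IH; case: m {IH} => [|m] /=; first by rewrite mul0r mulr0 add0r mulr0.
rewrite -[m.+2]addn1 -[m.+1]addn1 !natrD; ring.
Qed.
(** The normalising factors of the n one-variable problems multiply to that of the n-variable
    problem, because sum_j (mu0 - k j) = n mu0 / 2 and p^2 is raised to this power. *)
Lemma Zst_prod (p : R) c : 0 < p -> \prod_(j < n) Zst 1 0 p (c + RC (mu0 n k - k * j%:R)) = Zst n k p c.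
Proof.
move=> p0; have p2 : 0 < p ^+ 2 by rewrite exprn_gt0.
have E (j : 'I_n) : Zst 1 0 p (c + RC (mu0 n k - k * j%:R)) = (RC (p * expR (- p ^+ 2)) * cpow (RC (p ^+ 2)) c) * RC ((p ^+ 2) `^ (mu0 n k - k * j%:R)).
  by rewrite /Zst /mu0 mul0r mulr0 powRr0 RC1 mulr1 expr1 cpowD -mulrA cpow_RC.
rewrite (eq_bigr _ (fun j _ => E j)) big_split /= prodr_const card_ord /Zst; congr (_ * _).
rewrite -rmorph_prod; congr RC.
have pE (a : R) : (p ^+ 2) `^ a = expR (a * (2 * ln p)) by rewrite /powR gt_eqF// lnXn// mulr_natl.
rewrite (eq_bigr _ (fun j _ => pE _)) -expR_sum -mulr_suml /powR gt_eqF//; congr expR.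
rewrite big_split /= sumr_const card_ord sumrN -mulr_sumr -[mu0 n k *+ n]mulr_natr mulrA; congr (_ * _).
have := sum_ord_nat n; rewrite mu0E; move: (\sum_(_ < _) _) => S HS.
by transitivity (2 * (k * n.-1%:R * n%:R) - k * (2 * S)); [ring|rewrite HS; ring].
Qed.
(** [Lap_cross] at N = (m+1)^2 has the common nonzero factor [Zst] on both sides. After cancellation
    the rescaled integrals tend to c_A on one side and to n copies of the one-variable constant on
    the other. The margin 1 in the hypothesis keeps the exponents at nonnegative real part, as
    [sfac_bound] demands. *)
Lemma Lap_const1 s : mu0 n k + 1 <= cRe s -> RC (cA n k) * Gprod s = Lap k0 s one * RC (cA 1 0) ^+ n.
Proof.
move=> s0; have s1 : mu0 n k < cRe s by lra.
pose c := s - RC (mu0 n k) - 1; pose cj (j : 'I_n) := s - RC (k * j%:R) - 1.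
have c0 : 0 <= cRe c by rewrite /c !cReB cReRC; have -> : cRe (1 : CC R) = 1 by []; lra.
have cj0 j : 0 <= cRe (cj j).
  by rewrite /cj !cReB !cReRC; have := kj_le j; lra.
pose A m := cint (tmu R n) (tset (shalf m.+1%:R) n) (sint k m.+1%:R c).
pose a j m := cint (tmu R 1) (tset (shalf m.+1%:R) 1) (sint 0 m.+1%:R (cj j)).
have E m : A m * Gprod s = Lap k0 s one * \prod_j a j m.
  have := Lap_cross ((m.+1 ^ 2)%N) s1; rewrite (Lap_stir k0 m s0) -/(A m) -/c.
  have p0 : 0 < (m.+1%:R : R) by rewrite ltr0n.
  have G1 : Gprod (s + ((m.+1 ^ 2)%N)%:R) = Zst n k m.+1%:R (c + ((m.+1 ^ 2)%N)%:R) * \prod_j a j m.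
    rewrite -Zst_prod// -big_split /=; apply: eq_bigr => j _.
    have sj : mu0 1 (0 : R) + 1 <= cRe (s - RC (k * j%:R)) by rewrite /mu0 mul0r add0r cRe_kj; have := kj_le j; lra.
    rewrite (_ : s + _ - _ = (s - RC (k * j%:R)) + ((m.+1 ^ 2)%N)%:R); last by rewrite addrAC.
    rewrite cGamma_Lap; last by rewrite cReNat ltr_wpDr//; move: sj; rewrite /mu0 mul0r add0r; apply: lt_le_trans.
    rewrite (Lap_stir (lexx 0) m sj) /a /cj /mu0 mul0r RC0 subr0; congr (Zst _ _ _ _ * _).
    by rewrite /c /mu0 RCB; ring.
  rewrite G1; have Z0 := Zst_neq0 n k (c + ((m.+1 ^ 2)%N)%:R) p0.
  by rewrite -mulrA [RHS]mulrCA => /(mulfI Z0).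
have lA : ccvg (fun m => A m * Gprod s) (RC (cA n k) * Gprod s) by apply: ccvgM; [exact: stirling_lim|exact: ccvg_cst].
have la : ccvg (fun m => Lap k0 s one * \prod_j a j m) (Lap k0 s one * \prod_(j < n) RC (cA 1 0)).
  by apply: ccvgM; [exact: ccvg_cst|apply: ccvg_prod => j; exact: stirling_lim].
rewrite (_ : _ ^+ n = \prod_(j < n) RC (cA 1 0)); last by rewrite prodr_const card_ord.
by apply: (ccvg_uniq lA); apply: ccvg_eq la => m; rewrite E.
Qed.
Lemma Gamma_nsE s : mu0 n k < cRe s -> Gamma_ns n k s = Lap k0 s one.
Proof.
move=> s0.
have G : forall s, Gamma_ns n k s = RC (cA n k * (2 * pi) `^ (- (n%:R / 2))) * Gprod s.
  by move=> t; rewrite /Gamma_ns /Gamma_n /Gprod; congr (_ * _); apply: eq_bigr => j _; rewrite mxE.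
have pi2 : 0 < 2 * pi :> R by rewrite mulr_gt0// pi_gt0.
have big t : mu0 n k + 1 <= cRe t -> Gamma_ns n k t = Lap k0 t one.
  move=> t0; rewrite G RCM mulrAC (Lap_const1 t0) -mulrA -[RHS]mulr1; congr (_ * _).
  rewrite cA_gauss -rmorphXn /= -RCM -RC1; congr RC.
  rewrite -powR_mulrn ?powR_ge0// -powRrM -powRD; last by rewrite (gt_eqF pi2) implybT.
  by rewrite (_ : _ + _ = 0) ?powRr0//; field.
(* One step of the common recursion extends the identity down to Re s > mu0; the factors s - k j
   have positive real part there and can be cancelled. *)
have s1 : mu0 n k + 1 <= cRe (s + 1) by rewrite cReD; have -> : cRe (1 : CC R) = 1 by []; lra.
have := big _ s1; rewrite G (Gprod_rec s0) (Lap_rec k0 s0) mulrCA -G => /mulfI; apply.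
apply/prodf_neq0 => j _; apply/eqP => e; have := cRe_kj s j; rewrite e /= => /esym/eqP.
rewrite subr_eq0 => /eqP h; have := kj_le j; rewrite -h; lra.
Qed.
End const.
End gamma_const.

(** * The K-Bessel integral *)
Section Kernel.
Variables (R : realType) (n : nat) (k : R).
Hypothesis k0 : 0 <= k.
Local Notation V := ('rV[CC R]_n).
Local Notation T := (n.-tuple (measurableTypeR R)).
Implicit Types (x : 'rV[R]_n) (w z : V) (nu : CC R).
Definition Kint nu w z x : CC R := EE k0 (- rv2C x) w * EE k0 (- rv2C (rvinv x)) z * lpsi k nu x.
Lemma KintE nu w z : Kintegrand n k nu w z = Kint nu w z.
Proof. by apply/funext => x; rewrite /Kintegrand !EA_EE /Kint /lpsi mulrA. Qed.
Definition Kmaj (M d e : R) x : R := expR (- (d * vsum x)) * expR (- (e * vsum (rvinv x))) * expR (M * lnsum x) * omegaA k x.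
Lemma Deltapow_le x (s : CC R) : posv x -> cmod (Deltapow (rv2C x) s) <= expR (`|cRe s| * lnsum x).
Proof. by move=> x0; rewrite cmod_Deltapow//; exact: prod_powR_le. Qed.
Lemma EE_le_exp x w (d : R) : vge0 x -> (forall i, d < cRe (w 0 i)) -> cmod (EE k0 (- rv2C x) w) <= expR (- (d * vsum x)).
Proof. by move=> x0 dw; rewrite -cmod_leP; exact: EE_neg_exp. Qed.
Lemma Kint_bound nu w z (d e : R) x : (forall i, d < cRe (w 0 i)) -> (forall i, e < cRe (z 0 i)) -> posv x ->
  cmod (Kint nu w z x) <= Kmaj `|cRe (nu - RC (mu0 n k) - 1)| d e x.
Proof.
move=> dw ez x0; rewrite /Kint /lpsi !cmodM cmod_RC ger0_norm ?omegaA_ge0// /Kmaj mulrA ler_wpM2r ?omegaA_ge0//.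
apply: ler_pM; rewrite ?mulr_ge0 ?cmod_ge0//; last exact: Deltapow_le.
by apply: ler_pM; rewrite ?cmod_ge0//; apply: EE_le_exp => //; apply: posv_ge0 => //; exact: posv_inv.
Qed.
Lemma vmeas_Kint nu w z : vmeas (Kint nu w z).
Proof. by apply: cmeasM; [apply: cmeasM; [exact: cmeas_EE_neg|exact: cmeas_EE_inv]|exact: vmeas_lpsi]. Qed.
Lemma measurable_vsum (E : set T) : measurable_fun E (fun s => vsum (tv s) : R).
Proof. by apply: measurable_sum => j; exact: measurable_tv. Qed.
Lemma vmeas_Kmaj M d e : vmeas (fun x => RC (Kmaj M d e x)).
Proof.
apply: cmeas_RC; apply: measurable_funM; last exact: measurable_omegaA.
have mi i : measurable_fun (@Dpos R n) (fun s => rvinv (tv s) 0 i).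
  rewrite (_ : (fun s => _) = (fun t : measurableTypeR R => t^-1 : measurableTypeR R) \o (fun s => tv s 0 i)); last by apply/funext => s; rewrite mxE.
  by apply: measurableT_comp; [exact: measurable_inv|exact: measurable_tv].
apply: measurable_funM; first apply: measurable_funM.
- by apply: measurableT_comp => //; apply: measurableT_comp => //; apply: measurable_funM => //; exact: measurable_vsum.
- by apply: measurableT_comp => //; apply: measurableT_comp => //; apply: measurable_funM => //; apply: measurable_sum.
apply: measurableT_comp => //; apply: measurable_funM => //; apply: measurable_sum => i.
apply: measurableT_comp; first exact: normr_measurable.
by apply: measurableT_comp; [exact: measurable_ln|exact: measurable_tv].
Qed.
Lemma Kmaj_ge0 M d e x : 0 <= Kmaj M d e x.
Proof. by rewrite !mulr_ge0 ?expR_ge0 ?omegaA_ge0. Qed.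
Lemma Kmaj_int M d e : 0 <= M -> 0 < d -> 0 < e -> vintble (fun x : 'rV[R]_n => RC (Kmaj M d e x)).
Proof.
move=> M0 d0 e0; have [C C0 H] := bessel_majorant_le n k0 M0 d0 e0.
apply: (dom_intble (C := C) ltr01 (divr_gt0 d0 (ltr0n _ 2)) (vmeas_Kmaj M d e)) => x x0.
by rewrite cmod_RC ger0_norm ?Kmaj_ge0//; exact: H.
Qed.
Lemma Kint_all nu w z : RePos w -> RePos z ->
  [/\ abs_conv_pos n (Kintegrand n k nu w z), Kker n k nu w z = vint (Kint nu w z) & vintble (Kint nu w z)].
Proof.
move=> /RePos_min [d d0 dw] /RePos_min [e e0 ez].
have [C C0 H] := @bessel_majorant_le R n k k0 _ d e (normr_ge0 (cRe (nu - RC (mu0 n k) - 1))) d0 e0.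
have d2 : 0 < d / 2 by rewrite divr_gt0.
have b x : posv x -> cmod (Kint nu w z x) <= C * vmaj 1 (d / 2) x.
  by move=> x0; apply: le_trans (Kint_bound nu dw ez x0) _; exact: H.
have m := vmeas_Kint nu w z.
by split; rewrite ?/Kker ?KintE; [exact: (dom_abs ltr01 d2 m b)|exact: (dom_intC ltr01 d2 m b)|exact: (dom_intble ltr01 d2 m b)].
Qed.
Lemma Kker_int nu w z : RePos w -> RePos z -> Kker n k nu w z = vint (Kint nu w z).
Proof. by move=> w0 z0; have [] := Kint_all nu w0 z0. Qed.
Lemma Kint_int nu w z : RePos w -> RePos z -> vintble (Kint nu w z).
Proof. by move=> w0 z0; have [] := Kint_all nu w0 z0. Qed.
Lemma RePos_permv s w : RePos w -> RePos (permv s w).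
Proof. by move=> w0 i; rewrite mxE; exact: w0. Qed.
Lemma Kker_permv s nu w z : RePos w -> RePos z -> Kker n k nu (permv s w) (permv s z) = Kker n k nu w z.
Proof.
move=> w0 z0; have ws := RePos_permv s w0; have zs := RePos_permv s z0; rewrite (Kker_int nu ws zs) (Kker_int nu w0 z0).
rewrite -(vint_perm s (Kint_int nu ws zs)).2; apply: vint_eq => x x0; rewrite /Kint.
have e1 : - rv2C (permv s x) = permv s (- rv2C x) by apply/rowP => i; rewrite !mxE.
have e2 : - rv2C (rvinv (permv s x)) = permv s (- rv2C (rvinv x)) by apply/rowP => i; rewrite !mxE.
have e3 : rv2C (permv s x) = permv s (rv2C x) by apply/rowP => i; rewrite !mxE.
by rewrite e1 e2 !EE_inv /lpsi e3 Deltapow_permv omegaA_permv.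
Qed.
Lemma rvinvK x : rvinv (rvinv x) = x.
Proof. by apply/rowP => i; rewrite !mxE invrK. Qed.
(** Exponents add up as -(nu - mu0 - 1) - 2 mu0 - 2 = -nu - mu0 - 1, with -2 mu0 from the weight and
    -2 from the Jacobian. The shift mu0 + 1 is thus the one that makes inversion act as nu ->
    -nu. *)
Lemma lpsi_inv nu x : posv x -> lpsi k nu (rvinv x) * RC (\prod_i (x 0 i ^+ 2)^-1) = lpsi k (- nu) x.
Proof.
move=> x0; rewrite /lpsi Deltapow_inv// omegaA_inv// RCM.
have e1 : \prod_i x 0 i `^ (- (2 * mu0 n k)) = \prod_i x 0 i `^ (- (2 * mu0 n k)) by [].
have e2 : RC (\prod_i (x 0 i ^+ 2)^-1) = Deltapow (rv2C x) (RC (- 2)).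
  rewrite Deltapow_real//; congr RC; apply: eq_bigr => i _.
  by rewrite powRN -powR_mulrn// ltW.
rewrite e2 -Deltapow_real//.
have -> : - nu - RC (mu0 n k) - 1 = - (nu - RC (mu0 n k) - 1) + RC (- (2 * mu0 n k)) + RC (-2).
  have R2 : RC (2 : R) = 1 + 1 by rewrite -RC1 -RCD.
  by rewrite !RCN RCM R2; ring.
rewrite !DeltapowD; have alg (A B C D : CC R) : A * (D * B) * C = A * B * C * D by ring.
exact: alg.
Qed.
Lemma Kker_inv nu w z : RePos w -> RePos z -> Kker n k nu w z = Kker n k (- nu) z w.
Proof.
move=> w0 z0; rewrite (Kker_int nu w0 z0) (Kker_int (- nu) z0 w0) -(vint_inv (Kint_int nu w0 z0)).2; apply: vint_eq => x x0.
by rewrite /Kint rvinvK -[LHS]mulrA lpsi_inv// [EE _ _ w * _]mulrC.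
Qed.
Lemma rvRe_pos w : RePos w -> RePos (rvRe w).
Proof. by move=> w0 i; rewrite mxE; exact: w0. Qed.
Lemma Kker_norm nu w z : RePos w -> RePos z -> `|Kker n k nu w z| <= Kker n k (RC (cRe nu)) (rvRe w) (rvRe z).
Proof.
move=> w0 z0; have wr := rvRe_pos w0; have zr := rvRe_pos z0; rewrite (Kker_int nu w0 z0) (Kker_int _ wr zr).
have mD := @measurable_Dpos R n.
have i1 := Kint_int nu w0 z0.
apply: le_trans (norm_cint mD i1) _; apply: le_cint => //.
- exact: (cintble_norm mD i1).
- exact: (Kint_int _ wr zr).
move=> s /Dpos_posv; move: (tv s) => x x0; rewrite /Kint !normrM.
have xi := posv_inv x0.
apply: ler_pM; rewrite ?mulr_ge0//.
  by apply: ler_pM => //; apply: EE_neg_le_Re; exact: posv_ge0.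
apply: ler_pM => //; last by rewrite ger0_norm// RC_ge0 omegaA_ge0.
rewrite CC_norm cmod_Deltapow// -RC1 -!RCB Deltapow_real// RC_le cRe_lpsi//.
Qed.
Lemma EE_scale (c : CC R) (l z : V) : EE k0 (c *: l) z = EE k0 l (c *: z).
Proof.
have h m f : hpoly m f -> forall z, f (c *: z) = c ^+ m * f z.
  move=> H; elim: H => {m f} [m|a|m j f _ IH|m f g _ IH _ IH'] y; rewrite ?mulr0 ?mul1r//; first by rewrite mxE IH exprS; ring.
  by rewrite IH IH' mulrDr.
rewrite /EE; congr csum; apply/funext => m.
by rewrite EF_sym (h m _ (EF_hpoly _ _ _)) EF_sym -(h m _ (EF_hpoly _ _ _)).
Qed.
(** Using |h| <= 1 and l <= e^l, the three quantities, divided by the due power of |h|, are at most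
    e^l, 2 e^(2 l) and 4 e^(3 l); a common bound is what [qr] expects. *)
Lemma cexp_qr_bounds (h : CC R) (l r : R) : 0 <= l -> cmod h <= r -> r <= 1 ->
  [/\ cmod (cexp (h * RC l)) <= 8 * expR (3 * l), cmod (cexp (h * RC l) - 1) <= cmod h * (8 * expR (3 * l)) &
      cmod (cexp (h * RC l) - 1 - h * RC l) <= cmod h ^+ 2 * (8 * expR (3 * l))].
Proof.
move=> l0 hr r1; have h1 := le_trans hr r1; have h0 := cmod_ge0 h.
have m : cmod (h * RC l) = cmod h * l by rewrite cmodM cmod_RC ger0_norm.
have hl : cmod h * l <= l by rewrite ler_piMl.
have el : 1 <= expR l by rewrite -expR0 ler_expR.
have ll : l <= expR l by apply: le_trans (expR_ge1Dx l); rewrite lerDr.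
have e3 : expR (3 * l) = expR l * expR l * expR l by rewrite -!expRD; congr expR; ring.
have eh : expR (cmod h * l) <= expR l by rewrite ler_expR.
have E0 := expR_ge0 (cmod h * l).
split.
- rewrite cmod_cexp; apply: (@le_trans _ _ (expR l)).
    rewrite ler_expR; apply: le_trans hl; apply: le_trans (ler_norm _) _; apply: le_trans (cRe_le_norm _) _; by rewrite m.
  rewrite e3; move: el; move: (expR l) => E E1; have : 1 <= E * E by nra.
  by move=> EE1; nra.
- apply: le_trans (cexp_bound1 _) _; rewrite m e3.
  have -> : 2 * (cmod h * l * expR (cmod h * l)) = cmod h * (2 * (l * expR (cmod h * l))) by ring.
  rewrite ler_wpM2l//; have b := ler_pM l0 E0 ll eh.
  move: b el; move: (expR l) (l * _) => E B b E1; have : 1 <= E * E by nra.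
  by move=> EE1; nra.
apply: le_trans (cexp_bound2 _) _; rewrite m e3.
have -> : 4 * ((cmod h * l) ^+ 2 * expR (cmod h * l)) = cmod h ^+ 2 * (4 * (l * l * expR (cmod h * l))) by ring.
rewrite ler_wpM2l ?sqr_ge0//; have b := ler_pM (mulr_ge0 l0 l0) E0 (ler_pM l0 l0 ll ll) eh.
have Ep : 0 <= expR l * expR l * expR l by rewrite !mulr_ge0 ?expR_ge0.
by move: b Ep; move: (expR l * _ * _) (l * l * _) => E B; lra.
Qed.
Lemma Deltapow_exp x (s : CC R) : posv x -> Deltapow (rv2C x) s = cexp (s * RC (\sum_i ln (x 0 i))).
Proof.
move=> x0; rewrite /Deltapow; have : forall r : seq 'I_n, \prod_(i <- r) cpow (rv2C x 0 i) s = cexp (s * RC (\sum_(i <- r) ln (x 0 i))).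
  elim=> [|i r IH]; first by rewrite !big_nil RC0 mulr0 cexp0.
  by rewrite !big_cons IH rv2C_coord cpowE// RCD mulrDr cexpD.
by apply.
Qed.
(** As a function of the exponent, Delta^v is an exponential with rate l = sum_i ln x_i. If l is
    negative, h and l both change sign. The price of differentiating is the additional 3 in front of
    [lnsum x]. *)
Lemma Deltapow_qr x (s b : CC R) (r : R) : posv x -> 0 < r -> r <= 1 ->
  qr (fun v : CC R => Deltapow (rv2C x) (v - b)) s (fun h => h * (RC (\sum_i ln (x 0 i)) * Deltapow (rv2C x) (s - b))) (RC r) (RC (8 * expR ((`|cRe (s - b)| + 3) * lnsum x))).
Proof.
move=> x0 r0 r1; split.
  by move=> a u v /=; rewrite mulrDl; congr (_ + _); exact: (esym (mulrA a u _)).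
move=> h hr0; have hr : cmod h <= r by rewrite -cmod_leP.
have S : `|\sum_i ln (x 0 i)| <= lnsum x by exact: ler_norm_sum.
pose l := \sum_i ln (x 0 i).
have [B1 B2 B3] : [/\ cmod (cexp (h * RC l)) <= 8 * expR (3 * lnsum x), cmod (cexp (h * RC l) - 1) <= cmod h * (8 * expR (3 * lnsum x)) &
      cmod (cexp (h * RC l) - 1 - h * RC l) <= cmod h ^+ 2 * (8 * expR (3 * lnsum x))].
  have mono : 8 * expR (3 * `|l|) <= 8 * expR (3 * lnsum x) by rewrite ler_pM2l// ler_expR ler_pM2l.
  have [c1 c2 c3] : [/\ cmod (cexp (h * RC l)) <= 8 * expR (3 * `|l|), cmod (cexp (h * RC l) - 1) <= cmod h * (8 * expR (3 * `|l|)) &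
      cmod (cexp (h * RC l) - 1 - h * RC l) <= cmod h ^+ 2 * (8 * expR (3 * `|l|))].
    have [l0|l0] := leP 0 l; first by rewrite ger0_norm//; exact: (@cexp_qr_bounds h l r).
    rewrite ltr0_norm//; have := @cexp_qr_bounds (- h) (- l) r; rewrite cmodN RCN mulrNN; apply => //.
    by rewrite oppr_ge0 ltW.
  split; first exact: le_trans mono.
    by apply: le_trans c2 _; rewrite ler_wpM2l// cmod_ge0.
  by apply: le_trans c3 _; rewrite ler_wpM2l// sqr_ge0.
set D := Deltapow (rv2C x) (s - b).
have DE : Deltapow (rv2C x) (s + h - b) = D * cexp (h * RC l).
  by rewrite (_ : s + h - b = (s - b) + h); [rewrite DeltapowD (Deltapow_exp h x0)|ring].
have Db : cmod D <= expR (`|cRe (s - b)| * lnsum x) by exact: Deltapow_le.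
have E : 8 * expR ((`|cRe (s - b)| + 3) * lnsum x) = expR (`|cRe (s - b)| * lnsum x) * (8 * expR (3 * lnsum x)).
  by rewrite [(_ + 3) * _]mulrDl expRD; ring.
rewrite E DE; set M := expR (`|_| * _) in Db *; set Q := 8 * _ in B1 B2 B3 *.
have M0 : 0 <= M by exact: expR_ge0.
have rC : `|RC r| = RC r by rewrite ger0_norm// RC_ge0 ltW.
split.
- by rewrite cmod_leP cmodM; apply: ler_pM; rewrite ?cmod_ge0.
- rewrite (_ : D * _ - D = D * (cexp (h * RC l) - 1)); last by ring.
  rewrite !CC_norm -!RCM RC_le cmodM.
  have -> : cmod h * (M * Q) = M * (cmod h * Q) by ring.
  apply: le_trans (_ : cmod D * cmod (cexp (h * RC l) - 1) <= _); first by rewrite ler_piMl// mulr_ge0 ?cmod_ge0.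
  by apply: ler_pM; rewrite ?cmod_ge0.
rewrite (_ : D * _ - D - _ = D * (cexp (h * RC l) - 1 - h * RC l)); last by rewrite -/l; ring.
rewrite !CC_norm -!rmorphXn /= -!RCM RC_le cmodM.
have -> : cmod h ^+ 2 * (M * Q) = M * (cmod h ^+ 2 * Q) by ring.
apply: le_trans (_ : cmod D * cmod (cexp (h * RC l) - 1 - h * RC l) <= _).
  by rewrite ler_piMl ?mulr_ge0 ?cmod_ge0// exprn_ile1// ltW.
by apply: ler_pM; rewrite ?cmod_ge0.
Qed.
End Kernel.

Section qr_proj.
Variables (R : realType) (U W : normedModType (CC R)).
Lemma qr_proj (f L : W -> CC R) (P : U -> W) p rho g : 0 < rho -> (forall a u v, P (a *: u + v) = a *: P u + P v) ->
  (forall u, `|P u| <= `|u|) -> qr f (P p) L rho g -> qr (fun u => f (P u)) p (fun h => L (P h)) rho g.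
Proof.
move=> r0 lP nP H; have g0 := qr_ge0 r0 H; case: H => l H.
have PD u v : P (u + v) = P u + P v by have := lP 1 u v; rewrite !scale1r.
split; first by move=> a u v; rewrite lP l.
move=> h hr; have [a b c] := H (P h) (le_trans (nP h) hr); rewrite PD; split => //.
  by apply: le_trans b _; rewrite ler_wpM2r.
by apply: le_trans c _; rewrite ler_wpM2r// lerXn2r ?nnegrE.
Qed.
Lemma qr_local (f f' L : U -> CC R) p rho g : 0 < rho -> (forall h, `|h| <= rho -> f (p + h) = f' (p + h)) -> qr f p L rho g -> qr f' p L rho g.
Proof.
move=> r0 ff [l H]; split => // h hr; have := ff 0; rewrite normr0 addr0 => /(_ (ltW r0)) <-.
by rewrite -ff//; exact: H.
Qed.
Lemma norm_fst_le (u : U * W) : `|u.1| <= `|u|.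
Proof. by rewrite prod_normE /Num.max; case: ifP => // /ltW. Qed.
Lemma norm_snd_le (u : U * W) : `|u.2| <= `|u|.
Proof.
rewrite prod_normE /Num.max; case: ifP => // h; rewrite real_leNgt ?h//; exact: normr_real.
Qed.
End qr_proj.
Section qr_pair.
Variables (R : realType) (U W : normedModType (CC R)).
Lemma qr_fst (f L : U -> CC R) (p : U * W) rho g : 0 < rho -> qr f p.1 L rho g -> qr (fun u : U * W => f u.1) p (fun h => L h.1) rho g.
Proof. by move=> r0; apply: (qr_proj (P := fun u : U * W => u.1) r0) => // u; exact: norm_fst_le. Qed.
Lemma qr_snd (f L : W -> CC R) (p : U * W) rho g : 0 < rho -> qr f p.2 L rho g -> qr (fun u : U * W => f u.2) p (fun h => L h.2) rho g.
Proof. by move=> r0; apply: (qr_proj (P := fun u : U * W => u.2) r0) => // u; exact: norm_snd_le. Qed.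
End qr_pair.
Section tmu_box.
Variable R : realType.
Local Notation T n := (n.-tuple (measurableTypeR R)).
Local Notation leb := (@lebesgue_measure R).
Definition sbox n (m : nat) : set (T n) := [set x : T n | forall i : 'I_n, ((m + i)%N)%:R < tnth x i < ((m + i).+1)%:R].
Lemma measurable_sbox n m : measurable (@sbox n m).
Proof.
have -> : @sbox n m = \bigcap_(i in [set: 'I_n]) ((fun x : T n => tnth x i) @^-1` `]((m + i)%N)%:R, ((m + i).+1)%:R[%classic).
  apply/seteqP; split => x /= H i; first by move=> _; rewrite /= in_itv /=; exact: H.
  by have := H i Logic.I; rewrite /= in_itv.
apply: fin_bigcap_measurable => // i _; rewrite -[X in measurable X]setTI.
by apply: (@measurable_tnth _ _ n i) => //; exact: measurable_itv.
Qed.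
(* On this box the coordinates are pairwise distinct, hence omega is positive there. *)
Lemma tmu_sbox n m : (0 < tmu R n (@sbox n m))%E.
Proof.
elim: n m => [|n IH] m.
  have -> : @sbox 0 m = setT by apply/seteqP; split => // x _ [].
  by rewrite /= diracT lte01.
have mB := @measurable_sbox n.+1 m; have mB' := @measurable_sbox n m.+1.
pose I : set (measurableTypeR R) := `](m%:R : R), m.+1%:R[%classic.
have mI : measurable I by exact: measurable_itv.
have E (t : R) (s : T n) : (\1_(@sbox n.+1 m) (consT ((t : measurableTypeR R), s)) : R)%:E = ((\1_I t : R)%:E * (\1_(@sbox n m.+1) s : R)%:E)%E.
  rewrite -EFinM !indicE -natrM mulnb; congr (_ %:R%:E); congr nat_of_bool.
  apply/idP/andP => [/set_mem H|[/set_mem It /set_mem H]].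
    split; apply/mem_set; first by have := H ord0; rewrite addn0 /I /= in_itv.
    by move=> i; have := H (lift ord0 i); rewrite tnthS /= /bump /= add1n addnS addSn.
  apply/mem_set => i; case: (unliftP ord0 i) => [j|] ->; last by move: It; rewrite /I /= in_itv addn0.
  by have := H j; rewrite tnthS /= /bump /= add1n addnS addSn.
have -> : tmu R n.+1 (@sbox n.+1 m) = (\int[tmu R n.+1]_x (\1_(@sbox n.+1 m) x : R)%:E)%E by rewrite integral_indic ?setIT.
rewrite tmu_recl; last 2 first.
- by apply/measurable_EFinP; exact: measurable_indic.
- by move=> x; rewrite lee_fin.
under eq_integral => t _.
  under eq_integral do rewrite E.
  rewrite ge0_integralZl; [|exact: measurableT|by apply/measurable_EFinP; exact: measurable_indic|by move=> x _; rewrite lee_fin|by rewrite lee_fin].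
  rewrite (integral_indic _ _ mB') ?setIT// muleC.
  over.
rewrite ge0_integralZl; [|exact: measurableT|by apply/measurable_EFinP; exact: measurable_indic|by move=> x _; rewrite lee_fin|exact: measure_ge0].
have I1 : (leb I = 1)%E.
  by rewrite /I lebesgue_measure_itv /= lte_fin ltr_nat ltnSn -natr1 -EFinB addrAC subrr add0r.
by rewrite integral_indic ?setIT// (_ : _ I = 1%E)// mule1; exact: IH.
Qed.
End tmu_box.

Section positive.
Variables (R : realType) (n : nat).
Implicit Types (x : 'rV[R]_n) (G : 'rV[R]_n -> CC R).
Local Notation T := (n.-tuple (measurableTypeR R)).
(** A vanishing integral would make f vanish almost everywhere, yet f is positive on a box of
    positive measure. Positivity is asked only at points with distinct coordinates, since the weight
    omega can vanish elsewhere. *)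
Lemma vint_gt0 (f : 'rV[R]_n -> R) : vintble (fun x => RC (f x)) -> (forall x, posv x -> 0 <= f x) ->
  (forall x, posv x -> injective (fun i => x 0 i) -> 0 < f x) -> 0 < vint (fun x => RC (f x)).
Proof.
move=> [i1 i2] f0 fp; have mD := @measurable_Dpos R n.
have ge0 : 0 <= vint (fun x => RC (f x)) by apply: cint_ge0 => // s /Dpos_posv s0; rewrite RC_ge0 f0.
rewrite lt_def ge0 andbT; apply/eqP => e.
have e2 : (\int[tmu R n]_(s in @Dpos R n) (f (tv s))%:E = 0)%E.
  have := congr1 (@cRe R) e; rewrite /vint /cint /= /Rintegral => e3.
  have fin : (\int[tmu R n]_(s in @Dpos R n) (f (tv s))%:E)%E \is a fin_num by exact: (integrable_fin_num mD i1).
  by rewrite -(fineK fin); congr EFin; exact: e3.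
have mf : measurable_fun (@Dpos R n) (fun s => (f (tv s))%:E) by have /integrableP[] := i1.
have /(ae_eq_integral_abs _ mD mf) ae : (\int[tmu R n]_(s in @Dpos R n) `|(f (tv s))%:E| = 0)%E.
  rewrite -e2; apply: eq_integral => s /set_mem/Dpos_posv s0; by rewrite gee0_abs// lee_fin f0.
have [N [mN N0 sub]] := ae.
have : (tmu R n (@sbox R n 0) <= tmu R n N)%E.
  apply: (@le_measure _ _ _ (tmu R n)); [apply: mem_set; exact: measurable_sbox|exact: mem_set|].
  move=> s Bs; apply: sub => /= H.
  have s0 : posv (tv s).
    by move=> i; rewrite tvE; have /andP[h _] := Bs i; apply: le_lt_trans h.
  have inj : injective (fun i => tv s 0 i).
    move=> i j; rewrite !tvE => ij; apply/val_inj; have /andP[a1 a2] := Bs i; have /andP[b1 b2] := Bs j.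
    rewrite ij in a1 a2; rewrite !add0n in a1 a2 b1 b2.
    have := lt_trans a1 b2; have := lt_trans b1 a2; rewrite !ltr_nat !ltnS => h1 h2.
    by apply/eqP; rewrite eqn_leq h1 h2.
  have := fp _ s0 inj; have : (f (tv s))%:E = 0%E by apply: H; apply/Dpos_posv.
  by move=> [->]; rewrite ltxx.
by rewrite N0 leNgt tmu_sbox.
Qed.
End positive.

(** * Holomorphy, estimates, Dunkl equations and limits of the Bessel integral *)

Section final.
Variables (R : realType) (n : nat) (k : R).
Hypothesis k0 : 0 <= k.
Local Notation V := ('rV[CC R]_n).
Implicit Types (x y : 'rV[R]_n) (w z : V) (nu : CC R).
Lemma Kker_holo (p : CC R * (V * V)) : RePos p.2.1 -> RePos p.2.2 ->
  differentiable (fun q : CC R * (V * V) => Kker n k q.1 q.2.1 q.2.2) p.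
Proof.
move=> w0 z0; have [d d0 dw] := RePos_min w0; have [e e0 ez] := RePos_min z0.
pose r := Num.min 1 (Num.min (d / 2) (e / 2)).
have r0 : 0 < r by rewrite !lt_min ltr01 !divr_gt0.
have r1 : r <= 1 by rewrite ge_min lexx.
have rd : r <= d / 2 by rewrite !ge_min lexx orbT.
have re : r <= e / 2 by rewrite !ge_min lexx !orbT.
have d2 : 0 < d / 2 by rewrite divr_gt0.
have e2 : 0 < e / 2 by rewrite divr_gt0.
have dw2 i : d / 2 + r < cRe (p.2.1 0 i) by apply: le_lt_trans (dw i); lra.
have ez2 i : e / 2 + r < cRe (p.2.2 0 i) by apply: le_lt_trans (ez i); lra.
have R0 : 0 < RC r by rewrite RC_gt0.
pose b := RC (mu0 n k) + 1.
pose M := `|cRe (p.1 - b)| + 3.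
have M0 : 0 <= M by rewrite addr_ge0.
(* 72 = 3 * 3 * 8: two applications of the product rule [qrM] and the constant of [Deltapow_qr],
   whose additional exponent 3 is contained in M. *)
pose g x := RC (72 * Kmaj k M (d / 2) (e / 2) x).
pose Phi x (q : CC R * (V * V)) := Kint k0 q.1 q.2.1 q.2.2 x.
have H x : posv x -> qr (Phi x) p (fun v => 'D_v (Phi x) p) (RC r) (g x).
  move=> x0; apply: qr_deriveE => //.
  have q1 := EE_neg_qr k0 r0 dw2 (posv_ge0 x0).
  have q2 := EE_neg_qr k0 r0 ez2 (posv_ge0 (posv_inv x0)).
  have q3 := Deltapow_qr p.1 b x0 r0 r1; rewrite -/M in q3.
  have {}q1 := @qr_snd R (CC R) (V * V)%type _ _ p _ _ R0 (qr_fst R0 q1).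
  have {}q2 := @qr_snd R (CC R) (V * V)%type _ _ p _ _ R0 (qr_snd R0 q2).
  have {}q3 := @qr_fst R (CC R) (V * V)%type _ _ p _ _ R0 q3.
  have q4 := qrZ (_ : 0 <= RC (omegaA k x)) (qrM R0 (qrM R0 q1 q2) q3).
  have {q4} := q4 ltac:(by rewrite RC_ge0 omegaA_ge0).
  move=> q4; apply: qr_le; last first.
    apply: qr_eq q4 => // q; rewrite /Phi /Kint /lpsi /b.
    by rewrite (_ : q.1 - (RC (mu0 n k) + 1) = q.1 - RC (mu0 n k) - 1); [rewrite mulrC mulrA|ring].
  rewrite /g /Kmaj.
  have N3 : (3%:R : CC R) = RC 3 by rewrite (natr_RC R 3).
  rewrite N3 -!RCM RC_le le_eqVlt; apply/orP; left; apply/eqP.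
  move: (expR _) (expR _) (expR _) (omegaA _ _) => A B D O; ring.
have ig : vintble g.
  by apply: vintble_eq (vintbleZ (RC 72) (Kmaj_int n k0 M0 d2 e2)) => x _; rewrite /g RCM.
have mem h : `|h| <= RC r -> RePos (p + h).2.1 /\ RePos (p + h).2.2.
  move=> hr; split => i.
    have h1 : `|h.2.1| <= RC r by apply: le_trans hr; apply: le_trans (norm_snd_le _); exact: norm_fst_le.
    by apply: lt_trans d2 _; exact: (RePos_near dw2 h1).
  have h1 : `|h.2.2| <= RC r by apply: le_trans hr; apply: le_trans (norm_snd_le _); exact: norm_snd_le.
  by apply: lt_trans e2 _; exact: (RePos_near ez2 h1).
have [Q _] := @qr_cint _ _ R (tmu R n) (@Dpos R n) (@measurable_Dpos R n) _ (fun s q => Phi (tv s) q) (fun s v => 'D_v (Phi (tv s)) p) p (RC r) (fun s => g (tv s))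
  R0 ig (fun s Ds => H (tv s) ((Dpos_posv s).1 Ds)) (fun h _ => vmeas_Kint k0 (p + h).1 (p + h).2.1 (p + h).2.2).
have F h : `|h| <= RC r -> vint (fun x => Phi x (p + h)) = Kker n k (p + h).1 (p + h).2.1 (p + h).2.2.
  by move=> /mem [h1 h2]; rewrite (Kker_int k0 _ h1 h2).
have Q' := qr_local (f' := fun q : CC R * (V * V) => Kker n k q.1 q.2.1 q.2.2) R0 F Q.
exact: (qr_diff R0 Q').1.
Qed.
Lemma lpsi_real (a : R) x : posv x -> lpsi k (RC a) x = RC ((\prod_i x 0 i `^ (a - mu0 n k - 1)) * omegaA k x).
Proof. by move=> x0; rewrite /lpsi -RC1 -!RCB Deltapow_real// RCM. Qed.
Lemma omegaA_gt0 x : injective (fun i => x 0 i) -> 0 < omegaA k x.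
Proof.
move=> inj; apply: prodr_gt0 => i _; apply: prodr_gt0 => j ij; rewrite powR_gt0// normr_gt0 subr_eq0.
by apply: contraTneq ij => /inj ->; rewrite ltnn.
Qed.
Lemma rv2C_pos x : posv x -> RePos (rv2C x).
Proof. by move=> x0 i; rewrite mxE; exact: x0. Qed.
Lemma Kint_real (a : R) x y t : posv t -> Kint k0 (RC a) (rv2C x) (rv2C y) t =
  RC (cRe (EE k0 (- rv2C t) (rv2C x)) * cRe (EE k0 (- rv2C (rvinv t)) (rv2C y)) * ((\prod_i t 0 i `^ (a - mu0 n k - 1)) * omegaA k t)) /\
  0 < cRe (EE k0 (- rv2C t) (rv2C x)) * cRe (EE k0 (- rv2C (rvinv t)) (rv2C y)).
Proof.
move=> t0; have e1 := EE_neg_gt0 k0 x (posv_ge0 t0); have e2 := EE_neg_gt0 k0 y (posv_ge0 (posv_inv t0)).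
have r1 := RC_real (ltW e1); have r2 := RC_real (ltW e2).
split; first by rewrite /Kint lpsi_real// {1}r1 {1}r2 -!RCM.
by rewrite mulr_gt0// -RC_gt0 -?r1 -?r2.
Qed.
Lemma Kker_gt0 (a : R) x y : posv x -> posv y -> 0 < Kker n k (RC a) (rv2C x) (rv2C y).
Proof.
move=> x0 y0; have w0 := rv2C_pos x0; have z0 := rv2C_pos y0; rewrite (Kker_int k0 _ w0 z0).
pose f t := cRe (EE k0 (- rv2C t) (rv2C x)) * cRe (EE k0 (- rv2C (rvinv t)) (rv2C y)) * ((\prod_i t 0 i `^ (a - mu0 n k - 1)) * omegaA k t).
have E t : posv t -> Kint k0 (RC a) (rv2C x) (rv2C y) t = RC (f t) by move=> t0; have [] := Kint_real a x y t0.
rewrite (vint_eq E); apply: vint_gt0; first exact: vintble_eq E (Kint_int k0 _ w0 z0).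
  move=> t t0; have [_ h] := Kint_real a x y t0; rewrite /f mulr_ge0 ?(ltW h)// mulr_ge0 ?omegaA_ge0// prodr_ge0// => i _; exact: powR_ge0.
move=> t t0 inj; have [_ h] := Kint_real a x y t0; rewrite /f mulr_gt0// mulr_gt0 ?omegaA_gt0// prodr_gt0// => i _; exact: powR_gt0.
Qed.
Lemma Lap_Gamma nu w : mu0 n k < cRe nu -> RePos w -> Lap k0 nu w = Gamma_ns n k nu * Deltapow w (- nu).
Proof. by move=> h w0; rewrite (Lap_formula k0 h w0) (Gamma_nsE k0 h). Qed.
Lemma Lap_int nu w : mu0 n k < cRe nu -> RePos w -> vintble (fun x => EE k0 (- rv2C x) w * lpsi k nu x).
Proof. by move=> h w0; have := good_intble k0 (@id_ge0 R n) (@id_meas R n) (good_lpsi k0 h) w0. Qed.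
Lemma Kker_upper (a : R) x y : posv x -> posv y -> mu0 n k < a ->
  Kker n k (RC a) (rv2C x) (rv2C y) <= Gamma_ns n k (RC a) * Deltapow (rv2C x) (RC (- a)).
Proof.
move=> x0 y0 h; have w0 := rv2C_pos x0; have z0 := rv2C_pos y0; rewrite (Kker_int k0 _ w0 z0) RCN -Lap_Gamma//.
apply: le_cint; [exact: measurable_Dpos|exact: (Kint_int k0 _ w0 z0)|exact: (Lap_int (nu := RC a) h w0)|].
move=> s /Dpos_posv; move: (tv s) => t t0; rewrite /Kint lpsi_real//.
have e1 := EE_neg_gt0 k0 x (posv_ge0 t0); have e2 := EE_neg_le1 k0 (posv_ge0 (posv_inv t0)) (posv_ge0 y0).
rewrite ler_wpM2r//; last by rewrite ler_piMr// ltW.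
by rewrite RC_ge0 mulr_ge0 ?omegaA_ge0// prodr_ge0// => i _; exact: powR_ge0.
Qed.
Lemma Kker_upper_neg (a : R) x y : posv x -> posv y -> a < - mu0 n k ->
  Kker n k (RC a) (rv2C x) (rv2C y) <= Gamma_ns n k (RC (- a)) * Deltapow (rv2C y) (RC a).
Proof.
move=> x0 y0 h; rewrite (Kker_inv k0 _ (rv2C_pos x0) (rv2C_pos y0)) -RCN -[X in Deltapow _ (RC X)]opprK.
by apply: Kker_upper => //; rewrite ltrNr.
Qed.
(** The exponential lies above its tangent at the barycentre m; average this at a and b. *)
Lemma expR_convex (a b t : R) : 0 <= t <= 1 -> expR ((1 - t) * a + t * b) <= (1 - t) * expR a + t * expR b.
Proof.
move=> /andP[t0 t1]; set m := _ + _; have e c : expR m * (1 + (c - m)) <= expR c.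
  have -> : expR c = expR m * expR (c - m) by rewrite -expRD addrC subrK.
  by rewrite ler_wpM2l ?expR_ge0//; exact: expR_ge1Dx.
have t1' : 0 <= 1 - t by rewrite subr_ge0.
have := lerD (ler_wpM2l t1' (e a)) (ler_wpM2l t0 (e b)); apply: le_trans.
rewrite le_eqVlt; apply/orP; left; apply/eqP; rewrite /m; move: (expR _) => E; ring.
Qed.
Lemma prod_powR_exp (t : 'rV[R]_n) (c : R) : posv t -> \prod_i t 0 i `^ c = expR (c * \sum_i ln (t 0 i)).
Proof. by move=> t0; rewrite mulr_sumr expR_sum; apply: eq_bigr => i _; rewrite /powR gt_eqF. Qed.
Lemma Kker_convex x y (a b t : R) : posv x -> posv y -> 0 <= t <= 1 ->
  Kker n k (RC ((1 - t) * a + t * b)) (rv2C x) (rv2C y) <=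
  RC (1 - t) * Kker n k (RC a) (rv2C x) (rv2C y) + RC t * Kker n k (RC b) (rv2C x) (rv2C y).
Proof.
move=> x0 y0 t01; have w0 := rv2C_pos x0; have z0 := rv2C_pos y0.
have iK c := Kint_int k0 (RC c) w0 z0.
rewrite !(Kker_int k0 _ w0 z0) -!vintZ// -vintD; [|exact: vintbleZ|exact: vintbleZ].
apply: le_cint; [exact: measurable_Dpos|exact: iK|by have h := vintbleD (vintbleZ (RC (1 - t)) (iK a)) (vintbleZ (RC t) (iK b)); exact: h|].
move=> s /Dpos_posv; move: (tv s) => u u0.
have [-> h] := Kint_real ((1 - t) * a + t * b) x y u0; have [-> _] := Kint_real a x y u0; have [-> _] := Kint_real b x y u0.
rewrite -!RCM -RCD RC_le !prod_powR_exp//; move: h; move: (_ * _) => A A0.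
have := expR_convex ((a - mu0 n k - 1) * \sum_i ln (u 0 i)) ((b - mu0 n k - 1) * \sum_i ln (u 0 i)) t01.
rewrite (_ : (1 - t) * _ + t * _ = ((1 - t) * a + t * b - mu0 n k - 1) * \sum_i ln (u 0 i)); last by ring.
have alg1 (X O : R) : A * (X * O) = A * O * X by ring.
have alg2 (Y Z O : R) : (1 - t) * (A * (Y * O)) + t * (A * (Z * O)) = A * O * ((1 - t) * Y + t * Z) by ring.
by move=> h; rewrite alg1 alg2 ler_wpM2l// mulr_ge0 ?omegaA_ge0// ltW.
Qed.
(** Pointwise Delta^nu <= Delta^(mu0 + 1) + Delta^(-mu0 - e): the first term suffices where Delta >=
    1, the second where Delta < 1. Hence K_nu is at most the sum of two Bessel integrals to which
    [Kker_upper] and [Kker_upper_neg] apply. *)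
Lemma Kker_mid (a e : R) x y : posv x -> posv y -> `|a| <= mu0 n k -> 0 < e ->
  Kker n k (RC a) (rv2C x) (rv2C y) <= Gamma_ns n k (RC (mu0 n k + 1)) * Deltapow (rv2C x) (RC (- mu0 n k - 1)) +
         Gamma_ns n k (RC (mu0 n k + e)) * Deltapow (rv2C y) (RC (- mu0 n k - e)).
Proof.
move=> x0 y0 am e0; have w0 := rv2C_pos x0; have z0 := rv2C_pos y0.
have b1 := @Kker_upper (mu0 n k + 1) x y x0 y0 ltac:(by rewrite ltrDl).
have b2 := @Kker_upper_neg (- mu0 n k - e) x y x0 y0 ltac:(by rewrite gtrDl oppr_lt0).
rewrite opprD in b1; rewrite opprD !opprK in b2.
apply: le_trans (lerD b1 b2); rewrite !(Kker_int k0 _ w0 z0).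
have iK c := Kint_int k0 (RC c) w0 z0; rewrite -vintD//.
apply: le_cint; [exact: measurable_Dpos|exact: iK|by have h := vintbleD (iK (mu0 n k + 1)) (iK (- mu0 n k - e)); exact: h|].
move=> s /Dpos_posv; move: (tv s) => u u0.
have [-> h] := Kint_real a x y u0; have [-> _] := Kint_real (mu0 n k + 1) x y u0; have [-> _] := Kint_real (- mu0 n k - e) x y u0.
rewrite -RCD RC_le -mulrDr -mulrDl ler_wpM2l ?(ltW h)// ler_wpM2r ?omegaA_ge0// !prod_powR_exp//.
move: am; rewrite ler_norml => /andP[a1 a2]; set S := \sum_i _.
have [S0|S0] := leP 0 S.
  apply: le_trans (_ : expR ((mu0 n k + 1 - mu0 n k - 1) * S) <= _); last by rewrite lerDl expR_ge0.
  by rewrite ler_expR ler_wpM2r//; lra.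
apply: le_trans (_ : expR ((- mu0 n k - e - mu0 n k - 1) * S) <= _); last by rewrite lerDr expR_ge0.
by rewrite ler_expR ler_wnM2r ?(ltW S0)//; lra.
Qed.
(** The kernel and its parametric integral are compared only where real parts are positive. An
    iterated Dunkl operator sees nothing else at such points, provided every intermediate function
    is differentiable there. *)
Lemma dunkl_foldr_eq (f g : V -> CC R) (r : seq 'I_n) : (forall y : V, RePos y -> f y = g y) ->
  (forall r' (y : V), RePos y -> differentiable (foldr (fun i h => dunklA k i h) g r') y) ->
  forall y : V, RePos y -> foldr (fun i h => dunklA k i h) f r y = foldr (fun i h => dunklA k i h) g r y.
Proof.
move=> fg dg; elim: r => [//|i r IH] y y0 /=.
by apply: esym; apply: dunkl_eq_RePos => // [u u0|]; [rewrite IH|exact: dg].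
Qed.
Lemma Gint_foldr_diff (u : 'rV[R]_n -> 'rV[R]_n) psi (r : seq 'I_n) (y : V) : (forall x, posv x -> vge0 (u x)) ->
  (forall i, measurable_fun (@Dpos R n) (fun s => u (tv s) 0 i)) -> goodw u psi -> RePos y ->
  differentiable (foldr (fun i h => dunklA k i h) (Gint k0 u psi) r) y.
Proof.
move=> u0 mu g y0; have [rr rr0 Hr] := RePos_local y0.
have H := (Gint_cder k0 u0 mu (good_prod u0 mu r g) y0).2.
have E h : `|h| <= rr -> Gint k0 u (fun x => \prod_(i <- r) (- RC (u x 0 i)) * psi x) (y + h) = foldr (fun i h => dunklA k i h) (Gint k0 u psi) r (y + h).
  by move=> /Hr h0; rewrite (Gint_dunkl_seq k0 u0 mu r g h0).
exact: (cder_diff (cder_local rr0 E H)).1.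
Qed.
Lemma DeltaT_Gint (f : V -> CC R) (u : 'rV[R]_n -> 'rV[R]_n) psi z : (forall x, posv x -> vge0 (u x)) ->
  (forall i, measurable_fun (@Dpos R n) (fun s => u (tv s) 0 i)) -> goodw u psi -> RePos z ->
  (forall y : V, RePos y -> f y = Gint k0 u psi y) ->
  DeltaT k f z = (-1) ^+ n * Gint k0 u (fun x => RC (\prod_i u x 0 i) * psi x) z.
Proof.
move=> u0 mu g z0 fE; rewrite -(Gint_DeltaT k0 u0 mu g z0) /DeltaT.
by apply: dunkl_foldr_eq => // r' y y0; exact: Gint_foldr_diff.
Qed.
Lemma vge0_inv x : posv x -> vge0 (rvinv x).
Proof. by move=> x0; apply: posv_ge0; exact: posv_inv. Qed.
Lemma measurable_rvinv i : measurable_fun (@Dpos R n) (fun t => rvinv (tv t) 0 i).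
Proof.
rewrite (_ : (fun s => _) = (fun t : measurableTypeR R => t^-1 : measurableTypeR R) \o (fun s => tv s 0 i)); last by apply/funext => s; rewrite mxE.
by apply: measurableT_comp; [exact: measurable_inv|exact: measurable_tv].
Qed.
Lemma good_K1 nu z : RePos z -> goodw id (fun x => EE k0 (- rv2C (rvinv x)) z * lpsi k nu x).
Proof.
move=> z0; have [e e0 ez] := RePos_min z0; split.
  by apply: cmeasM; [exact: cmeas_EE_inv|exact: vmeas_lpsi].
move=> d d0; have iK := Kmaj_int n k0 (normr_ge0 (cRe (nu - RC (mu0 n k) - 1))) d0 e0.
apply: vintble_dom iK _ => [|x x0].
  apply: cmeasM; last by apply: cmeas_norm; apply: cmeasM; [exact: cmeas_EE_inv|exact: vmeas_lpsi].
  by apply: cmeas_RC; apply: measurableT_comp => //; apply: measurableT_comp => //; apply: measurable_funM => //; exact: measurable_vsum.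
rewrite normrM (ger0_norm (_ : 0 <= RC _)) ?RC_ge0 ?expR_ge0// normr_id !normrM !CC_norm -!RCM RC_le /Kmaj.
rewrite cmod_RC (ger0_norm (omegaA_ge0 _ _)) -!mulrA ler_wpM2l ?expR_ge0//; apply: ler_pM; rewrite ?mulr_ge0 ?cmod_ge0 ?omegaA_ge0//.
  by apply: EE_le_exp => //; exact: vge0_inv.
by rewrite ler_wpM2r ?omegaA_ge0//; exact: Deltapow_le.
Qed.
Lemma good_K2 nu w : RePos w -> goodw (@rvinv R n) (fun x => EE k0 (- rv2C x) w * lpsi k nu x).
Proof.
move=> w0; have [d d0 dw] := RePos_min w0; split.
  by apply: cmeasM; [exact: cmeas_EE_neg|exact: vmeas_lpsi].
move=> e e0; have iK := Kmaj_int n k0 (normr_ge0 (cRe (nu - RC (mu0 n k) - 1))) d0 e0.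
apply: vintble_dom iK _ => [|x x0].
  apply: cmeasM; last by apply: cmeas_norm; apply: cmeasM; [exact: cmeas_EE_neg|exact: vmeas_lpsi].
  apply: cmeas_RC; apply: measurableT_comp => //; apply: measurableT_comp => //; apply: measurable_funM => //.
  by apply: measurable_sum => i; exact: measurable_rvinv.
rewrite normrM (ger0_norm (_ : 0 <= RC _)) ?RC_ge0 ?expR_ge0// normr_id !normrM !CC_norm -!RCM RC_le /Kmaj.
rewrite cmod_RC (ger0_norm (omegaA_ge0 _ _)).
have as1 (A B C D : R) : A * B * C * D = B * (A * (C * D)) by ring.
rewrite as1 ler_wpM2l ?expR_ge0//; apply: ler_pM; rewrite ?mulr_ge0 ?cmod_ge0 ?omegaA_ge0//.
  by apply: EE_le_exp => //; exact: posv_ge0.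
by rewrite ler_wpM2r ?omegaA_ge0//; exact: Deltapow_le.
Qed.
Lemma lpsi_pred nu x : posv x -> RC (\prod_i (rvinv x) 0 i) * lpsi k nu x = lpsi k (nu - 1) x.
Proof.
move=> x0; rewrite -prod_RC; last exact: posv_inv.
rewrite Deltapow_inv// /lpsi mulrA -DeltapowD; congr (Deltapow _ _ * _); ring.
Qed.
Lemma Kker_DeltaT nu w z : RePos w -> RePos z ->
  DeltaT k (fun z' => Kker n k nu w z') z = (-1) ^+ n * Kker n k (nu - 1) w z /\
  DeltaT k (fun w' => Kker n k nu w' z) w = (-1) ^+ n * Kker n k (nu + 1) w z.
Proof.
move=> w0 z0; split.
  rewrite (DeltaT_Gint vge0_inv measurable_rvinv (good_K2 nu w0) z0); last first.
    by move=> y y0; rewrite (Kker_int k0 _ w0 y0); apply: vint_eq => x _; have alg (A B D : CC R) : A * B * D = B * (A * D) by [rewrite [A * B]mulrC mulrA]; exact: alg.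
  rewrite (Kker_int k0 _ w0 z0); congr (_ * _); apply: vint_eq => x x0; rewrite /Kint -lpsi_pred//.
  by move: (EE _ _ _) (EE _ _ _) (RC _) (lpsi _ _ _) => A B C D; ring.
rewrite (DeltaT_Gint (@id_ge0 R n) (@id_meas R n) (good_K1 nu z0) w0); last first.
  by move=> y y0; rewrite (Kker_int k0 _ y0 z0); apply: vint_eq => x _; rewrite /Kint mulrA.
rewrite (Kker_int k0 _ w0 z0); congr (_ * _); apply: vint_eq => x x0; rewrite /Kint -(lpsi_succ k nu x0) /=.
by move: (EE _ _ _) (EE _ _ _) (RC _) (lpsi _ _ _) => A B C D; ring.
Qed.
(** The sequential criterion for right limits is applied to the real function |l - f|; it makes
    dominated convergence, a statement about sequences, available for the limits in epsilon. *)
Lemma cvg_right_seq (f : R -> CC R) (l : CC R) : (forall u : nat -> R, (forall m, 0 < u m) -> u @ \oo --> 0 -> ccvg (fun m => f (u m)) l) ->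
  f x @[x --> (0 : R)^'+] --> l.
Proof.
move=> H; have c0 : cmod (0 : CC R) = 0 by apply/eqP; rewrite cmod_eq0.
have c : (fun t : R => cmod (l - f t)) @ (0 : R)^'+ --> 0.
  apply/cvg_at_rightP => u [u0 ul]; rewrite -c0; apply: ccvg_cmod.
  have := ccvgD (ccvg_cst l) (ccvgM (ccvg_cst (-1)) (H u u0 ul)); rewrite mulN1r subrr.
  by apply: ccvg_eq => m; rewrite mulN1r.
apply/cvgrPdist_le => e e0; have er := RC_real (ltW e0).
have r0 : 0 < cRe e by rewrite -RC_gt0 -er.
move/cvgrPdist_le: c => /(_ _ r0) c; near=> x; rewrite er cmod_leP.
have : `|0 - cmod (l - f x)| <= cRe e by near: x; exact: c.
by rewrite sub0r normrN ger0_norm ?cmod_ge0.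
Unshelve. all: by end_near. Qed.
Lemma lpsi_scale nu (e : R) x : 0 < e -> posv x -> lpsi k nu (e *: x) * RC (e ^+ n) = cpow (RC e) (n%:R * nu) * lpsi k nu x.
Proof.
move=> e0 x0; rewrite /lpsi Deltapow_scale// omegaA_scale// RCM -(cpow_RC _ e0).
have -> : RC (e ^+ n) = cpow (RC e) (RC n%:R) by rewrite cpow_RC// powR_mulrn// ltW.
have -> : n%:R * nu = n%:R * (nu - RC (mu0 n k) - 1) + RC (n%:R * mu0 n k) + RC n%:R.
  by rewrite RCM -!natr_RC; ring.
rewrite !cpowD; have alg (A B C D E : CC R) : A * B * (C * D) * E = A * C * E * (B * D) by ring.
exact: alg.
Qed.
(** The substitution x -> x / e moves the small parameter from w into the second kernel, as E(-e/x,
    z), which stays bounded by 1 and tends to 1; the power of e is the homogeneity degree of the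
    measure. *)
Lemma Kker_scale nu w z (e : R) : 0 < e -> RePos w -> RePos z ->
  cpow (RC e) (n%:R * nu) * Kker n k nu (RC e *: w) z =
  vint (fun x => EE k0 (- rv2C x) w * EE k0 (- rv2C (e *: rvinv x)) z * lpsi k nu x).
Proof.
move=> e0 w0 z0; have we : RePos (RC e *: w).
  by move=> i; rewrite mxE cReM cReRC cImRC mul0r subr0 mulr_gt0.
have iK := Kint_int k0 nu we z0; have ei : 0 < e^-1 by rewrite invr_gt0.
have [i1 E1] := vint_scale ei iK.
rewrite (Kker_int k0 _ we z0) -E1 -(vintZ _ i1); apply: vint_eq => x x0.
have E2 : rvinv (e^-1 *: x) = e *: rvinv x by apply/rowP => i; rewrite !mxE invfM invrK.
have E3 : - rv2C (e^-1 *: x) = RC e^-1 *: (- rv2C x) by apply/rowP => i; rewrite !mxE RCM mulrN.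
rewrite /Kint E2 E3 EE_scale scalerA -RCM mulVf ?gt_eqF// RC1 scale1r -[X in _ * X]mulrA lpsi_scale// cpowV// cpowN.
have c0 := cpow_neq0 (RC e) (n%:R * nu).
move: (EE _ _ _) (EE _ _ _) (lpsi _ _ _) => A B C.
by rewrite mulrCA; congr (_ * _); rewrite mulrA divff// mul1r.
Qed.
Lemma EE_neg_le1C x z : vge0 x -> RePos z -> cmod (EE k0 (- rv2C x) z) <= 1.
Proof.
move=> x0 z0; rewrite -cmod_leP; apply: le_trans (EE_neg_le_Re k0 z x0) _.
have -> : rvRe z = rv2C (map_mx (@cRe R) z) by apply/rowP => i; rewrite !mxE.
by rewrite RC1; apply: EE_neg_le1 => // i; rewrite mxE ltW.
Qed.
Lemma EE_neg_lim z x (u : nat -> R) : vge0 x -> RePos z -> (forall m, 0 < u m) -> u @ \oo --> 0 ->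
  ccvg (fun m => EE k0 (- rv2C (u m *: x)) z) 1.
Proof.
move=> x0 z0 u0 ul; have [d d0 dz] := RePos_min z0; have [C C0 H] := EE_neg_lip k0 dz.
have s0 := vsum_ge0 x0; pose K := 2 * C * vsum x.
have K0 : 0 <= K by rewrite !mulr_ge0.
apply: ccvgP => e e0; near=> m.
have um : u m <= e / (K + 1).
  near: m; move/cvgrPdist_le: ul => /(_ (e / (K + 1))) h; have e1 : 0 < e / (K + 1) by rewrite divr_gt0// ltr_wpDl.
  by apply: filterS (h e1) => m; rewrite sub0r normrN ger0_norm// ltW.
have uk : u m * (K + 1) <= e by rewrite -ler_pdivlMr// ltr_wpDl.
have ux : vge0 (u m *: x) by move=> i; rewrite mxE mulr_ge0// ltW.
have z00 : vge0 (0 : 'rV[R]_n) by move=> i; rewrite mxE.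
have E0 : EE k0 (- rv2C (0 : 'rV[R]_n)) z = 1.
  have -> : - rv2C (0 : 'rV[R]_n) = 0 by apply/rowP => i; rewrite !mxE RC0 oppr0.
  by rewrite EE_sym EE_0.
have := H (u m *: x) 0 (u m * vsum x) (mulr_ge0 (ltW (u0 m)) s0) ux z00.
rewrite E0 cmod_leP => h; apply: le_trans (h _) _.
  move=> i; rewrite !mxE subr0 ger0_norm ?mulr_ge0 ?(ltW (u0 m))// ler_wpM2l ?(ltW (u0 m))//; exact: coord_le_vsum.
have ex (y : 'rV[R]_n) : vge0 y -> expR (- (d * vsum y)) <= 1.
  by move=> y0; rewrite -expR0 ler_expR oppr_le0 mulr_ge0 ?(ltW d0)// vsum_ge0.
apply: le_trans uk; apply: (@le_trans _ _ (C * (u m * vsum x) * (1 + 1))).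
  by rewrite ler_wpM2l ?lerD ?ex// mulr_ge0// mulr_ge0// ltW.
rewrite /K; have := u0 m; move: (u m) (vsum x) => a b a0.
by rewrite (_ : C * (a * b) * (1 + 1) = a * (2 * C * b)); [rewrite ler_wpM2l ?(ltW a0)// lerDl|ring].
Unshelve. all: by end_near. Qed.
Lemma Kker_lim nu w z (u : nat -> R) : RePos w -> RePos z -> mu0 n k < cRe nu -> (forall m, 0 < u m) -> u @ \oo --> 0 ->
  ccvg (fun m => cpow (RC (u m)) (n%:R * nu) * Kker n k nu (RC (u m) *: w) z) (Gamma_ns n k nu * Deltapow w (- nu)).
Proof.
move=> w0 z0 h u0 ul; rewrite -Lap_Gamma//.
have iL := Lap_int h w0.
have ig : vintble (fun x => RC (cmod (EE k0 (- rv2C x) w * lpsi k nu x))).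
  have i2 : vintble (fun x => `|EE k0 (- rv2C x) w * lpsi k nu x|) := cintble_norm (@measurable_Dpos R n) iL.
  by apply: vintble_eq i2 => x _; rewrite CC_norm.
pose F m x := EE k0 (- rv2C x) w * EE k0 (- rv2C (u m *: rvinv x)) z * lpsi k nu x.
have mF m : vmeas (F m).
  apply: cmeasM; last exact: vmeas_lpsi.
  apply: cmeasM; first exact: cmeas_EE_neg.
  apply: cmeas_EE => i; last exact: cmeas_cst.
  have mi : measurable_fun (@Dpos R n) (fun s => u m * rvinv (tv s) 0 i) by apply: measurable_funM => //; exact: measurable_rvinv.
  by apply: eq_cmeas (cmeasN (cmeas_RC mi)) => s _; rewrite !mxE.
have um x m : posv x -> vge0 (u m *: rvinv x).
  by move=> x0 i; rewrite mxE mulr_ge0 ?(ltW (u0 m))//; exact: vge0_inv.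
have bF m x : posv x -> cmod (F m x) <= cmod (EE k0 (- rv2C x) w * lpsi k nu x).
  move=> x0; rewrite /F mulrAC [leLHS]cmodM ler_piMr ?cmod_ge0//; apply: EE_neg_le1C => //; exact: um.
have lF x : posv x -> ccvg (fun m => F m x) (EE k0 (- rv2C x) w * lpsi k nu x).
  move=> x0; rewrite -[X in ccvg _ (X * _)]mulr1; apply: ccvgM; last exact: ccvg_cst.
  by apply: ccvgM; [exact: ccvg_cst|apply: EE_neg_lim => //; exact: vge0_inv].
have [_ c] := vint_dct mF ig bF lF.
by apply: ccvg_eq c => m; rewrite (Kker_scale nu (u0 m) w0 z0).
Qed.
Lemma Kker_limits nu w z : RePos w -> RePos z ->
  (cRe nu < - mu0 n k ->
     (fun eps : R => cpow (RC eps) (- (n%:R * nu)) * Kker n k nu w (RC eps *: z)) @ (0 : R)^'+ --> Gamma_ns n k (- nu) * Deltapow z nu) /\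
  (mu0 n k < cRe nu ->
     (fun eps : R => cpow (RC eps) (n%:R * nu) * Kker n k nu (RC eps *: w) z) @ (0 : R)^'+ --> Gamma_ns n k nu * Deltapow w (- nu)).
Proof.
move=> w0 z0; split => h; apply: cvg_right_seq => u u0 ul; last exact: Kker_lim.
have h' : mu0 n k < cRe (- nu) by rewrite cReN ltrNr.
have := Kker_lim z0 w0 h' u0 ul; rewrite opprK; apply: ccvg_eq => m.
have ze : RePos (RC (u m) *: z).
  by move=> i; rewrite mxE cReM cReRC cImRC mul0r subr0 mulr_gt0.
by rewrite (Kker_inv k0 nu w0 ze) mulrN.
Qed.
End final.

Theorem theorem4p10 (R : realType) (n : nat) (k : R) :
  (1 <= n)%N -> 0 <= k ->
  (* absolute convergence *)
  (forall (nu : CC R) (w z : 'rV[CC R]_n), RePos w -> RePos z ->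
     abs_conv_pos n (Kintegrand n k nu w z)) /\
  (* holomorphy of (nu, w, z) |-> K_nu(w, z) on C x {Re w > 0} x {Re z > 0} *)
  (forall p : CC R * ('rV[CC R]_n * 'rV[CC R]_n), RePos p.2.1 -> RePos p.2.2 ->
     differentiable (fun q : CC R * ('rV[CC R]_n * 'rV[CC R]_n) =>
                       Kker n k q.1 q.2.1 q.2.2) p) /\
  (* (i) *)
  (forall (s : 'S_n) (nu : CC R) (w z : 'rV[CC R]_n), RePos w -> RePos z ->
     Kker n k nu (permv s w) (permv s z) = Kker n k nu w z) /\
  (* (ii) *)
  (forall (nu : CC R) (w z : 'rV[CC R]_n), RePos w -> RePos z ->
     Kker n k nu w z = Kker n k (- nu) z w /\
     `|Kker n k nu w z| <= Kker n k (RC (cRe nu)) (rvRe w) (rvRe z)) /\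
  (* (iii) *)
  (forall (nu : R) (x y : 'rV[R]_n), posv x -> posv y ->
     (mu0 n k < nu ->
        0 < Kker n k (RC nu) (rv2C x) (rv2C y) /\
        Kker n k (RC nu) (rv2C x) (rv2C y) <=
          Gamma_ns n k (RC nu) * Deltapow (rv2C x) (RC (- nu))) /\
     (nu < - mu0 n k ->
        0 < Kker n k (RC nu) (rv2C x) (rv2C y) /\
        Kker n k (RC nu) (rv2C x) (rv2C y) <=
          Gamma_ns n k (RC (- nu)) * Deltapow (rv2C y) (RC nu))) /\
  (forall (x y : 'rV[R]_n), posv x -> posv y ->
     forall (a b t : R), 0 <= t <= 1 ->
       Kker n k (RC ((1 - t) * a + t * b)) (rv2C x) (rv2C y) <=
         RC (1 - t) * Kker n k (RC a) (rv2C x) (rv2C y) +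
         RC t * Kker n k (RC b) (rv2C x) (rv2C y)) /\
  (* (iv) *)
  (forall (nu : R) (x y : 'rV[R]_n), posv x -> posv y -> `|nu| <= mu0 n k ->
     forall eps : R, 0 < eps ->
       0 < Kker n k (RC nu) (rv2C x) (rv2C y) /\
       Kker n k (RC nu) (rv2C x) (rv2C y) <=
         Gamma_ns n k (RC (mu0 n k + 1)) * Deltapow (rv2C x) (RC (- mu0 n k - 1)) +
         Gamma_ns n k (RC (mu0 n k + eps)) * Deltapow (rv2C y) (RC (- mu0 n k - eps))) /\
  (* (v) *)
  (forall (nu : CC R) (w z : 'rV[CC R]_n), RePos w -> RePos z ->
     DeltaT k (fun z' => Kker n k nu w z') z = (-1) ^+ n * Kker n k (nu - 1) w z /\
     DeltaT k (fun w' => Kker n k nu w' z) w = (-1) ^+ n * Kker n k (nu + 1) w z) /\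
  (* (vi) *)
  (forall (nu : CC R) (w z : 'rV[CC R]_n), RePos w -> RePos z ->
     (cRe nu < - mu0 n k ->
        (fun eps : R => cpow (RC eps) (- (n%:R * nu)) * Kker n k nu w (RC eps *: z))
          @ (0 : R)^'+ --> Gamma_ns n k (- nu) * Deltapow z nu) /\
     (mu0 n k < cRe nu ->
        (fun eps : R => cpow (RC eps) (n%:R * nu) * Kker n k nu (RC eps *: w) z)
          @ (0 : R)^'+ --> Gamma_ns n k nu * Deltapow w (- nu))).
Proof.
move=> _ k0.
split; first by move=> nu w z w0 z0; have [] := Kint_all k0 nu w0 z0.
split; first exact: Kker_holo.
split; first by move=> s nu w z; exact: Kker_permv.
split; first by move=> nu w z w0 z0; split; [exact: Kker_inv|exact: Kker_norm].
split.
  move=> nu x y x0 y0; split => h; split; try exact: Kker_gt0; [exact: Kker_upper|exact: Kker_upper_neg].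
split; first by move=> x y x0 y0 a b t; exact: Kker_convex.
split; first by move=> nu x y x0 y0 nm eps e0; split; [exact: Kker_gt0|exact: Kker_mid].
split; first exact: Kker_DeltaT.
exact: Kker_limits.
Qed.
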